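(* For the critical exponent of a skew-periodic interval map $F_{\mathbb N}$ with reflective boundary (as in the context) we have $$\delta_{\mathbb N}=\begin{cases}\delta_{\mathbb Z}, & \alpha_{\max}\ge0,\\ \delta_0, & \alpha_{\max}<0,\end{cases}$$ and the following trichotomy holds. (Lean case) $\dim_H(R(F_{\mathbb N}))>\dim_H(T^+(F_{\mathbb N}))$ if and only if $\alpha_{\max}<0$ and there exists $q>0$ with $\sum_{x\in\mathrm{Per}_1(F_0)}e^{\delta_0\varphi(x)+q\psi(x)}<\infty$. In this case $\mu_{\delta_0\varphi}(R(F_{\mathbb N}))=1$. (Balanced case) $\dim_H(R(F_{\mathbb N}))=\dim_H(T^+(F_{\mathbb N}))$ if and only if either $\alpha_{\max}=0$, or $\alpha_{\max}<0$ and for all $q>0$ one has $\sum_{x\in\mathrm{Per}_1(F_0)}e^{\delta_0\varphi(x)+q\psi(x)}=\infty$. In this case $\mu_{\delta_0\varphi}(R(F_{\mathbb N}))=1$. (Black hole case) The following are equivalent: (i) $\dim_H(R(F_{\mathbb N}))<\dim_H(T^+(F_{\mathbb N}))$; (ii) $\dim_H(R(F_{\mathbb N}))<\dim_H(\mathfrak R(F_{\mathbb N}))$; (iii) $\alpha_{\max}>0$; (iv) $\mu_{\delta_0\varphi}(T^+(F_{\mathbb N}))=1$. In particular, $F_{\mathbb N}$ exhibits a dimension gap (i.e. (ii) holds) if and only if $\alpha_{\max}>0$, or equivalently, if and only if $\mu_{\delta_0\varphi}(T^+(F_{\mathbb N}))=1$.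
   Context: Conventions: $\mathbb N=\{0,1,2,\dots\}$; $\dim_H$ is Hausdorff dimension. Base map. $I\subset\mathbb N$ with $\mathrm{card}(I)\ge 2$ (finite or countably infinite), $(J_i)_{i\in I}$ are non-empty pairwise disjoint open subintervals of $(0,1)$, $\Delta_0=\bigcup_{i\in I}J_i$, and $F_0:\Delta_0\to(0,1)$ satisfies: $F_0(J_i)=(0,1)$ for every $i$; each $F_0|_{J_i}$ has a $C^2$-extension to a neighbourhood of $\overline{J_i}$; $\inf_{\Delta_0}|F_0'|>1$; $\sup_{\Delta_0}|F_0''|/(F_0')^2<\infty$. Step functions. $\psi:\Delta_0\to\mathbb Z$ is constant on each $J_i$, with $\inf\psi=-1<0<\sup\psi\le\infty$. $\psi_1:\Delta_0\to\mathbb N$ (reflexion rule) is constant on each $J_i$ with $\psi\le\psi_1\le\psi+M$ for some $M>0$. Extensions. $F_{\mathbb Z}:\Delta_0+\mathbb Z\to\mathbb R$, $F_{\mathbb Z}(x)=F_0(x-\lfloor x\rfloor)+\psi(x-\lfloor x\rfloor)+\lfloor x\rfloor$. $F_{\mathbb N}:\Delta_0+\mathbb N\to\mathbb R$, $F_{\mathbb N}(x)=F_0(x)+\psi_1(x)$ if $x\in(0,1)$ and $F_{\mathbb N}(x)=F_0(x-\lfloor x\rfloor)+\psi(x-\lfloor x\rfloor)+\lfloor x\rfloor$ if $x>1$. For a map $f$ with domain $\Delta\subset\mathbb R$: the repeller is $\mathfrak R(f)=\bigcap_{n\ge0}f^{-n}(\Delta)$; $\mathrm{Per}_n(f)=\{x\in\mathfrak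 R(f):f^n(x)=x\}$; $R(f)=\{x\in\mathfrak R(f):\liminf_{n\to\infty}|f^n(x)|<\infty\}$; $T^+(f)=\{x\in\mathfrak R(f):\liminf_{n\to\infty}f^n(x)=+\infty\}$. It is assumed that $F_{\mathbb Z}$ and $F_{\mathbb N}$ are topologically transitive on their repellers (for all non-empty relatively open $U,V$ there is $n\in\mathbb N$ with $f^n(U)\cap V\ne\emptyset$). Critical exponents. For $f\in\{F_0,F_{\mathbb N},F_{\mathbb Z}\}$ and a fixed basic interval $J$ of $f$ (that is, $J=J_i$ for $F_0$, and $J=J_i+h$ with $i\in I$ and $h\in\mathbb N$, resp. $h\in\mathbb Z$, for $F_{\mathbb N}$, resp. $F_{\mathbb Z}$), $\delta(f)=\inf\{s\ge0:\sum_{n\ge1}\sum_{x\in\mathrm{Per}_n(f)\cap J}|(f^n)'(x)|^{-s}<\infty\}$, which does not depend on $J$. Write $\delta_0=\delta(F_0)$, $\delta_{\mathbb N}=\delta(F_{\mathbb N})$, $\delta_{\mathbb Z}=\delta(F_{\mathbb Z})$. Pressure and Gibbs measures on the base. Write $\mathfrak R_0=\mathfrak R(F_0)$. A function $g:\mathfrak R_0\to\mathbb R$ is called Hölder continuous if its restrictions to $\mathfrak R_0\cap J_i$ are Hölder continuous with exponent and constant independent of $i$. With $S_ng=\sum_{k=0}^{n-1}g\circ F_0^k$ put $\mathcal P(g)=\limsup_{n\to\infty}\frac1n\log\sum_{x\in\mathrm{Per}_n(F_0)\cap J_i}\exp(S_ng(x))$ (independent of $i\in I$). If $\mathcal P(g)<\infty$,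 $\mu_g$ denotes the unique $F_0$-invariant Borel probability measure on $\mathfrak R_0$ for which there is $C\ge1$ with $C^{-1}\le \mu_g(J_\omega)/\exp(S_\omega g-n\mathcal P(g))\le C$ for all $n\ge1$, $\omega\in I^n$, where $J_\omega=\{x: F_0^k(x)\in J_{\omega_k},\,0\le k<n\}$ and $S_\omega g=\sup_{J_\omega\cap\mathfrak R_0}S_ng$. The measure $\mu_g$ is regarded as a Borel measure on $\mathbb R$ with support contained in $[0,1]$. Geometric potential: $\varphi=-\log|F_0'|$. $F_0$ is assumed strongly regular: there is $s>0$ with $0<\mathcal P(s\varphi)<\infty$; then $\mathcal P(\delta_0\varphi)=0$. It is assumed that $\int(-\varphi)\,d\mu_{\delta_0\varphi}<\infty$. Finally $\alpha_{\max}=\int\psi\,d\mu_{\delta_0\varphi}\in\mathbb R\cup\{+\infty\}$. *)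

(* Defs.v *)
From HB Require Import structures.
From mathcomp Require Import all_boot all_order all_algebra.
From mathcomp Require Import all_classical all_reals all_analysis.

Set Implicit Arguments.
Unset Strict Implicit.
Unset Printing Implicit Defensive.

Import Order.TTheory GRing.Theory Num.Theory.
Import numFieldNormedType.Exports.
Local Open Scope classical_set_scope.
Local Open Scope ring_scope.

Section Hausdorff.
Context {R : realType}.
Implicit Types (s d : R) (A : set R).

(* [ereal_sup set0 = -oo], so the empty set gets the value [-oo] here; it is
   treated separately in [diam_pow]. *)
Definition diam A : \bar R :=
  ereal_sup [set z | exists x y, [/\ A x, A y & z = (`|x - y|)%:E]].

Definition diam_pow s A : \bar R :=
  if A == set0 then 0%E else (diam A `^ s)%E.

Definition hausdorff_content s d A : \bar R :=
  ereal_inf [set z | exists U : nat -> set R,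
    [/\ forall k, (diam (U k) <= d%:E)%E, A `<=` \bigcup_k U k
      & z = (\sum_(0 <= k <oo) diam_pow s (U k))%E]].

Definition hausdorff_measure s A : \bar R :=
  ereal_sup [set hausdorff_content s d A | d in [set d | 0 < d]].

Definition dimH A : \bar R :=
  ereal_inf [set s%:E | s in [set s | 0 <= s /\ hausdorff_measure s A = 0%E]].

End Hausdorff.

(* A map with domain [D] is a total function [f : R -> R] together with
   [D : set R]; the values of [f] outside [D] are irrelevant, since only orbits
   staying in [D] are considered and the domains below are open. *)

Section PartialMaps.
Context {R : realType}.
Implicit Types (f : R -> R) (D B : set R) (n : nat).

Definition repeller f D : set R := \bigcap_n (iter n f @^-1` D).

Definition Per f D n : set R := repeller f D `&` [set x | iter n f x = x].

Definition Rset f D : set R :=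
  repeller f D `&`
  [set x | (limn_einf (fun n => (`|iter n f x|)%:E) < +oo)%E].

Definition Tplus f D : set R :=
  repeller f D `&`
  [set x | limn_einf (fun n => (iter n f x)%:E) = +oo%E].

Definition top_transitive f D : Prop :=
  forall U V : set R, open U -> open V ->
  U `&` repeller f D !=set0 -> V `&` repeller f D !=set0 ->
  exists n, (iter n f @` (U `&` repeller f D)) `&` (V `&` repeller f D) !=set0.

(* The critical exponent is independent of the basic interval [B] with which
   it is computed; so is [pressure] below. It is [+oo] if no [s] qualifies. *)
Definition delta f D B : \bar R :=
  ereal_inf [set s%:E | s in [set s : R | 0 <= s /\
    (\esum_(n in [set n | (1 <= n)%N]) \esum_(x in Per f D n `&` B)
       (`|derive1 (iter n f) x| `^ (- s))%:E < +oo)%E]].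

Definition birkhoff f (g : R -> R) n (x : R) : R :=
  \sum_(0 <= k < n) g (iter k f x).

Definition pressure f D B (g : R -> R) : \bar R :=
  limn_esup (fun n => ((n%:R^-1)%:E *
    lne (\esum_(x in Per f D n `&` B) (expR (birkhoff f g n x))%:E))%E).

Definition geom_pot f (x : R) : R := - ln `|derive1 f x|.

End PartialMaps.

Section SkewPeriodic.
Context {R : realType}.
Implicit Types (I : set nat) (J : nat -> set R)
  (psi : R -> int).

Definition Delta0 I J : set R := \bigcup_(i in I) J i.

Definition C2_on (U : set R) (g : R -> R) : Prop :=
  forall x, U x -> [/\ derivable g x 1, derivable (derive1 g) x 1
    & {for x, continuous (derive1n 2 g)}].

Definition base_map I J (F0 : R -> R) : Prop :=
  [/\ (`I_2 #<= I)%card,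
      forall i, I i -> exists a b : R, [/\ 0 <= a, a < b, b <= 1
        & J i = `]a, b[%classic],
      trivIset I J,
      forall i, I i -> F0 @` J i = `]0, 1[%classic
    & forall i, I i -> exists (U : set R) (g : R -> R),
        [/\ open U, closure (J i) `<=` U, C2_on U g & {in J i, F0 =1 g}]]
  /\ (1 < ereal_inf [set (`|derive1 F0 x|)%:E | x in Delta0 I J])%E
  /\ (ereal_sup [set (`|derive1n 2 F0 x| / (derive1 F0 x) ^+ 2)%:E | x in Delta0 I J]
        < +oo)%E.

Definition constant_on_branches (T : Type) I J (u : R -> T) : Prop :=
  forall i x y, I i -> J i x -> J i y -> u x = u y.

Definition step_function I J psi : Prop :=
  [/\ constant_on_branches I J psi,
      ereal_inf [set ((psi x)%:~R : R)%:E | x in Delta0 I J] = (-1)%:E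
    & (0 < ereal_sup [set ((psi x)%:~R : R)%:E | x in Delta0 I J])%E].

Definition reflexion_rule I J psi (psi1 : R -> nat) : Prop :=
  constant_on_branches I J psi1 /\
  exists2 M : nat, (0 < M)%N &
    forall x, Delta0 I J x -> psi x <= (psi1 x)%:Z <= psi x + M%:Z.

Definition domZ I J : set R :=
  [set y | exists x (k : int), Delta0 I J x /\ y = x + k%:~R].

Definition domN I J : set R :=
  [set y | exists x (k : nat), Delta0 I J x /\ y = x + k%:R].

Definition frac (x : R) : R := x - (Num.floor x)%:~R.

Definition extZ (F0 : R -> R) psi (x : R) : R :=
  F0 (frac x) + (psi (frac x))%:~R + (Num.floor x)%:~R.

(* Only points of [domN] matter, so the second branch stands for [x > 1]. *)
Definition extN (F0 : R -> R) psi (psi1 : R -> nat) (x : R) : R :=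
  if 0 < x < 1 then F0 x + (psi1 x)%:R else extZ F0 psi x.

Definition shiftJ J (i : nat) (h : int) : set R := [set x + h%:~R | x in J i].

Definition cylinder J (F0 : R -> R) (w : seq nat) : set R :=
  [set x | forall k, (k < size w)%N -> J (nth 0%N w k) (iter k F0 x)].

Definition cyl_sup I J (F0 : R -> R) (g : R -> R) (w : seq nat) : \bar R :=
  ereal_sup [set (birkhoff F0 g (size w) x)%:E |
              x in cylinder J F0 w `&` repeller F0 (Delta0 I J)].

(* [mu] is the Gibbs measure of [g], as a Borel measure on the line; [B] is the
   basic interval used to compute the pressure. *)
Definition is_gibbs I J (F0 : R -> R) (B : set R) (g : R -> R)
    (mu : probability (measurableTypeR R) R) : Prop :=
  [/\ mu (repeller F0 (Delta0 I J)) = 1%E,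
      forall A : set R, measurable A ->
        mu (Delta0 I J `&` F0 @^-1` A) = mu A
    & exists2 C : R, 1 <= C &
      forall w : seq nat, w != [::] -> {in w, forall i, I i} ->
        let e := expeR (cyl_sup I J F0 g w
                        - (size w)%:R%:E * pressure F0 (Delta0 I J) B g)%E in
        ((C^-1)%:E * e <= mu (cylinder J F0 w))%E /\
        (mu (cylinder J F0 w) <= C%:E * e)%E].

Definition strongly_regular I J (F0 : R -> R) (B : set R) : Prop :=
  exists2 s : R, 0 < s &
    (0 < pressure F0 (Delta0 I J) B (fun x => (s * geom_pot F0 x)%R) < +oo)%E.

Definition fix_sum I J (F0 : R -> R) psi (d q : R) : \bar R :=
  \esum_(x in Per F0 (Delta0 I J) 1)
    (expR (d * geom_pot F0 x + q * (psi x)%:~R))%:E.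

End SkewPeriodic.

(* Main.v *)
(* Write l_w ~ |J_w| for the size of the cylinder of a word w, p_w for the sum of
   psi along w, and Z_n(s,q) for the sum of l_w^s e^(q p_w) over words of length
   n. Distortion makes Z_n submultiplicative up to a constant.

   Upper bounds: if Z_n(s,q) decays then the cylinders with p_w bounded above
   (q <= 0), resp. below (q >= 0), have summable l_w^s, which bounds dim R and
   delta_N, resp. dim T^+, by s; for delta_Z any q will do. Lower bounds: if Z_n(s,q) is
   large uniformly in q <= 0 (resp. q >= 0), a minimax argument yields finite
   families of words of one length with p_w <= -1 (resp. p_w >= 1) and large sum
   of l_w^s. Concatenating them gives orbits that return to a bounded region
   (resp. escape), hence Cantor sets and periodic points of exponent s.

   At s = delta_0 one has l_w^s ~ mu(J_w), so Z_n(delta_0,q) ~ int e^(q S_n psi) dmu.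
   Since e^y >= 1 + y, this is bounded below for q <= 0 if alpha_max <= 0, and for
   q >= 0 if alpha_max >= 0. If alpha_max > 0 then S_n psi >= c n outside a set of small
   measure, so it is small for q = - t / n; symmetrically for alpha_max < 0
   provided exponential moments exist. Interpolating with strong regularity, decay at
   (delta_0,q) yields decay at some (s,q') with s < delta_0. The linear drift comes from
   the maximal identity int (f + m_n o T)^+ = int f + int m_n - int m_(n+1), where
   m_n = min_(k <= n) S_k f, and a zero-one law for sets invariant under F_0. *)
Require Import Defs.
From HB Require Import structures.
From mathcomp Require Import all_boot all_order all_algebra.
From mathcomp Require Import all_classical all_reals all_analysis.
From mathcomp Require Import measurable_realfun.
From mathcomp Require Import ring lra zify.
Set Implicit Arguments.
Unset Strict Implicit.
Unset Printing Implicit Defensive.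
Import Order.TTheory GRing.Theory Num.Theory.
Import numFieldNormedType.Exports.
Local Open Scope classical_set_scope.
Local Open Scope ring_scope.

(** * Words and drift *)

(** Two obstacles shape the argument. The branches are open and may be infinite in number, so a
    prescribed itinerary need not be realised: the limit of its cylinders can fall on an endpoint.
    Lower bounds therefore use words containing a fixed block [b] whose cylinder stays away from 0
    and 1 ([inner]). Its recurrence yields genuine orbits and periodic points and, at the end of
    every word, it also separates cylinders. Secondly, partition functions may be infinite for
    [q > 0], and no regularity of a pressure in [(s, q)] is used. It is replaced by an alternative:
    either [contr] holds, or there is a lower bound at all lengths, which becomes arbitrarily large
    at a smaller [s]. Finite subfamilies on a grid of values of [q] then feed the minimax argument.
    That [mu] is comparable to the power [d0] of [ell] is derived: a nonzero exponential rate
    between the two would contradict the criticality of [d0]. The series over fixed points is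
    compared with the series over letters, as all but at most two branches contain a fixed point. *)

Lemma int_comb (a b c d : nat) : (d * c = a * b + d)%N -> (0 < d)%N ->
  1 <= (- a%:Z) *+ b + d%:Z *+ c.
Proof.
move=> e d0; rewrite mulNrn !pmulrn !mulrzz -!PoszM e PoszD addKr lez_nat //.
Qed.

Section WordLists.
Context {R : realType} {T : eqType} (A : seq T -> R) (x : seq T -> int)
  (P : set T).
Definition wordP (w : seq T) : Prop := {in w, forall i, P i}.
Hypothesis A_gt0 : forall w, wordP w -> 0 < A w.
Hypothesis A_cat : forall u v, wordP u -> wordP v -> A u * A v <= A (u ++ v).
Hypothesis x_cat : forall u v, x (u ++ v) = x u + x v.

Lemma wordP_cat u v : wordP u -> wordP v -> wordP (u ++ v).
Proof. by move=> hu hv i; rewrite mem_cat => /orP[/hu|/hv]. Qed.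

Lemma wordP_catl u v : wordP (u ++ v) -> wordP u.
Proof. by move=> h i iu; apply: h; rewrite mem_cat iu. Qed.

Lemma wordP_catr u v : wordP (u ++ v) -> wordP v.
Proof. by move=> h i iu; apply: h; rewrite mem_cat iu orbT. Qed.

(** The common length makes concatenation injective on pairs, so products and powers of a family
    stay duplicate free and their masses multiply. *)
Definition word_list n (L : seq (seq T)) :=
  uniq L /\ {in L, forall w, size w = n /\ wordP w}.

Definition cat_list (L L' : seq (seq T)) := [seq u ++ v | u <- L, v <- L'].

Definition weight (L : seq (seq T)) (q : R) :=
  \sum_(w <- L) A w * expR (q * (x w)%:~R).

Lemma word_list_cat n m L L' : word_list n L -> word_list m L' ->
  word_list (n + m) (cat_list L L').
Proof.
move=> [uL hL] [uL' hL']; split.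
  apply: allpairs_uniq => // -[u v] [u' v'] /=.
  move=> /allpairsP[[a b] /= [aL bL' [-> ->]]] /allpairsP[[c d] /= [cL dL' [-> ->]]].
  move=> e; have sz : size a = size c by rewrite (hL _ aL).1 (hL _ cL).1.
  move/eqP: e; rewrite eqseq_cat// => /andP[/eqP -> /eqP ->] //.
move=> w /allpairsP[[a b] /= [aL bL' ->]]; rewrite size_cat (hL _ aL).1 (hL' _ bL').1.
by split=> //; apply: wordP_cat; [exact: (hL _ aL).2|exact: (hL' _ bL').2].
Qed.

Lemma weight_ge0 n L q : word_list n L -> 0 <= weight L q.
Proof.
move=> [uL hL]; rewrite /weight big_seq; apply: sumr_ge0 => w wL.
by rewrite mulr_ge0 ?expR_ge0// ltW// A_gt0//; exact: (hL _ wL).2.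
Qed.

Lemma weight_cat n m L L' q : word_list n L -> word_list m L' ->
  weight L q * weight L' q <= weight (cat_list L L') q.
Proof.
move=> [uL hL] [uL' hL']; rewrite /weight /cat_list big_allpairs_dep /= mulr_suml.
rewrite big_seq [leRHS]big_seq; apply: ler_sum => u uL0.
rewrite mulr_sumr big_seq [leRHS]big_seq; apply: ler_sum => v vL0.
rewrite x_cat intrD mulrDr expRD mulrACA ler_wpM2r//.
by apply: A_cat; [exact: (hL _ uL0).2|exact: (hL' _ vL0).2].
Qed.

Fixpoint pow_list (L : seq (seq T)) k :=
  if k is k'.+1 then cat_list (pow_list L k') L else L.

Lemma word_list_pow n L k : word_list n L -> word_list (k.+1 * n) (pow_list L k).
Proof.
move=> hL; elim: k => [|k IH] /=; first by rewrite mul1n.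
by rewrite mulSn addnC; apply: word_list_cat.
Qed.

Lemma weight_pow n L k q : word_list n L ->
  weight L q ^+ k.+1 <= weight (pow_list L k) q.
Proof.
move=> hL; elim: k => [|k IH] /=; first by rewrite expr1.
rewrite exprSr; apply: le_trans (weight_cat q (word_list_pow k hL) hL).
by rewrite ler_wpM2r// (weight_ge0 _ hL).
Qed.

Lemma x_pow (L : seq (seq T)) k (a : int) : {in L, forall w, x w = a} ->
  {in pow_list L k, forall w, x w = a *+ k.+1}.
Proof.
move=> h; elim: k => [|k IH] w /=; first by move/h ->.
by move=> /allpairsP[[u v] /= [uL vL ->]]; rewrite x_cat (IH _ uL) (h _ vL) [RHS]mulrSr.
Qed.

Lemma x_pow_ge (L : seq (seq T)) k (a : int) : {in L, forall w, a <= x w} ->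
  {in pow_list L k, forall w, a *+ k.+1 <= x w}.
Proof.
move=> h; elim: k => [|k IH] w /=; first by move/h.
by move=> /allpairsP[[u v] /= [uL vL ->]]; rewrite x_cat [leLHS]mulrSr lerD// ?IH// h.
Qed.

Lemma x_pow_le (L : seq (seq T)) k (a : int) : {in L, forall w, x w <= a} ->
  {in pow_list L k, forall w, x w <= a *+ k.+1}.
Proof.
move=> h; elim: k => [|k IH] w /=; first by move/h.
by move=> /allpairsP[[u v] /= [uL vL ->]]; rewrite x_cat [leRHS]mulrSr lerD// ?IH// h.
Qed.

Lemma pigeonhole_sum (M : nat) (f : nat -> R) (c : R) :
  c <= \sum_(j < M) f j -> 0 < c -> exists2 j : nat, (j < M)%N & c / M%:R <= f j.
Proof.
move=> h c0; apply: contrapT => hn.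
have M0 : (0 < M)%N by case: M h {hn} => //; rewrite big_ord0 leNgt c0.
have : \sum_(j < M) f j < \sum_(j < M) c / M%:R.
  apply: ltr_sum; first by apply/hasP; exists (Ordinal M0) => //; rewrite mem_index_enum.
  by move=> j _; rewrite ltNge; apply/negP => hj; apply: hn; exists j.
rewrite sumr_const card_ord -[X in _ < X]mulr_natr divfK ?pnatr_eq0 -?lt0n// => /(le_lt_trans h).
by rewrite ltxx.
Qed.

Lemma weight_sub n n' L L' q : word_list n L -> word_list n' L' ->
  {subset L' <= L} -> weight L' q <= weight L q.
Proof.
move=> [uL hL] [uL' hL'] sub; rewrite /weight.
rewrite (perm_big [seq w <- L | w \in L']); last first.
  apply: uniq_perm => //; first exact: filter_uniq.
  by move=> w; rewrite mem_filter; case: (boolP (w \in L')) => // /sub ->.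
rewrite big_filter [leRHS](bigID (mem L'))/= lerDl big_seq_cond sumr_ge0// => w /andP[wL _].
by rewrite mulr_ge0 ?expR_ge0// ltW// A_gt0//; exact: (hL _ wL).2.
Qed.

Lemma exp2_ge (c : R) : exists m : nat, c <= 2 ^+ m.
Proof.
exists (Num.bound c); apply: (@le_trans _ _ `|c|); first exact: ler_norm.
apply: (le_trans (ltW (archi_boundP (normr_ge0 c)))).
have -> : Num.bound `|c| = Num.bound c by rewrite /Num.bound normr_id.
by rewrite -natrX ler_nat ltnW// ltn_expl.
Qed.

(** Products of [N] words fall into at most [2 * V * N + 1] drift classes, and one grid step of the
    tilt costs (3/4)^N against the total 2^N. The remaining (3/2)^N must be twice the number of
    classes; Bernoulli on the two halves of [N = 200 * V] makes it quadratic in [V]. *)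
Lemma pow43_gap (V : nat) : (0 < V)%N ->
  2 * (2 * V * (200 * V) + 1)%:R <= (3 / 2 : R) ^+ (200 * V).
Proof.
move=> V0.
have bern : forall k, 1 + k%:R / 2 <= (3 / 2 : R) ^+ k.
  elim=> [|k IH]; first by rewrite mul0r addr0 expr0.
  have k0 : 0 <= k%:R :> R by [].
  rewrite exprS -natr1; nra.
have := bern (100 * V)%N; rewrite natrM => h.
have V1 : 1 <= V%:R :> R by rewrite ler1n.
rewrite (_ : 200 * V = 100 * V + 100 * V)%N; last by lia.
rewrite exprD natrD !natrM.
set y := (3 / 2) ^+ (100 * V) in h *.
have : (50 * V%:R) * (50 * V%:R) <= y * y by apply: ler_pM; lra.
rewrite natrD natrM; nra.
Qed.

(* Split the words of length N n by their drift v in [-V N, V N]: for each q >= 0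
   some class has weight >= 2^N / M. Let j be least such that at q = eta j some
   class of positive drift k is that heavy. If j = 0 take its powers; otherwise
   at q = eta (j - 1) a class of drift - u <= 0 is heavy, and k blocks of it followed
   by u blocks of drift k have total drift 0 and unweighted mass >= 2. *)
Lemma list_drift n L : word_list n L -> (0 < n)%N ->
  (forall q, 0 <= q -> 2 <= weight L q) ->
  (exists2 e, e \in L & 1 <= x e) ->
  forall c : R, exists m L', [/\ (0 < m)%N, word_list m L',
    {in L', forall w, 1 <= x w} & c <= weight L' 0].
Proof.
move=> hL n0 W2 [e eL xe] c.
have [V V0 hV] : exists2 V : nat, (0 < V)%N & {in L, forall w, `|x w| <= V%:Z}.
  exists (\max_(w <- L) `|x w|%N).+1 => // w wL.
  have : (`|x w| <= \max_(w <- L) `|x w|)%N by apply: (@leq_bigmax_seq _ L xpredT (fun w => `|x w|%N)).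
  by lia.
have [N N0 NV] : exists2 N, (0 < N)%N & 2 * (2 * V * N + 1)%:R <= (3 / 2 : R) ^+ N.
  by exists (200 * V)%N; [lia|exact: pow43_gap].
pose M := (2 * V * N + 1)%N.
have M0 : (0 < M)%N by rewrite /M; lia.
pose L1 := pow_list L N.-1.
have hL1 : word_list (N * n) L1 by rewrite -(prednK N0); exact: word_list_pow.
have xL1 : {in L1, forall w, `|x w| <= (V * N)%:Z}.
  move=> w wL1; rewrite ler_norml; apply/andP; split.
    have /x_pow_ge : {in L, forall w, - V%:Z <= x w}.
      by move=> w0 /hV; rewrite ler_norml => /andP[].
    by move=> /(_ N.-1 w wL1); rewrite prednK//; lia.
  have /x_pow_le : {in L, forall w, x w <= V%:Z}.
    by move=> w0 /hV; rewrite ler_norml => /andP[].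
  by move=> /(_ N.-1 w wL1); rewrite prednK//; lia.
pose B v := [seq w <- L1 | x w == v].
have hB v : word_list (N * n) (B v).
  split; first by rewrite filter_uniq// hL1.1.
  by move=> w; rewrite mem_filter => /andP[_ /hL1.2].
have xB v : {in B v, forall w, x w = v} by move=> w; rewrite mem_filter => /andP[/eqP].
pose b v := weight (B v) 0.
have b0 v : 0 <= b v by exact: weight_ge0 (hB v).
have bE v q : weight (B v) q = b v * expR (q * v%:~R).
  rewrite /b /weight mulr_suml !big_seq; apply: eq_bigr => w /xB ->.
  by rewrite mul0r expR0 mulr1.
have WB q : weight L1 q = \sum_(j < M) weight (B (j%:Z - (V * N)%:Z)) q.
  rewrite /weight /B big_seq (eq_bigr (fun w => \sum_(j < M | x w == j%:Z - (V * N)%:Z)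
      A w * expR (q * (x w)%:~R))).
    rewrite -big_seq (exchange_big_dep predT)//=.
    by apply: eq_bigr => j _; rewrite big_filter.
  move=> w /xL1; rewrite ler_norml => /andP[h1 h2].
  have hj : (`|(x w + (V * N)%:Z)%R| < M)%N by rewrite /M; lia.
  rewrite (big_pred1 (Ordinal hj))// => j /=.
  by apply/eqP/eqP => [?|->/=]; [apply: val_inj => /=; lia|lia].
pose tau : R := 2 ^+ N / M%:R.
have tau0 : 0 < tau by rewrite divr_gt0 ?exprn_gt0 ?ltr0n.
have pick q : 0 <= q -> exists2 v : int, `|v| <= (V * N)%:Z & tau <= b v * expR (q * v%:~R).
  move=> q0; have h : 2 ^+ N <= \sum_(j < M) weight (B (j%:Z - (V * N)%:Z)) q.
    rewrite -WB -{1}(prednK N0); apply: le_trans (weight_pow _ _ hL).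
    by rewrite lerXn2r ?nnegrE ?W2//; apply: le_trans (W2 _ q0).
  have [j jM hj] := pigeonhole_sum (f := fun j : nat => weight (B (j%:Z - (V * N)%:Z)) q) h (exprn_gt0 N (ltr0Sn R 1)).
  exists (j%:Z - (V * N)%:Z); first by move: jM; rewrite /M; lia.
  by rewrite -bE; apply: hj.
(* A product of [N] words has drift at most [V * N] in absolute value, so moving [q] by [eta]
   changes its weight by a factor at most (4/3)^N. By the choice of [N], [tau] divided by this
   factor is still at least 2. *)
pose eta : R := ln (4 / 3) / V%:R.
have eta0 : 0 < eta by rewrite divr_gt0 ?ltr0n// ln_gt0//; lra.
have etaV : expR (- eta * (V * N)%:R) = (3 / 4) ^+ N.
  have e1 : eta * V%:R = ln (4 / 3) by rewrite /eta divfK// pnatr_eq0 -lt0n.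
  rewrite natrM mulrA mulNr e1 expRM_natr expRN lnK ?posrE; last by lra.
  by rewrite invf_div.
have tau2 : 2 <= tau * expR (- eta * (V * N)%:R).
  rewrite etaV /tau mulrAC -exprMn ler_pdivlMr ?ltr0n//.
  by rewrite (_ : 2 * (3 / 4) = 3 / 2); last lra.
have tau2' : 2 <= tau.
  apply: (le_trans tau2); rewrite ler_piMr ?(ltW tau0)//.
  by rewrite -[leRHS]expR0 ler_expR mulNr oppr_le0 mulr_ge0// ltW.
pose Pj (j : nat) := [exists k : 'I_(V * N).+1, (0 < k)%N &&
   (tau <= b k%:Z * expR (eta * j%:R * k%:R))].
(* The powers of [e] alone form part of a class of positive drift, and that class is heavy once the
   tilt makes the weight of [e] at least 2. *)
have [j0 hj0] : exists j, Pj j.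
  have [J hJ] : exists J : nat, 2 <= A e * expR (eta * J%:R).
    have Ae : 0 < A e by apply: A_gt0; exact: (hL.2 _ eL).2.
    have h0 : 0 <= 2 / A e / eta by exact: (divr_ge0 (divr_ge0 (ler0n _ _) (ltW Ae)) (ltW eta0)).
    exists (Num.bound (2 / A e / eta)); rewrite mulrC -ler_pdivrMr//.
    apply: le_trans (expR_ge1Dx _); have := archi_boundP h0.
    rewrite ltr_pdivrMr// [_%:R * eta]mulrC => /ltW h1; apply: (le_trans h1).
    by rewrite lerDr.
  exists J; have sub : forall k, {subset pow_list [:: e] k <= pow_list L k}.
    elim=> [|k IH] w /=; first by rewrite inE => /eqP ->.
    by move=> /allpairsP[[w1 w2] /= [/IH h1]]; rewrite inE => /eqP -> ->; exact: allpairs_f.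
  have he : word_list n [:: e].
    by split=> // w; rewrite inE => /eqP ->; exact: hL.2.
  have xe' : {in [:: e], forall w, x w = x e} by move=> w; rewrite inE => /eqP ->.
  have kE : x e *+ N = (N * `|x e|)%N%:Z by rewrite -mulr_natr; lia.
  have xeN := x_pow (k := N.-1) xe'; rewrite prednK// kE in xeN.
  have eN : word_list (N * n) (pow_list [:: e] N.-1).
    by rewrite -(prednK N0); exact: word_list_pow.
  have wt : 2 ^+ N <= weight (pow_list [:: e] N.-1) (eta * J%:R).
    rewrite -{1}(prednK N0); apply: le_trans (weight_pow _ _ he).
    rewrite lerXn2r ?nnegrE// ?(weight_ge0 _ he)// /weight big_seq1.
    apply: (le_trans hJ); rewrite ler_pM2l ?A_gt0//; last exact: (hL.2 _ eL).2.
    rewrite ler_expR ler_peMr ?(mulr_ge0 (ltW eta0))//.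
    by rewrite ler1z.
  have eB : {subset pow_list [:: e] N.-1 <= B (N * `|x e|)%N}.
    by move=> w hw; rewrite mem_filter xeN// eqxx; exact: sub.
  have kb : (N * `|x e| < (V * N).+1)%N.
    have [w hw] : exists w, w \in pow_list [:: e] N.-1.
      case: (pow_list _ _) wt => [|w r]; last by exists w; rewrite inE eqxx.
      by rewrite /weight big_nil leNgt exprn_gt0.
    by have := xL1 _ (sub _ _ hw); rewrite xeN//; lia.
  apply/existsP; exists (Ordinal kb) => /=; apply/andP; split; first by rewrite muln_gt0; lia.
  have := weight_sub (eta * J%:R) (hB (N * `|x e|)%N) eN eB.
  rewrite bE => /(le_trans wt); apply: le_trans.
  by rewrite /tau ler_pdivrMr ?ltr0n// ler_peMr ?exprn_ge0// ler1n.
case: (ex_minnP (ex_intro _ j0 hj0)) => j /existsP[k /andP[k0 hk]] jmin.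
have bk0 : 0 < b k%:Z.
  by rewrite -(pmulr_lgt0 _ (expR_gt0 (eta * j%:R * k%:R))); exact: lt_le_trans hk.
have kVN : (k <= V * N)%N by rewrite -ltnS.
case: j => [|j] in hk jmin.
  have [m hm] := exp2_ge c; exists (m.+1 * (N * n))%N, (pow_list (B k%:Z) m); split.
  - by rewrite muln_gt0 muln_gt0 N0 n0.
  - exact: word_list_pow.
  - by move=> w /(x_pow (xB _)) ->; rewrite -mulr_natr natz -PoszM lez_nat muln_gt0 k0.
  - apply: le_trans (weight_pow _ _ (hB _)).
    apply: (le_trans hm); rewrite mulr0 mul0r expR0 mulr1 in hk.
    have b2 : 2 <= b k%:Z by exact: le_trans hk.
    apply: (@le_trans _ _ (2 ^+ m.+1)); first by rewrite ler_eXn2l//; lra.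
    by rewrite lerXn2r ?nnegrE// b0.
have [v hv bv] := pick (eta * j%:R) (mulr_ge0 (ltW eta0) (ler0n _ _)).
have [v0|v1] := leP v 0; last first.
  suff /jmin : Pj j by rewrite ltnn.
  have hv' : (`|v| < (V * N).+1)%N by rewrite ltnS -lez_nat abszE.
  apply/existsP; exists (Ordinal hv') => /=; rewrite absz_gt0 gt_eqF//=.
  have -> : `|v|%N%:R = v%:~R :> R by rewrite -[in RHS](gtz0_abs v1).
  by rewrite gtz0_abs.
pose u := `|v|%N.
have vE : v = - u%:Z by rewrite /u lez0_abs// opprK.
have step2 : 2 <= b v ^+ k * b k%:Z ^+ u.
  have h1 : tau * expR (eta * j%:R * u%:R) <= b v.
    rewrite -ler_pdivlMr ?expR_gt0// -expRN -mulrN.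
    by move: bv; rewrite {2}vE rmorphN.
  have h2 : tau * expR (- (eta * j.+1%:R * k%:R)) <= b k%:Z.
    by rewrite expRN ler_pdivrMr ?expR_gt0.
  apply: (@le_trans _ _ ((tau * expR (eta * j%:R * u%:R)) ^+ k * (tau * expR (- (eta * j.+1%:R * k%:R))) ^+ u)); last first.
    by apply: ler_pM; rewrite ?exprn_ge0 ?lerXn2r ?nnegrE ?mulr_ge0 ?expR_ge0// ltW.
  rewrite exprMn [X in _ * X]exprMn -!expRM_natr mulrACA -expRD.
  have -> : eta * j%:R * u%:R * k%:R + - (eta * j.+1%:R * k%:R) * u%:R = - eta * k%:R * u%:R :> R.
    by rewrite -natr1; ring.
  rewrite expRM_natr -mulrA -exprMn -[2]mulr1.
  have t2k : 2 <= tau * expR (- eta * k%:R).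
    apply: (le_trans tau2); rewrite ler_pM2l// ler_expR !mulNr lerN2 ler_pM2l// ler_nat//.
  apply: ler_pM => //.
    rewrite -(prednK k0) exprS -[2]mulr1; apply: ler_pM => //.
    by rewrite exprn_ege1//; lra.
  by rewrite exprn_ege1//; lra.
(* The repeated pattern has drift 0, so one more block of drift [k] is appended to make the drift
   positive; its mass is divided out of the target [c] beforehand. *)
have [m hm] := exp2_ge (c / b k%:Z).
pose m1 := m.+1.
exists ((m1 * k).-1.+1 * (N * n) + (m1 * u).+1 * (N * n))%N,
  (cat_list (pow_list (B v) (m1 * k).-1) (pow_list (B k%:Z) (m1 * u))).
have mk0 : (0 < m1 * k)%N by rewrite muln_gt0.
split.
- by rewrite !mulSn addnC -addnA addn_gt0 muln_gt0 N0 n0.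
- by apply: word_list_cat; exact: word_list_pow.
- move=> w /allpairsP[[w1 w2] /= [/(x_pow (xB _)) h1 /(x_pow (xB _)) h2 ->]].
  have e1 : (k * (m1 * u).+1 = u * (m1 * k) + k)%N.
    by rewrite mulnS addnC mulnCA [(u * _)%N]mulnCA [(u * k)%N]mulnC.
  rewrite x_cat h1 h2 prednK// vE.
  exact: int_comb.
- apply: (@le_trans _ _ (b v ^+ (m1 * k) * b k%:Z ^+ (m1 * u).+1)).
    rewrite exprSr mulrA -ler_pdivrMr//; apply: (le_trans hm).
    rewrite mulnC exprM [(m1 * u)%N]mulnC exprM -exprMn.
    apply: (@le_trans _ _ (2 ^+ m1)); first by rewrite ler_eXn2l//; lra.
    rewrite lerXn2r ?nnegrE// mulr_ge0// ?exprn_ge0//.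
  apply: le_trans (weight_cat _ (word_list_pow _ (hB _)) (word_list_pow _ (hB _))).
  apply: ler_pM; rewrite ?exprn_ge0//; last exact: weight_pow (hB _).
  by rewrite -{1}(prednK mk0); exact: weight_pow (hB _).
Qed.

End WordLists.

(** * Sums over countable families *)

Section Esum.
Context {R : realType}.

Lemma esum_subset (T : choiceType) (S S' : set T) (f : T -> \bar R) :
  S `<=` S' -> (\esum_(i in S) f i <= \esum_(i in S') f i)%E.
Proof.
move=> sub; apply: ge_ereal_sup => _ /= [X [finX XS] <-].
by apply: esum_ge; exists X => //; split=> //; exact: subset_trans sub.
Qed.

Lemma esum_ge1 (T : choiceType) (S : set T) (f : T -> \bar R) i : S i ->
  (0 <= f i)%E -> (f i <= \esum_(i in S) f i)%E.
Proof.
move=> Si f0; rewrite -[leLHS](@esum_set1 R T i f)//.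
by apply: esum_subset => _ ->.
Qed.

Lemma esumZl (T : choiceType) (S : set T) (f : T -> \bar R) (c : R) :
  0 < c -> (forall i, S i -> 0 <= f i)%E ->
  (\esum_(i in S) (c%:E * f i) = c%:E * \esum_(i in S) f i)%E.
Proof.
have main (g : T -> \bar R) (d : R) : 0 < d -> (forall i, S i -> 0 <= g i)%E ->
    (\esum_(i in S) (d%:E * g i) <= d%:E * \esum_(i in S) g i)%E.
  move=> d0 g0; apply: ge_ereal_sup => _ /= [X [finX XS] <-].
  rewrite fsbig_finite//= big_seq -ge0_sume_distrr; last first.
    by move=> i; rewrite in_fset_set// inE => /XS /g0.
  rewrite lee_pmul2l ?lte_fin//; apply: esum_ge; exists X => //.
  by rewrite fsbig_finite//= [leRHS]big_seq.
move=> c0 f0; apply/eqP; rewrite eq_le main//=.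
have c0' : 0 < c^-1 by rewrite invr_gt0.
rewrite -lee_pdivlMl//; apply: le_trans (main (fun i => c%:E * f i)%E _ c0' _).
  by apply: le_esum => i Si; rewrite muleA -EFinM mulVf ?gt_eqF// mul1e.
by move=> i Si; rewrite mule_ge0// ?f0// lee_fin ltW.
Qed.

Lemma esum_list (T : choiceType) (S : set T) (f : T -> R) (c : R) :
  (c%:E < \esum_(i in S) (f i)%:E)%E ->
  exists L : seq T, [/\ uniq L, {in L, forall i, S i} & c < \sum_(i <- L) f i].
Proof.
move=> /ereal_sup_gt[_ [X [finX XS] <-]].
rewrite fsbig_finite//= sumEFin lte_fin => h.
by exists (finmap.enum_fset (fset_set X)); split=> // i; rewrite in_fset_set// inE => /XS.
Qed.

Lemma esum_list_le (T : choiceType) (S : set T) (f : T -> R) (L : seq T) :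
  uniq L -> {in L, forall i, S i} ->
  ((\sum_(i <- L) f i)%:E <= \esum_(i in S) (f i)%:E)%E.
Proof.
move=> uL LS; apply: esum_ge; exists [set` L].
  by split; [exact: finite_seq|move=> i /= /LS].
by rewrite -sumEFin fsbig_seq.
Qed.

Lemma esum_prod_le (T T' : choiceType) (A : set T) (B : set T')
    (f : T -> R) (g : T' -> R) (x y : R) :
  (forall i, A i -> 0 < f i) -> (forall j, B j -> 0 <= g j) ->
  (\esum_(i in A) (f i)%:E <= x%:E)%E -> (\esum_(j in B) (g j)%:E = y%:E)%E ->
  (\esum_(k in A `*`` (fun=> B)) (f k.1 * g k.2)%:E <= (x * y)%:E)%E.
Proof.
move=> f0 g0 fx gy.
have y0 : 0 <= y by rewrite -lee_fin -gy esum_ge0// => j /g0; rewrite lee_fin.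
rewrite -(@esum_esum _ _ _ A (fun=> B) (fun i j => (f i * g j)%:E)); last first.
  by move=> i j Ai Bj; rewrite lee_fin mulr_ge0 ?g0// ltW ?f0.
apply: (@le_trans _ _ (\esum_(i in A) (y%:E * (f i)%:E)%E)%E).
  apply: le_esum => i Ai; under eq_esum do rewrite EFinM.
  by rewrite esumZl ?f0// gy muleC.
have [y0'|yn0] := eqVneq y 0.
  rewrite y0' mulr0 esum1// => i _; by rewrite mul0e.
have y1 : 0 < y by rewrite lt_neqAle eq_sym yn0.
rewrite esumZl//; last by move=> i /f0 /ltW; rewrite lee_fin.
by rewrite [x * y]mulrC EFinM lee_pmul2l// lte_fin.
Qed.

(** With [G M] the partial sums and [r = K * f N < 1], one has [G M <= G (N + M) <= G N + r * G M],
    whence the bound [G N / (1 - r)]. *)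
Lemma submult_series (f : nat -> R) (K : R) (N : nat) :
  (forall n, 0 <= f n) -> (forall n m, f (n + m)%N <= K * (f n * f m)) ->
  (0 < N)%N -> K * f N < 1 ->
  exists B, forall M, \sum_(i < M) f i.+1 <= B.
Proof.
move=> f0 fM N0 r1; pose G M := \sum_(i < M) f i.+1.
exists (G N / (1 - K * f N)) => M.
have G1 : G M <= G (N + M)%N.
  by rewrite /G addnC big_split_ord /= lerDl sumr_ge0.
have G2 : G (N + M)%N <= G N + K * f N * G M.
  rewrite /G big_split_ord /= lerD2l mulr_sumr; apply: ler_sum => i _.
  by rewrite -addnS -mulrA; exact: fM.
rewrite ler_pdivlMr; last by lra.
rewrite -/(G M); nra.
Qed.

Lemma esum_nat_bound (f : nat -> R) (B : R) : (forall n, 0 <= f n) ->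
  (forall M, \sum_(i < M) f i.+1 <= B) ->
  (\esum_(n in [set n | (1 <= n)%N]) (f n)%:E <= B%:E)%E.
Proof.
move=> f0 h; rewrite -nneseries_esum; last by move=> n _; rewrite lee_fin.
apply: lime_le; first by apply: is_cvg_nneseries_cond => n _ _; rewrite lee_fin.
apply: nearW => M; rewrite sumEFin lee_fin; case: M => [|M].
  by rewrite big_geq//; apply: le_trans (h 0%N); rewrite big_ord0.
by rewrite big_ltn_cond//= big_add1/= big_mkord.
Qed.

End Esum.

(** * Partition functions of words *)

Section Symbolic.
Context {R : realType} (I : set nat) (l : seq nat -> R) (K th : R) (p : nat -> int).

Definition words n : set (seq nat) := [set w | size w = n /\ wordP I w].
Definition psum (w : seq nat) : int := \sum_(i <- w) p i.
Definition wterm (s q : R) w := l w `^ s * expR (q * (psum w)%:~R).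
(** Dividing by [K] before taking the power turns the quasi-multiplicativity of [l] into exact
    supermultiplicativity ([psize_cat]), so powers of a finite family lose no constants. *)
Definition psize s w := (l w / K) `^ s.
Definition part n s q : \bar R := \esum_(w in words n) (wterm s q w)%:E.

(* Some partition function beats the submultiplicativity constant, so that they
   decay geometrically. *)
Definition contr s q := exists2 n, (0 < n)%N & ((K `^ s)%:E * part n s q < 1)%E.
(** The length [n] is fixed before [q]: separate bounds for each [q] could not be reduced to a
    finite family of words of one length. *)
Definition unif_plus s := forall c : R, exists2 n, (0 < n)%N &
  forall q, 0 <= q -> (c%:E <= part n s q)%E.
Definition unif_minus s := forall c : R, exists2 n, (0 < n)%N &
  forall q, q <= 0 -> (c%:E <= part n s q)%E.

Hypothesis l_gt0 : forall w, wordP I w -> 0 < l w.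
Hypothesis K_ge1 : 1 <= K.
Hypothesis l_cat_le : forall u v, wordP I u -> wordP I v -> l (u ++ v) <= K * l u * l v.
Hypothesis l_cat_ge : forall u v, wordP I u -> wordP I v -> l u * l v <= K * l (u ++ v).
Hypothesis th_gt0 : 0 < th.
Hypothesis th_lt1 : th < 1.
Hypothesis l_le : forall w, wordP I w -> l w <= K * th ^+ size w.
Hypothesis p_ge : forall i, I i -> -1 <= p i.

Lemma K_gt0 : 0 < K. Proof. exact: lt_le_trans K_ge1. Qed.

Lemma psum_cat u v : psum (u ++ v) = psum u + psum v.
Proof. by rewrite /psum big_cat. Qed.

Lemma psum_cons i v : psum (i :: v) = p i + psum v.
Proof. by rewrite /psum big_cons. Qed.

Lemma psum_ge w : wordP I w -> - (size w)%:Z <= psum w.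
Proof.
elim: w => [|i w IH] h; first by rewrite /psum big_nil.
have h1 := p_ge (h i (mem_head _ _)).
have h2 := IH (wordP_catr (u := [:: i]) h).
move: h1 h2; rewrite psum_cons /=; clear; lia.
Qed.

Lemma psum_nseq n i : psum (nseq n i) = p i *+ n.
Proof. by rewrite /psum big_nseq iter_addr addr0. Qed.

Lemma wordP_nseq n i : I i -> wordP I (nseq n i).
Proof. by move=> Ii j; rewrite mem_nseq => /andP[_ /eqP ->]. Qed.

Lemma wterm_gt0 s q w : wordP I w -> 0 < wterm s q w.
Proof. by move=> h; rewrite mulr_gt0 ?expR_gt0// powR_gt0// l_gt0. Qed.

Lemma part_ge0 n s q : (0 <= part n s q)%E.
Proof. by apply: esum_ge0 => w [_ h]; rewrite lee_fin ltW// wterm_gt0. Qed.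

Lemma wterm_cat_le s q u v : 0 <= s -> wordP I u -> wordP I v ->
  wterm s q (u ++ v) <= K `^ s * (wterm s q u * wterm s q v).
Proof.
move=> s0 hu hv; rewrite /wterm psum_cat intrD mulrDr expRD.
rewrite [X in _ <= _ * X]mulrACA [leRHS]mulrA ler_wpM2r ?mulr_ge0 ?expR_ge0//.
rewrite -powRM ?(ltW (l_gt0 _))// -powRM ?mulr_ge0 ?(ltW (l_gt0 _)) ?(ltW K_gt0)//.
apply: ge0_ler_powR => //; rewrite ?nnegrE ?mulr_ge0 ?(ltW (l_gt0 _)) ?(ltW K_gt0)//.
- exact: wordP_cat.
- by rewrite mulrA l_cat_le.
Qed.

Lemma wterm_cat_ge s q u v : 0 <= s -> wordP I u -> wordP I v ->
  wterm s q u * wterm s q v <= K `^ s * wterm s q (u ++ v).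
Proof.
move=> s0 hu hv; rewrite /wterm psum_cat intrD mulrDr expRD.
rewrite mulrACA [leRHS]mulrA ler_wpM2r ?mulr_ge0 ?expR_ge0//.
have h := ltW (l_gt0 (wordP_cat hu hv)).
rewrite -(powRM s (ltW (l_gt0 hu)) (ltW (l_gt0 hv))) -(powRM s (ltW K_gt0) h).
apply: ge0_ler_powR => //; rewrite ?nnegrE ?mulr_ge0 ?(ltW (l_gt0 _)) ?(ltW K_gt0)//.
- exact: wordP_cat.
- exact: l_cat_ge.
Qed.

Lemma words_cat_bij n m :
  set_bij (words n `*`` (fun=> words m)) (words (n + m)) (fun k => k.1 ++ k.2).
Proof.
split.
- by move=> [u v] /= [[su hu] [sv hv]]; split; [rewrite size_cat su sv|exact: wordP_cat].
- move=> [u v] [u' v']; rewrite !inE /= => -[[su hu] [sv hv]] [[su' hu'] [sv' hv']] /eqP.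
  by rewrite eqseq_cat ?su ?su'// => /andP[/eqP -> /eqP ->].
- move=> w [sw hw]; exists (take n w, drop n w) => /=; last by rewrite cat_take_drop.
  rewrite -(cat_take_drop n w) in hw.
  split; split; [|exact: wordP_catl hw| |exact: wordP_catr hw].
    by rewrite size_takel// sw leq_addr.
  by rewrite size_drop sw addKn.
Qed.

Lemma part_cat_le n m s q (x y : R) : 0 <= s -> (part n s q <= x%:E)%E ->
  (part m s q = y%:E)%E -> (part (n + m) s q <= (K `^ s * (x * y))%:E)%E.
Proof.
move=> s0 hx hy; rewrite /part (reindex_esum _ _ _ _ (words_cat_bij n m)).
apply: (@le_trans _ _ (\esum_(k in words n `*`` (fun=> words m))
   ((K `^ s)%:E * (wterm s q k.1 * wterm s q k.2)%:E)%E)%E).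
  apply: le_esum => -[u v] /= [[su hu] [sv hv]]; rewrite -EFinM lee_fin.
  exact: wterm_cat_le.
rewrite esumZl ?powR_gt0 ?K_gt0//; last first.
  by move=> [u v] /= [[su hu] [sv hv]]; rewrite lee_fin mulr_ge0// ltW// wterm_gt0.
rewrite EFinM lee_pmul2l ?lte_fin ?powR_gt0 ?K_gt0//.
apply: (@esum_prod_le R _ _ (words n) (words m) (wterm s q) (wterm s q)) => //.
  by move=> u [_]; exact: wterm_gt0.
by move=> u [_ h]; rewrite ltW// wterm_gt0.
Qed.

(** Appending a fixed word of length [n - 1] embeds the letters into the words of length [n] at the
    cost of a constant factor. Consequently a sum that is infinite at length 1 is infinite at every
    positive length. *)
Lemma part1_fin n s q : 0 <= s -> I !=set0 -> (0 < n)%N -> (part n s q < +oo)%E ->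
  (part 1 s q < +oo)%E.
Proof.
move=> s0 [i Ii] n0 h; pose v := nseq n.-1 i.
have hv : wordP I v by exact: wordP_nseq.
have tv := wterm_gt0 s q hv.
have : ((wterm s q v)%:E * part 1 s q <= (K `^ s)%:E * part n s q)%E.
  rewrite -!esumZl ?powR_gt0 ?K_gt0//; first last.
  - by move=> w [_ hw]; rewrite lee_fin ltW// wterm_gt0.
  - by move=> w [_ hw]; rewrite lee_fin ltW// wterm_gt0.
  apply: (@le_trans _ _ (\esum_(w in words 1) ((K `^ s)%:E * (wterm s q (w ++ v))%:E)%E)%E).
    apply: le_esum => w [_ hw]; rewrite -!EFinM lee_fin mulrC; exact: wterm_cat_ge.
  have inj : set_inj (words 1) (fun w => w ++ v).
    move=> w w'; rewrite !inE => -[sw _] [sw' _] /eqP.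
    by rewrite eqseq_cat ?sw ?sw'// => /andP[/eqP].
  rewrite -(esum_image (words 1) (fun w => w ++ v) (fun w => (K `^ s)%:E * (wterm s q w)%:E)%E inj).
  apply: esum_subset => _ [w [sw hw] <-]; split; last exact: wordP_cat.
  by rewrite size_cat sw size_nseq add1n prednK.
move=> hle; rewrite ltey; apply/eqP => e; move: hle.
rewrite e gt0_muley ?lte_fin// leye_eq => /eqP e2.
have := part_ge0 n s q; move: h e2; case: (part n s q) => //.
Qed.

Lemma part_fin n s q : 0 <= s -> (part 1 s q < +oo)%E -> (0 < n)%N -> (part n s q < +oo)%E.
Proof.
move=> s0 h; case: n => // n _; elim: n => [//|n IH].
have := part_ge0 n.+1 s q; have := part_ge0 1 s q.
case E1 : (part 1 s q) h => [x| |]// _ _.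
case En : (part n.+1 s q) IH => [y| |]// _ _.
rewrite -addn1; apply: le_lt_trans (part_cat_le s0 (_ : _ <= y%:E)%E E1) _ => //.
  by rewrite En.
by rewrite ltry.
Qed.

(** The rate is K^s times the partition function at length [N]. The induction carries an extra
    factor K^(-s), which absorbs the constant of the next concatenation and is dropped at the end
    because [K >= 1]. *)
Lemma contr_step s q : 0 <= s -> I !=set0 -> contr s q ->
  exists N (r : R), [/\ (0 < N)%N, 0 <= r, r < 1 &
    forall k, (part (k.+1 * N) s q <= (r ^+ k.+1)%:E)%E].
Proof.
move=> s0 I0 [N N0 hN].
have Ks : 0 < K `^ s by rewrite powR_gt0 ?K_gt0.
have Ks1 : 1 <= K `^ s by rewrite -(powRr0 K) ler_powR.
have a0 := part_ge0 N s q.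
case E : (part N s q) hN a0 => [y| |]; last 2 first.
- by rewrite gt0_muley.
- by [].
rewrite -EFinM lte_fin lee_fin => r1 y0.
have r0 : 0 <= K `^ s * y by rewrite mulr_ge0// ltW.
exists N, (K `^ s * y); split=> // k.
suff : (part (k.+1 * N) s q <= ((K `^ s)^-1 * (K `^ s * y) ^+ k.+1)%:E)%E.
  move=> h; apply: (le_trans h); rewrite lee_fin ler_piMl ?exprn_ge0// invf_le1//.
elim: k => [|k IH]; first by rewrite mul1n expr1 mulKf ?gt_eqF// E.
rewrite mulSn addnC; apply: (le_trans (part_cat_le s0 IH E)).
by rewrite lee_fin [X in _ <= _ * X]exprS le_eqVlt; apply/orP; left; apply/eqP; ring.
Qed.

Lemma contr_summable s q : 0 <= s -> I !=set0 -> contr s q ->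
  (\esum_(n in [set n | (1 <= n)%N]) part n s q < +oo)%E.
Proof.
move=> s0 I0 [N N0 hN].
have Ks : 0 < K `^ s by rewrite powR_gt0 ?K_gt0.
have fN : (part N s q < +oo)%E.
  by rewrite ltey; apply/eqP => e; move: hN; rewrite e gt0_muley ?lte_fin.
have f1 := part1_fin s0 I0 N0 fN.
pose f n := fine (part n s q).
have fin n : (0 < n)%N -> part n s q = (f n)%:E.
  by move=> n0; rewrite fineK// ge0_fin_numE ?part_ge0// part_fin.
(* The value 1 replaces the term of the empty word, so that submultiplicativity also holds when one
   of the lengths is 0. *)
pose g n := if n is 0%N then 1 else f n.
have f0 n : 0 <= f n by rewrite fine_ge0// part_ge0.
have Ks1 : 1 <= K `^ s by rewrite -(powRr0 K) ler_powR.
have [B hB] : exists B, forall M, \sum_(i < M) g i.+1 <= B.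
  apply: (@submult_series R g (K `^ s) N) => //.
  - by case=> [|n] //=.
  - move=> [|n] [|m] /=.
    + by rewrite !mulr1.
    + by rewrite mul1r ler_peMl.
    + by rewrite addn0 mulr1 ler_peMl.
    + rewrite -lee_fin -fin//; apply: part_cat_le => //; last by rewrite fin.
      by rewrite fin.
  - by case: N N0 hN {fN} => // N _; rewrite fin// -EFinM lte_fin.
apply: le_lt_trans (ltry B); rewrite (eq_esum (b := fun n => (g n)%:E)).
  by apply: esum_nat_bound => //; case=> [|n] /=.
by case=> //= n _; rewrite fin.
Qed.

Lemma wterm_s_le s1 s2 q w : s1 <= s2 -> wordP I w ->
  wterm s2 q w <= (K * th ^+ size w) `^ (s2 - s1) * wterm s1 q w.
Proof.
move=> s12 hw; rewrite /wterm mulrA ler_wpM2r ?expR_ge0//.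
rewrite -{1}(subrK s1 s2) [l w `^ _]powRD; last by rewrite (gt_eqF (l_gt0 hw)) /= implybT.
rewrite ler_wpM2r ?powR_ge0//; apply: ge0_ler_powR; rewrite ?nnegrE ?subr_ge0//.
- by rewrite ltW ?l_gt0.
- by rewrite mulr_ge0 ?exprn_ge0 ?ltW// K_gt0.
- exact: l_le.
Qed.

Lemma part_s_le n s1 s2 q : s1 <= s2 ->
  (part n s2 q <= ((K * th ^+ n) `^ (s2 - s1))%:E * part n s1 q)%E.
Proof.
move=> s12; rewrite -esumZl.
- apply: le_esum => w [sw hw]; rewrite -EFinM lee_fin -sw; exact: wterm_s_le.
- by rewrite powR_gt0// mulr_gt0 ?exprn_gt0 ?K_gt0.
- by move=> w [_ hw]; rewrite lee_fin ltW// wterm_gt0.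
Qed.

Lemma th_powR_small (e c : R) : 0 < e -> exists2 n, (0 < n)%N & c * (K * th ^+ n) `^ e <= 1.
Proof.
move=> e0.
have h : (fun n => th ^+ n : R) @ \oo --> (0 : R) by apply: cvg_expr; rewrite ger0_norm ?ltW.
pose d : R := (`|c| + 1)^-1 `^ e^-1 / K.
have d0 : 0 < d.
  by rewrite divr_gt0 ?K_gt0// powR_gt0// invr_gt0; have := normr_ge0 c; lra.
have : \forall n \near \oo, th ^+ n < d.
  have /cvgrPdist_lt /(_ d d0) := h; apply: filterS => n.
  by rewrite sub0r normrN ger0_norm ?exprn_ge0// ltW.
move=> [N _ hN]; exists N.+1 => //; have := hN N.+1 (leqnSn N) => /= hd.
have c1 : 0 < `|c| + 1 by have := normr_ge0 c; lra.
apply: (@le_trans _ _ (`|c| * (`|c| + 1)^-1)); last first.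
  by rewrite ler_pdivrMr// mul1r lerDl.
apply: (@le_trans _ _ (`|c| * (K * th ^+ N.+1) `^ e)); first by rewrite ler_wpM2r ?powR_ge0// ler_norm.
rewrite ler_wpM2l//.
have -> : (`|c| + 1)^-1 = (K * d) `^ e.
  by rewrite /d mulrC divfK ?gt_eqF ?K_gt0// -powRrM mulVf ?gt_eqF// powRr1// invr_ge0 ltW.
apply: ge0_ler_powR; rewrite ?nnegrE ?(ltW e0)//.
- by rewrite mulr_ge0 ?exprn_ge0 ?ltW// K_gt0.
- by rewrite mulr_ge0 ?ltW// K_gt0.
- by rewrite ler_pM2l ?K_gt0// ltW.
Qed.

(** Lowering the exponent from [s2] to [s1] multiplies each term of length [n] at least by the
    inverse of (K th^n)^(s2 - s1), which tends to infinity with [n], independently of [q]. *)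
Lemma unif_of_lower (Q : set R) s1 s2 (c : R) : s1 < s2 -> 0 < c ->
  (forall n q, (0 < n)%N -> Q q -> (c%:E <= part n s2 q)%E) ->
  forall C : R, exists2 n, (0 < n)%N & forall q, Q q -> (C%:E <= part n s1 q)%E.
Proof.
move=> s12 c0 h C.
have e0 : 0 < s2 - s1 by rewrite subr_gt0.
have [n n0 hn] := th_powR_small (C / c) e0.
exists n => // q Qq; have := le_trans (h n q n0 Qq) (part_s_le n q (ltW s12)).
set x := (_ `^ _) in hn *.
have x0 : 0 < x by rewrite powR_gt0// mulr_gt0 ?exprn_gt0 ?K_gt0.
rewrite -lee_pdivrMl//; apply: le_trans; rewrite lee_fin.
by rewrite mulrC ler_pdivlMr//; move: hn; rewrite mulrAC ler_pdivrMr// mul1r.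
Qed.

(** If [contr] fails at [s2] for every [q <= 0], all partition functions there are at least K^(-s2),
    whatever the length, and [unif_of_lower] applies. This alternative stands in for a variational
    formula for the critical exponent. *)
Lemma contr_or_unif_minus s1 s2 : 0 <= s1 -> s1 < s2 ->
  (exists2 q, q <= 0 & contr s2 q) \/ unif_minus s1.
Proof.
move=> s10 s12; have [[q [q0 hq]]|hn] := pselect (exists q, q <= 0 /\ contr s2 q).
  by left; exists q.
right; apply: (@unif_of_lower [set q | q <= 0] s1 s2 (K `^ s2)^-1) => //.
  by rewrite invr_gt0 powR_gt0 ?K_gt0.
move=> n q n0 q0; rewrite leNgt; apply/negP => h; apply: hn; exists q; split=> //; exists n => //.
by rewrite -lte_pdivlMl ?mule1// powR_gt0 ?K_gt0.
Qed.

Hypothesis im_ex : exists2 i, I i & p i = -1.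
Hypothesis ip_ex : exists2 i, I i & 1 <= p i.

Lemma psize_gt0 s w : wordP I w -> 0 < psize s w.
Proof. by move=> h; rewrite powR_gt0// divr_gt0 ?l_gt0 ?K_gt0. Qed.

Lemma psize_cat s u v : 0 <= s -> wordP I u -> wordP I v ->
  psize s u * psize s v <= psize s (u ++ v).
Proof.
move=> s0 hu hv; have lu := ltW (l_gt0 hu); have lv := ltW (l_gt0 hv).
have k0 := ltW K_gt0.
rewrite -powRM ?divr_ge0//; have luv : 0 <= l (u ++ v) by rewrite ltW// l_gt0//; exact: wordP_cat.
apply: ge0_ler_powR => //; rewrite ?nnegrE ?mulr_ge0 ?divr_ge0 ?invr_ge0//.
have ki : 0 < K^-1 by rewrite invr_gt0 K_gt0.
rewrite mulrA ler_pM2r// mulrAC ler_pdivrMr ?K_gt0//.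
by rewrite [leRHS]mulrC; exact: l_cat_ge.
Qed.

Lemma psize_wterm s q w : wordP I w ->
  psize s w * expR (q * (psum w)%:~R) = (K `^ s)^-1 * wterm s q w.
Proof.
move=> hw; rewrite /psize powRM ?invr_ge0 ?(ltW K_gt0) ?(ltW (l_gt0 hw))//.
by rewrite -powR_inv1 ?(ltW K_gt0)// -powRrM mulN1r powRN /wterm; ring.
Qed.

(** A grid cell has width [1 / n] and every word of length [n] has [psum] at least [- n], so moving
    [q] to the right inside a cell costs at most a factor e. In the constant 3 e K^s, e pays for
    this move, K^s for the passage to [psize], and 3 in place of 2 leaves room to extract finite
    lists. *)
Lemma finite_sub n s q0 (k : nat) : (0 < n)%N -> 0 <= s ->
  (forall j, (j <= k)%N -> ((3 * expR 1 * K `^ s)%:E <= part n s (q0 + j%:R / n%:R))%E) ->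
  exists L, word_list I n L /\
    forall q, q0 <= q <= q0 + k%:R / n%:R -> 2 <= weight (psize s) psum L q.
Proof.
move=> n0 s0 h.
have Ks : 0 < K `^ s by rewrite powR_gt0 ?K_gt0.
have nR : 0 < n%:R :> R by rewrite ltr0n.
have /choice[Lf hLf] : forall j, exists L, (j <= k)%N -> word_list I n L /\
    2 * expR 1 <= weight (psize s) psum L (q0 + j%:R / n%:R).
  move=> j; have [jk|jk] := leqP j k; last by exists [::].
  have : ((2 * expR 1 * K `^ s)%:E < part n s (q0 + j%:R / n%:R))%E.
    apply: lt_le_trans (h j jk); rewrite lte_fin ltr_pM2r// ltr_pM2r ?expR_gt0//.
    by rewrite ltr_nat.
  move=> /esum_list[L [uL LW hL]]; exists L => _; split; first by split.
  rewrite /weight big_seq (eq_bigr (fun w => (K `^ s)^-1 * wterm s (q0 + j%:R / n%:R) w)).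
    by rewrite -big_seq -mulr_sumr ler_pdivlMl// mulrC ltW.
  by move=> w /LW [_ hw]; exact: psize_wterm.
have Lf1 j : (j <= k)%N -> word_list I n (Lf j) by move=> /hLf[].
pose L := undup (flatten [seq Lf j | j <- iota 0 k.+1]).
have wL : word_list I n L.
  split; first exact: undup_uniq.
  move=> w; rewrite mem_undup => /flatten_mapP[j]; rewrite mem_iota /= add0n ltnS => jk.
  exact: (Lf1 j jk).2.
exists L; split=> // q /andP[q1 q2].
pose j := Num.trunc ((q - q0) * n%:R).
have x0 : 0 <= (q - q0) * n%:R by rewrite mulr_ge0 ?subr_ge0.
have /andP[j1 j2] := truncn_itv x0; rewrite -/j in j1 j2.
have jk : (j <= k)%N.
  rewrite -(ler_nat R); apply: (le_trans j1).
  by rewrite -ler_pdivlMr// lerBlDl.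
have [_ hj] := hLf j jk.
have sub : {subset Lf j <= L}.
  by move=> w hw; rewrite mem_undup; apply/flatten_mapP; exists j => //; rewrite mem_iota.
apply: le_trans (weight_sub psum (psize_gt0 s) q wL (Lf1 j jk) sub).
rewrite -(ler_pM2r (expR_gt0 1)); apply: (le_trans hj).
rewrite /weight mulr_suml big_seq [leRHS]big_seq; apply: ler_sum => w wLj.
have [sw hw] := (Lf1 j jk).2 w wLj.
rewrite -mulrA ler_pM2l ?psize_gt0// -expRD ler_expR.
have pn : - n%:R <= (psum w)%:~R :> R.
  by rewrite (_ : - n%:R = (- n%:Z)%:~R) ?ler_int -?sw ?psum_ge// rmorphN.
pose d := q - (q0 + j%:R / n%:R).
have d0 : 0 <= d by rewrite subr_ge0 -lerBrDl ler_pdivrMr.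
have d1 : d * n%:R <= 1.
  by rewrite mulrBl mulrDl divfK ?gt_eqF//; rewrite -natr1 in j2; lra.
have -> : q = q0 + j%:R / n%:R + d by rewrite /d; lra.
by nra.
Qed.

Lemma weight_large n s e q Q L : 0 <= s -> word_list I n L -> word_list I n [:: e] ->
  1 <= psum e -> 2 <= psize s e * expR Q -> 0 <= Q -> Q <= q ->
  2 <= weight (psize s) psum (undup (e :: L)) q.
Proof.
move=> s0 wL we pe hQ Q0 Qq; apply: (le_trans hQ).
have wu : word_list I n (undup (e :: L)).
  split; first exact: undup_uniq.
  move=> w; rewrite mem_undup inE => /orP[/eqP ->|/wL.2//].
  by apply: we.2; rewrite inE.
have he := (we.2 e (mem_head _ _)).2.
apply: le_trans (weight_sub psum (psize_gt0 s) q wu we _); last first.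
  by move=> w; rewrite inE => /eqP ->; rewrite mem_undup inE eqxx.
rewrite /weight big_seq1 ler_pM2l ?psize_gt0// ler_expR; apply: (le_trans Qq).
by rewrite ler_peMr ?(le_trans Q0)// ler1z.
Qed.

Lemma weightN (L : seq (seq nat)) s q :
  weight (psize s) (fun w => - psum w) L q = weight (psize s) psum L (- q).
Proof. by apply: eq_bigr => w _; rewrite rmorphN mulrN mulNr. Qed.

Lemma exists_grid (n : nat) (x : R) : (0 < n)%N -> exists2 k : nat, x <= k%:R / n%:R & 0 <= k%:R / n%:R :> R.
Proof.
move=> n0; exists (Num.bound (`|x| * n%:R)); last by rewrite divr_ge0.
have h : 0 <= `|x| * n%:R by rewrite mulr_ge0.
rewrite ler_pdivlMr ?ltr0n//; apply: ltW; apply: le_lt_trans (archi_boundP h).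
by rewrite ler_wpM2r// ler_norm.
Qed.

Lemma expR_large (a : R) : 0 < a -> exists2 x : R, 0 <= x & 2 <= a * expR x.
Proof.
move=> a0; exists (2 / a); first by rewrite divr_ge0// ltW.
rewrite -ler_pdivrMl// mulrC; apply: le_trans (expR_ge1Dx _); lra.
Qed.

(** Compactness in [q]: finitely many words serve the bounded range covered by the grid, and one
    word [e] of positive drift serves all larger [q]. Together they satisfy the hypotheses of
    [list_drift]. *)
Lemma list_plus s c : 0 <= s -> unif_plus s -> exists m L,
  [/\ (0 < m)%N, word_list I m L, {in L, forall w, 1 <= psum w} &
      c <= \sum_(w <- L) psize s w].
Proof.
move=> s0 /(_ (3 * expR 1 * K `^ s))[n n0 hn].
have [i Ii pi] := ip_ex; pose e := nseq n i.
have we : word_list I n [:: e].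
  by split=> // w; rewrite inE => /eqP ->; rewrite size_nseq; split=> //; exact: wordP_nseq.
have pe : 1 <= psum e.
  by rewrite psum_nseq -mulr_natr natz; move: pi n0; clear; nia.
have he := (we.2 e (mem_head _ _)).2.
have [Q Q0 hQ] := expR_large (psize_gt0 s he).
have [k hk k0] := exists_grid Q n0.
have [|L [wL hL]] := @finite_sub n s 0 k n0 s0.
  by move=> j jk; apply: hn; rewrite add0r divr_ge0.
have wu : word_list I n (undup (e :: L)).
  split; first exact: undup_uniq.
  move=> w; rewrite mem_undup inE => /orP[/eqP ->|/wL.2//].
  by apply: we.2; rewrite inE.
have [||m [L' [m0 wL' xL' hL']]] := list_drift (psize_gt0 s) (fun u v => @psize_cat s u v s0) psum_cat wu n0 _ _ c.
- move=> q q0; have [q1|q1] := leP q (k%:R / n%:R).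
    have := hL q; rewrite q0 add0r q1 => /(_ isT) h; apply: (le_trans h).
    apply: (weight_sub psum (psize_gt0 s) q wu wL) => w wL0.
    by rewrite mem_undup inE wL0 orbT.
  by apply: (@weight_large n s e q Q) => //; exact: le_trans (ltW q1).
- by exists e => //; rewrite mem_undup mem_head.
exists m, L'; split=> //; apply: (le_trans hL').
by rewrite /weight le_eqVlt; apply/orP; left; apply/eqP; apply: eq_bigr => w _; rewrite mul0r expR0 mulr1.
Qed.

(** The mirror image of [list_plus]: [list_drift] is applied to the drift [- psum], and the grid
    covers an interval ending at 0. *)
Lemma list_minus s c : 0 <= s -> unif_minus s -> exists m L,
  [/\ (0 < m)%N, word_list I m L, {in L, forall w, psum w <= -1} &
      c <= \sum_(w <- L) psize s w].
Proof.
move=> s0 /(_ (3 * expR 1 * K `^ s))[n n0 hn].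
have [i Ii pi] := im_ex; pose e := nseq n i.
have we : word_list I n [:: e].
  by split=> // w; rewrite inE => /eqP ->; rewrite size_nseq; split=> //; exact: wordP_nseq.
have pe : psum e <= -1.
  by rewrite psum_nseq -mulr_natr natz pi; move: n0; clear; nia.
have he := (we.2 e (mem_head _ _)).2.
have [Q Q0 hQ] := expR_large (psize_gt0 s he).
have [k hk k0] := exists_grid Q n0.
have [|L [wL hL]] := @finite_sub n s (- (k%:R / n%:R)) k n0 s0.
  move=> j jk; apply: hn; rewrite addrC subr_le0 ler_pM2r ?invr_gt0 ?ltr0n//.
  by rewrite ler_nat.
have wu : word_list I n (undup (e :: L)).
  split; first exact: undup_uniq.
  move=> w; rewrite mem_undup inE => /orP[/eqP ->|/wL.2//].
  by apply: we.2; rewrite inE.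
pose y w := - psum w.
have ycat u v : y (u ++ v) = y u + y v by rewrite /y psum_cat opprD.
have [||m [L' [m0 wL' xL' hL']]] := list_drift (psize_gt0 s) (fun u v => @psize_cat s u v s0) ycat wu n0 _ _ c.
- move=> q q0; have [q1|q1] := leP q (k%:R / n%:R).
    have := hL (- q); rewrite addrC subrr oppr_le0 lerN2 q1 q0 => /(_ isT) h.
    rewrite weightN; apply: (le_trans h).
    apply: (weight_sub psum (psize_gt0 s) (- q) wu wL) => w wL0.
    by rewrite mem_undup inE wL0 orbT.
  apply: (le_trans hQ); apply: le_trans (weight_sub y (psize_gt0 s) q wu we _); last first.
    by move=> w; rewrite inE => /eqP ->; rewrite mem_undup inE eqxx.
  rewrite /weight big_seq1 ler_pM2l ?psize_gt0// ler_expR.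
  apply: (le_trans (le_trans hk (ltW q1))).
  by rewrite ler_peMr// ler1z /y; move: pe; clear; lia.
- by exists e; rewrite ?mem_undup ?mem_head// /y; move: pe; clear; lia.
exists m, L'; split=> //; first by move=> w /xL'; rewrite /y; clear; lia.
apply: (le_trans hL').
by rewrite /weight le_eqVlt; apply/orP; left; apply/eqP; apply: eq_bigr => w _; rewrite mul0r expR0 mulr1.
Qed.

End Symbolic.

(** * Hausdorff measure *)

Section HausdorffTools.
Context {R : realType}.
Implicit Types (A B : set R) (s d e : R).

Lemma diam_pow_ge0 s A : (0 <= diam_pow s A)%E.
Proof. by rewrite /diam_pow; case: ifPn => // _; exact: poweR_ge0. Qed.

Lemma diam_leP A (r : R) :
  (diam A <= r%:E)%E <-> (forall x y, A x -> A y -> `|x - y| <= r).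
Proof.
split=> [h x y Ax Ay|h].
  by rewrite -lee_fin; apply: le_trans h; apply: ereal_sup_ubound; exists x, y.
by apply: ge_ereal_sup => _ [x [y [Ax Ay ->]]]; rewrite lee_fin; exact: h.
Qed.

Lemma diam_ge0 A : A !=set0 -> (0 <= diam A)%E.
Proof.
move=> [x Ax]; apply: ereal_sup_ubound; exists x, x; split=> //.
by rewrite subrr normr0.
Qed.

Lemma diam_pow_le s A (r : R) : 0 <= s -> 0 <= r -> (diam A <= r%:E)%E ->
  (diam_pow s A <= (r `^ s)%:E)%E.
Proof.
move=> s0 r0 h; rewrite /diam_pow; case: ifPn => [_|/set0P A0]; first by rewrite lee_fin powR_ge0.
rewrite -poweR_EFin gt0_ler_poweR// in_itv/= ?diam_ge0 ?leey//= ?lee_fin ?r0//.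
Qed.

Lemma null_setP s A : hausdorff_measure s A = 0%E <->
  forall d e, 0 < d -> 0 < e -> exists U : nat -> set R,
    [/\ forall k, (diam (U k) <= d%:E)%E, A `<=` \bigcup_k U k &
        (\sum_(0 <= k <oo) diam_pow s (U k) <= e%:E)%E].
Proof.
have c0 d : (0 <= hausdorff_content s d A)%E.
  apply: le_ereal_inf_tmp => _ [U [_ _ ->]]; apply: nneseries_ge0 => k _ _.
  exact: diam_pow_ge0.
split=> [h d e d0 e0|h].
  have : (hausdorff_content s d A < e%:E)%E.
    apply: (@le_lt_trans _ _ 0%E); last by rewrite lte_fin.
    by rewrite -h; apply: ereal_sup_ubound; exists d.
  by move=> /ereal_inf_lt[_ [U [U1 U2 ->]] /ltW U3]; exists U.
apply/eqP; rewrite eq_le; apply/andP; split; last first.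
  by apply: (le_trans (c0 1)); apply: ereal_sup_ubound; exists 1 => //=.
apply: ge_ereal_sup => _ [d d0 <-]; apply/lee_addgt0Pr => e e0.
have [U [U1 U2 U3]] := h d e d0 e0; rewrite add0e.
by apply: le_trans U3; apply: ereal_inf_lbound; exists U.
Qed.

Lemma null_cover (T : countType) s A : 0 <= s ->
  (forall d e, 0 < d -> 0 < e -> exists (V : set T) (B : T -> set R) (r : T -> R),
    [/\ forall t, V t -> 0 <= r t <= d,
        forall t x y, V t -> B t x -> B t y -> `|x - y| <= r t,
        A `<=` \bigcup_(t in V) B t &
        (\esum_(t in V) (r t `^ s)%:E <= e%:E)%E]) ->
  hausdorff_measure s A = 0%E.
Proof.
move=> s0 h; apply/null_setP => d e d0 e0.
have [V [B [r [hr hB AB hs]]]] := h d e d0 e0.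
pose U k := if pickle_inv k is Some t then if t \in V then B t else set0 else set0.
have dset0 : (diam (set0 : set R) <= d%:E)%E by apply/diam_leP.
have dU k : (diam (U k) <= d%:E)%E.
  rewrite /U; case: pickle_inv => // t; case: ifPn => //; rewrite inE => Vt.
  by apply/diam_leP => x y hx hy; apply: (le_trans (hB t x y Vt hx hy)); case/andP: (hr t Vt).
exists U; split=> //.
  move=> x /AB[t Vt Bx]; exists (pickle t) => //.
  by rewrite /U pickleK_inv mem_set.
rewrite nneseries_esumT; last by move=> k; exact: diam_pow_ge0.
rewrite (esumID (pickle @` V)); last by move=> k _; exact: diam_pow_ge0.
rewrite setTI [X in (_ + X)%E]esum1 ?adde0; last first.
  move=> k [_ /= nk]; rewrite /U; case E : (pickle_inv k) => [t|]; last by rewrite /diam_pow eqxx.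
  case: ifPn; rewrite ?inE /diam_pow ?eqxx// => Vt; exfalso; apply: nk; exists t => //.
  by have := pickle_invK (T := T) k; rewrite E.
rewrite esum_image; last by move=> t t' _ _; exact: (pcan_inj pickleK_inv).
apply: le_trans hs; apply: le_esum => t Vt.
have /andP[r0 _] := hr t Vt.
apply: diam_pow_le => //; rewrite /U pickleK_inv mem_set//.
by apply/diam_leP => x y; exact: hB.
Qed.

Lemma null_bigcup (T : countType) s (A : T -> set R) : 0 <= s ->
  (forall t, hausdorff_measure s (A t) = 0%E) ->
  hausdorff_measure s (\bigcup_t A t) = 0%E.
Proof.
move=> s0 h; apply/null_setP => d e d0 e0.
have e2 (t : T) : 0 < e / (2 ^ (pickle t).+1)%:R by rewrite divr_gt0// ltr0n expn_gt0.
have /choice[U hU] : forall t, exists U : nat -> set R,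
    [/\ forall k, (diam (U k) <= d%:E)%E, A t `<=` \bigcup_k U k &
        (\sum_(0 <= k <oo) diam_pow s (U k) <= (e / (2 ^ (pickle t).+1)%:R)%:E)%E].
  by move=> t; have /null_setP := h t; apply.
pose P : countType := (T * nat)%type.
pose W k := if @pickle_inv P k is Some p then U p.1 p.2 else set0.
exists W; split.
- move=> k; rewrite /W; case: pickle_inv => [p|]; first by have [h1 _ _] := hU p.1.
  exact/diam_leP.
- move=> x [t _ Ax]; have [_ /(_ x Ax)[k _ hx] _] := hU t.
  by exists (@pickle P (t, k)) => //; rewrite /W pickleK_inv.
rewrite nneseries_esumT; last by move=> k; exact: diam_pow_ge0.
rewrite (esumID (@pickle P @` setT)); last by move=> k _; exact: diam_pow_ge0.
rewrite setTI [X in (_ + X)%E]esum1 ?adde0; last first.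
  move=> k [_ /= nk]; rewrite /W; case E : (pickle_inv k) => [t|]; last by rewrite /diam_pow eqxx.
  by exfalso; apply: nk; exists t => //; have := pickle_invK (T := P) k; rewrite E.
rewrite esum_image; last by move=> t t' _ _; exact: (pcan_inj pickleK_inv).
rewrite (eq_esum (b := fun p : P => diam_pow s (U p.1 p.2))); last first.
  by move=> p _; rewrite /W pickleK_inv.
have -> : [set: P] = [set: T] `*`` (fun=> [set: nat]) by apply/seteqP; split.
rewrite -(@esum_esum _ _ _ _ (fun=> [set: nat]) (fun t k => diam_pow s (U t k))); last first.
  by move=> t k _ _; exact: diam_pow_ge0.
apply: (@le_trans _ _ (\esum_(t in [set: T]) (e / (2 ^ (pickle t).+1)%:R)%:E)%E).
  apply: le_esum => t _; have [_ _] := hU t; rewrite nneseries_esumT// => k.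
  exact: diam_pow_ge0.
have pos k : (0 <= (e / (2 ^ k.+1)%:R)%:E)%E by rewrite lee_fin divr_ge0// ltW.
rewrite -(esum_image setT pickle (fun k : nat => (e / (2 ^ k.+1)%:R)%:E)); last first.
  by move=> t t' _ _; exact: (pcan_inj pickleK_inv).
apply: (@le_trans _ _ (\esum_(k in [set: nat]) (e / (2 ^ k.+1)%:R)%:E)%E).
  exact: esum_subset.
rewrite -nneseries_esumT//.
have := @epsilon_trick R (fun=> 0%E) e xpredT (fun=> lexx _) (ltW e0).
rewrite [X in (_ <= X + _)%E]eseries0// add0e; apply: le_trans.
by apply: lee_nneseries => k _ //; rewrite add0e.
Qed.

Lemma dimH_le s A : 0 <= s -> hausdorff_measure s A = 0%E -> (dimH A <= s%:E)%E.
Proof. by move=> s0 h; apply: ereal_inf_lbound; exists s. Qed.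

Lemma dimH_subset A B : A `<=` B -> (dimH A <= dimH B)%E.
Proof.
move=> AB; apply: le_ereal_inf_tmp => _ [s [s0 /null_setP h] <-].
apply: dimH_le => //; apply/null_setP => d e d0 e0.
have [U [U1 U2 U3]] := h d e d0 e0; exists U; split=> //; exact: subset_trans U2.
Qed.

Lemma diam_pow_ge t A x y : 0 <= t -> A x -> A y ->
  ((`|x - y| `^ t)%:E <= diam_pow t A)%E.
Proof.
move=> t0 Ax Ay; rewrite /diam_pow ifF; last by apply/negbTE/set0P; exists x.
rewrite -poweR_EFin gt0_ler_poweR//.
- by rewrite in_itv/= leey lee_fin normr_ge0.
- by rewrite in_itv/= leey andbT diam_ge0//; exists x.
- by apply: ereal_sup_ubound; exists x, y.
Qed.

(** A mass distribution argument without a measure. Suppose the set is null for some [t < s] and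
    take a cover with small weights [v k]; let [S u] be the total weight of the cover sets meeting
    [E u]. While [S u] is below (g r(u))^s, no cover set counted in it meets two children, for its
    weight alone would exceed that number. So the children share [S u] and one of them inherits the
    inequality. The branch obtained in this way has a limit point in some [U k], although [v k] lies
    below a sequence tending to 0. *)
Lemma tree_dim_ge {T : choiceType} (L : seq T) (E : seq T -> set R) (r : seq T -> R)
    (g s : R) A :
  uniq L -> 0 < g -> 0 < s -> (forall u : seq T, {in u, forall w, w \in L} -> 0 < r u) ->
  (forall (u : seq T) w, {in u, forall w, w \in L} -> w \in L -> E (rcons u w) `<=` E u) ->
  (forall (u : seq T) w w' x y, {in u, forall w, w \in L} -> w \in L -> w' \in L -> w != w' ->
     E (rcons u w) x -> E (rcons u w') y -> g * r u <= `|x - y|) ->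
  (forall u : seq T, {in u, forall w, w \in L} -> r u `^ s <= \sum_(w <- L) r (rcons u w) `^ s) ->
  (forall e, 0 < e -> exists n, forall u : seq T, {in u, forall w, w \in L} -> size u = n -> r u < e) ->
  (forall om : nat -> T, (forall n, om n \in L) ->
     exists2 x, A x & forall n, E (mkseq om n) x) ->
  (s%:E <= dimH A)%E.
Proof.
move=> uL g0 s0 r0 subE sep sumr rsmall lim; apply: le_ereal_inf_tmp => _ [t [t0 /null_setP h] <-].
rewrite lee_fin leNgt; apply/negP => ts.
pose inL (u : seq T) := {in u, forall w, w \in L}.
have inLr u w : inL u -> w \in L -> inL (rcons u w).
  by move=> hu hw w'; rewrite mem_rcons inE => /orP[/eqP ->|/hu].
have gr u : inL u -> 0 < g * r u by move=> hu; rewrite mulr_gt0// r0.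
have nilL : inL [::] by [].
pose e := (g * r [::]) `^ s / 4.
have e0 : 0 < e by rewrite divr_gt0// powR_gt0// gr.
(* Covers at scale 1 suffice: distances inside a cover set are at most 1, where the power [t]
   dominates the power [s]. *)
have [U [U1 U2 U3]] := h 1 e ltr01 e0.
(* The added geometric term makes every weight positive, even for a set of zero diameter; the final
   contradiction needs a fixed positive [v k]. The total stays below [2 * e], half of the bound
   required at the root. *)
pose v k := fine (diam_pow t (U k)) + e / (2 ^ k.+1)%:R.
have dfin k : diam_pow t (U k) \is a fin_num.
  rewrite ge0_fin_numE ?diam_pow_ge0//.
  exact: le_lt_trans (diam_pow_le t0 ler01 (U1 k)) (ltry _).
have ek k : 0 < e / (2 ^ k.+1)%:R by rewrite divr_gt0// ltr0n expn_gt0.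
have v0 k : 0 < v k by rewrite ltr_wpDl// fine_ge0// diam_pow_ge0.
have v00 k : (0 <= (v k)%:E)%E by rewrite lee_fin ltW.
have Sv : (\esum_(k in [set: nat]) (v k)%:E <= (2 * e)%:E)%E.
  rewrite -nneseries_esumT// (_ : 2 * e = e + e); last by rewrite mulr_natl mulr2n.
  have := @epsilon_trick R (fun k => diam_pow t (U k)) e xpredT (fun k => diam_pow_ge0 t (U k)) (ltW e0).
  rewrite EFinD => h2; apply: (@le_trans _ _ (\sum_(0 <= k <oo) diam_pow t (U k) + e%:E)%E); last by rewrite leeD2r.
  apply: le_trans h2; apply: lee_nneseries => k _//.
  by rewrite EFinD fineK.
pose meet u := [set k | U k `&` E u !=set0].
pose S u := (\esum_(k in meet u) (v k)%:E)%E.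
have [w0 w0L] : exists w, w \in L.
  case: {+}L (sumr [::] nilL) => [|w L' _]; last by exists w; rewrite mem_head.
  by rewrite big_nil leNgt powR_gt0// r0.
have step u : exists w, inL u -> (S u < ((g * r u) `^ s)%:E)%E ->
    w \in L /\ (S (rcons u w) < ((g * r (rcons u w)) `^ s)%:E)%E.
  have [[hu hS]|hn] := pselect (inL u /\ (S u < ((g * r u) `^ s)%:E)%E); last first.
    by exists w0 => hu hS; exfalso; apply: hn.
  apply: contrapT => hn; suff : (((g * r u) `^ s)%:E <= S u)%E by rewrite leNgt hS.
  have SL w : w \in L -> (((g * r (rcons u w)) `^ s)%:E <= S (rcons u w))%E.
    by move=> wL; rewrite leNgt; apply/negP => h1; apply: hn; exists w.
  have gE u' : inL u' -> (g * r u') `^ s = g `^ s * r u' `^ s.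
    by move=> hu'; rewrite powRM ?ltW// r0.
  apply: (@le_trans _ _ (\sum_(w <- L) S (rcons u w))%E).
    apply: (@le_trans _ _ (\sum_(w <- L) ((g * r (rcons u w)) `^ s)%:E)%E); last first.
      by rewrite big_seq [leRHS]big_seq; apply: lee_sum => w /SL.
    rewrite sumEFin lee_fin big_seq (eq_bigr (fun w => g `^ s * r (rcons u w) `^ s)); last first.
      by move=> w wL; rewrite gE//; exact: inLr.
    by rewrite -big_seq -mulr_sumr gE// ler_wpM2l ?powR_ge0// sumr.
  rewrite /S [leRHS]esum_mkcond (eq_bigr (fun w => \esum_(k in [set: nat])
      if k \in meet (rcons u w) then (v k)%:E else 0%E)%E); last first.
    by move=> w _; rewrite esum_mkcond.
  apply: (@le_trans _ _ (\esum_(k in [set: nat]) \sum_(w <- L)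
      if k \in meet (rcons u w) then (v k)%:E else 0)%E).
    by rewrite esum_sum// => k w _ _; case: ifP.
  apply: le_esum => k _.
  have [[w [wL hw]]|hnone] := pselect (exists w, w \in L /\ meet (rcons u w) k); last first.
    rewrite big_seq big1; first by case: ifP.
    move=> w wL; rewrite ifF//; apply/negbTE; rewrite notin_setE => hw.
    by apply: hnone; exists w.
  have uk : meet u k by case: hw => x [Ux Ex]; exists x; split=> //; exact: (subE u w hu wL).
  rewrite (bigD1_seq w)//= !mem_set// big_seq_cond big1 ?adde0// => w' /andP[w'L w'w].
  rewrite ifF//; apply/negbTE; rewrite notin_setE => hw'.
  have [x [Ux Ex]] := hw; have [y [Uy Ey]] := hw'.
  have ww' : w != w' by rewrite eq_sym.
  have hxy := sep u w w' x y hu wL w'L ww' Ex Ey.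
  have xy1 : `|x - y| <= 1 by have /diam_leP := U1 k; apply.
  suff : ((g * r u) `^ s < v k).
    apply/negP; rewrite -leNgt -lee_fin ltW//; apply: le_lt_trans hS.
    exact: (@esum_ge1 _ _ (meet u) (fun k => (v k)%:E)).
  apply: (@le_lt_trans _ _ (`|x - y| `^ t)).
    apply: (@le_trans _ _ (`|x - y| `^ s)).
      by apply: ge0_ler_powR; rewrite ?nnegrE// ltW// gr.
    apply: ger_powR; last exact: ltW.
    by rewrite xy1 andbT (lt_le_trans _ hxy)// gr.
  apply: (@le_lt_trans _ _ (fine (diam_pow t (U k)))); last by rewrite ltrDl.
  by rewrite -lee_fin fineK// diam_pow_ge.
have [f hf] := choice step.
pose u n := iter n (fun u => rcons u (f u)) [::].
have hu n : inL (u n) /\ (S (u n) < ((g * r (u n)) `^ s)%:E)%E.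
  elim: n => [|n [h1 h2]].
    split=> //=; apply: (@le_lt_trans _ _ (2 * e)%:E).
      by apply: le_trans Sv; exact: esum_subset.
    rewrite lte_fin /e; have := powR_gt0 s (gr [::] nilL); lra.
  by have [h3 h4] := hf _ h1 h2; split=> //=; exact: inLr.
pose om n := f (u n).
have uE n : mkseq om n = u n by elim: n => // n IH; rewrite mkseqS IH.
have [n|x Ax hx] := lim om; first by have [h1 h2] := hu n; have [] := hf _ h1 h2.
have [k _ Ukx] := U2 x Ax.
have vs n : v k < (g * r (u n)) `^ s.
  have [_ h2] := hu n; rewrite -lte_fin; apply: le_lt_trans h2.
  apply: (@esum_ge1 _ _ (meet (u n)) (fun k => (v k)%:E)) => //.
  by exists x; split=> //; rewrite -uE.
have [n hn] := rsmall (v k `^ s^-1 / g) (divr_gt0 (powR_gt0 _ (v0 k)) g0).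
have := vs n; apply/negP; rewrite -leNgt.
have su : size (u n) = n by rewrite -uE size_mkseq.
have h2 := hn (u n) (hu n).1 su.
rewrite -[leRHS](@powRr1 _ (v k)) ?(ltW (v0 k))// -(mulVf (lt0r_neq0 s0)) powRrM.
apply: ge0_ler_powR; rewrite ?nnegrE ?(ltW s0) ?powR_ge0//.
  by rewrite ltW// gr//; exact: (hu n).1.
by rewrite mulrC -ler_pdivlMr// ltW.
Qed.

End HausdorffTools.

(** * Distortion and cylinders *)

Section Branches.
Context {R : realType} (I : set nat) (J : nat -> set R) (F0 : R -> R).
Hypothesis bm : base_map I J F0.

Lemma branch_itv i : I i -> exists a b : R, [/\ 0 <= a, a < b, b <= 1 & J i = `]a, b[%classic].
Proof. by case: bm => -[_ + _ _ _] _; apply. Qed.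

Lemma branch_disj i j x : I i -> I j -> J i x -> J j x -> i = j.
Proof.
by case: bm => -[_ _ /trivIsetP tJ _ _] _ Ii Ij Jx Jy; apply/eqP/negP => /negP ij;
  have := tJ i j Ii Ij ij; apply/eqP/set0P; exists x.
Qed.

Lemma branch01 i x : I i -> J i x -> 0 < x < 1.
Proof.
move=> /branch_itv[a [b [a0 _ b1 ->]]]; rewrite /= in_itv/= => /andP[h1 h2].
by rewrite (le_lt_trans a0)// (lt_le_trans h2).
Qed.

Lemma branch_conv i x y z : I i -> J i x -> J i y -> x <= z <= y -> J i z.
Proof.
move=> /branch_itv[a [b [_ _ _ ->]]]; rewrite /= !in_itv/= => /andP[h1 h2] /andP[h3 h4] /andP[h5 h6].
by rewrite (lt_le_trans h1)// (le_lt_trans h6).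
Qed.

Lemma branch_open i : I i -> open (J i).
Proof. by move=> /branch_itv[a [b [_ _ _ ->]]]; exact: interval_open. Qed.

Lemma branch_img i : I i -> F0 @` J i = `]0, 1[%classic.
Proof. by case: bm => -[_ _ _ + _] _; apply. Qed.

Lemma branch_nbhs i x (P : R -> Prop) : I i -> J i x -> (forall y, J i y -> P y) ->
  \forall y \near x, P y.
Proof.
move=> Ii Jx h; have : nbhs x (J i) by apply: open_nbhs_nbhs; split=> //; exact: branch_open.
exact: filterS.
Qed.

Lemma branch_C2 i x : I i -> J i x -> derivable F0 x 1 /\ derivable (derive1 F0) x 1.
Proof.
move=> Ii Jx; have [_ _ _ _ /(_ i Ii)[U [g [oU JU gC2 eq]]]] := bm.1.
have sub y : J i y -> U y by move=> Jy; apply: JU; exact: subset_closure.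
have e1 y : J i y -> F0 y = g y by move=> Jy; apply: eq; rewrite inE.
have n1 y : J i y -> \forall z \near y, g z = F0 z.
  by move=> Jy; apply: (branch_nbhs Ii Jy) => z /e1.
have e2 y : J i y -> derive1 F0 y = derive1 g y.
  by move=> Jy; rewrite !derive1E; apply/esym/near_eq_derive; exact: n1.
have [g1 g2 _] := gC2 x (sub x Jx); split.
  exact: near_eq_derivable (n1 x Jx) g1.
apply: near_eq_derivable g2; apply: (branch_nbhs Ii Jx) => z /e2 //.
Qed.

Lemma expansion : exists2 lam : R, 1 < lam & forall x, Delta0 I J x -> lam <= `|derive1 F0 x|.
Proof.
have [_ [h _]] := bm.
have hl x : Delta0 I J x -> (ereal_inf [set (`|derive1 F0 x|)%:E | x in Delta0 I J] <= (`|derive1 F0 x|)%:E)%E.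
  by move=> Dx; apply: ereal_inf_lbound; exists x.
move: h hl; case: ereal_inf => [r| |]//.
  by rewrite lte_fin => r1 hl; exists r => // x /hl; rewrite lee_fin.
(* An infinite infimum leaves no point in the domain, so any constant above 1 serves. *)
by move=> _ hl; exists 2 => [|x /hl]; [rewrite ltr1n|rewrite leye_eq].
Qed.

Lemma adler : exists2 M : R, 0 <= M &
  forall x, Delta0 I J x -> `|derive1n 2 F0 x| <= M * (derive1 F0 x) ^+ 2.
Proof.
have [_ [_ h]] := bm; have [lam lam1 hlam] := expansion.
have hl x : Delta0 I J x -> ((`|derive1n 2 F0 x| / (derive1 F0 x) ^+ 2)%:E <=
   ereal_sup [set (`|derive1n 2 F0 x| / (derive1 F0 x) ^+ 2)%:E | x in Delta0 I J])%E.
  by move=> Dx; apply: ereal_sup_ubound; exists x.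
move: h hl; case: ereal_sup => [r| |]// _ hl.
  exists `|r| => // x Dx; have := hl x Dx; rewrite lee_fin ler_pdivrMr; last first.
    rewrite lt_neqAle sqr_ge0 andbT eq_sym sqrf_eq0 -normr_gt0.
    by apply: lt_le_trans (hlam x Dx); lra.
  by move=> h; apply: (le_trans h); rewrite ler_wpM2r ?sqr_ge0 ?ler_norm.
by exists 0 => // x /hl; rewrite leeNy_eq.
Qed.

Context (lam M : R).
Hypothesis lam_gt1 : 1 < lam.
Hypothesis lamP : forall x, Delta0 I J x -> lam <= `|derive1 F0 x|.
Hypothesis M_ge0 : 0 <= M.
Hypothesis MP : forall x, Delta0 I J x -> `|derive1n 2 F0 x| <= M * (derive1 F0 x) ^+ 2.

Lemma lam_gt0 : 0 < lam. Proof. exact: lt_trans lam_gt1. Qed.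

Lemma branch_der_neq0 i x : I i -> J i x -> derive1 F0 x != 0.
Proof.
move=> Ii Jx; rewrite -normr_gt0; apply: lt_le_trans (lamP _); first exact: lam_gt0.
by exists i.
Qed.

Lemma branch_within i x y : I i -> J i x -> J i y -> {within `[x, y], continuous F0}.
Proof.
move=> Ii Jx Jy; apply: derivable_within_continuous => z; rewrite in_itv/= => zi.
by have [] := branch_C2 Ii (branch_conv Ii Jx Jy zi).
Qed.

Lemma branch_is_derive i x : I i -> J i x -> is_derive x 1 F0 (derive1 F0 x).
Proof.
by move=> Ii Jx; have [h _] := branch_C2 Ii Jx; rewrite derive1E; exact: DeriveDef.
Qed.

Lemma branch_MVT i x y : I i -> J i x -> J i y -> x < y ->
  exists c, [/\ J i c, x < c < y & F0 y - F0 x = derive1 F0 c * (y - x)].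
Proof.
move=> Ii Jx Jy xy.
have conv z : z \in `]x, y[ -> J i z.
  by rewrite in_itv/= => /andP[z1 z2]; apply: (branch_conv Ii Jx Jy); rewrite !ltW.
have [c cxy e] := MVT xy (fun z hz => branch_is_derive Ii (conv z hz)) (branch_within Ii Jx Jy).
by exists c; split=> //; exact: conv.
Qed.

Lemma branch_expand i x y : I i -> J i x -> J i y -> lam * `|x - y| <= `|F0 x - F0 y|.
Proof.
move=> Ii; wlog xy : x y / x <= y.
  move=> H Jx Jy; case: (leP x y) => [|/ltW] h; first exact: H.
  by rewrite distrC [X in _ <= X]distrC; exact: H.
move=> Jx Jy; have [->|xny] := eqVneq x y; first by rewrite !subrr normr0 mulr0.
have [|c [Jc _ e]] := branch_MVT Ii Jx Jy; first by rewrite lt_neqAle xny.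
rewrite distrC [X in _ <= X]distrC e normrM ler_wpM2r// lamP//; by exists i.
Qed.

Lemma branch_inj i x y : I i -> J i x -> J i y -> F0 x = F0 y -> x = y.
Proof.
move=> Ii Jx Jy e; have := branch_expand Ii Jx Jy; rewrite e subrr normr0.
rewrite pmulr_rle0 ?lam_gt0// normr_le0 subr_eq0 => /eqP //.
Qed.

Lemma branch_mono i : I i ->
  (forall x y, J i x -> J i y -> x < y -> F0 x < F0 y) \/
  (forall x y, J i x -> J i y -> x < y -> F0 y < F0 x).
Proof.
move=> Ii; have [a [b [a0 ab b1 JE]]] := branch_itv Ii.
have JP x : (x \in `]a, b[) = (x \in J i) by rewrite JE mem_setE.
have mono : unstable.strict_monotonic `]a, b[ F0.
  apply: itv_continuous_inj_mono.
    apply: derivable_within_continuous => x; rewrite JP inE => Jx.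
    by have [] := branch_C2 Ii Jx.
  by move=> x y; rewrite !JP !inE => Jx Jy; exact: branch_inj Jx Jy.
case: mono => h; [left|right] => x y Jx Jy xy.
  by apply: h; rewrite ?JP ?inE.
by apply: h; rewrite ?JP ?inE.
Qed.

(** The mean value theorem returns a point [c] between [x] and [y]; monotonicity puts its image no
    farther from [F0 x] than [F0 y] is, so the distortion at [c] is governed by the distance of the
    two images. *)
Lemma branch_between i x y c : I i -> J i x -> J i y -> x <= c <= y \/ y <= c <= x ->
  `|F0 c - F0 x| <= `|F0 y - F0 x|.
Proof.
move=> Ii Jx Jy h.
have Jc : J i c by case: h; [exact: branch_conv Jx Jy|exact: branch_conv Jy Jx].
have le2 (u v : R) : J i u -> J i v -> u <= v -> forall m : (forall x y, J i x -> J i y -> x < y -> F0 x < F0 y), F0 u <= F0 v.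
  by move=> Ju Jv; rewrite le_eqVlt => /orP[/eqP ->//|uv] m; rewrite ltW// m.
have ge2 (u v : R) : J i u -> J i v -> u <= v -> forall m : (forall x y, J i x -> J i y -> x < y -> F0 y < F0 x), F0 v <= F0 u.
  by move=> Ju Jv; rewrite le_eqVlt => /orP[/eqP ->//|uv] m; rewrite ltW// m.
have [m|m] := branch_mono Ii; case: h => /andP[h1 h2].
- have := le2 _ _ Jx Jc h1 m; have := le2 _ _ Jc Jy h2 m => a1 a2.
  by rewrite !ger0_norm ?subr_ge0//; lra.
- have := le2 _ _ Jy Jc h1 m; have := le2 _ _ Jc Jx h2 m => a1 a2.
  by rewrite !ler0_norm ?subr_le0//; lra.
- have := ge2 _ _ Jx Jc h1 m; have := ge2 _ _ Jc Jy h2 m => a1 a2.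
  by rewrite !ler0_norm ?subr_le0//; lra.
- have := ge2 _ _ Jy Jc h1 m; have := ge2 _ _ Jc Jx h2 m => a1 a2.
  by rewrite !ger0_norm ?subr_ge0//; lra.
Qed.

(** Cauchy's mean value theorem for [h], the logarithm of the squared derivative, against [F0]
    itself: the quotient of the derivatives is 2 F0''/(F0')^2, bounded by [2 * M]. Hence the
    logarithm of the derivative is Lipschitz in the image variable. Squaring avoids the sign of the
    derivative. *)
Lemma branch_distortion i x y : I i -> J i x -> J i y ->
  `|derive1 F0 x| <= `|derive1 F0 y| * expR (M * `|F0 x - F0 y|).
Proof.
move=> Ii.
pose h z := ln ((derive1 F0 z) ^+ 2).
pose dh z := 2 * derive1n 2 F0 z / derive1 F0 z.
have sq0 z : J i z -> 0 < derive1 F0 z ^+ 2.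
  move=> Jz; rewrite lt_neqAle sqr_ge0 andbT eq_sym sqrf_eq0; exact: branch_der_neq0 Jz.
have dhP z : J i z -> is_derive z 1 h (dh z).
  move=> Jx; have [_ d2] := branch_C2 Ii Jx.
  have e2 : is_derive z 1 (derive1 F0) (derive1n 2 F0 z).
    by have := DeriveDef d2 erefl; rewrite -derive1E.
  have e3 : is_derive z 1 (fun u => derive1 F0 u ^+ 2) (2 * derive1 F0 z * derive1n 2 F0 z).
    by apply: is_derive_eq (is_deriveM e2 e2) _; rewrite /GRing.scale/=; ring.
  have e4 := @is_derive1_comp _ _ (fun u => derive1 F0 u ^+ 2) _ _ _ (is_derive1_ln (sq0 z Jx)) e3.
  apply: is_derive_eq e4 _; have n0 := branch_der_neq0 Ii Jx; rewrite /dh.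
  by field.
have main a b : J i a -> J i b -> a < b -> `|h b - h a| <= 2 * M * `|F0 b - F0 a|.
  move=> Ja Jb ab.
  have conv z : z \in `]a, b[ -> J i z.
    by rewrite in_itv/= => /andP[z1 z2]; apply: (branch_conv Ii Ja Jb); rewrite !ltW.
  have hcont : {within `[a, b], continuous h}.
    apply: derivable_within_continuous => z; rewrite in_itv/= => zi.
    by have [] := dhP z (branch_conv Ii Ja Jb zi).
  have [c cab e] := cauchy_MVT ab hcont (branch_within Ii Ja Jb)
    (fun z hz => dhP z (conv z hz)) (fun z hz => branch_is_derive Ii (conv z hz))
    (fun z hz => branch_der_neq0 Ii (conv z hz)).
  have Jc := conv c cab.
  have n0 : F0 b - F0 a != 0.
    rewrite subr_eq0; apply/eqP => /(branch_inj Ii Jb Ja) ba.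
    by move: ab; rewrite ba ltxx.
  have -> : h b - h a = dh c / derive1 F0 c * (F0 b - F0 a) by rewrite e divfK.
  rewrite normrM ler_wpM2r// /dh.
  have d0 := branch_der_neq0 Ii Jc.
  rewrite -mulrA -invfM -expr2 normrM normrM normfV (ger0_norm (ltW (sq0 c Jc))).
  rewrite ger0_norm// -mulrA ler_pM2l// ler_pdivrMr ?sq0// MP//; by exists i.
move=> Jx Jy.
have hxy : h x - h y <= 2 * M * `|F0 x - F0 y|.
  apply: (le_trans (ler_norm _)); case: (ltgtP x y) => [xy|xy|->].
  - by rewrite distrC [X in _ <= _ * X]distrC; exact: main.
  - exact: main.
  - by rewrite !subrr !normr0 mulr0.
have pos z : J i z -> 0 < `|derive1 F0 z| by move=> Jz; rewrite normr_gt0; exact: branch_der_neq0 Jz.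
have hE z : J i z -> h z = 2 * ln `|derive1 F0 z|.
  by move=> Jz; rewrite /h -[in LHS]real_normK ?num_real// expr2 lnM ?posrE ?pos//; lra.
rewrite -ler_pdivrMl ?pos// -ler_ln ?posrE ?expR_gt0 ?mulr_gt0 ?invr_gt0 ?pos//.
rewrite expRK lnM ?posrE ?invr_gt0 ?pos// lnV ?posrE ?pos//.
by move: hxy; rewrite !hE//; lra.
Qed.

End Branches.

Section Cylinders.
Context {R : realType} (I : set nat) (J : nat -> set R) (F0 : R -> R).

Definition br i (t : R) : R := xget 0 [set x | J i x /\ F0 x = t].
Definition brw w (t : R) : R := foldr br t w.

Fixpoint dF n (x : R) : R := if n is n'.+1 then `|derive1 F0 x| * dF n' (F0 x) else 1.

(* Unlike [cylinder], the cylinder of the empty word is the unit interval. *)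
Fixpoint cyl w (x : R) : Prop :=
  if w is i :: w' then J i x /\ cyl w' (F0 x) else 0 < x < 1.

(** The size of a cylinder, measured by the inverse derivative at the point that the word sends to
    1/2. Unlike the length it is handled by the chain rule, and it agrees with the length up to the
    factor [distortion]. *)
Definition ell w : R := (dF (size w) (brw w 2^-1))^-1.

Context (lam M : R).
(** A square because one factor compares derivatives at two points of a cylinder and the other
    compares distances with derivatives. The exponent bounds the geometric series of the diameters
    of successive images. *)
Definition distortion : R := expR (M * (1 - lam^-1)^-1) ^+ 2.

Hypothesis bm : base_map I J F0.
Hypothesis lam_gt1 : 1 < lam.
Hypothesis lamP : forall x, Delta0 I J x -> lam <= `|derive1 F0 x|.
Hypothesis M_ge0 : 0 <= M.
Hypothesis MP : forall x, Delta0 I J x -> `|derive1n 2 F0 x| <= M * (derive1 F0 x) ^+ 2.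

Let lam0 : 0 < lam := lam_gt0 lam_gt1.
Let K0 : R := expR (M * (1 - lam^-1)^-1).

Lemma brP i t : I i -> 0 < t < 1 -> J i (br i t) /\ F0 (br i t) = t.
Proof.
move=> Ii t01; have : (F0 @` J i) t by rewrite (branch_img bm Ii) /= in_itv.
by move=> [x Jx e]; rewrite /br; case: xgetP => [_ ->|/(_ x)] //; case.
Qed.

Lemma branch_F01 i x : I i -> J i x -> 0 < F0 x < 1.
Proof.
move=> Ii Jx; have : (F0 @` J i) (F0 x) by exists x.
by rewrite (branch_img bm Ii) /= in_itv.
Qed.

Lemma wordP_cons (P : set nat) i w : wordP P (i :: w) -> P i /\ wordP P w.
Proof.
by move=> h; split; [apply: h; rewrite mem_head|move=> j jw; apply: h; rewrite inE jw orbT].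
Qed.

Lemma wordP_consI (P : set nat) i w : P i -> wordP P w -> wordP P (i :: w).
Proof. by move=> Pi hw j; rewrite inE => /orP[/eqP ->|/hw]. Qed.

Lemma cyl01 w x : wordP I w -> cyl w x -> 0 < x < 1.
Proof.
by case: w => [|i w] //= /wordP_cons[Ii _] [Jx _]; exact: (branch01 bm Ii Jx).
Qed.

Lemma cyl_brw w t : wordP I w -> 0 < t < 1 ->
  cyl w (brw w t) /\ iter (size w) F0 (brw w t) = t.
Proof.
elim: w => [|i w IH] //= /wordP_cons[Ii hw] t01.
have [c e] := IH hw t01; have [h1 h2] := brP Ii (cyl01 hw c).
rewrite -iterS iterSr h2; split=> //.
Qed.

Lemma cyl_iter w x : wordP I w -> cyl w x -> 0 < iter (size w) F0 x < 1.
Proof.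
elim: w x => [|i w IH] x //= /wordP_cons[Ii hw] [Jx c].
by rewrite -iterS iterSr; exact: IH.
Qed.

Lemma cyl_cat u v x : wordP I u -> wordP I v ->
  cyl (u ++ v) x <-> cyl u x /\ cyl v (iter (size u) F0 x).
Proof.
elim: u x => [|i u IH] x /=.
  by move=> _ hv; split=> [c|[]//]; split=> //; exact: cyl01 c.
move=> /wordP_cons[Ii hu] hv; rewrite -iterS iterSr; split.
  by move=> [Jx /(IH _ hu hv)[c1 c2]].
by move=> [[Jx c1] c2]; split=> //; apply/IH.
Qed.

Lemma cylinder_cyl w x : wordP I w -> w != [::] -> cylinder J F0 w x <-> cyl w x.
Proof.
elim: w x => [|i w IH] x // /wordP_cons[Ii hw] _; split.
  move=> h; have Jx : J i x := h 0%N isT; split=> //.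
  case: w IH hw h => [|j w] IH hw h /=.
    exact: branch_F01 Ii Jx.
  by apply/IH => // k ks; have := h k.+1 ks; rewrite iterSr.
move=> [Jx c] [|k] ks //=; rewrite -iterS iterSr.
case: w IH hw c ks => [|j w] IH hw c ks //.
by have /IH := c; apply.
Qed.

Lemma dF_cat n m x : dF (n + m) x = dF n x * dF m (iter n F0 x).
Proof.
elim: n x => [|n IH] x; first by rewrite add0n mul1r.
by rewrite addSn /= IH -iterS iterSr mulrA.
Qed.

Lemma dF_ge w x : wordP I w -> cyl w x -> lam ^+ size w <= dF (size w) x.
Proof.
elim: w x => [|i w IH] x //= /wordP_cons[Ii hw] [Jx c].
rewrite exprS; apply: ler_pM; rewrite ?exprn_ge0 ?(ltW lam0)//; last exact: IH.
by apply: lamP; exists i.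
Qed.

Lemma dF_gt0 w x : wordP I w -> cyl w x -> 0 < dF (size w) x.
Proof. by move=> hw c; apply: lt_le_trans (dF_ge hw c); rewrite exprn_gt0. Qed.

Lemma cyl_expand w x y : wordP I w -> cyl w x -> cyl w y ->
  lam ^+ size w * `|x - y| <= `|iter (size w) F0 x - iter (size w) F0 y|.
Proof.
elim: w x y => [|i w IH] x y /=; first by rewrite mul1r.
move=> /wordP_cons[Ii hw] [Jx cx] [Jy cy]; rewrite -!iterS !iterSr.
apply: le_trans (IH _ _ hw cx cy); rewrite exprSr -mulrA ler_pM2l ?exprn_gt0//.
exact: (branch_expand bm lamP Ii Jx Jy).
Qed.

Lemma cyl_small w x y : wordP I w -> cyl w x -> cyl w y -> `|x - y| <= lam^-1 ^+ size w.
Proof.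
move=> hw cx cy; rewrite exprVn -[_^-1]mul1r ler_pdivlMr ?exprn_gt0// mulrC.
apply: (le_trans (cyl_expand hw cx cy)).
have := cyl_iter hw cx; have := cyl_iter hw cy => /andP[a b] /andP[c d].
by rewrite ler_norml; apply/andP; split; lra.
Qed.

Lemma geo_le n : \sum_(k < n) lam^-1 ^+ k <= (1 - lam^-1)^-1.
Proof.
have h1 : lam^-1 < 1 by rewrite invf_lt1.
have h0 : 0 <= lam^-1 by rewrite invr_ge0 ltW.
have h2 : 0 < 1 - lam^-1 by lra.
rewrite -[leRHS]mul1r ler_pdivlMr//.
have -> : (\sum_(k < n) lam^-1 ^+ k) * (1 - lam^-1) = 1 - lam^-1 ^+ n.
  elim: n => [|n IH]; first by rewrite big_ord0 expr0; lra.
  by rewrite big_ord_recr/= mulrDl IH exprS; lra.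
by have := exprn_ge0 n h0; lra.
Qed.

(** After each step the images of the two points share the cylinder of the remaining letters, so the
    one-branch distortion exponents are [M] times successive powers of [lam^-1]. *)
Lemma dF_distortion w x y : wordP I w -> cyl w x -> cyl w y ->
  dF (size w) x <= K0 * dF (size w) y.
Proof.
move=> hw cx cy.
suff : dF (size w) x <= expR (M * \sum_(k < size w) lam^-1 ^+ k) * dF (size w) y.
  move=> h; apply: (le_trans h); rewrite (ler_wpM2r (ltW (dF_gt0 hw cy)))// ler_expR.
  by rewrite ler_wpM2l// geo_le.
elim: w x y hw cx cy => [|i w IH] x y /=.
  by rewrite big_ord0 mulr0 expR0 mulr1.
move=> /wordP_cons[Ii hw] [Jx cx] [Jy cy].
have h1 := branch_distortion bm lam_gt1 lamP MP Ii Jx Jy.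
have h2 : `|derive1 F0 x| <= `|derive1 F0 y| * expR (M * lam^-1 ^+ size w).
  apply: (le_trans h1); rewrite ler_wpM2l// ler_expR ler_wpM2l//; exact: (cyl_small hw cx cy).
rewrite big_ord_recr/= mulrDr expRD.
apply: (@le_trans _ _ ((`|derive1 F0 y| * expR (M * lam^-1 ^+ size w)) *
   (expR (M * \sum_(k < size w) lam^-1 ^+ k) * dF (size w) (F0 y)))); last first.
  by rewrite le_eqVlt; apply/orP; left; apply/eqP; ring.
apply: ler_pM => //; last exact: IH.
by rewrite ltW// dF_gt0.
Qed.

(** The mean value theorem is used letter by letter; at each step the derivative at the intermediate
    point is traded for that at [x], and the errors add up as in [dF_distortion]. *)
Lemma cyl_mean_le w x y : wordP I w -> cyl w x -> cyl w y ->
  `|x - y| * dF (size w) x <= K0 * `|iter (size w) F0 x - iter (size w) F0 y| /\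
  `|iter (size w) F0 x - iter (size w) F0 y| <= K0 * (`|x - y| * dF (size w) x).
Proof.
move=> hw cx cy.
suff [h1 h2] : `|x - y| * dF (size w) x <= expR (M * \sum_(k < size w) lam^-1 ^+ k) *
     `|iter (size w) F0 x - iter (size w) F0 y| /\
  `|iter (size w) F0 x - iter (size w) F0 y| <= expR (M * \sum_(k < size w) lam^-1 ^+ k) *
     (`|x - y| * dF (size w) x).
  have ke : expR (M * \sum_(k < size w) lam^-1 ^+ k) <= K0.
    by rewrite ler_expR ler_wpM2l// geo_le.
  split; [apply: (le_trans h1)|apply: (le_trans h2)]; apply: ler_wpM2r => //.
  by rewrite mulr_ge0// ltW// dF_gt0.
elim: w x y hw cx cy => [|i w IH] x y /=.
  by rewrite big_ord0 mulr0 expR0 !mul1r mulr1.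
move=> /wordP_cons[Ii hw] [Jx cx] [Jy cy]; rewrite -!iterS !iterSr.
have [h1 h2] := IH _ _ hw cx cy.
have d0 := dF_gt0 hw cx.
have sm := cyl_small hw cx cy.
rewrite big_ord_recr/= mulrDr expRD.
set E := expR (M * \sum_(k < _) _) in h1 h2 *.
have E0 : 0 < E by exact: expR_gt0.
set e := expR (M * lam^-1 ^+ size w).
have e0 : 0 < e by exact: expR_gt0.
have [b1 b2] : `|x - y| * `|derive1 F0 x| <= e * `|F0 x - F0 y| /\
    `|F0 x - F0 y| <= e * (`|x - y| * `|derive1 F0 x|).
  have main c : J i c -> `|F0 c - F0 x| <= `|F0 y - F0 x| ->
      `|F0 x - F0 y| = `|derive1 F0 c| * `|x - y| ->
      `|x - y| * `|derive1 F0 x| <= e * `|F0 x - F0 y| /\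
      `|F0 x - F0 y| <= e * (`|x - y| * `|derive1 F0 x|).
    move=> Jc cxy eq.
    have ee : expR (M * `|F0 c - F0 x|) <= e.
      rewrite ler_expR ler_wpM2l//; apply: (le_trans cxy); rewrite distrC; exact: sm.
    have d1 := branch_distortion bm lam_gt1 lamP MP Ii Jx Jc.
    have d2 := branch_distortion bm lam_gt1 lamP MP Ii Jc Jx.
    rewrite distrC in d1; split.
      rewrite eq mulrC mulrA ler_wpM2r// mulrC; apply: (le_trans d1).
      by rewrite ler_wpM2l.
    rewrite eq; apply: (@le_trans _ _ (`|derive1 F0 x| * e * `|x - y|)).
      by rewrite ler_wpM2r//; apply: (le_trans d2); rewrite ler_wpM2l.
    by rewrite le_eqVlt; apply/orP; left; apply/eqP; ring.
  have [xy|xy|xy] := ltgtP x y.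
  - have [c [Jc cc eq]] := branch_MVT bm Ii Jx Jy xy; apply: (main c Jc).
      apply: (branch_between bm lam_gt1 lamP Ii Jx Jy); left.
      by case/andP: cc => c1 c2; rewrite !ltW.
    by rewrite distrC eq normrM [`|x - y|]distrC.
  - have [c [Jc cc eq]] := branch_MVT bm Ii Jy Jx xy; apply: (main c Jc).
      apply: (branch_between bm lam_gt1 lamP Ii Jx Jy); right.
      by case/andP: cc => c1 c2; rewrite !ltW.
    by rewrite eq normrM.
  - by rewrite xy !subrr !normr0 !mul0r !mulr0.
set u := `|x - y| in b1 b2 *; set v := `|F0 x - F0 y| in b1 b2 h1 h2 *.
set D := `|derive1 F0 x| in b1 b2 *; set D' := dF _ _ in h1 h2 d0 *.
set z := `|_ - _| in h1 h2 *.
split.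
  apply: (@le_trans _ _ (e * (v * D'))).
    by rewrite !mulrA ler_pM2r.
  by rewrite [E * e]mulrC -mulrA ler_pM2l.
apply: (le_trans h2); rewrite -mulrA ler_pM2l// !mulrA ler_pM2r// -mulrA.
exact: b2.
Qed.

Let K := distortion.
Let K0_ge1 : 1 <= K0.
Proof.
rewrite -expR0 ler_expR mulr_ge0// invr_ge0 subr_ge0 ltW// invf_lt1//.
Qed.
Let K0_gt0 : 0 < K0. Proof. exact: expR_gt0. Qed.
Let KE : K = K0 * K0. Proof. by rewrite /K /distortion expr2. Qed.
Let K0K : K0 <= K. Proof. by rewrite KE ler_peMl// ltW. Qed.

Lemma distortion_ge1 : 1 <= K. Proof. exact: le_trans K0K. Qed.
Let K_gt0 : 0 < K. Proof. exact: lt_le_trans distortion_ge1. Qed.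

Let half01 : 0 < (2^-1 : R) < 1. Proof. by apply/andP; split; lra. Qed.
Let mid w := brw w 2^-1.

Lemma cyl_mid w : wordP I w -> cyl w (mid w).
Proof. by move=> hw; have [] := cyl_brw hw half01. Qed.

Lemma ell_gt0 w : wordP I w -> 0 < ell w.
Proof. by move=> hw; rewrite invr_gt0; exact: (dF_gt0 hw (cyl_mid hw)). Qed.

Lemma dF_ell w x : wordP I w -> cyl w x ->
  dF (size w) x * ell w <= K0 /\ 1 <= K0 * (dF (size w) x * ell w).
Proof.
move=> hw cx; have cm := cyl_mid hw; have d0 := dF_gt0 hw cm; split.
  rewrite ler_pdivrMr//; exact: dF_distortion.
by rewrite mulrA ler_pdivlMr// mul1r; exact: dF_distortion.
Qed.

Let ell_cat u v : wordP I u -> wordP I v ->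
  (ell (u ++ v))^-1 = dF (size u) (mid (u ++ v)) * (ell v)^-1.
Proof.
move=> hu hv; rewrite !invrK size_cat dF_cat; congr (_ * dF _ _).
have hm : brw (u ++ v) 2^-1 = brw u (mid v) by rewrite /mid /brw foldr_cat.
by rewrite hm; have [_ ->] := cyl_brw hu (cyl01 hv (cyl_mid hv)).
Qed.

Let cyl_mid_cat u v : wordP I u -> wordP I v -> cyl u (mid (u ++ v)).
Proof.
by move=> hu hv; have /(cyl_cat _ hu hv)[] := cyl_mid (wordP_cat hu hv).
Qed.

Lemma ell_cat_le u v : wordP I u -> wordP I v -> ell (u ++ v) <= K * ell u * ell v.
Proof.
move=> hu hv; have [_ h] := dF_ell hu (cyl_mid_cat hu hv).
have := ell_cat hu hv; have luv := ell_gt0 (wordP_cat hu hv); have lu := ell_gt0 hu; have lv := ell_gt0 hv.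
move=> e; have {e} e : ell v = dF (size u) (mid (u ++ v)) * ell (u ++ v).
  by rewrite -[LHS]invrK -[X in _ = _ * X]invrK e invfM invrK mulrA mulfV ?mul1r// gt_eqF// (dF_gt0 hu (cyl_mid_cat hu hv)).
rewrite e mulrA -[leLHS]mul1r ler_pM2r//; apply: (le_trans h).
by rewrite -mulrA [ell u * _]mulrC ler_pM2r// mulr_gt0// (dF_gt0 hu (cyl_mid_cat hu hv)).
Qed.

Lemma ell_cat_ge u v : wordP I u -> wordP I v -> ell u * ell v <= K * ell (u ++ v).
Proof.
move=> hu hv; have [h _] := dF_ell hu (cyl_mid_cat hu hv).
have := ell_cat hu hv; have luv := ell_gt0 (wordP_cat hu hv); have lu := ell_gt0 hu; have lv := ell_gt0 hv.
move=> e; have {e} e : ell v = dF (size u) (mid (u ++ v)) * ell (u ++ v).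
  by rewrite -[LHS]invrK -[X in _ = _ * X]invrK e invfM invrK mulrA mulfV ?mul1r// gt_eqF// (dF_gt0 hu (cyl_mid_cat hu hv)).
by rewrite e mulrA ler_pM2r// mulrC; exact: le_trans h K0K.
Qed.

Lemma ell_le w : wordP I w -> ell w <= K * lam^-1 ^+ size w.
Proof.
move=> hw; have h := dF_ge hw (cyl_mid hw).
apply: (@le_trans _ _ (lam^-1 ^+ size w)).
  by rewrite exprVn lef_pV2// posrE ?exprn_gt0// (dF_gt0 hw (cyl_mid hw)).
by rewrite ler_peMl ?distortion_ge1// exprn_ge0// invr_ge0 ltW.
Qed.

Lemma dF_ell_le w x : wordP I w -> cyl w x -> (dF (size w) x)^-1 <= K * ell w.
Proof.
move=> hw cx; have [_ h] := dF_ell hw cx; have d0 := dF_gt0 hw cx.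
rewrite -[leLHS]mul1r ler_pdivrMr//; apply: (le_trans h).
rewrite (_ : K * ell w * _ = K * (dF (size w) x * ell w)); last by ring.
by rewrite ler_pM2r// mulr_gt0// ell_gt0.
Qed.

Lemma dF_ell_ge w x : wordP I w -> cyl w x -> ell w / K <= (dF (size w) x)^-1.
Proof.
move=> hw cx; have [h _] := dF_ell hw cx; have d0 := dF_gt0 hw cx.
rewrite ler_pdivrMr// ler_pdivlMl//; exact: le_trans h K0K.
Qed.

Lemma cyl_diam w x y : wordP I w -> cyl w x -> cyl w y ->
  `|x - y| <= K * ell w * `|iter (size w) F0 x - iter (size w) F0 y| /\
  ell w * `|iter (size w) F0 x - iter (size w) F0 y| <= K * `|x - y|.
Proof.
move=> hw cx cy; have [h1 h2] := cyl_mean_le hw cx cy; have [h3 h4] := dF_ell hw cx.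
have d0 := dF_gt0 hw cx; have l0 := ell_gt0 hw.
set z := `|_ - iter _ _ y| in h1 h2 *; set u := `|x - y| in h1 h2 *.
have z0 : 0 <= z by exact: normr_ge0.
have u0 : 0 <= u by exact: normr_ge0.
set D := dF _ _ in h1 h2 h3 h4 d0; set l := ell w in h3 h4 l0 *.
rewrite KE; split.
  apply: (@le_trans _ _ (u * (K0 * (D * l)))); first by rewrite ler_peMr.
  apply: (@le_trans _ _ (K0 * l * (u * D))).
    by rewrite le_eqVlt; apply/orP; left; apply/eqP; ring.
  rewrite (_ : K0 * K0 * l * z = K0 * l * (K0 * z)); last by ring.
  by rewrite ler_wpM2l// mulr_ge0// ltW.
apply: (@le_trans _ _ (l * (K0 * (u * D)))); first by rewrite ler_wpM2l// ltW.
rewrite (_ : l * _ = K0 * u * (D * l)); last by ring.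
rewrite (_ : K0 * K0 * u = K0 * u * K0); last by ring.
by rewrite ler_wpM2l// mulr_ge0// ltW.
Qed.

Lemma cyl_diam_le w x y : wordP I w -> cyl w x -> cyl w y -> `|x - y| <= K * ell w.
Proof.
move=> hw cx cy; have [h _] := cyl_diam hw cx cy; apply: (le_trans h).
rewrite ler_piMr ?mulr_ge0 ?(ltW (ell_gt0 hw)) ?(ltW K_gt0)//.
have := cyl_iter hw cx; have := cyl_iter hw cy => /andP[a b] /andP[c d].
by rewrite ler_norml; apply/andP; split; lra.
Qed.

Lemma cyl_monotone w : wordP I w ->
  (forall x y, cyl w x -> cyl w y -> x < y -> iter (size w) F0 x < iter (size w) F0 y) \/
  (forall x y, cyl w x -> cyl w y -> x < y -> iter (size w) F0 y < iter (size w) F0 x).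
Proof.
elim: w => [|i w IH]; first by left.
move=> /wordP_cons[Ii hw]; have mi := branch_mono bm lam_gt1 lamP Ii.
case: (IH hw) => hi; case: mi => mi; [left|right|right|left] => x y [Jx cx] [Jy cy] xy;
  rewrite /= -!iterS !iterSr; apply: hi => //; exact: mi.
Qed.

Lemma cyl_conv w x y z : wordP I w -> cyl w x -> cyl w y -> x <= z <= y -> cyl w z.
Proof.
elim: w x y z => [|i w IH] x y z /=.
  by move=> _ /andP[a _] /andP[_ b] /andP[c d]; rewrite (lt_le_trans a)// (le_lt_trans d).
move=> /wordP_cons[Ii hw] [Jx cx] [Jy cy] /andP[xz zy].
have Jz : J i z by apply: (branch_conv bm Ii Jx Jy); rewrite xz.
split=> //; move: xz; rewrite le_eqVlt => /orP[/eqP <-//|xz].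
move: zy; rewrite le_eqVlt => /orP[/eqP ->//|zy].
case: (branch_mono bm lam_gt1 lamP Ii) => mi.
  by apply: (IH _ _ _ hw cx cy); rewrite (ltW (mi _ _ Jx Jz xz)) (ltW (mi _ _ Jz Jy zy)).
by apply: (IH _ _ _ hw cy cx); rewrite (ltW (mi _ _ Jz Jy zy)) (ltW (mi _ _ Jx Jz xz)).
Qed.

(** The preimages [p] and [r] of [d / 2] and [1 - d / 2] lie in the cylinder on either side of [x].
    A point outside this interval is beyond one of them, and their distance to [x] is bounded below
    by [cyl_diam]. Levels strictly inside (0, 1) are needed because 0 and 1 have no preimage in the
    cylinder. *)
Lemma cyl_gap w x y d : wordP I w -> cyl w x -> ~ cyl w y -> 0 < d ->
  d <= iter (size w) F0 x <= 1 - d -> d / (2 * K) * ell w <= `|x - y|.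
Proof.
move=> hw cx ncy d0 /andP[hx1 hx2].
set t := iter (size w) F0 x in hx1 hx2 *.
have d2 : d <= 1 / 2 by lra.
have s01 : 0 < d / 2 < 1 by apply/andP; split; lra.
have s02 : 0 < 1 - d / 2 < 1 by apply/andP; split; lra.
have [c1 e1] := cyl_brw hw s01; have [c2 e2] := cyl_brw hw s02.
set p := brw w (d / 2) in c1 e1; set r := brw w (1 - d / 2) in c2 e2.
have far z : cyl w z -> d / 2 <= `|t - iter (size w) F0 z| -> d / (2 * K) * ell w <= `|x - z|.
  move=> cz hz; have [_ h] := cyl_diam hw cx cz.
  rewrite -/t in h; rewrite invfM mulrA mulrAC ler_pdivrMr// [leRHS]mulrC.
  by apply: le_trans h; rewrite mulrC ler_pM2l// ell_gt0.
have fp : d / (2 * K) * ell w <= `|x - p|.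
  by apply: far => //; rewrite e1 ger0_norm//; lra.
have fr : d / (2 * K) * ell w <= `|x - r|.
  by apply: far => //; rewrite e2 ler0_norm//; lra.
have btw : p <= x <= r \/ r <= x <= p.
  case: (cyl_monotone hw) => m; [left|right]; apply/andP; split; rewrite leNgt; apply/negP.
  - by move=> /(m _ _ cx c1); rewrite e1 -/t; lra.
  - by move=> /(m _ _ c2 cx); rewrite e2 -/t; lra.
  - by move=> /(m _ _ cx c2); rewrite e2 -/t; lra.
  - by move=> /(m _ _ c1 cx); rewrite e1 -/t; lra.
have out a b : cyl w a -> cyl w b -> a <= x <= b -> y < a \/ b < y.
  move=> ca cb _; case: (ltP y a) => ya; [by left|right].
  by rewrite ltNge; apply/negP => yb; apply: ncy; apply: (cyl_conv hw ca cb); rewrite ya.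
case: btw => bt; have /andP[b1 b2] := bt.
  case: (out _ _ c1 c2 bt) => h.
    by apply: (le_trans fp); rewrite !ger0_norm//; lra.
  by apply: (le_trans fr); rewrite !ler0_norm//; lra.
case: (out _ _ c2 c1 bt) => h.
  by apply: (le_trans fr); rewrite !ger0_norm//; lra.
by apply: (le_trans fp); rewrite !ler0_norm//; lra.
Qed.

End Cylinders.

(** * Symbolic coding and periodic points *)

Section Coding.
Context {R : realType} (I : set nat) (J : nat -> set R) (F0 : R -> R).
Notation D0 := (Delta0 I J).
Notation cyl := (cyl J F0).
Notation brw := (brw J F0).

Definition inner w := exists2 d : R, 0 < d & forall x, cyl w x -> d <= x <= 1 - d.
Definition idx (x : R) : nat := xget 0%N [set i | I i /\ J i x].
Definition itin n (x : R) : seq nat := mkseq (fun k => idx (iter k F0 x)) n.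

Context (lam : R).
Hypothesis bm : base_map I J F0.
Hypothesis lam_gt1 : 1 < lam.
Hypothesis lamP : forall x, Delta0 I J x -> lam <= `|derive1 F0 x|.

Let lam0 : 0 < lam := lam_gt0 lam_gt1.

Lemma le_geometric0 (a r : R) : 0 <= r -> r < 1 -> (forall n, a <= r ^+ n) -> a <= 0.
Proof.
move=> r0 r1 h; have c : (fun n => r ^+ n : R) @ \oo --> (0 : R).
  by apply: cvg_expr; rewrite ger0_norm.
rewrite leNgt; apply/negP => a0.
have /cvgrPdist_lt /(_ a a0)[N _ hN] := c.
by have := hN N (leqnn N); rewrite /= sub0r normrN ger0_norm ?exprn_ge0// ltNge h.
Qed.

Let th0 : 0 <= lam^-1. Proof. by rewrite invr_ge0 ltW. Qed.
Let th1 : lam^-1 < 1. Proof. by rewrite invf_lt1. Qed.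

Lemma nested_limit (u e : nat -> R) : (forall m m', (m <= m')%N -> `|u m - u m'| <= e m) ->
  exists X, forall m, `|u m - X| <= e m.
Proof.
move=> h; have e0 m : 0 <= e m by apply: le_trans (h m m (leqnn m)).
have hle m m' : u m - e m <= u m' + e m'.
  have [mm|/ltnW mm] := leqP m m'; have := h _ _ mm; rewrite ler_norml => /andP[].
    by have := e0 m'; lra.
  by have := e0 m; lra.
pose S := [set u m - e m | m in [set: nat]].
have S0 : has_sup S.
  split; first by exists (u 0%N - e 0%N); exists 0%N.
  by exists (u 0%N + e 0%N) => _ [m _ <-]; exact: hle.
exists (sup S) => m.
have h1 : u m - e m <= sup S by apply: (ub_le_sup S0.2); exists m.
have h2 : sup S <= u m + e m.
  by apply: ge_sup S0.1 _ => _ [m' _ <-]; exact: hle.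
by rewrite ler_norml; apply/andP; split; lra.
Qed.

Lemma itinerary_cyl om x : 0 < x < 1 -> (forall k, I (om k)) ->
  (forall k, J (om k) (iter k F0 x)) -> forall n, cyl (mkseq om n) x.
Proof.
move=> x01 Iom Jom n; suff : forall j, cyl [seq om k | k <- iota j n] (iter j F0 x) by move=> /(_ 0%N).
elim: n => [|n IH] j /=; last by split; [exact: Jom|exact: (IH j.+1)].
by case: j => [//|j]; rewrite iterS; exact: (branch_F01 bm (Iom j) (Jom j)).
Qed.

Lemma wordP_mkseq (om : nat -> nat) n : (forall k, I (om k)) -> wordP I (mkseq om n).
Proof. by move=> h i /mapP[k _ ->]. Qed.

Lemma itinerary_inj om x y : 0 < x < 1 -> 0 < y < 1 -> (forall k, I (om k)) ->
  (forall k, J (om k) (iter k F0 x)) -> (forall k, J (om k) (iter k F0 y)) -> x = y.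
Proof.
move=> x01 y01 Iom Jx Jy; apply/eqP; rewrite -subr_eq0 -normr_le0.
apply: (le_geometric0 th0 th1) => n.
have := cyl_small bm lam_gt1 lamP (wordP_mkseq Iom) (itinerary_cyl x01 Iom Jx n) (itinerary_cyl y01 Iom Jy n).
by rewrite size_mkseq.
Qed.

(** [X j] is a limit of points realising longer and longer pieces of the itinerary from [j] on; a
    priori it may be 0 or 1. Each occurrence of [b] confines some [X j'] to [[d, 1 - d]], and
    inverse branches carry interiority back to all earlier indices. Recurrence of [b] thus reaches
    every index. *)
Lemma coding om b : (forall k, I (om k)) -> wordP I b -> inner b ->
  (forall N, exists2 j, (N <= j)%N & forall k, (k < size b)%N -> om (j + k)%N = nth 0%N b k) ->
  exists2 x, 0 < x < 1 & forall k, J (om k) (iter k F0 x).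
Proof.
move=> Iom hb [d d0 inb] occ.
pose tw j m := [seq om k | k <- iota j m].
have Itw j m : wordP I (tw j m) by move=> i /mapP[k _ ->].
have half : 0 < (2^-1 : R) < 1 by apply/andP; split; lra.
pose y j m := brw (tw j m) 2^-1.
have cy j m : cyl (tw j m) (y j m) by have [] := cyl_brw bm (Itw j m) half.
have tw_cat j m m' : (m <= m')%N -> tw j m' = tw j m ++ tw (j + m)%N (m' - m)%N.
  by move=> mm; rewrite /tw -map_cat -iotaD subnKC.
have cy2 j m m' : (m <= m')%N -> cyl (tw j m) (y j m').
  move=> mm; have := cy j m'; rewrite {1}(tw_cat j m m' mm).
  by move=> /(cyl_cat bm _ (Itw _ _) (Itw _ _))[].
have szt j m : size (tw j m) = m by rewrite size_map size_iota.
have near_y j m m' : (m <= m')%N -> `|y j m - y j m'| <= lam^-1 ^+ m.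
  by move=> mm; rewrite -{2}(szt j m); apply: (cyl_small bm lam_gt1 lamP (Itw j m)) => //; exact: cy2.
have /choice[X hX] : forall j, exists X, forall m, `|y j m - X| <= lam^-1 ^+ m.
  by move=> j; apply: nested_limit; exact: near_y.
have yS j m : y j m.+1 = br J F0 (om j) (y j.+1 m) by [].
have y01 j m : 0 < y j m < 1 by exact: (cyl01 bm (Itw j m) (cy j m)).
(* Once [X j.+1] is interior, the inverse branch is defined there and contracts distances, hence
   commutes with the limit. *)
have step j : 0 < X j.+1 < 1 -> J (om j) (X j) /\ F0 (X j) = X j.+1.
  move=> X01; have [h1 h2] := brP bm (Iom j) X01.
  suff -> : X j = br J F0 (om j) (X j.+1) by [].
  apply/eqP; rewrite -subr_eq0 -normr_le0.
  have -> : `|X j - br J F0 (om j) (X j.+1)| = 2 * (`|X j - br J F0 (om j) (X j.+1)| / 2) by lra.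
  rewrite pmulr_rle0//; apply: (le_geometric0 th0 th1) => m.
  rewrite ler_pdivrMr//.
  have a1 := hX j m.+1; rewrite yS in a1.
  have [p1 p2] := brP bm (Iom j) (y01 j.+1 m).
  have a2 := branch_expand bm lamP (Iom j) p1 h1; rewrite p2 h2 in a2.
  have a3 := hX j.+1 m.
  have a4 : `|br J F0 (om j) (y j.+1 m) - br J F0 (om j) (X j.+1)| <= lam^-1 ^+ m.
    by apply: le_trans (le_trans a2 a3); rewrite ler_peMl// ltW.
  have a5 : lam^-1 ^+ m.+1 <= lam^-1 ^+ m by rewrite exprS ler_piMl ?exprn_ge0// ltW.
  have a6 := ler_distD (br J F0 (om j) (y j.+1 m)) (X j) (br J F0 (om j) (X j.+1)).
  by rewrite [`|X j - br _ _ _ (y _ _)|]distrC in a6; lra.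
have X01 j : 0 < X j < 1.
  have [j' jj' hj'] := occ j.
  have twb m : (size b <= m)%N -> tw j' m = b ++ tw (j' + size b)%N (m - size b)%N.
    move=> bm'; rewrite (tw_cat j' _ _ bm'); congr (_ ++ _).
    apply: (@eq_from_nth _ 0%N); first by rewrite szt.
    by move=> k; rewrite szt => kb; rewrite (nth_map 0%N) ?size_iota// nth_iota// hj'.
  have Xd : d <= X j' <= 1 - d.
    have yd m : (size b <= m)%N -> d <= y j' m <= 1 - d.
      move=> bm'; apply: inb; have := cy j' m; rewrite {1}(twb m bm').
      by move=> /(cyl_cat bm _ hb (Itw _ _))[].
    have sm (a : R) : (forall m, (size b <= m)%N -> a <= lam^-1 ^+ m) -> a <= 0.
      move=> h; apply: (le_geometric0 th0 th1) => m.
      apply: (le_trans (h (m + size b)%N (leq_addl _ _))).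
      by rewrite exprD ler_piMr ?exprn_ge0// exprn_ile1// ltW.
    apply/andP; split; rewrite -subr_le0; apply: sm => m /yd /andP[g1 g2];
      have := hX j' m; rewrite ler_norml => /andP[]; lra.
  have main k : (k <= j')%N -> 0 < X (j' - k)%N < 1.
    elim: k => [_|k IH kj].
      by rewrite subn0; case/andP: Xd => g1 g2; apply/andP; split; lra.
    have := IH (ltnW kj); rewrite -(subnSK kj) => /step[Jx _].
    exact: (branch01 bm (Iom _) Jx).
  by have := main _ (leq_subr j j'); rewrite subKn.
exists (X 0%N) => // k; suff -> : iter k F0 (X 0%N) = X k by have [] := step k (X01 _).
by elim: k => //= k ->; have [] := step k (X01 _).
Qed.

(** Take branch [i] to the left of branch [j], and two subcylinders inside branch [i]. The right one
    has the other on its left and branch [j] on its right, so it stays away from 0 and 1. Which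
    second letter gives the right one depends on the monotonicity of [F0] on branch [i]. *)
Lemma inner_exists : exists b, [/\ b != [::], wordP I b & inner b].
Proof.
have [i [j [Ii Ij ij]]] : exists i j, [/\ I i, I j & i != j].
  have [[/pcard_leP/unsquash f _ _ _ _] _] := bm.
  exists (f 0%N), (f 1%N).
  have h0 : `I_2 0%N by []. have h1 : `I_2 1%N by [].
  split; [exact: (@funS _ _ _ _ f _ h0)|exact: (@funS _ _ _ _ f _ h1)|].
  by apply/eqP => e; have := @inj _ _ _ f 0%N 1%N (mem_set h0) (mem_set h1) e.
have half : 0 < (2^-1 : R) < 1 by apply/andP; split; lra.
have pt k : I k -> exists z, J k z by move=> Ik; have [] := brP bm Ik half; exists (br J F0 k 2^-1).
wlog lt_ij : i j Ii Ij ij / forall x y, J i x -> J j y -> x < y.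
  move=> H; have [x Jx] := pt i Ii; have [y Jy] := pt j Ij.
  have sep k k' a c a' c' : I k -> I k' -> k != k' -> J k a -> J k' c -> J k a' -> J k' c' -> a < c -> a' < c'.
    move=> Ik Ik' kk' Ja Jc Ja' Jc' ac; rewrite ltNge; apply/negP => ca.
    have no z : J k z -> J k' z -> False.
      by move=> z1 z2; move/eqP: kk'; apply; exact: (branch_disj bm Ik Ik' z1 z2).
    have [ac'|ac'] := leP a c'.
      by apply: (no c') => //; apply: (branch_conv bm Ik Ja Ja'); rewrite ac'.
    by apply: (no a) => //; apply: (branch_conv bm Ik' Jc' Jc); rewrite !ltW.
  have [xy|xy|xy] := ltgtP x y.
  - apply: (H i j) => // x' y' Jx' Jy'; exact: (sep i j x y).
  - apply: (H j i) => // [|x' y' Jx' Jy']; first by rewrite eq_sym.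
    by apply: (sep j i y x) => //; rewrite eq_sym.
  - by exfalso; move/eqP: ij; apply; apply: (branch_disj bm Ii Ij Jx _); rewrite xy.
have [k [k' [Ik Ik' kk]]] : exists k k', [/\ I k, I k' &
    forall x y, cyl [:: i; k'] x -> cyl [:: i; k] y -> x < y].
  have [m|m] := branch_mono bm lam_gt1 lamP Ii.
    exists j, i; split=> // x y [Jx [Jx' _]] [Jy [Jy' _]].
    rewrite ltNge; apply/negP; rewrite le_eqVlt => /orP[/eqP e|/(m _ _ Jy Jx)].
      by have := lt_ij _ _ Jx' Jy'; rewrite e ltxx.
    by apply/negP; rewrite -leNgt ltW//; exact: lt_ij.
  exists i, j; split=> // x y [Jx [Jx' _]] [Jy [Jy' _]].
  rewrite ltNge; apply/negP; rewrite le_eqVlt => /orP[/eqP e|/(m _ _ Jy Jx)].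
    by have := lt_ij _ _ Jy' Jx'; rewrite e ltxx.
  by apply/negP; rewrite -leNgt ltW//; exact: lt_ij.
have w1 : wordP I [:: i; k] by move=> z; rewrite !inE => /orP[]/eqP ->.
have w2 : wordP I [:: i; k'] by move=> z; rewrite !inE => /orP[]/eqP ->.
exists [:: i; k]; split=> //.
have [cy _] := cyl_brw bm w2 half; set y := brw _ _ in cy.
have [z Jz] := pt j Ij.
have /andP[y0 y1] := cyl01 bm w2 cy.
have /andP[z0 z1] := branch01 bm Ij Jz.
exists (Num.min y (1 - z)); first by rewrite lt_min y0 subr_gt0.
move=> x cx; have yx := kk _ _ cy cx; have xz := lt_ij _ _ cx.1 Jz.
apply/andP; split; first by rewrite ge_min ltW.
by rewrite lerBrDl -lerBrDr ge_min; apply/orP; right; lra.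
Qed.

Lemma repellerP x : repeller F0 D0 x <-> forall k, D0 (iter k F0 x).
Proof. by split=> [h k|h k _]; [exact: (h k Logic.I)|exact: h]. Qed.

Lemma repeller_iter x k : repeller F0 D0 x -> repeller F0 D0 (iter k F0 x).
Proof. by move=> /repellerP h; apply/repellerP => n; rewrite -iterD; exact: h. Qed.

Lemma idxP x : D0 x -> I (idx x) /\ J (idx x) x.
Proof. by move=> [i Ii Jx]; rewrite /idx; case: xgetP => [_ ->|/(_ i)] //; case. Qed.

Lemma idxE i x : I i -> J i x -> idx x = i.
Proof.
move=> Ii Jx; have [|h1 h2] := @idxP x; first by exists i.
exact: (branch_disj bm h1 Ii h2 Jx).
Qed.

Lemma repeller01 x : repeller F0 D0 x -> 0 < x < 1.
Proof. by move=> /repellerP/(_ 0%N)[i Ii Jx]; exact: (branch01 bm Ii Jx). Qed.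

Lemma itinP n x : repeller F0 D0 x ->
  [/\ size (itin n x) = n, wordP I (itin n x) & cyl (itin n x) x].
Proof.
move=> rx; have /repellerP h := rx; split; first by rewrite size_mkseq.
  by apply: wordP_mkseq => k; have [] := idxP (h k).
apply: itinerary_cyl; first exact: repeller01.
  by move=> k; have [] := idxP (h k).
by move=> k; have [] := idxP (h k).
Qed.

Lemma itinE w x : wordP I w -> cyl w x -> itin (size w) x = w.
Proof.
move=> hw cx; apply: (@eq_from_nth _ 0%N); rewrite size_mkseq// => k kw.
rewrite nth_mkseq//; elim: w x k hw cx kw => [|i w IH] x k //= /wordP_cons[Ii hw] [Jx cx].
case: k => [|k] kw /=; first exact: idxE.
by rewrite -iterS iterSr; exact: IH.
Qed.

Lemma periodic_uniq w x y : w != [::] -> wordP I w -> cyl w x -> cyl w y ->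
  iter (size w) F0 x = x -> iter (size w) F0 y = y -> x = y.
Proof.
move=> w0 hw cx cy ex ey; have := cyl_expand bm lam_gt1 lamP hw cx cy; rewrite ex ey.
move=> h; apply/eqP; rewrite -subr_eq0 -normr_le0 leNgt; apply/negP => pos.
move: h; rewrite -{2}[`|x - y|]mul1r ler_pM2r// leNgt exprn_egt1//.
by case: w w0 {hw cx cy ex ey}.
Qed.

(** [coding] applies to the periodic repetition of [w], in which [b] recurs. After one period the
    image has the same itinerary, and itineraries determine points. *)
Lemma periodic_point w u b v : w = u ++ b ++ v -> wordP I w -> b != [::] -> inner b ->
  exists x, [/\ cyl w x, iter (size w) F0 x = x & repeller F0 D0 x].
Proof.
move=> wE hw b0 inb.
have sb : (0 < size b)%N by case: b b0 {wE inb}.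
have sw : (0 < size w)%N by rewrite wE !size_cat; lia.
pose om k := nth 0%N w (k %% size w).
have Iom k : I (om k) by apply: hw; rewrite mem_nth// ltn_mod.
have hb : wordP I b by rewrite wE in hw; exact: wordP_catl (wordP_catr hw).
have [N|x x01 Jx] := coding Iom hb inb.
  exists (N * size w + size u)%N; first by nia.
  move=> k kb; rewrite /om -addnA modnMDl modn_small ?wE ?size_cat; last by lia.
  by rewrite nth_cat ltnNge leq_addr/= addKn nth_cat kb.
have wm : mkseq om (size w) = w.
  apply: (@eq_from_nth _ 0%N); rewrite size_mkseq// => k kw.
  by rewrite nth_mkseq// /om modn_small.
exists x; split.
- by rewrite -wm; exact: itinerary_cyl.
- have Jy k : J (om k) (iter k F0 (iter (size w) F0 x)).
    by rewrite -iterD /om -(modnDr k (size w)); exact: Jx.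
  apply: (itinerary_inj _ x01 Iom Jy Jx).
  rewrite -(prednK sw) iterS; exact: (branch_F01 bm (Iom _) (Jx _)).
- by apply/repellerP => k; exists (om k).
Qed.

End Coding.

(** * Skew products *)

Section Limits.
Context {R : realType}.

Lemma limn_einf_sup_range (u : nat -> \bar R) : limn_einf u = ereal_sup (range (einfs u)).
Proof. by rewrite limn_einf_lim; apply/cvg_lim => //; exact: cvg_einfs_sup. Qed.

Lemma limn_einf_pinfty (u : nat -> R) : limn_einf (fun n => (u n)%:E) = +oo%E <->
  forall B : R, exists N, forall n, (N <= n)%N -> B <= u n.
Proof.
rewrite limn_einf_sup_range; split=> [h B|h].
  have : (B%:E < ereal_sup (range (einfs (fun n => (u n)%:E))))%E by rewrite h ltry.
  move=> /ereal_sup_gt[_ [N _ <-] /ltW hN]; exists N => n Nn.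
  rewrite -lee_fin; apply: (le_trans hN); apply: ereal_inf_lbound.
  by exists n.
have ge (B : R) : (B%:E <= ereal_sup (range (einfs (fun n => (u n)%:E))))%E.
  have [N hN] := h B; apply: (@le_trans _ _ (einfs (fun n => (u n)%:E) N)).
    by apply: le_ereal_inf_tmp => _ [n Nn <-]; rewrite lee_fin; exact: hN.
  by apply: ereal_sup_ubound; exists N.
case: ereal_sup ge => [r| |]// ge; last by have := ge 0; rewrite leeNy_eq.
by exfalso; have := ge (r + 1); rewrite lee_fin; lra.
Qed.

Lemma powRNV (a s : R) : 0 <= a -> a `^ (- s) = a^-1 `^ s.
Proof. by move=> a0; rewrite -powR_inv1// -powRrM mulN1r. Qed.

End Limits.

Section Skew.
Context {R : realType} (I : set nat) (J : nat -> set R) (F0 : R -> R).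
Notation D0 := (Delta0 I J).
Notation cyl := (cyl J F0).
Notation ell := (ell J F0).
Notation idx := (idx I J).
Notation itin := (itin I J F0).
Context (lam M : R).
Hypothesis bm : base_map I J F0.
Hypothesis lam_gt1 : 1 < lam.
Hypothesis lamP : forall x, Delta0 I J x -> lam <= `|derive1 F0 x|.
Hypothesis M_ge0 : 0 <= M.
Hypothesis MP : forall x, Delta0 I J x -> `|derive1n 2 F0 x| <= M * (derive1 F0 x) ^+ 2.
Notation K := (distortion lam M).

(* [F_0], [F_Z] and [F_N] are all of the form x + k |-> F_0(x) + st k i for x
   in J_i, with levels k in {0}, Z and N respectively. *)
Context (f : R -> R) (D : set R) (S : set int) (st : int -> nat -> int).
Definition height (k : int) (w : seq nat) : int := foldl st k w.

Hypothesis S_st : forall k i, S k -> I i -> S (st k i).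
Hypothesis DE : forall y, D y <-> exists x k, [/\ D0 x, S k & y = x + k%:~R].
Hypothesis fE : forall x k, D0 x -> S k -> f (x + k%:~R) = F0 x + (st k (idx x))%:~R.

Lemma level_uniq (x x' : R) (k k' : int) : 0 < x < 1 -> 0 < x' < 1 ->
  x + k%:~R = x' + k'%:~R -> x = x' /\ k = k'.
Proof.
move=> /andP[x0 x1] /andP[x0' x1'] e; have kk : k = k'.
  apply/eqP; rewrite eq_le; apply/andP; split; rewrite leNgt; apply/negP => h.
    have : (k' + 1)%:~R <= k%:~R :> R by rewrite ler_int lezD1.
    rewrite intrD; lra.
  have : (k + 1)%:~R <= k'%:~R :> R by rewrite ler_int lezD1.
  rewrite intrD; lra.
by split=> //; move: e; rewrite kk => /addIr.
Qed.

Lemma D0_01 x : D0 x -> 0 < x < 1.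
Proof. by move=> [i Ii Jx]; exact: (branch01 bm Ii Jx). Qed.

Lemma skew_D x k : 0 < x < 1 -> S k -> D (x + k%:~R) <-> D0 x.
Proof.
move=> x01 Sk; split=> [/DE[x' [k' [Dx' Sk' e]]]|Dx]; last by apply/DE; exists x, k.
by have [-> _] := level_uniq x01 (D0_01 Dx') e.
Qed.

Lemma height_S k w : S k -> wordP I w -> S (height k w).
Proof.
by elim: w k => [|i w IH] k Sk //= /wordP_cons[Ii hw]; apply: IH => //; exact: S_st.
Qed.

Lemma height_cat k u v : height k (u ++ v) = height (height k u) v.
Proof. by rewrite /height foldl_cat. Qed.

Lemma skew_iter w x k : wordP I w -> cyl w x -> S k ->
  iter (size w) f (x + k%:~R) = iter (size w) F0 x + (height k w)%:~R.
Proof.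
elim: w x k => [|i w IH] x k //= /wordP_cons[Ii hw] [Jx cx] Sk.
rewrite -!iterS !iterSr fE//; last by exists i.
by rewrite (idxE bm Ii Jx) IH//; exact: S_st.
Qed.

Lemma skew_iter_itin n x k : repeller F0 D0 x -> S k ->
  iter n f (x + k%:~R) = iter n F0 x + (height k (itin n x))%:~R.
Proof.
move=> rx Sk; have [sz hw cx] := itinP bm n rx.
by have := skew_iter hw cx Sk; rewrite sz.
Qed.

Lemma skew_repeller x k : 0 < x < 1 -> S k -> repeller f D (x + k%:~R) <-> repeller F0 D0 x.
Proof.
move=> x01 Sk; split=> [h|rx].
  apply/repellerP => n; elim: n x k x01 Sk h => [|n IH] x k x01 Sk h.
    by apply/(skew_D x01 Sk); exact: (h 0%N Logic.I).
  have Dx : D0 x by apply/(skew_D x01 Sk); exact: (h 0%N Logic.I).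
  have [Ii Jx] := idxP Dx.
  rewrite iterSr; apply: (IH _ (st k (idx x))); first exact: (branch_F01 bm Ii Jx).
    exact: S_st.
  by move=> m _; rewrite -fE// /preimage/= -iterSr; exact: (h m.+1 Logic.I).
move=> n _; rewrite /preimage/= skew_iter_itin//; have [_ hw _] := itinP bm n rx.
have := repeller_iter n rx => rn; apply/skew_D; first exact: (repeller01 bm rn).
  exact: height_S.
by move/repellerP: rn => /(_ 0%N).
Qed.

Lemma skew_repellerE y : repeller f D y ->
  exists x k, [/\ repeller F0 D0 x, S k & y = x + k%:~R].
Proof.
move=> h; have /DE[x [k [Dx Sk e]]] := h 0%N Logic.I; exists x, k; split=> //.
by apply/(skew_repeller (D0_01 Dx) Sk); rewrite -e.
Qed.

Lemma skew_is_derive w x k : wordP I w -> cyl w x -> S k ->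
  exists2 d, is_derive (x + k%:~R) 1 (iter (size w) f) d & `|d| = dF F0 (size w) x.
Proof.
elim: w x k => [|i w IH] x k.
  by exists 1; [exact: is_derive_id|rewrite normr1].
move=> /wordP_cons[Ii hw] [Jx cx] Sk.
have Dx : D0 x by exists i.
have [d hd de] := IH (F0 x) (st k i) hw cx (S_st Sk Ii).
have near_f : \forall y \near (x + k%:~R), F0 (y - k%:~R) + (st k i)%:~R = f y.
  have : nbhs x (J i) by apply: open_nbhs_nbhs; split=> //; exact: (branch_open bm Ii).
  move=> /nbhs_ballP[e e0 be]; apply/nbhs_ballP; exists e => // y xy.
  have Jy : J i (y - k%:~R).
    apply: be; move: xy; rewrite /ball /= => h.
    by rewrite (_ : x - (y - k%:~R) = x + k%:~R - y)//; lra.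
  have Dy : D0 (y - k%:~R) by exists i.
  by rewrite -{2}(subrK k%:~R y) fE// (idxE bm Ii Jy).
have df : is_derive (x + k%:~R) 1 f (derive1 F0 x).
  apply: near_eq_is_derive near_f _.
  have h1 : is_derive (x + k%:~R) 1 (fun y : R => y - k%:~R) 1.
    apply: is_derive_eq; by rewrite subr0.
  have h2 : is_derive (x + k%:~R - k%:~R) 1 F0 (derive1 F0 x).
    by rewrite addrK; exact: (branch_is_derive bm Ii Jx).
  have h3 := @is_derive1_comp _ F0 (fun y : R => y - k%:~R) (x + k%:~R) _ _ h2 h1.
  by apply: is_derive_eq (is_deriveD h3 (is_derive_cst ((st k i)%:~R : R) _ _)) _; rewrite addr0 mulr1.
have fx : f (x + k%:~R) = F0 x + (st k i)%:~R by rewrite fE// (idxE bm Ii Jx).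
exists (d * derive1 F0 x).
  have -> : iter (size (i :: w)) f = iter (size w) f \o f by apply/funext => y; rewrite /= -iterS iterSr.
  by apply: is_derive1_comp => //; rewrite fx.
by rewrite normrM de mulrC.
Qed.

Lemma skew_derive w x k : wordP I w -> cyl w x -> S k ->
  `|derive1 (iter (size w) f) (x + k%:~R)| = dF F0 (size w) x.
Proof.
move=> hw cx Sk; have [d hd <-] := skew_is_derive hw cx Sk.
by rewrite derive1E; case: hd => _ ->.
Qed.

Lemma skew_Per x k n : S k -> 0 < x < 1 -> Per f D n (x + k%:~R) <->
  [/\ repeller F0 D0 x, iter n F0 x = x & height k (itin n x) = k].
Proof.
move=> Sk x01; split.
  move=> [/(skew_repeller x01 Sk) rx /=]; rewrite skew_iter_itin// => e.
  by have [-> ->] := level_uniq (repeller01 bm (repeller_iter n rx)) x01 e.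
move=> [rx ex hx]; split; first exact/skew_repeller.
by rewrite /= skew_iter_itin// ex hx.
Qed.

(** Periodic points over a fixed basic interval are determined by their itineraries, and their
    inverse derivatives are at most [K * ell]. Closed orbits satisfy [q * psum >= 0], so inserting
    the exponential weight only increases the terms, and [contr_summable] bounds the series. *)
Lemma skew_delta_le i k s q (p : nat -> int) : S k -> I i -> 0 <= s -> I !=set0 ->
  contr I ell K p s q -> (forall w, wordP I w -> height k w = k -> 0 <= q * (psum p w)%:~R) ->
  (delta f D (shiftJ J i k) <= s%:E)%E.
Proof.
move=> Sk Ii s0 I0 ct hq; apply: ereal_inf_lbound; exists s => //; split=> //.
have K1 : 1 <= K := distortion_ge1 lam_gt1 M_ge0.
have K0 : 0 < K by exact: lt_le_trans K1.
have Ks : 0 < K `^ s by rewrite powR_gt0.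
have lg := ell_gt0 bm lam_gt1 lamP.
have fin := contr_summable lg K1 (ell_cat_le bm lam_gt1 lamP M_ge0 MP) (ell_cat_ge bm lam_gt1 lamP M_ge0 MP) s0 I0 ct.
have wt0 w : wordP I w -> 0 <= wterm ell p s q w by move=> hw; rewrite mulr_ge0 ?expR_ge0 ?powR_ge0.
apply: (@le_lt_trans _ _ (\esum_(n in [set n | (1 <= n)%N]) ((K `^ s)%:E * part I ell p n s q))%E); last first.
  rewrite esumZl//; last by move=> n _; apply: esum_ge0 => w [_ hw]; rewrite lee_fin wt0.
  by apply: lte_mul_pinfty => //; rewrite lee_fin ltW.
apply: le_esum => n /= n0.
pose P := Per f D n `&` shiftJ J i k; pose e y := itin n (y - k%:~R).
have PP y : P y -> exists x, [/\ y = x + k%:~R, repeller F0 D0 x, iter n F0 x = x & height k (itin n x) = k].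
  move=> [Py [x Jx xy]]; rewrite -xy in Py *.
  by have /(skew_Per n Sk (branch01 bm Ii Jx))[rx ex hx] := Py; exists x.
have eP y : P y -> words I n (e y) /\ (`|derive1 (iter n f) y| `^ (- s) <= K `^ s * wterm ell p s q (e y)).
  move=> /PP[x [-> rx ex hx]]; rewrite /e addrK; have [sz hw cx] := itinP bm n rx; split=> //.
  have := skew_derive hw cx Sk; rewrite sz => ->.
  have := dF_ell_le bm lam_gt1 lamP M_ge0 MP hw cx; rewrite sz => h.
  have d0 := dF_gt0 lam_gt1 lamP hw cx; rewrite sz in d0.
  rewrite powRNV ?(ltW d0)//.
  apply: (@le_trans _ _ ((K * ell (itin n x)) `^ s)).
    by apply: ge0_ler_powR; rewrite ?nnegrE ?invr_ge0 ?mulr_ge0 ?(ltW (lg _ hw)) ?(ltW d0) ?(ltW K0).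
  rewrite powRM ?(ltW (lg _ hw)) ?(ltW K0)// ler_wpM2l ?(ltW Ks)//.
  by rewrite /wterm ler_peMr ?powR_ge0// -[leLHS]expR0 ler_expR; exact: hq.
have einj : set_inj P e.
  move=> y y'; rewrite !inE => /PP[x [-> rx ex hx]] /PP[x' [-> rx' ex' hx']].
  rewrite /e !addrK => ee; congr (_ + _).
  have [sz hw cx] := itinP bm n rx; have [sz' hw' cx'] := itinP bm n rx'; rewrite -ee in cx'.
  apply: (periodic_uniq bm lam_gt1 lamP _ hw cx cx'); rewrite ?sz//.
  by apply/eqP => e0; move: sz n0; rewrite e0 /= => <-.
apply: (@le_trans _ _ (\esum_(y in P) ((K `^ s)%:E * (wterm ell p s q (e y))%:E))%E).
  by apply: le_esum => y /eP[_ h]; rewrite -EFinM lee_fin.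
rewrite esumZl//; last by move=> y /eP[[_ hw] _]; rewrite lee_fin wt0.
rewrite lee_pmul2l ?lte_fin// -(esum_image P e (fun w => (wterm ell p s q w)%:E))//.
by apply: esum_subset => _ [y /eP[h _] <-].
Qed.

(** For [t < s] the terms are no smaller than at [s], since [ell w / K <= 1]. A single level [n]
    then contributes at least [c], for every [c], so the series at [t] diverges. *)
Lemma skew_delta_ge i k s : S k -> I i ->
  (forall c : R, exists n L, [/\ (0 < n)%N, word_list I n L, c <= \sum_(w <- L) psize ell K s w &
     forall w, w \in L -> [/\ exists v, w = i :: v, height k w = k &
       exists x, [/\ cyl w x, iter (size w) F0 x = x & repeller F0 D0 x]]]) ->
  (s%:E <= delta f D (shiftJ J i k))%E.
Proof.
move=> Sk Ii hL; apply: le_ereal_inf_tmp => _ [t [t0 ht] <-]; rewrite lee_fin leNgt.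
apply/negP => ts.
have K1 : 1 <= K := distortion_ge1 lam_gt1 M_ge0.
have K0 : 0 < K by exact: lt_le_trans K1.
have lg := ell_gt0 bm lam_gt1 lamP.
set T := (\esum_(n in _) _)%E in ht.
suff big (c : R) : (c%:E <= T)%E.
  case: T ht big => [r| |]// _ big; first by have := big (r + 1); rewrite lee_fin; lra.
  by have := big 0; rewrite leeNy_eq.
have [n [L [n0 hwL hc hw]]] := hL c.
have /choice[pt hpt] : forall w, exists x, w \in L -> [/\ cyl w x, iter (size w) F0 x = x & repeller F0 D0 x].
  move=> w; have [wL|] := boolP (w \in L); last by exists 0.
  by have [_ _ [x hx]] := hw w wL; exists x.
have g0 (m : nat) (y : R) : (0 <= (`|derive1 (iter m f) y| `^ (- t))%:E)%E by rewrite lee_fin powR_ge0.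
apply: (@le_trans _ _ (\esum_(y in Per f D n `&` shiftJ J i k) (`|derive1 (iter n f) y| `^ (- t))%:E)%E); last first.
  apply: (@esum_ge1 R _ [set n | (1 <= n)%N] (fun n => \esum_(y in Per f D n `&` shiftJ J i k) (`|derive1 (iter n f) y| `^ (- t))%:E)%E) => //.
  exact: esum_ge0.
pose Y := [seq pt w + k%:~R | w <- L].
have ptL w : w \in L -> [/\ size w = n, wordP I w, cyl w (pt w), iter n F0 (pt w) = pt w & repeller F0 D0 (pt w)].
  move=> wL; have [sz hww] := hwL.2 w wL; have [c1 c2 c3] := hpt w wL; by rewrite -sz.
have uY : uniq Y.
  rewrite map_inj_in_uniq ?hwL.1// => w w' wL w'L /addIr e.
  have [sz hww cw _ _] := ptL w wL; have [sz' hww' cw' _ _] := ptL w' w'L.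
  by rewrite -(itinE bm hww cw) -(itinE bm hww' cw') e sz sz'.
have YS : {in Y, forall y, (Per f D n `&` shiftJ J i k) y}.
  move=> _ /mapP[w wL ->]; have [sz hww cw ew rw] := ptL w wL; have [[v wv] hk _] := hw w wL.
  split; last by exists (pt w) => //; move: cw; rewrite wv => -[].
  apply/(skew_Per n Sk (repeller01 bm rw)); split=> //.
  by rewrite -sz (itinE bm hww cw).
apply: le_trans (esum_list_le (fun y => `|derive1 (iter n f) y| `^ (- t)) uY YS).
rewrite lee_fin big_map; apply: (le_trans hc).
rewrite [leLHS]big_seq [leRHS]big_seq; apply: ler_sum => w wL.
have [sz hww cw _ _] := ptL w wL.
have := skew_derive hww cw Sk; rewrite sz => ->.
have d0 := dF_gt0 lam_gt1 lamP hww cw; rewrite sz in d0.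
rewrite powRNV ?(ltW d0)//.
have h := dF_ell_ge bm lam_gt1 lamP M_ge0 MP hww cw; rewrite sz in h.
have p0 : 0 < ell w / K by rewrite divr_gt0 ?lg.
apply: (@le_trans _ _ ((ell w / K) `^ t)).
  apply: ger_powR; last exact: ltW.
  rewrite p0 ler_pdivrMr// mul1r; apply: (le_trans (ell_le bm lam_gt1 lamP M_ge0 hww)).
  rewrite ler_piMr ?(ltW K0)// exprn_ile1// ?invr_ge0 ?(ltW (lam_gt0 lam_gt1))//.
  by rewrite invf_le1 ?(lam_gt0 lam_gt1)// ltW.
by apply: ge0_ler_powR; rewrite ?nnegrE ?(ltW p0) ?invr_ge0 ?(ltW d0).
Qed.

End Skew.

(** * Dimension bounds *)

Section Dimension.
Context {R : realType} (I : set nat) (J : nat -> set R) (F0 : R -> R).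
Notation D0 := (Delta0 I J).
Notation cyl := (cyl J F0).
Notation ell := (ell J F0).
Notation idx := (idx I J).
Notation itin := (itin I J F0).
Context (lam M : R).
Hypothesis bm : base_map I J F0.
Hypothesis lam_gt1 : 1 < lam.
Hypothesis lamP : forall x, Delta0 I J x -> lam <= `|derive1 F0 x|.
Hypothesis M_ge0 : 0 <= M.
Hypothesis MP : forall x, Delta0 I J x -> `|derive1n 2 F0 x| <= M * (derive1 F0 x) ^+ 2.
Notation K := (distortion lam M).

Let K1 : 1 <= K := distortion_ge1 lam_gt1 M_ge0.
Let K0 : 0 < K. Proof. exact: lt_le_trans K1. Qed.
Let lg := ell_gt0 bm lam_gt1 lamP.
Let th0 : 0 < lam^-1. Proof. by rewrite invr_gt0 (lam_gt0 lam_gt1). Qed.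
Let th1 : lam^-1 < 1. Proof. by rewrite invf_lt1// (lam_gt0 lam_gt1). Qed.
Let lcat_ge := ell_cat_ge bm lam_gt1 lamP M_ge0 MP.
Let lcat_le := ell_cat_le bm lam_gt1 lamP M_ge0 MP.
Let lle := ell_le bm lam_gt1 lamP M_ge0.

Lemma geometric_small (c r e : R) : 0 <= r -> r < 1 -> 0 < e ->
  exists N, forall n, (N <= n)%N -> c * r ^+ n < e.
Proof.
move=> r0 r1 e0.
have h : (fun n => r ^+ n : R) @ \oo --> (0 : R) by apply: cvg_expr; rewrite ger0_norm.
have c1 : 0 < `|c| + 1 by have := normr_ge0 c; lra.
have /cvgrPdist_lt /(_ (e / (`|c| + 1)) (divr_gt0 e0 c1))[N _ hN] := h.
exists N => n Nn; have := hN n Nn; rewrite /= sub0r normrN ger0_norm ?exprn_ge0//.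
rewrite ltr_pdivlMr// => h2; apply: le_lt_trans h2.
rewrite mulrC ler_wpM2l ?exprn_ge0//; have := ler_norm c; lra.
Qed.

Lemma list_min (T : eqType) (L : seq T) (g : T -> R) : {in L, forall w, 0 < g w} ->
  exists2 m, 0 < m & {in L, forall w, m <= g w}.
Proof.
elim: L => [|w L IH] h; first by exists 1.
have [|m m0 hm] := IH; first by move=> v vL; apply: h; rewrite inE vL orbT.
exists (Num.min m (g w)); first by rewrite lt_min m0 h// mem_head.
move=> v; rewrite inE => /orP[/eqP ->|/hm h2]; first by rewrite ge_min lexx orbT.
by rewrite ge_min h2.
Qed.

Lemma flatten_size (L : seq (seq nat)) n u : word_list I n L -> {in u, forall w, w \in L} ->
  size (flatten u) = (n * size u)%N /\ wordP I (flatten u).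
Proof.
move=> [_ hL]; elim: u => [|w u IH] hu; first by rewrite muln0.
have [|h1 h2] := IH; first by move=> v vu; apply: hu; rewrite inE vu orbT.
have [sw hw] := hL w (hu w (mem_head _ _)).
by rewrite /= size_cat sw h1 mulnS; split=> //; exact: wordP_cat.
Qed.

(** Concatenations of blocks from [L] form a tree of cylinders for [tree_dim_ge]. The common suffix
    [b] has two tasks: it makes every infinite concatenation realisable by [coding], and it keeps
    points well inside the cylinder of the prefix before it, which separates siblings. *)
Lemma ifs_dim_ge (k : int) n L b s (A : set R) : (0 < n)%N -> word_list I n L ->
  wordP I b -> b != [::] -> inner J F0 b -> {in L, forall w, exists w0, w = w0 ++ b} ->
  0 < s -> 1 <= \sum_(w <- L) psize ell K s w ->
  (forall x om, repeller F0 D0 x -> (forall j, om j \in L) ->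
     (forall j, cyl (flatten (mkseq om j)) x) -> A (x + k%:~R)) ->
  (s%:E <= dimH A)%E.
Proof.
move=> n0 wL hb bn0 inb Lb s0 hs hA; have [d d0 hd] := inb.
pose pre (w : seq nat) := take (n - size b) w.
have preP w : w \in L -> [/\ w = pre w ++ b, wordP I (pre w) & size (pre w) = (n - size b)%N].
  move=> wLw; have [w0 we] := Lb w wLw; have [sz hw] := wL.2 w wLw.
  have sz0 : size w0 = (n - size b)%N by rewrite -sz we size_cat addnK.
  have pw : pre w = w0 by rewrite /pre we take_size_cat.
  by rewrite pw; split=> //; rewrite we in hw; exact: wordP_catl hw.
have [m m0 hm] : exists2 m, 0 < m & {in L, forall w, m <= ell (pre w)}.
  by apply: list_min => w /preP[_ /lg].
have fl u : {in u, forall w, w \in L} -> size (flatten u) = (n * size u)%N /\ wordP I (flatten u).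
  exact: flatten_size.
(* The first factor is the relative gap from [cyl_gap] for the word made of [u] and a prefix; the
   second compares the size of that word with the size of [u]. *)
pose g := d / (2 * K) * (m / K).
have g0 : 0 < g by apply: mulr_gt0; apply: divr_gt0 => //; exact: mulr_gt0.
apply: (@tree_dim_ge R (seq nat) L (fun u => [set y | cyl (flatten u) (y - k%:~R)]) (fun u => ell (flatten u)) g s) => //.
- exact: wL.1.
- by move=> u /fl[_ /lg].
- move=> u w hu wLw y /=; rewrite flatten_rcons => h; have [_ hfu] := fl u hu.
  by have [] := (cyl_cat bm (y - k%:~R) hfu (wL.2 w wLw).2).1 h.
- move=> u w w' x y hu wLw w'L ww' /=; rewrite !flatten_rcons => hx hy.
  have [_ hfu] := fl u hu; have [we hw0 sp] := preP w wLw; have [we' hw0' sp'] := preP w' w'L.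
  have hc := wordP_cat hfu hw0; have hc' := wordP_cat hfu hw0'.
  rewrite we catA in hx; rewrite we' catA in hy.
  have [cx bx] := (cyl_cat bm _ hc hb).1 hx; have [cy _] := (cyl_cat bm _ hc' hb).1 hy.
  have szz : size (flatten u ++ pre w) = size (flatten u ++ pre w').
    by rewrite !size_cat sp sp'.
  (* Distinct blocks share the suffix [b], so their prefixes differ; being of equal length, the
     prefixes have disjoint cylinders. *)
  have ncy : ~ cyl (flatten u ++ pre w) (y - k%:~R).
    move=> c2; move/eqP: ww'; apply; rewrite we we'; congr (_ ++ _).
    have := itinE bm hc c2; rewrite szz (itinE bm hc' cy) => /eqP.
    by rewrite eqseq_cat// eqxx /= => /eqP.
  have := cyl_gap bm lam_gt1 lamP M_ge0 MP hc cx ncy d0 (hd _ bx).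
  rewrite opprD opprK addrACA addNr addr0 => h; apply: le_trans h.
  rewrite /g -mulrA ler_pM2l; last by rewrite divr_gt0// mulr_gt0.
  rewrite mulrAC ler_pdivrMr//; have := lcat_ge hfu hw0; rewrite [K * _]mulrC; apply: le_trans.
  by rewrite mulrC ler_pM2l ?lg// hm.
- move=> u hu; have [_ hfu] := fl u hu.
  have p0 := powR_gt0 s (lg hfu).
  apply: (@le_trans _ _ (\sum_(w <- L) ell (flatten u) `^ s * psize ell K s w)).
    by rewrite -mulr_sumr ler_peMr// ltW.
  rewrite [leLHS]big_seq [leRHS]big_seq; apply: ler_sum => w wLw.
  have hw := (wL.2 w wLw).2; have l1 := lg hfu; have l2 := lg hw.
  rewrite -powRM ?divr_ge0 ?(ltW l1) ?(ltW l2) ?(ltW K0)//; apply: ge0_ler_powR; rewrite ?nnegrE ?(ltW s0)//.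
  + by rewrite mulr_ge0 ?divr_ge0 ?(ltW l1) ?(ltW l2) ?(ltW K0).
  + by rewrite flatten_rcons (ltW (lg (wordP_cat hfu hw))).
  + by rewrite flatten_rcons mulrA ler_pdivrMr// [leRHS]mulrC; exact: lcat_ge.
- move=> e e0; have [N hN] := geometric_small K (ltW th0) th1 e0.
  exists N => u hu su; have [szu hfu] := fl u hu.
  by apply: le_lt_trans (lle hfu) _; apply: hN; rewrite szu su leq_pmull.
- move=> om omL.
  pose om' i := nth 0%N (om (i %/ n)%N) (i %% n)%N.
  have szo j : size (om j) = n by exact: (wL.2 _ (omL j)).1.
  have Iom i : I (om' i).
    by apply: ((wL.2 _ (omL (i %/ n)%N)).2); rewrite mem_nth// szo ltn_mod.
  have [N|x x01 Jx] := coding bm lam_gt1 lamP Iom hb inb.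
    have [w0 we] := Lb _ (omL N).
    have szw : (size w0 + size b = n)%N by rewrite -(szo N) we size_cat.
    exists (N * n + size w0)%N; first by rewrite (leq_trans (leq_pmulr N n0))// leq_addr.
    move=> i ib; rewrite /om' -addnA divnMDl// divn_small ?addn0; last by clear - ib szw; lia.
    rewrite modnMDl modn_small; last by clear - ib szw; lia.
    by rewrite we nth_cat ltnNge leq_addr /= addKn.
  have rx : repeller F0 D0 x by apply/repellerP => i; exists (om' i).
  have mk j : flatten (mkseq om j) = mkseq om' (n * j).
    elim: j => [|j IH]; first by rewrite muln0.
    rewrite mkseqS flatten_rcons IH mulnS addnC /mkseq iotaD map_cat; congr (_ ++ _).
    apply: (@eq_from_nth _ 0%N); first by rewrite szo size_map size_iota.
    move=> i; rewrite szo => i_n; rewrite (nth_map 0%N) ?size_iota// nth_iota// add0n.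
    by rewrite /om' mulnC divnMDl// divn_small// addn0 modnMDl modn_small.
  have cx j : cyl (flatten (mkseq om j)) x by rewrite mk; exact: (itinerary_cyl bm).
  exists (x + k%:~R); first exact: (hA x om).
  by move=> j /=; rewrite addrK.
Qed.

Lemma null_words s (k : int) (A : set R) : 0 <= s ->
  (forall N (e : R), 0 < e -> exists V : set (seq nat),
    [/\ forall w, V w -> wordP I w /\ (N <= size w)%N,
        forall y, A y -> exists2 w, V w & cyl w (y - k%:~R) &
        (\esum_(w in V) (ell w `^ s)%:E <= e%:E)%E]) ->
  hausdorff_measure s A = 0%E.
Proof.
move=> s0 h; apply: (@null_cover R (seq nat)) => // d e d0 e0.
have Ks : 0 < K `^ s by rewrite powR_gt0.
have [N hN] := geometric_small (K * K) (ltW th0) th1 d0.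
have [V [V1 V2 V3]] := h N (e / K `^ s) (divr_gt0 e0 Ks).
exists V, (fun w => [set y | cyl w (y - k%:~R)]), (fun w => K * ell w); split.
- move=> w /V1[hw Nw]; rewrite mulr_ge0 ?(ltW K0) ?(ltW (lg hw))//=.
  apply: le_trans (ltW (hN _ Nw)); rewrite -mulrA ler_pM2l//; exact: lle.
- move=> w x y /V1[hw _] /= cx cy; have := cyl_diam_le bm lam_gt1 lamP M_ge0 MP hw cx cy.
  by rewrite opprD opprK addrACA addNr addr0.
- by move=> y /V2[w Vw cw]; exists w.
- apply: (@le_trans _ _ ((K `^ s)%:E * \esum_(w in V) (ell w `^ s)%:E)%E).
    rewrite -esumZl//; last by move=> w _; rewrite lee_fin powR_ge0.
    by apply: le_esum => w /V1[hw _]; rewrite -EFinM lee_fin powRM ?(ltW K0) ?(ltW (lg hw)).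
  by rewrite -lee_pdivlMl// -EFinM mulrC.
Qed.

Lemma itin_cat n m x : itin (n + m) x = itin n x ++ itin m (iter n F0 x).
Proof.
rewrite /itin /mkseq iotaD map_cat; congr (_ ++ _).
rewrite add0n -[in iota n m](addn0 n) iotaDl -map_comp; apply: eq_map => i /=.
by rewrite addnC iterD.
Qed.

Lemma esum_geometric (r : R) : 0 <= r -> r < 1 ->
  (\esum_(i in [set: nat]) (r ^+ i)%:E <= ((1 - r)^-1)%:E)%E.
Proof.
move=> r0 r1; rewrite -nneseries_esumT; last by move=> n; rewrite lee_fin exprn_ge0.
apply: lime_le; first by apply: is_cvg_nneseries => n _ _; rewrite lee_fin exprn_ge0.
apply: nearW => n; rewrite sumEFin lee_fin.
have r2 : 0 < 1 - r by lra.
rewrite -[leRHS]mul1r ler_pdivlMr// big_mkord.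
have -> : (\sum_(k < n) r ^+ k) * (1 - r) = 1 - r ^+ n.
  elim: n => [|n IH]; first by rewrite big_ord0 expr0; lra.
  by rewrite big_ord_recr/= mulrDl IH exprS; lra.
by have := exprn_ge0 n r0; lra.
Qed.

Context (p : nat -> int).
Hypothesis p_ge : forall i, I i -> -1 <= p i.
Hypothesis I0 : I !=set0.

Let wt0 s q w : wordP I w -> 0 < wterm ell p s q w.
Proof. by move=> hw; exact: (wterm_gt0 p lg). Qed.

(** Decay is known at multiples of [N0] only. A time with small sum is rounded down to such a
    multiple; fewer than [N0] steps are dropped, each at least -1, so the sum there is at most
    [h + N0]. On such words the weight with [q <= 0] is bounded below, and the multiples contribute
    a geometric series. *)
Lemma null_psum_low s q (h : int) (k : int) : 0 <= s -> q <= 0 -> contr I ell K p s q ->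
  hausdorff_measure s [set x + k%:~R | x in [set x | repeller F0 D0 x /\
     forall N, exists2 n, (N <= n)%N & psum p (itin n x) <= h]] = 0%E.
Proof.
move=> s0 q0 ct; have [N0 [r [N00 r0 r1 hr]]] := contr_step lg K1 lcat_le s0 I0 ct.
apply: (null_words (k := k) s0) => N e e0.
pose h' := h + N0%:Z; pose C := expR (- q * h'%:~R).
have C0 : 0 < C by exact: expR_gt0.
have r2 : 0 < 1 - r by lra.
have [i1 hi1] := geometric_small (C / (1 - r)) r0 r1 e0.
pose i0 := maxn i1 N.
pose V i := words I ((i0 + i).+1 * N0) `&` [set w | psum p w <= h'].
have tV : trivIset [set: nat] V.
  apply/trivIsetP => i j _ _ ij; apply/eqP/negPn/negP => /set0P[w [[[s1 _] _] [[s2 _] _]]].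
  by move: s1; rewrite s2 => /eqP; rewrite eqn_pmul2r// eqSS eqn_add2l eq_sym (negbTE ij).
exists (\bigcup_i V i); split.
- move=> w [i _ [[sw hw] _]]; split=> //; rewrite sw.
  by apply: leq_trans (leq_pmulr _ N00); rewrite ltnW// ltnS (leq_trans (leq_maxr i1 N))// leq_addr.
- move=> _ [x [rx hx] <-]; rewrite addrK; have [n ln hn] := hx ((i0.+1 * N0)%N).
  pose j := (n %/ N0)%N; have j1 : (i0 < j)%N by rewrite /j leq_divRL.
  have jE : (i0 + (j - i0.+1)).+1 = j by rewrite -addSn subnKC.
  have nE : n = (j * N0 + n %% N0)%N by rewrite /j -divn_eq.
  have [sz hw cw] := itinP bm (j * N0) rx.
  exists (itin (j * N0) x) => //; exists (j - i0.+1)%N => //.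
  split; first by split; rewrite // jE.
  have := hn; rewrite {1}nE itin_cat psum_cat /=.
  have [sz2 hw2 _] := itinP bm (n %% N0) (repeller_iter (j * N0) rx).
  have := psum_ge p_ge hw2; rewrite sz2 /h'; have : (n %% N0 < N0)%N by rewrite ltn_mod.
  by move: (psum p _) (psum p _) => a a'; clear; lia.
- rewrite esum_bigcupT//; last by move=> w; rewrite lee_fin powR_ge0.
  apply: (@le_trans _ _ (\esum_(i in [set: nat]) ((C * r ^+ i0.+1)%:E * (r ^+ i)%:E))%E).
    apply: le_esum => i _; apply: (@le_trans _ _ (C%:E * part I ell p ((i0 + i).+1 * N0) s q)%E).
      rewrite -esumZl//; last by move=> w [_ hw]; rewrite lee_fin ltW// wt0.
      apply: (@le_trans _ _ (\esum_(w in V i) (C%:E * (wterm ell p s q w)%:E)%E)%E); last by apply: esum_subset => w [].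
      apply: le_esum => w [[_ hw] /= hp]; rewrite -EFinM lee_fin /wterm mulrCA.
      rewrite ler_peMr ?powR_ge0// -expRD -[leLHS]expR0 ler_expR mulNr addrC subr_ge0.
      by rewrite -subr_le0 -mulrBr mulr_le0_ge0// subr_ge0 ler_int.
    by rewrite -EFinM -mulrA -exprD addSn EFinM lee_pmul2l ?lte_fin.
  have [z|z] := eqVneq r 0.
    by rewrite esum1 ?lee_fin ?(ltW e0)// => i _; rewrite z expr0n /= mulr0 mul0e.
  have rp : 0 < r by rewrite lt_neqAle eq_sym z.
  have c0 : 0 < C * r ^+ i0.+1 by rewrite mulr_gt0// exprn_gt0.
  rewrite esumZl//; last by move=> i _; rewrite lee_fin exprn_ge0.
  apply: (@le_trans _ _ ((C * r ^+ i0.+1)%:E * ((1 - r)^-1)%:E)%E).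
    by rewrite lee_pmul2l ?lte_fin// esum_geometric.
  rewrite -EFinM lee_fin mulrAC; apply/ltW/hi1.
  by rewrite (leq_trans (leq_maxl i1 N)).
Qed.

(** The condition holds at every time after the prefix [u], so words of one long length already give
    a cover, in contrast with [null_psum_low]. The prefix enters only through the constant [C]. *)
Lemma null_psum_high s q (h : int) (u : seq nat) (k : int) : 0 <= s -> 0 <= q -> wordP I u ->
  contr I ell K p s q ->
  hausdorff_measure s [set x + k%:~R | x in [set x | [/\ repeller F0 D0 x, cyl u x &
     forall n, h <= psum p (itin n (iter (size u) F0 x))]]] = 0%E.
Proof.
move=> s0 q0 hu ct; have [N0 [r [N00 r0 r1 hr]]] := contr_step lg K1 lcat_le s0 I0 ct.
apply: (null_words (k := k) s0) => N e e0.
pose C := (K * ell u) `^ s * expR (- q * h%:~R).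
have kl : 0 < K * ell u by rewrite mulr_gt0// lg.
have C0 : 0 < C by rewrite mulr_gt0 ?expR_gt0// powR_gt0.
have [i1 hi1] := geometric_small C r0 r1 e0.
pose i0 := maxn i1 N.
pose V := words I (i0.+1 * N0) `&` [set w | h <= psum p w].
have inj : set_inj V (fun w => u ++ w).
  by move=> w w' _ _ /eqP; rewrite eqseq_cat// eqxx => /eqP.
exists ((fun w => u ++ w) @` V); split.
- move=> _ [w [[sw hw] _] <-]; split; first exact: wordP_cat.
  rewrite size_cat sw; apply: leq_trans (leq_addl _ _).
  by apply: leq_trans (leq_pmulr _ N00); rewrite ltnW// ltnS leq_maxr.
- move=> _ [x [rx cx hx] <-]; rewrite addrK.
  have [sz hw cw] := itinP bm (i0.+1 * N0) (repeller_iter (size u) rx).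
  exists (u ++ itin (i0.+1 * N0) (iter (size u) F0 x)).
    exists (itin (i0.+1 * N0) (iter (size u) F0 x)) => //.
    by split; [split|exact: hx].
  exact/(cyl_cat bm).
- rewrite esum_image//.
  apply: (@le_trans _ _ (C%:E * part I ell p (i0.+1 * N0) s q)%E).
    rewrite -esumZl//; last by move=> w [_ hw]; rewrite lee_fin ltW// wt0.
    apply: (@le_trans _ _ (\esum_(w in V) (C%:E * (wterm ell p s q w)%:E)%E)%E); last by apply: esum_subset => w [].
    apply: le_esum => w [[_ hw] /= hp]; rewrite -EFinM lee_fin /wterm /C mulrACA -expRD.
    apply: (@le_trans _ _ ((K * ell u) `^ s * ell w `^ s)).
      have luw := lg (wordP_cat hu hw).
      rewrite -powRM ?(ltW kl) ?(ltW (lg hw))//; apply: ge0_ler_powR => //; rewrite ?nnegrE ?(ltW luw)//.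
        by rewrite mulr_ge0 ?(ltW kl) ?(ltW (lg hw)).
      exact: lcat_le.
    rewrite ler_peMr ?mulr_ge0 ?powR_ge0// -[leLHS]expR0 ler_expR mulNr addrC -mulrBr.
    by rewrite mulr_ge0// subr_ge0 ler_int.
  apply: (@le_trans _ _ (C%:E * (r ^+ i0.+1)%:E)%E); first by rewrite lee_pmul2l ?lte_fin.
  by rewrite -EFinM lee_fin; apply/ltW/hi1; rewrite (leq_trans (leq_maxl i1 N)).
Qed.

End Dimension.

(** * Families of loops and critical exponents *)

Section Loops.
Context {R : realType}.

(** Appending [b] may lower the drift by the absolute value of [x b] and multiplies the mass at
    least by [A b]. A power of a family of drift at least 1 first gains enough drift, and asking for
    mass [c / A b] compensates the factor. *)
Lemma list_suffix (T : eqType) (A : seq T -> R) (x : seq T -> int) (P : set T) (b : seq T) :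
  (forall w, wordP P w -> 0 < A w) ->
  (forall u v, wordP P u -> wordP P v -> A u * A v <= A (u ++ v)) ->
  (forall u v, x (u ++ v) = x u + x v) -> wordP P b ->
  (forall c : R, exists m L, [/\ (0 < m)%N, word_list P m L, {in L, forall w, 1 <= x w} &
     c <= \sum_(w <- L) A w]) ->
  forall c : R, exists m L, [/\ (0 < m)%N, word_list P m L,
     {in L, forall w, 1 <= x w /\ exists w0, w = w0 ++ b} & c <= \sum_(w <- L) A w].
Proof.
move=> A0 Acat xcat hb hL c; have Ab := A0 b hb.
have [m [L [m0 wL xL cL]]] := hL (Num.max 1 (c / A b)).
have WE L' : weight A x L' 0 = \sum_(w <- L') A w.
  by apply: eq_bigr => w _; rewrite mul0r expR0 mulr1.
pose k := `|x b|%N; pose L1 := pow_list L k.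
have wb : word_list P (size b) [:: b] by split=> // w; rewrite inE => /eqP ->.
have wL1 := word_list_pow k wL.
exists (k.+1 * m + size b)%N, (cat_list L1 [:: b]); split.
- by rewrite addn_gt0 muln_gt0 m0.
- exact: word_list_cat.
- move=> w /allpairsP[[u v] /= [uL]]; rewrite inE => /eqP -> ->; split; last by exists u.
  have := x_pow_ge xcat xL uL; rewrite xcat -mulr_natr mul1r natz /k; clear; lia.
- rewrite -WE; apply: le_trans (weight_cat Acat xcat 0 wL1 wb).
  have -> : weight A x [:: b] 0 = A b by rewrite WE big_seq1.
  rewrite -ler_pdivrMr//; apply: le_trans (weight_pow A0 Acat xcat k 0 wL).
  rewrite WE; move: cL; rewrite ge_max => /andP[c1 c2].
  by rewrite exprS (le_trans c2)// ler_peMr ?(le_trans ler01)// exprn_ege1.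
Qed.

Context (I : set nat) (J : nat -> set R) (F0 : R -> R).
Notation D0 := (Delta0 I J).
Notation cyl := (cyl J F0).
Notation ell := (ell J F0).
Notation idx := (idx I J).
Notation itin := (itin I J F0).
Context (lam M : R).
Hypothesis bm : base_map I J F0.
Hypothesis lam_gt1 : 1 < lam.
Hypothesis lamP : forall x, Delta0 I J x -> lam <= `|derive1 F0 x|.
Hypothesis M_ge0 : 0 <= M.
Hypothesis MP : forall x, Delta0 I J x -> `|derive1n 2 F0 x| <= M * (derive1 F0 x) ^+ 2.
Notation K := (distortion lam M).

Context (f : R -> R) (D : set R) (S : set int) (st : int -> nat -> int).
Hypothesis S_st : forall k i, S k -> I i -> S (st k i).
Hypothesis DE : forall y, D y <-> exists x k, [/\ D0 x, S k & y = x + k%:~R].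
Hypothesis fE : forall x k, D0 x -> S k -> f (x + k%:~R) = F0 x + (st k (idx x))%:~R.
Notation height := (height st).

Let K1 : 1 <= K := distortion_ge1 lam_gt1 M_ge0.
Let lg := ell_gt0 bm lam_gt1 lamP.
Let lcat_ge := ell_cat_ge bm lam_gt1 lamP M_ge0 MP.

(** Read after the letter [i], the words of [L] end at heights in the finite set [V]. By pigeonhole
    one height [v] carries a fixed proportion of the mass, and one fixed word starting with [b]
    leads from there back to [k]. The loops so obtained contain [b], hence carry periodic points.
    The losses form a constant factor, prepaid in [c']. *)
Lemma loops_delta_ge i k s b (V : seq int) : S k -> I i -> 0 <= s ->
  wordP I b -> b != [::] -> inner J F0 b ->
  {in V, forall v, exists2 e, wordP I e & height v (b ++ e) = k} ->
  (forall c : R, exists n L, [/\ word_list I n L, c <= \sum_(w <- L) psize ell K s w &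
     {in L, forall u, height k (i :: u) \in V}]) ->
  (s%:E <= delta f D (shiftJ J i k))%E.
Proof.
move=> Sk Ii s0 hb b0 inb hV hL; apply: (skew_delta_ge bm lam_gt1 lamP M_ge0 MP S_st DE fE) => // c.
have A0 := psize_gt0 lg K1 s; have Acat := fun u v => psize_cat lg K1 lcat_ge (s := s) (u := u) (v := v) s0.
have /choice[e he] : forall v, exists e, v \in V -> wordP I e /\ height v (b ++ e) = k.
  move=> v; have [/hV[e e1 e2]|] := boolP (v \in V); last by exists [::].
  by exists e.
pose ext v := b ++ e v.
have hext v : v \in V -> wordP I (ext v) by move=> /he[h _]; exact: wordP_cat.
have [m m0 hm] : exists2 m, 0 < m & {in V, forall v, m <= psize ell K s (ext v)}.
  by apply: list_min => v /hext/A0.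
have hi : wordP I [:: i] by move=> j; rewrite inE => /eqP ->.
have pi := A0 _ hi; set ai := psize _ _ _ [:: i] in pi.
pose c' := Num.max 1 (`|c| * (size V)%:R / (m * ai)).
have [n [L [wL cL hLV]]] := hL c'.
have c'0 : 0 < c' by rewrite lt_max ltr01.
pose g v := \sum_(u <- L | height k (i :: u) == v) psize ell K s u.
have gle : c' <= \sum_(j < size V) g (nth 0 V j).
  apply: (le_trans cL); rewrite /g (exchange_big_dep predT)//=.
  rewrite [leLHS]big_seq [leRHS]big_seq; apply: ler_sum => u uL.
  have hj : (index (height k (i :: u)) V < size V)%N by rewrite index_mem hLV.
  rewrite (bigD1 (Ordinal hj))/=; last by rewrite nth_index// hLV.
  by rewrite lerDl sumr_ge0// => j _; rewrite ltW// A0//; exact: (wL.2 u uL).2.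
have [j jV hj] := pigeonhole_sum (f := fun j => g (nth 0 V j)) gle c'0.
set v := nth 0 V j in hj.
have vV : v \in V by rewrite mem_nth.
pose L' := [seq [:: i] ++ u ++ ext v | u <- L & height k (i :: u) == v].
exists (1 + (n + size (ext v)))%N, L'; split.
- by rewrite add1n.
- split.
    rewrite map_inj_in_uniq ?filter_uniq ?wL.1// => u u'; rewrite !mem_filter => /andP[_ uL] /andP[_ u'L].
    move=> /eqP; rewrite eqseq_cat// eqxx /= eqseq_cat ?(wL.2 _ uL).1 ?(wL.2 _ u'L).1//.
    by move=> /andP[/eqP].
  move=> _ /mapP[u + ->]; rewrite mem_filter => /andP[_ uL]; have [su hu] := wL.2 u uL.
  rewrite !size_cat su; split=> //; apply: wordP_cat => //; apply: wordP_cat => //; exact: hext.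
- rewrite big_map big_filter.
  have sV : 0 < (size V)%:R :> R by rewrite ltr0n (leq_ltn_trans _ jV).
  have h1 : c <= m * ai * g v.
    apply: (le_trans (ler_norm c)); rewrite -ler_pdivrMl ?mulr_gt0//.
    apply: le_trans hj; rewrite ler_pdivlMr// mulrC; apply: le_trans (_ : `|c| * (size V)%:R / (m * ai) <= _); last by rewrite le_max lexx orbT.
    by rewrite le_eqVlt; apply/orP; left; apply/eqP; ring.
  apply: (le_trans h1); rewrite /g mulr_sumr big_seq_cond [leRHS]big_seq_cond.
  apply: ler_sum => u /andP[uL _]; have [_ hu] := wL.2 u uL.
  apply: le_trans (Acat _ _ hi (wordP_cat hu (hext _ vV))).
  rewrite -/ai [m * ai]mulrC -mulrA ler_pM2l//.
  apply: le_trans (Acat _ _ hu (hext _ vV)); rewrite mulrC ler_pM2l ?A0//.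
  exact: hm.
- move=> _ /mapP[u + ->]; rewrite mem_filter => /andP[/eqP hu uL].
  have [su wu] := wL.2 u uL; have [we ev] := he v vV; split.
  + by exists (u ++ ext v).
  + by rewrite catA height_cat hu.
  + apply: (periodic_point bm lam_gt1 lamP (u := [:: i] ++ u) (b := b) (v := e v)) => //.
    by apply: wordP_cat => //; apply: wordP_cat => //; exact: hext.
Qed.

End Loops.

(** * The skew-periodic maps *)

Section Extensions.
Context {R : realType} (I : set nat) (J : nat -> set R) (F0 : R -> R)
  (psi : R -> int) (psi1 : R -> nat).
Notation D0 := (Delta0 I J).
Notation cyl := (cyl J F0).
Notation ell := (ell J F0).
Notation idx := (idx I J).
Notation itin := (itin I J F0).
Notation FZ := (extZ F0 psi).
Notation FN := (extN F0 psi psi1).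
Notation DZ := (domZ I J).
Notation DN := (domN I J).

(** Steps become functions of letters; constancy on branches makes the sample point irrelevant. *)
Definition pstep i : int := psi (br J F0 i 2^-1).
Definition pstep1 i : int := (psi1 (br J F0 i 2^-1))%:Z.
Definition stepZ (k : int) i := k + pstep i.
Definition stepN (k : int) i := if k == 0 then pstep1 i else k + pstep i.
Definition step0 (k : int) (i : nat) : int := 0.

Context (lam M : R).
Hypothesis bm : base_map I J F0.
Hypothesis lam_gt1 : 1 < lam.
Hypothesis lamP : forall x, Delta0 I J x -> lam <= `|derive1 F0 x|.
Hypothesis M_ge0 : 0 <= M.
Hypothesis MP : forall x, Delta0 I J x -> `|derive1n 2 F0 x| <= M * (derive1 F0 x) ^+ 2.
Notation K := (distortion lam M).
Hypothesis sf : step_function I J psi.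
Hypothesis rr : reflexion_rule I J psi psi1.

Let half : 0 < (2^-1 : R) < 1. Proof. by apply/andP; split; lra. Qed.
Let K1 : 1 <= K := distortion_ge1 lam_gt1 M_ge0.
Let lg := ell_gt0 bm lam_gt1 lamP.
Let lcat_ge := ell_cat_ge bm lam_gt1 lamP M_ge0 MP.

Lemma psi_idx x : D0 x -> psi x = pstep (idx x).
Proof.
move=> Dx; have [Ii Jx] := idxP Dx; have [J2 _] := brP bm Ii half.
by case: sf => h _ _; exact: (h _ _ _ Ii Jx J2).
Qed.

Lemma psi1_idx x : D0 x -> (psi1 x)%:Z = pstep1 (idx x).
Proof.
move=> Dx; have [Ii Jx] := idxP Dx; have [J2 _] := brP bm Ii half.
by case: rr => h _; rewrite /pstep1 (h _ _ _ Ii Jx J2).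
Qed.

Let br_D0 i : I i -> D0 (br J F0 i 2^-1).
Proof. by move=> Ii; exists i => //; have [] := brP bm Ii half. Qed.

Lemma pstep_ge i : I i -> -1 <= pstep i.
Proof.
move=> /br_D0 Dx; case: sf => _ h _; rewrite -(ler_int R) -lee_fin rmorphN1 -h.
by apply: ereal_inf_lbound; exists (br J F0 i 2^-1).
Qed.

Lemma pstep_minus : exists2 i, I i & pstep i = -1.
Proof.
case: sf => _ h _.
have : (ereal_inf [set ((psi x)%:~R : R)%:E | x in D0] < 0)%E by rewrite h lte_fin ltrN10.
move=> /ereal_inf_lt[_ [x Dx <-]]; rewrite lte_fin -[0]/(0%:~R) ltr_int psi_idx// => h1.
have [Ii _] := idxP Dx; exists (idx x) => //; have := pstep_ge Ii; clear - h1; lia.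
Qed.

Lemma pstep_plus : exists2 i, I i & 1 <= pstep i.
Proof.
case: sf => _ _ /ereal_sup_gt[_ [x Dx <-]]; rewrite lte_fin -[0]/(0%:~R) ltr_int psi_idx// => h1.
by have [Ii _] := idxP Dx; exists (idx x).
Qed.

Lemma pstep1_bounds : exists M1 : nat, forall i, I i -> pstep i <= pstep1 i <= pstep i + M1%:Z.
Proof. by case: rr => _ [M1 _ h]; exists M1 => i /br_D0; exact: h. Qed.

Let I0 : I !=set0. Proof. by have [i Ii _] := pstep_minus; exists i. Qed.

Lemma stepZ_S k i : [set: int] k -> I i -> [set: int] (stepZ k i). Proof. by []. Qed.

Lemma domZE y : DZ y <-> exists x k, [/\ D0 x, [set: int] k & y = x + k%:~R].
Proof. by split=> [[x [k [Dx ->]]]|[x [k [Dx _ ->]]]]; exists x, k. Qed.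

Lemma frac_floor (x : R) (k : int) : 0 < x < 1 -> Num.floor (x + k%:~R) = k /\ Defs.frac (x + k%:~R) = x.
Proof.
move=> /andP[x0 x1]; have e : Num.floor (x + k%:~R) = k.
  by apply: floor_def; rewrite intrD; apply/andP; split; lra.
by rewrite /Defs.frac e addrK.
Qed.

Lemma FZE x k : D0 x -> [set: int] k -> FZ (x + k%:~R) = F0 x + (stepZ k (idx x))%:~R.
Proof.
move=> Dx _; have [e1 e2] := frac_floor k (D0_01 bm Dx).
by rewrite /extZ e1 e2 psi_idx// /stepZ intrD -addrA [k%:~R + _]addrC.
Qed.

Let SN : set int := [set k | 0 <= k].

Lemma stepN_S k i : SN k -> I i -> SN (stepN k i).
Proof.
rewrite /SN /= /stepN => k0 Ii; case: eqP => [_|/eqP kn]; first by rewrite /pstep1.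
have := pstep_ge Ii; clear - k0 kn; lia.
Qed.

Lemma domNE y : DN y <-> exists x k, [/\ D0 x, SN k & y = x + k%:~R].
Proof.
split=> [[x [k [Dx ->]]]|[x [k [Dx k0 ->]]]]; first by exists x, k%:Z.
by exists x, `|k|%N; split=> //; rewrite -[in LHS](gez0_abs k0).
Qed.

Lemma FNE x k : D0 x -> SN k -> FN (x + k%:~R) = F0 x + (stepN k (idx x))%:~R.
Proof.
move=> Dx; rewrite /SN /= /extN /stepN; have /andP[x0 x1] := D0_01 bm Dx.
case: eqP => [-> _|/eqP kn k0].
  by rewrite addr0 x0 x1 -psi1_idx.
have k1 : (1 <= k) by clear - kn k0; lia.
rewrite ifF ?FZE//; apply/negbTE/negP => /andP[_ h].
have : 1%:~R <= k%:~R :> R by rewrite ler_int.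
lra.
Qed.

Lemma step0_S k i : [set 0 : int] k -> I i -> [set 0 : int] (step0 k i). Proof. by []. Qed.

Lemma dom0E y : D0 y <-> exists x k, [/\ D0 x, [set 0 : int] k & y = x + k%:~R].
Proof.
by split=> [Dy|[x [k [Dx -> ->]]]]; [exists y, 0; rewrite addr0|rewrite addr0].
Qed.

Lemma F00E x k : D0 x -> [set 0 : int] k -> F0 (x + k%:~R) = F0 x + (step0 k (idx x))%:~R.
Proof. by move=> _ ->; rewrite !addr0. Qed.

Lemma heightZE k w : height stepZ k w = k + psum pstep w.
Proof.
elim: w k => [|i w IH] k /=; first by rewrite /psum big_nil addr0.
by rewrite IH psum_cons /stepZ addrA.
Qed.

Lemma height0E w : height step0 0 w = 0. Proof. by elim: w => //= i w IH. Qed.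

(** Reflection replaces [psi] by [psi1], which is not smaller, so heights on the half line dominate
    the free sums. *)
Lemma heightN_ge (k : int) w : 0 <= k -> wordP I w -> k + psum pstep w <= height stepN k w.
Proof.
elim: w k => [|i w IH] k k0 /=; first by rewrite /psum big_nil addr0.
move=> /wordP_cons[Ii hw]; have k0' : 0 <= stepN k i by exact: stepN_S.
apply: le_trans (IH _ k0' hw); rewrite psum_cons addrA lerD2r /stepN.
case: eqP => [->|_//]; rewrite add0r.
by have [M1 /(_ i Ii)/andP[]] := pstep1_bounds.
Qed.

(** A free step lowers the level by at most 1, so from level [size w] on, every letter of [w] is
    read at a positive level. *)
Lemma heightN_high (k : int) w : wordP I w -> (size w)%:Z <= k -> height stepN k w = k + psum pstep w.
Proof.
elim: w k => [|i w IH] k /=; first by rewrite /psum big_nil addr0.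
move=> /wordP_cons[Ii hw] kw; rewrite psum_cons addrA -IH//.
  by rewrite /stepN ifF//; apply/negbTE/eqP => k0; move: kw; rewrite k0.
move: (pstep_ge Ii) kw; move: (pstep i) (size w); clear => p n; lia.
Qed.

Lemma heightN_pos x (k : int) : repeller F0 D0 x -> (forall n, 1 <= height stepN k (itin n x)) ->
  forall n, height stepN k (itin n x) = k + psum pstep (itin n x).
Proof.
move=> rx h; elim=> [|n IH]; first by rewrite /psum big_nil addr0.
have e : itin n.+1 x = rcons (itin n x) (idx (iter n F0 x)) by rewrite /itin mkseqS.
have := h n; rewrite e /height foldl_rcons -cats1 psum_cat psum_cons {2}/psum big_nil addr0.
rewrite -/(height _ _ _) IH => h1; rewrite {1}/stepN ifF ?addrA//.
by apply/negbTE/eqP => e0; move: h1; rewrite e0.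
Qed.

(** From level [m] upwards a block meets no reflection and descends; below [m] it gains at most
    [B w]. So the levels up to [m] plus the largest gain, enlarged to include [h0], are preserved by
    all blocks. *)
Lemma heightN_bounded m L (h0 : int) : word_list I m L -> {in L, forall w, psum pstep w <= -1} ->
  exists C : nat, h0 <= C%:Z /\ forall h w, w \in L -> 0 <= h <= C%:Z -> height stepN h w <= C%:Z.
Proof.
move=> wL hL; have [M1 hM1] := pstep1_bounds.
pose B w := (\sum_(i <- w) (`|pstep i| + M1))%N.
have up w h : wordP I w -> 0 <= h -> height stepN h w <= h + (B w)%:Z.
  elim: w h => [|i w IH] h /=; first by rewrite /B big_nil addr0.
  move=> /wordP_cons[Ii hw] hh; have hh' : 0 <= stepN h i by exact: stepN_S.
  apply: (le_trans (IH _ hw hh')); rewrite /B big_cons -/(B w) /stepN.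
  have /andP[_] := hM1 i Ii.
  by case: eqP => [->|_]; move: (pstep i) (pstep1 i) (B w); clear - hh; lia.
pose C := (`|h0| + m + \max_(w <- L) B w)%N; exists C; split; first by rewrite /C; clear; lia.
move=> h w wL0 /andP[h0' hC]; have [sw hw] := wL.2 w wL0.
have [hm|hm] := leP m%:Z h.
  rewrite heightN_high ?sw//; have := hL w wL0; move: hC (psum _ _); clear; lia.
apply: (le_trans (up w h hw h0')).
have : (B w <= \max_(w <- L) B w)%N by apply: (@leq_bigmax_seq _ L xpredT B).
rewrite /C; move: hm (B w) (\max_(w <- L) B w)%N; clear; lia.
Qed.

Lemma heightN_flatten_bounded m L (h0 : int) : word_list I m L ->
  {in L, forall w, psum pstep w <= -1} -> 0 <= h0 ->
  exists C : nat, forall u, {in u, forall w, w \in L} -> 0 <= height stepN h0 (flatten u) <= C%:Z.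
Proof.
move=> wL hL h00; have [C [hC1 hC2]] := heightN_bounded h0 wL hL; exists C.
elim/last_ind => [|u w IH] hu; first by rewrite h00.
have [|h1 h2] := andP (IH _); first by move=> v vu; apply: hu; rewrite mem_rcons inE vu orbT.
have wL0 : w \in L by apply: hu; rewrite mem_rcons mem_head.
rewrite flatten_rcons height_cat; apply/andP; split.
  by apply: (height_S stepN_S); [exact: h1|exact: (wL.2 w wL0).2].
by apply: hC2 => //; rewrite h1.
Qed.

Lemma FN_iter n x k : repeller F0 D0 x -> 0 <= k ->
  iter n FN (x + k%:~R) = iter n F0 x + (height stepN k (itin n x))%:~R.
Proof. by move=> rx k0; exact: (skew_iter_itin bm stepN_S FNE). Qed.

Lemma FN_iter_ge0 n x k : repeller F0 D0 x -> 0 <= k -> 0 <= iter n FN (x + k%:~R).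
Proof.
move=> rx k0; rewrite FN_iter//; have [_ hw _] := itinP bm n rx.
have h0 : 0 <= height stepN k (itin n x) by exact: (height_S stepN_S).
have /andP[i0 _] := repeller01 bm (repeller_iter n rx).
by rewrite addr_ge0 ?(ltW i0)// ler0z.
Qed.

(** Iterates differ from heights by an element of (0, 1), so divergence can be read off on
    integers. *)
Lemma TplusP x k : repeller F0 D0 x -> 0 <= k -> Tplus FN DN (x + k%:~R) <->
  forall B : int, exists N, forall n, (N <= n)%N -> B <= height stepN k (itin n x).
Proof.
move=> rx k0; have rN : repeller FN DN (x + k%:~R).
  exact/(skew_repeller bm stepN_S domNE FNE (repeller01 bm rx) k0).
split=> [[_ /limn_einf_pinfty h] B|h].
  have [N hN] := h (B + 1)%:~R; exists N => n /hN; rewrite FN_iter// => h1.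
  have /andP[_ i1] := repeller01 bm (repeller_iter n rx).
  rewrite -ltzD1 -(ltr_int R) intrD; rewrite intrD in h1; lra.
split=> //; apply/limn_einf_pinfty => B; have [N hN] := h (Num.ceil B); exists N => n /hN h1.
rewrite FN_iter//; have /andP[i0 _] := repeller01 bm (repeller_iter n rx).
have : (Num.ceil B)%:~R <= (height stepN k (itin n x))%:~R :> R by rewrite ler_int.
have := ceil_ge B; lra.
Qed.

Lemma RsetP x k : repeller F0 D0 x -> 0 <= k -> Rset FN DN (x + k%:~R) <->
  exists B : int, forall N, exists2 n, (N <= n)%N & height stepN k (itin n x) <= B.
Proof.
move=> rx k0; have rN : repeller FN DN (x + k%:~R).
  exact/(skew_repeller bm stepN_S domNE FNE (repeller01 bm rx) k0).
have e : (fun n => (`|iter n FN (x + k%:~R)|)%:E) = (fun n => (iter n FN (x + k%:~R))%:E).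
  by apply/funext => n; rewrite ger0_norm// FN_iter_ge0.
have -> : Rset FN DN (x + k%:~R) <-> ~ Tplus FN DN (x + k%:~R).
  rewrite /Rset /Tplus; split.
    by move=> [_ /= h] [_ /= h2]; move: h; rewrite e h2 ltxx.
  by move=> h; split=> //=; rewrite e ltey; apply/eqP => h2; apply: h; split.
rewrite TplusP//; split=> [/existsNP[B /forallNP hB]|[B hB] h].
  exists B => N; apply: contrapT => hn; apply: (hB N) => n Nn; rewrite leNgt; apply/negP => h.
  by apply: hn; exists n => //; exact: ltW.
have [N hN] := h (B + 1); have [n /hN h1 h2] := hB N.
by move: (le_trans h1 h2); clear; lia.
Qed.

Lemma repellerN_RT y : repeller FN DN y -> Rset FN DN y \/ Tplus FN DN y.
Proof.
move=> h; have [x [k [rx k0 ->]]] := skew_repellerE bm stepN_S domNE FNE h.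
have [t|t] := pselect (Tplus FN DN (x + k%:~R)); [by right|left].
apply/RsetP => //; move/TplusP : t => /(_ rx k0)/existsNP[B /forallNP hB].
exists B => N; apply: contrapT => hn; apply: (hB N) => n Nn; rewrite leNgt; apply/negP => h2.
by apply: hn; exists n => //; exact: ltW.
Qed.

Lemma deltaZ_le i k s q : I i -> 0 <= s -> contr I ell K pstep s q ->
  (delta FZ DZ (shiftJ J i k) <= s%:E)%E.
Proof.
move=> Ii s0 ct; apply: (skew_delta_le bm lam_gt1 lamP M_ge0 MP stepZ_S domZE FZE _ Ii s0 I0 ct) => // w _.
by rewrite heightZE -[X in _ = X]addr0 => /addrI ->; rewrite mulr0.
Qed.

Lemma deltaN_le i k s q : I i -> 0 <= k -> 0 <= s -> q <= 0 -> contr I ell K pstep s q ->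
  (delta FN DN (shiftJ J i k) <= s%:E)%E.
Proof.
move=> Ii k0 s0 q0 ct; apply: (skew_delta_le bm lam_gt1 lamP M_ge0 MP stepN_S domNE FNE _ Ii s0 I0 ct) => // w hw hk.
apply: mulr_le0 => //; rewrite lerz0; have := heightN_ge k0 hw; rewrite hk.
by clear; lia.
Qed.

Lemma shiftJ0 i : shiftJ J i 0 = J i.
Proof.
apply/seteqP; split=> [_ [x Jx <-]|x Jx]; first by rewrite addr0.
by exists x => //; rewrite addr0.
Qed.

Lemma delta0_le i s : I i -> 0 <= s -> contr I ell K pstep s 0 ->
  (delta F0 D0 (J i) <= s%:E)%E.
Proof.
move=> Ii s0 ct; rewrite -(shiftJ0 i).
apply: (skew_delta_le bm lam_gt1 lamP M_ge0 MP step0_S dom0E F00E _ Ii s0 I0 ct) => // w _ _; rewrite mul0r.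
Qed.

Lemma null_Rset s q : 0 <= s -> q <= 0 -> contr I ell K pstep s q ->
  hausdorff_measure s (Rset FN DN) = 0%E.
Proof.
move=> s0 q0 ct.
pose A (t : int * int) := [set x + t.1%:~R | x in [set x | repeller F0 D0 x /\
     forall N, exists2 n, (N <= n)%N & psum pstep (itin n x) <= t.2]].
have nA : hausdorff_measure s (\bigcup_t A t) = 0%E.
  apply: null_bigcup => // t.
  exact: (null_psum_low bm lam_gt1 lamP M_ge0 MP pstep_ge I0 t.2 t.1 s0 q0 ct).
have sub : Rset FN DN `<=` \bigcup_t A t.
  move=> y hy; have [x [k [rx k0 e]]] := skew_repellerE bm stepN_S domNE FNE hy.1.
  move: hy; rewrite e => /(RsetP rx k0)[B hB]; exists (k, B - k) => //.
  exists x => //; split=> // N; have [n Nn hn] := hB N; exists n => //=.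
  have [_ hw _] := itinP bm n rx; have := heightN_ge k0 hw; rewrite lerBrDl => h.
  exact: le_trans h hn.
by apply/null_setP => d e d0 e0; have /null_setP/(_ d e d0 e0)[U [U1 U2 U3]] := nA;
  exists U; split=> //; exact: subset_trans U2.
Qed.

(** From some time on the height is at least 1, so no reflection takes place any more and later
    heights are free sums added to the current height. This puts the orbit in one of countably many
    sets, indexed by initial level, bound and prefix. *)
Lemma null_Tplus s q : 0 <= s -> 0 <= q -> contr I ell K pstep s q ->
  hausdorff_measure s (Tplus FN DN) = 0%E.
Proof.
move=> s0 q0 ct.
(* Arbitrary lists are sent to admissible words, so that the countable type of lists can index the
   union. *)
pose g (u : seq nat) := if `[< wordP I u >] then u else [::].
have hg u : wordP I (g u) by rewrite /g; case: asboolP.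
pose A (t : int * int * seq nat) := [set x + t.1.1%:~R | x in [set x | [/\ repeller F0 D0 x, cyl (g t.2) x &
     forall n, t.1.2 <= psum pstep (itin n (iter (size (g t.2)) F0 x))]]].
have nA : hausdorff_measure s (\bigcup_t A t) = 0%E.
  apply: null_bigcup => // t.
  exact: (null_psum_high bm lam_gt1 lamP M_ge0 MP I0 t.1.2 t.1.1 s0 q0 (hg t.2) ct).
have sub : Tplus FN DN `<=` \bigcup_t A t.
  move=> y hy; have [x [k [rx k0 e]]] := skew_repellerE bm stepN_S domNE FNE hy.1.
  move: hy; rewrite e => /(TplusP rx k0)/(_ 1)[N hN].
  have [sz hw cx] := itinP bm N rx.
  pose h := height stepN k (itin N x).
  exists (k, - h, itin N x) => //; exists x => //=.
  have -> : g (itin N x) = itin N x by rewrite /g asboolT.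
  split=> // n; rewrite sz.
  have rN := repeller_iter N rx.
  have pos m : 1 <= height stepN h (itin m (iter N F0 x)).
    by have := hN (N + m)%N (leq_addr _ _); rewrite itin_cat height_cat.
  have := pos n; rewrite (heightN_pos rN pos); clear; lia.
by apply/null_setP => d e d0 e0; have /null_setP/(_ d e d0 e0)[U [U1 U2 U3]] := nA;
  exists U; split=> //; exact: subset_trans U2.
Qed.

Lemma null_repellerN s : 0 <= s -> contr I ell K pstep s 0 ->
  hausdorff_measure s (repeller FN DN) = 0%E.
Proof.
move=> s0 ct; pose A (b : bool) := if b then Rset FN DN else Tplus FN DN.
have nA : hausdorff_measure s (\bigcup_b A b) = 0%E.
  by apply: null_bigcup => // -[]; [exact: null_Rset ct|exact: null_Tplus ct].
apply/null_setP => d e d0 e0; have /null_setP/(_ d e d0 e0)[U [U1 U2 U3]] := nA.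
exists U; split=> //; apply: subset_trans U2 => y /repellerN_RT[] h; [by exists true|by exists false].
Qed.

Let A0 s := psize_gt0 lg K1 s.
Let Acat s (s0 : 0 <= s) u v := psize_cat lg K1 lcat_ge (s := s) (u := u) (v := v) s0.

Lemma list_minus_suffix s b c : 0 <= s -> unif_minus I ell pstep s -> wordP I b ->
  exists m L, [/\ (0 < m)%N, word_list I m L,
     {in L, forall w, psum pstep w <= -1 /\ exists w0, w = w0 ++ b} &
     c <= \sum_(w <- L) psize ell K s w].
Proof.
move=> s0 hU hb.
have suf := @list_suffix R nat (psize ell K s) (fun w => - psum pstep w) I b (A0 s) (Acat s0).
have [||m [L [m0 wL hL cL]]] := suf _ hb _ c.
- by move=> u v; rewrite psum_cat opprD.
- move=> c'; have [m [L [m0 wL xL cL]]] := list_minus lg K1 lcat_ge pstep_ge pstep_minus c' s0 hU.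
  by exists m, L; split=> // w /xL; clear; lia.
exists m, L; split=> // w /hL[h1 h2]; split=> //; move: h1; clear; lia.
Qed.

Lemma list_plus_suffix s b c : 0 <= s -> unif_plus I ell pstep s -> wordP I b ->
  exists m L, [/\ (0 < m)%N, word_list I m L,
     {in L, forall w, 1 <= psum pstep w /\ exists w0, w = w0 ++ b} &
     c <= \sum_(w <- L) psize ell K s w].
Proof.
move=> s0 hU hb.
apply: (@list_suffix R nat (psize ell K s) (psum pstep) I b (A0 s) (Acat s0) _ hb _ c).
  by move=> u v; rewrite psum_cat.
move=> c'; exact: (list_plus lg K1 lcat_ge pstep_ge pstep_plus c' s0 hU).
Qed.

Lemma itin_flatten x (om : nat -> seq nat) m L j : word_list I m L -> (forall j, om j \in L) ->
  (forall j, cyl (flatten (mkseq om j)) x) -> itin (m * j) x = flatten (mkseq om j).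
Proof.
move=> wL omL cx; have [|sz hw] := @flatten_size I L m (mkseq om j) wL.
  by move=> w /mapP[i _ ->].
by have := itinE bm hw (cx j); rewrite sz size_mkseq.
Qed.

(** Blocks of negative drift keep the heights at block ends bounded, and bounded heights at
    infinitely many times are all that [Rset] asks for. *)
Lemma dimR_ge s : 0 < s -> unif_minus I ell pstep s -> (s%:E <= dimH (Rset FN DN))%E.
Proof.
move=> s0 hU; have [b [b0 hb inb]] := inner_exists bm lam_gt1 lamP.
have [m [L [m0 wL hL cL]]] := list_minus_suffix 1 (ltW s0) hU hb.
have hL' : {in L, forall w, psum pstep w <= -1} by move=> w /hL[].
apply: (ifs_dim_ge bm lam_gt1 lamP M_ge0 MP (k := 0) m0 wL hb b0 inb _ s0 cL) => [w /hL[]//|].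
move=> x om rx omL cx; apply/(RsetP rx) => //.
have [C hC] := heightN_flatten_bounded wL hL' (lexx 0).
exists C%:Z => N; exists (m * N)%N; first by rewrite leq_pmull.
rewrite (itin_flatten N wL omL cx).
by have /andP[] : 0 <= height stepN 0 (flatten (mkseq om N)) <= C by apply: hC => w /mapP[i _ ->].
Qed.

(** Starting at level [m], the block length, the height before block [j] is at least [m + j]. Hence
    no block meets the reflection, each block adds at least 1, and less than [m] is lost inside a
    block. *)
Lemma dimT_ge s : 0 < s -> unif_plus I ell pstep s -> (s%:E <= dimH (Tplus FN DN))%E.
Proof.
move=> s0 hU; have [b [b0 hb inb]] := inner_exists bm lam_gt1 lamP.
have [m [L [m0 wL hL cL]]] := list_plus_suffix 1 (ltW s0) hU hb.
apply: (ifs_dim_ge bm lam_gt1 lamP M_ge0 MP (k := m%:Z) m0 wL hb b0 inb _ s0 cL) => [w /hL[]//|].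
move=> x om rx omL cx; apply/(TplusP rx) => //.
have blk j : (m + j)%N%:Z <= height stepN m%:Z (flatten (mkseq om j)).
  elim: j => [|j IH]; first by rewrite addn0.
  have [sw hw] := wL.2 _ (omL j); have [h1 _] := hL _ (omL j).
  rewrite mkseqS flatten_rcons height_cat heightN_high//.
    by move: IH h1; clear; lia.
  by rewrite sw (le_trans _ IH)// lez_nat leq_addr.
move=> B; exists (m * `|B|)%N => n hn.
pose j := (n %/ m)%N.
have jB : (`|B| <= j)%N by rewrite /j leq_divRL// mulnC.
have nE : n = (m * j + n %% m)%N by rewrite {1}(divn_eq n m) mulnC.
rewrite nE itin_cat height_cat (itin_flatten j wL omL cx).
have [sz hw _] := itinP bm (n %% m) (repeller_iter (m * j) rx).
have rm : (n %% m < m)%N by rewrite ltn_mod.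
have bj := blk j.
rewrite heightN_high ?sz//; last first.
  by move: bj rm; move: (height _ _ _) (n %% m)%N; clear => h r; lia.
have := psum_ge pstep_ge hw; rewrite sz.
move: bj rm jB; move: (psum _ _) (height _ _ _); clear; move: (n %% m)%N => r p h; lia.
Qed.

Lemma geometric_large (r c : R) : 1 < r -> exists n, c <= r ^+ n.+1.
Proof.
move=> r1; have r0 : 0 < r by exact: lt_trans r1.
have [||N hN] := @geometric_small R c r^-1 1 _ _ ltr01.
- by rewrite invr_ge0 ltW.
- by rewrite invf_lt1.
by exists N; have := hN N.+1 (leqnSn N); rewrite exprVn ltr_pdivrMr ?exprn_gt0// mul1r => /ltW.
Qed.

Let WE s L' : weight (psize ell K s) (psum pstep) L' 0 = \sum_(w <- L') psize ell K s w.
Proof. by apply: eq_bigr => w _; rewrite mul0r expR0 mulr1. Qed.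

Let WP s (s0 : 0 <= s) n L k : word_list I n L ->
  (\sum_(w <- L) psize ell K s w) ^+ k.+1 <= \sum_(w <- pow_list L k) psize ell K s w.
Proof.
by move=> wL; rewrite -!WE; exact: (weight_pow (A0 s) (Acat s0) (@psum_cat pstep) k 0 wL).
Qed.

(** A partition function above K^s contains a finite family of [psize] mass above 1. Its powers have
    unbounded mass, and for [F0] all words are loops at the single level 0. *)
Lemma delta0_ge i s n : I i -> 0 <= s -> (0 < n)%N -> ((K `^ s)%:E < part I ell pstep n s 0)%E ->
  (s%:E <= delta F0 D0 (J i))%E.
Proof.
move=> Ii s0 n0 hn; rewrite -(shiftJ0 i).
have [b [b0 hb inb]] := inner_exists bm lam_gt1 lamP.
apply: (loops_delta_ge bm lam_gt1 lamP M_ge0 MP step0_S dom0E F00E (V := [:: 0]) _ Ii s0 hb b0 inb) => //.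
  by move=> v; rewrite inE => /eqP ->; exists [::] => //; rewrite height0E.
move=> c; have [L [uL LW hL]] := esum_list hn.
have Ks : 0 < K `^ s by rewrite powR_gt0// (lt_le_trans ltr01 K1).
have wL : word_list I n L by split.
have r1 : 1 < \sum_(w <- L) psize ell K s w.
  rewrite big_seq (eq_bigr (fun w => (K `^ s)^-1 * wterm ell pstep s 0 w)).
    by rewrite -big_seq -mulr_sumr ltr_pdivlMl// mulr1.
  by move=> w /LW[_ hw]; rewrite -(psize_wterm pstep lg K1 s 0 hw) mul0r expR0 mulr1.
have [k hk] := geometric_large c r1.
exists (k.+1 * n)%N, (pow_list L k); split.
- exact: word_list_pow.
- exact: (le_trans hk (WP s0 k wL)).
- by move=> u _; rewrite height0E inE.
Qed.

(** Descending blocks bring every concatenation back to the levels from 0 to [C], which serve as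
    [V]; topological transitivity provides the words leading from there to level [k]. *)
Lemma deltaN_ge i (k : int) s : top_transitive FN DN -> I i -> 0 <= k -> 0 <= s ->
  unif_minus I ell pstep s -> (s%:E <= delta FN DN (shiftJ J i k))%E.
Proof.
move=> tt Ii k0 s0 hU.
have [b [b0 hb inb]] := inner_exists bm lam_gt1 lamP.
(* Transitivity between the copies of branch [i] at levels [v] and [k'] gives an orbit whose
   itinerary is the connecting word. The two sets meet the repeller because branch [i] contains a
   periodic point of [F0]. *)
have conn v k' : 0 <= v -> 0 <= k' -> exists2 e, wordP I e & height stepN v e = k'.
  move=> v0 k'0.
  have oU (t : int) : open [set y : R | J i (y - t%:~R)].
    have : open ((fun y : R => y - t%:~R) @^-1` J i).
      apply: open_comp; last exact: (branch_open bm Ii).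
      by move=> y _; apply: continuousB; [exact: cvg_id|exact: cvg_cst].
    by [].
  have [z [cz ez rz]] : exists x, [/\ cyl (i :: b) x, iter (size (i :: b)) F0 x = x & repeller F0 D0 x].
    apply: (periodic_point bm lam_gt1 lamP (u := [:: i]) (b := b) (v := [::])) => //.
      by rewrite cats0.
    exact: wordP_consI.
  have ne (t : int) : 0 <= t -> [set y : R | J i (y - t%:~R)] `&` repeller FN DN !=set0.
    move=> t0; exists (z + t%:~R); split; first by rewrite /= addrK; case: cz.
    exact/(skew_repeller bm stepN_S domNE FNE (repeller01 bm rz) t0).
  have [n [_ [[y [Jy ry] <-] [Jn _]]]] := tt _ _ (oU v) (oU k') (ne v v0) (ne k' k'0).
  have [x [t [rx t0 e]]] := skew_repellerE bm stepN_S domNE FNE ry.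
  have x01 := repeller01 bm rx.
  have [_ tv] : x = y - v%:~R /\ t = v.
    apply: level_uniq x01 (branch01 bm Ii Jy) _; by rewrite -e subrK.
  exists (itin n x); first by have [] := itinP bm n rx.
  have := Jn; rewrite /= e FN_iter// tv => Jn'.
  have n01 := repeller01 bm (repeller_iter n rx).
  by have [_ ->] := level_uniq n01 (branch01 bm Ii Jn') (esym (subrK k'%:~R _)).
have [m [L [m0 wL hL cL]]] := list_minus_suffix 2 s0 hU hb.
have hL' : {in L, forall w, psum pstep w <= -1} by move=> w /hL[].
have k1 : 0 <= stepN k i by exact: stepN_S.
have [C hC] := heightN_flatten_bounded wL hL' k1.
apply: (loops_delta_ge bm lam_gt1 lamP M_ge0 MP stepN_S domNE FNE (V := [seq j%:Z | j <- iota 0 C.+1]) _ Ii s0 hb b0 inb) => //.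
  move=> v /mapP[j _ ->].
  have [e he1 he2] := conn (height stepN j%:Z b) k (height_S stepN_S (isT : SN j%:Z) hb) k0.
  by exists e => //; rewrite height_cat.
move=> c; have [j hj] := exp2_ge c.
exists (j.+1 * m)%N, (pow_list L j); split.
- exact: word_list_pow.
- apply: (le_trans hj); apply: le_trans (WP s0 j wL).
  apply: (@le_trans _ _ (2 ^+ j.+1)); first by rewrite ler_eXn2l//; lra.
  by rewrite lerXn2r ?nnegrE// (le_trans _ cL).
- move=> u uL; have [us [uE hus]] : exists us, u = flatten us /\ {in us, forall w, w \in L}.
    elim: j u uL {hj} => [|j IH] u /=.
      by move=> uL; exists [:: u]; split; [rewrite /= cats0|move=> w; rewrite inE => /eqP ->].
    move=> /allpairsP[[u1 w] /= [/IH[us [-> hus]] wL0 ->]]; exists (rcons us w).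
    by rewrite flatten_rcons; split=> // w'; rewrite mem_rcons inE => /orP[/eqP ->|/hus].
  rewrite uE [height _ _ _]/=; have /andP[h0 h1] := hC us hus.
  apply/mapP; exists `|height stepN (stepN k i) (flatten us)|%N; last by rewrite gez0_abs.
  rewrite mem_iota /=; move: h0 h1; move: (height _ _ _); clear; lia.
Qed.

(** Crossed powers, the [m2]-th of one family and the [m1]-th of the other, equalise the two block
    lengths. *)
Lemma list_balance s : 0 <= s -> unif_plus I ell pstep s -> unif_minus I ell pstep s ->
  exists m Lp Lm, [/\ word_list I m Lp, word_list I m Lm,
     {in Lp, forall w, 0 <= psum pstep w}, {in Lm, forall w, psum pstep w <= 0} &
     2 <= \sum_(w <- Lp) psize ell K s w /\ 2 <= \sum_(w <- Lm) psize ell K s w].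
Proof.
move=> s0 hp hm.
have [m1 [L1 [m10 wL1 x1 c1]]] := list_plus lg K1 lcat_ge pstep_ge pstep_plus 2 s0 hp.
have [m2 [L2 [m20 wL2 x2 c2]]] := list_minus lg K1 lcat_ge pstep_ge pstep_minus 2 s0 hm.
have pw m L j : word_list I m L -> 2 <= \sum_(w <- L) psize ell K s w ->
    2 <= \sum_(w <- pow_list L j) psize ell K s w.
  move=> wL c; apply: le_trans (WP s0 j wL); apply: (@le_trans _ _ (2 ^+ j.+1)).
    by rewrite exprS ler_peMr// exprn_ege1//; lra.
  by rewrite lerXn2r ?nnegrE// (le_trans _ c).
exists (m1 * m2)%N, (pow_list L1 m2.-1), (pow_list L2 m1.-1); split.
- by have := word_list_pow m2.-1 wL1; rewrite prednK// mulnC.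
- by have := word_list_pow m1.-1 wL2; rewrite prednK.
- move=> w hw; have := x_pow_ge (@psum_cat pstep) x1 hw.
  by rewrite -mulr_natr natz; move: (psum _ _); clear; lia.
- move=> w hw; have := x_pow_le (@psum_cat pstep) x2 hw.
  by rewrite -mulr_natr natz; move: (psum _ _); clear; lia.
- split; [exact: (pw _ _ _ wL1 c1)|exact: (pw _ _ _ wL2 c2)].
Qed.

(* Steering the height: append a climbing block below level 0 and a descending
   block above it, so that the height stays bounded at no cost in size. *)
Fixpoint steer (Lp Lm : seq (seq nat)) j : seq (seq nat) :=
  if j is j'.+1 then
    [seq u ++ w | u <- steer Lp Lm j', w <- if psum pstep u <= 0 then Lp else Lm]
  else [:: [::]].

(** Whichever list the sign of the current sum selects has mass at least 2, so each stage at least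
    doubles the mass. *)
Lemma steerP s m Lp Lm j (C : int) : 0 <= s -> word_list I m Lp -> word_list I m Lm ->
  0 <= C ->
  {in Lp, forall w, 0 <= psum pstep w <= C} -> {in Lm, forall w, - C <= psum pstep w <= 0} ->
  2 <= \sum_(w <- Lp) psize ell K s w -> 2 <= \sum_(w <- Lm) psize ell K s w ->
  [/\ word_list I (j * m) (steer Lp Lm j),
     {in steer Lp Lm j, forall u, - C <= psum pstep u <= C} &
     2 ^+ j * psize ell K s [::] <= \sum_(u <- steer Lp Lm j) psize ell K s u].
Proof.
move=> s0 wLp wLm C0 hp hm cp cm; elim: j => [|j [[uj lj] bj cj]] /=.
  split.
  - by split=> // w; rewrite inE => /eqP ->; split.
  - by move=> w; rewrite inE => /eqP ->; rewrite /psum big_nil oppr_le0 C0.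
  - by rewrite big_seq1 expr0 mul1r.
pose Lu u := if psum pstep u <= 0 then Lp else Lm.
have wLu u : word_list I m (Lu u) by rewrite /Lu; case: ifP.
split; first split.
- apply: allpairs_uniq_dep => //; first by move=> u _; exact: (wLu u).1.
  move=> [u w] [u' w'] /allpairsPdep[u1 [w1 [h1 h2 [-> ->]]]] /allpairsPdep[u2 [w2 [h3 h4 [-> ->]]]] /=.
  move=> /eqP; rewrite eqseq_cat; last by rewrite (lj _ h1).1 (lj _ h3).1.
  by move=> /andP[/eqP -> /eqP ->].
- move=> w /allpairsPdep[u [v [hu hv ->]]]; have [su wu] := lj _ hu.
  have [sv wv] := (wLu u).2 _ hv; rewrite size_cat su sv mulSn addnC; split=> //.
  exact: wordP_cat.
- move=> w /allpairsPdep[u [v [hu hv ->]]]; rewrite psum_cat.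
  have := bj _ hu; move: hv; case: leP => h /[dup] hv; [move/hp|move/hm];
  by move: h; move: (psum _ _) (psum _ _); clear; lia.
- rewrite big_allpairs_dep exprS -mulrA.
  apply: (@le_trans _ _ (2 * \sum_(u <- steer Lp Lm j) psize ell K s u)).
    by rewrite ler_pM2l.
  rewrite mulr_sumr [leLHS]big_seq [leRHS]big_seq; apply: ler_sum => u hu.
  have [su wu] := lj _ hu.
  apply: (@le_trans _ _ (\sum_(w <- Lu u) psize ell K s u * psize ell K s w)).
    rewrite -mulr_sumr mulrC ler_pM2l ?A0// /Lu.
    by case: ifP.
  rewrite [leLHS]big_seq [leRHS]big_seq; apply: ler_sum => w hw.
  by apply: Acat => //; have [] := (wLu u).2 _ hw.
Qed.

Lemma psum_onto (t : int) : exists2 e, wordP I e & psum pstep e = t.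
Proof.
have [ip Ip hp] := pstep_plus; have [im Im hm] := pstep_minus.
pose a := `|t|%N; pose c := `|(a%:Z * pstep ip - t)%R|%N.
exists (nseq a ip ++ nseq c im); first by apply: wordP_cat; exact: wordP_nseq.
rewrite psum_cat !psum_nseq hm -(mulr_natr (pstep ip)) -(mulr_natr (-1)) !natz.
have c0 : c%:Z = a%:Z * pstep ip - t.
  by rewrite /c gez0_abs// /a; move: (pstep ip) hp; clear; nia.
by rewrite c0; clear; lia.
Qed.

(** On the line heights are free sums, so steering keeps them within [B] of 0, and [psum_onto]
    supplies connecting words from every height of this window. *)
Lemma deltaZ_ge i (k : int) s : I i -> 0 <= s ->
  unif_plus I ell pstep s -> unif_minus I ell pstep s ->
  (s%:E <= delta FZ DZ (shiftJ J i k))%E.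
Proof.
move=> Ii s0 hp hm.
have [b [b0 hb inb]] := inner_exists bm lam_gt1 lamP.
have [m [Lp [Lm [wLp wLm xp xm [cp cm]]]]] := list_balance s0 hp hm.
pose C := (\max_(w <- Lp ++ Lm) `|psum pstep w|)%N.
have hC w : w \in Lp ++ Lm -> (`|psum pstep w| <= C)%N.
  by move=> h; apply: (@leq_bigmax_seq _ (Lp ++ Lm) xpredT (fun w => `|psum pstep w|%N)).
have P0 : 0 < psize ell K s [::] by exact: A0.
have hS j := @steerP s m Lp Lm j C%:Z s0 wLp wLm isT _ _ cp cm.
have {}hS j : [/\ word_list I (j * m) (steer Lp Lm j),
     {in steer Lp Lm j, forall u, - C%:Z <= psum pstep u <= C%:Z} &
     2 ^+ j * psize ell K s [::] <= \sum_(u <- steer Lp Lm j) psize ell K s u].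
  apply: hS => w hw; [have := xp w hw|have := xm w hw].
    have := hC w; rewrite mem_cat hw => /(_ isT); move: (psum _ _); clear; lia.
  have := hC w; rewrite mem_cat hw orbT => /(_ isT); move: (psum _ _); clear; lia.
pose B := (C + `|(k + pstep i)%R|)%N.
apply: (loops_delta_ge bm lam_gt1 lamP M_ge0 MP stepZ_S domZE FZE (V := [seq j%:Z - B%:Z | j <- iota 0 (B + B).+1]) _ Ii s0 hb b0 inb) => //.
  move=> v _; have [e he pe] := psum_onto (k - v - psum pstep b).
  by exists e => //; rewrite heightZE psum_cat pe; move: (psum _ _); clear; lia.
move=> c; have [j hj] := exp2_ge (c / psize ell K s [::]).
have [w1 w2 w3] := hS j; exists (j * m)%N, (steer Lp Lm j); split=> //.
  by apply: le_trans w3; rewrite -ler_pdivrMr.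
move=> u /w2; rewrite [height _ _ _](heightZE (stepZ k i) u) [stepZ k i]/stepZ => hu; apply/mapP.
exists `|(k + pstep i + psum pstep u + B%:Z)%R|%N.
  rewrite mem_iota; move: hu; rewrite /B; move: (k + _) (psum _ _); clear; lia.
by move: hu; rewrite /B; move: (k + _) (psum _ _); clear; lia.
Qed.

End Extensions.

(** * A maximal ergodic argument *)

Section Dynamics.
Context d (X : measurableType d) (R : realType) (P : probability X R) (T : X -> X) (f : X -> R).
Hypothesis mT : measurable_fun setT T.
Hypothesis invT : forall A, measurable A -> P (T @^-1` A) = P A.
Hypothesis fi : P.-integrable setT (EFin \o f).

(** The minimum of the sums [bsum k] over [k <= n] ([rmin_le], [rmin_ge]), written so as to peel off
    the first step; the maximal identity is then immediate. *)
Fixpoint rmin n x : R := if n is n'.+1 then Num.min 0 (f x + rmin n' (T x)) else 0.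
Definition bsum n x : R := \sum_(k < n) f (iter k T x).

Lemma bsum_recl n x : bsum n.+1 x = f x + bsum n (T x).
Proof.
rewrite /bsum big_ord_recl; congr (_ + _); apply: eq_bigr => k _.
by rewrite -iterSr.
Qed.

Lemma rmin_rec n x : rmin n.+1 x = Num.min (rmin n x) (bsum n.+1 x).
Proof.
elim: n x => [|n IH] x; first by rewrite /= /bsum big_ord1 addr0.
by rewrite [LHS]/= -/(rmin n.+1 (T x)) IH addr_minr minA -bsum_recl.
Qed.

Lemma rmin_le n k x : (k <= n)%N -> rmin n x <= bsum k x.
Proof.
elim: n => [|n IH]; first by rewrite leqn0 => /eqP ->; rewrite /bsum big_ord0.
rewrite leq_eqVlt rmin_rec ge_min => /orP[/eqP ->|]; first by rewrite lexx orbT.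
by rewrite ltnS => /IH ->.
Qed.

Lemma rmin_ge c n x : (forall k, (k <= n)%N -> c <= bsum k x) -> c <= rmin n x.
Proof.
elim: n => [|n IH] h; first by have := h 0%N isT; rewrite /bsum big_ord0.
by rewrite rmin_rec le_min h// IH// => k kn; apply: h; rewrite ltnW.
Qed.

Lemma rmin_nincr n x : rmin n.+1 x <= rmin n x.
Proof. by rewrite rmin_rec ge_min lexx. Qed.

Lemma rmin_le0 n x : rmin n x <= 0.
Proof. by case: n => //= n; rewrite ge_min lexx. Qed.

Lemma integral_inv (h : X -> \bar R) : measurable_fun [set: X] h -> (forall x, 0 <= h x)%E ->
  (\int[P]_x h (T x) = \int[P]_x h x)%E.
Proof.
move=> mh h0; have := ge0_integral_pushforward mT P measurableT mh (fun x _ => h0 x).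
rewrite preimage_setT => <-; apply: eq_measure_integral => A mA _.
exact: invT.
Qed.

Lemma integrable_inv (h : X -> R) : P.-integrable setT (EFin \o h) ->
  P.-integrable setT (EFin \o (h \o T)) /\ \int[P]_x h (T x) = \int[P]_x h x.
Proof.
move=> ih; have [mh hf] := integrableP _ _ _ ih.
have ihT : P.-integrable setT (EFin \o (h \o T)).
  apply/integrableP; split; first last.
    have e := @integral_inv (fun x => `|(EFin \o h) x|%E).
    by rewrite [X in (X < _)%E]e//; exact: measurableT_comp.
  have mh' : measurable_fun setT h by exact/measurable_EFinP.
  by apply/measurable_EFinP; exact: measurableT_comp.
split=> //; rewrite /Rintegral; congr fine.
have := @integral_pushforward _ _ _ _ _ _ mT P setT (EFin \o h) mh.
rewrite preimage_setT => /(_ ihT measurableT) <-; apply: eq_measure_integral => A mA _.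
exact: invT.
Qed.

Lemma rmin_int n : P.-integrable setT (EFin \o rmin n).
Proof.
elim: n => [|n IH]; first exact: integrable0.
have i1 : P.-integrable setT (EFin \o (fun x => f x + rmin n (T x))).
  exact: (integrableD measurableT fi (integrable_inv IH).1).
have m1 : measurable_fun setT (fun x => f x + rmin n (T x)).
  by apply/measurable_EFinP; case/integrableP : i1.
apply: le_integrable i1 => //.
  by apply/measurable_EFinP; apply: measurable_minr.
move=> x _ /=; rewrite lee_fin; case: (leP 0 (f x + rmin n (T x))) => h.
  by rewrite normr0.
by [].
Qed.

Let hN n x := Num.max 0 (f x + rmin n (T x)).

(** A positive part is the function minus its minimum with 0, and here that minimum is [rmin n.+1]
    by definition. Invariance of [P] removes the composition with [T]. *)
Lemma maximal_int n : P.-integrable setT (EFin \o hN n) /\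
  \int[P]_x hN n x = \int[P]_x f x + \int[P]_x rmin n x - \int[P]_x rmin n.+1 x.
Proof.
have [iT eT] := integrable_inv (rmin_int n).
have i1 : P.-integrable setT (EFin \o (fun x => f x + rmin n (T x))).
  exact: (integrableD measurableT fi iT).
have e : hN n = fun x => (f x + rmin n (T x)) - rmin n.+1 x.
  apply/funext => x; rewrite /hN /=.
  by rewrite /Num.max /Num.min; case: ltgtP => [||<-]; rewrite ?subr0 ?subrr.
split; first by rewrite e; exact: (integrableB measurableT i1 (rmin_int n.+1)).
by rewrite e (RintegralB measurableT i1 (rmin_int n.+1)) (RintegralD measurableT fi iT) eT.
Qed.

Definition bounded_orbit : set X := [set x | exists C : nat, forall n, - C%:R <= bsum n x].

Lemma bsum_meas n : measurable_fun setT (bsum n).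
Proof.
have mf : measurable_fun setT f by apply/measurable_EFinP; case/integrableP : fi.
elim: n => [|n IH].
  by rewrite (_ : bsum 0 = cst 0)//; apply/funext => x; rewrite /bsum big_ord0.
rewrite (_ : bsum n.+1 = fun x => f x + bsum n (T x)); last by apply/funext => x; rewrite bsum_recl.
by apply: measurable_funD => //; exact: measurableT_comp.
Qed.

Lemma bounded_orbit_meas : measurable bounded_orbit.
Proof.
have -> : bounded_orbit = \bigcup_(C : nat) \bigcap_n (setT `&` bsum n @^-1` `[- C%:R, +oo[).
  apply/seteqP; split=> [x [C hC]|x [C _ hC]].
    by exists C => // n _; split=> //=; rewrite in_itv/= hC.
  by exists C => n; have [_ /=] := hC n I; rewrite in_itv/= andbT.
apply: bigcup_measurable => C _; apply: bigcap_measurable => // n _.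
exact: bsum_meas.
Qed.

Lemma unbounded_orbit_shift x : ~ bounded_orbit x -> ~ bounded_orbit (T x).
Proof.
move=> h [C hC]; apply: h; have [k hk] : exists k : nat, `|f x| + C%:R <= k%:R.
  by exists (Num.truncn (`|f x| + C%:R)).+1; exact: (ltW (Num.Theory.truncnS_gt _)).
exists k => -[|n]; first by rewrite /bsum big_ord0 oppr_le0.
rewrite bsum_recl; have := hC n; have := ler_norm (- f x); rewrite normrN; lra.
Qed.

Let cvg_bound (u : nat -> \bar R) (c : R) : u @ \oo --> 0%E -> (forall n, c%:E <= u n)%E -> c <= 0.
Proof.
move=> h1 h2; rewrite -lee_fin; have <- : limn u = 0%:E by exact: cvg_lim.
apply: lime_ge; first by apply/cvg_ex; exists 0%E.
by near=> n; exact: h2.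
Unshelve. all: by end_near. Qed.

Let RintE (h : X -> R) : P.-integrable setT (EFin \o h) ->
  (\int[P]_x (h x)%:E = (\int[P]_x h x)%R%:E)%E.
Proof. by move=> ih; rewrite /Rintegral fineK//; exact: integrable_fin_num. Qed.

(** If almost every orbit had sums unbounded below, [hN n] would eventually vanish almost
    everywhere, dominated by the absolute value of [f], and its integral would tend to 0. But the
    maximal identity and the monotonicity of [rmin] bound that integral below by the integral of
    [f]. *)
Lemma bounded_orbit_pos : 0 < \int[P]_x f x -> P bounded_orbit != 0%E.
Proof.
move=> f0; apply/eqP => G0.
have [mf _] := integrableP _ _ _ fi.
have dc := @dominated_convergence _ _ _ P setT measurableT (fun n => EFin \o hN n)
  (cst 0%E) (fun x => `|(EFin \o f) x|%E).
suff : \int[P]_x f x <= 0 by lra.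
apply: (cvg_bound (u := fun n => (\int[P]_x (EFin \o hN n) x)%E)).
  have [|||||_ _] := dc; last by rewrite integral0.
  - by move=> n; case/integrableP : (maximal_int n).1.
  - exact: measurable_cst.
  - exists bounded_orbit; split=> //; first exact: bounded_orbit_meas.
    move=> x /= hx; apply: contrapT => /unbounded_orbit_shift nG; apply: hx => _.
    apply: cvg_near_cst.
    have [k hk] : exists k : nat, `|f x| <= k%:R.
      by exists (Num.truncn `|f x|).+1; exact: (ltW (Num.Theory.truncnS_gt _)).
    have [n hn] : exists n, bsum n (T x) < - k%:R.
      apply: contrapT => hn; apply: nG; exists k => n; rewrite leNgt; apply/negP => hn'.
      by apply: hn; exists n.
    exists n => // N /= nN; rewrite /hN max_l//.
    have := rmin_le (T x) nN; have := ler_norm (f x); lra.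
  - exact: integrable_abse.
  - apply: aeW => x n _ /=; rewrite lee_fin /hN ger0_norm ?le_max ?lexx//.
    rewrite ge_max normr_ge0 /=; have := rmin_le0 n (T x); have := ler_norm (f x); lra.
move=> n; have [i1 e1] := maximal_int n; rewrite RintE// lee_fin e1.
suff : \int[P]_x rmin n.+1 x <= \int[P]_x rmin n x by lra.
by apply: le_Rintegral => //; [exact: rmin_int|exact: rmin_int|move=> x _; exact: rmin_nincr].
Qed.

(** Where sums are bounded below, [rmin n] converges, so its decrements tend to 0; they lie in
    [[0, 1]] because [f >= -1]. As the integral of [f] is nonpositive, the maximal identity bounds
    the integral of [hN n] by that of the decrement, while [hN n >= 1] on [B]. *)
Lemma positive_orbit_null (B : set X) : measurable B -> (forall x, -1 <= f x) -> \int[P]_x f x <= 0 ->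
  P (~` bounded_orbit) = 0%E -> (forall x, B x -> forall n, 1 <= bsum n.+1 x) -> P B = 0%E.
Proof.
move=> mB f1 f0 G1 hB.
pose u n x := rmin n x - rmin n.+1 x.
have iu n : P.-integrable setT (EFin \o u n).
  exact: (integrableB measurableT (rmin_int n) (rmin_int n.+1)).
have u01 n x : 0 <= u n x <= 1.
  rewrite {1}/u subr_ge0 rmin_nincr /u rmin_rec andTb.
  have h : rmin n x - 1 <= bsum n.+1 x.
    have := rmin_le x (leqnn n); rewrite /bsum big_ord_recr /= -/(bsum n x).
    have := f1 (iter n T x); lra.
  rewrite lerBlDl -lerBlDr le_min h andbT; lra.
have dc := @dominated_convergence _ _ _ P setT measurableT (fun n => EFin \o u n)
  (cst 0%E) (cst 1%E).
have PB : (fine (P B))%:E = P B by rewrite fineK// fin_num_measure.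
suff : fine (P B) <= 0.
  move=> h0; apply/eqP; rewrite eq_le measure_ge0 andbT -PB.
  by rewrite lee_fin.
apply: (cvg_bound (u := fun n => (\int[P]_x (EFin \o u n) x)%E)).
  have [|||||_ _] := dc; last by rewrite integral0.
  - by move=> n; case/integrableP : (iu n).
  - exact: measurable_cst.
  - exists (~` bounded_orbit); split=> //; first by apply: measurableC; exact: bounded_orbit_meas.
    move=> x /= hx; apply: contrapT => /contrapT[C hC]; apply: hx => _.
    have cm : rmin n x @[n --> \oo] --> inf (range (rmin ^~ x)).
      apply: nonincreasing_cvgn; first by apply/nonincreasing_seqP => n; exact: rmin_nincr.
      by exists (- C%:R) => _ [n _ <-]; apply: rmin_ge => k _; exact: hC.
    apply: cvg_EFin; first by near=> n.
    rewrite -(subrr (inf (range (rmin ^~ x)))); apply: cvgB => //.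
    by rewrite (cvg_shiftS (rmin ^~ x)).
  - exact: finite_measure_integrable_cst.
  - apply: aeW => x n _ /=; have /andP[u0 u1] := u01 n x.
    by rewrite lee_fin ger0_norm.
move=> n; have [i1 e1] := maximal_int n; rewrite PB RintE//.
have le1 : (P B <= (\int[P]_x hN n x)%R%:E)%E.
  rewrite -RintE//; have <- : (\int[P]_x (\1_B x)%:E = P B)%E by rewrite integral_indic// setIT.
  apply: ge0_le_integral => //.
  - by apply/measurable_EFinP; exact: measurable_indic.
  - by case/integrableP : i1.
  move=> x _; rewrite lee_fin indicE; case: (boolP (x \in B)) => [|_]; last by rewrite le_max lexx.
  rewrite inE => Bx; rewrite le_max; apply/orP; right.
  rewrite addrC -lerBlDr; apply: rmin_ge => k _; rewrite lerBlDr addrC -bsum_recl.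
  exact: hB.
apply: (le_trans le1); rewrite lee_fin e1 (RintegralB measurableT (rmin_int n) (rmin_int n.+1)).
lra.
Unshelve. all: by end_near. Qed.

End Dynamics.

(** * The Gibbs measure *)

Section GibbsMeasure.
Context {R : realType} (I : set nat) (J : nat -> set R) (F0 : R -> R).
Notation D0 := (Delta0 I J).
Notation cyl := (cyl J F0).
Notation idx := (idx I J).
Notation itin := (itin I J F0).
Notation rep := (repeller F0 D0).

Context (lam : R).
Hypothesis bm : base_map I J F0.
Hypothesis lam_gt1 : 1 < lam.
Hypothesis lamP : forall x, Delta0 I J x -> lam <= `|derive1 F0 x|.

(** Being a countable union of cylinders inside the repeller, such a set is measurable for an
    arbitrary [Q], and its measure is a sum over words. *)
Definition lev n (Q : seq nat -> Prop) : set R := [set x | repeller F0 D0 x /\ Q (itin n x)].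

Lemma cyl_meas w : wordP I w -> measurable (cyl w : set (measurableTypeR R)).
Proof.
move=> hw; apply: is_interval_measurable => x y cx cy z xz.
exact: (cyl_conv bm lam_gt1 lamP hw cx cy xz).
Qed.

Lemma countable_meas (T : countType) (A : T -> set (measurableTypeR R)) :
  (forall t, measurable (A t)) -> measurable (\bigcup_t A t).
Proof. by move=> h; apply: countable_bigcupT_measurable => //; exact: countableP. Qed.

Let cylP n (Q : seq nat -> Prop) : set (measurableTypeR R) :=
  \bigcup_w (if `[< words I n w /\ Q w >] then cyl w else set0).

Let cylP_meas n Q : measurable (cylP n Q).
Proof.
by apply: countable_meas => w; case: asboolP => // -[[_ hw] _]; exact: cyl_meas.
Qed.

Let cylP_E n Q x : cylP n Q x <-> exists w, [/\ words I n w, Q w & cyl w x].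
Proof.
split=> [[w _]|[w [h1 h2 h3]]]; last by exists w => //; rewrite asboolT.
by case: asboolP => // -[h1 h2] h3; exists w.
Qed.

Lemma rep_meas : measurable (rep : set (measurableTypeR R)).
Proof.
have -> : rep = \bigcap_n cylP n.+1 (fun=> True).
  apply/seteqP; split=> x.
    move=> rx n _; apply/cylP_E; have [h1 h2 h3] := itinP bm n.+1 rx.
    by exists (itin n.+1 x).
  move=> h; apply/repellerP => n; have /cylP_E[w [[sw hw] _ cx]] := h n Logic.I.
  have : (n < size w)%N by rewrite sw.
  elim: n w x hw cx {h sw} => [|n IH] [|i w] x // hw [Jx cx] sn.
    by exists i => //; have [] := wordP_cons hw.
  by rewrite iterSr; apply: (IH w) => //; have [] := wordP_cons hw.
by apply: bigcap_measurable => // n _; exact: cylP_meas.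
Qed.

Lemma lev_meas n Q : measurable (lev n Q : set (measurableTypeR R)).
Proof.
have -> : lev n Q = rep `&` cylP n Q.
  apply/seteqP; split=> x [rx hx]; split=> //.
    by apply/cylP_E; have [h1 h2 h3] := itinP bm n rx; exists (itin n x).
  move/cylP_E : hx => [w [[sw hw] qw cx]].
  by rewrite -sw (itinE bm hw cx).
by apply: measurableI; [exact: rep_meas|exact: cylP_meas].
Qed.

Lemma itin_measfun d (Y : measurableType d) n (h : seq nat -> Y) :
  measurable_fun (rep : set (measurableTypeR R)) (fun x => h (itin n x)).
Proof. by move=> _ A mA; apply: (lev_meas n (fun w => A (h w))). Qed.

Lemma D0_open : open D0.
Proof. by apply: bigcup_open => i Ii; exact: (branch_open bm Ii). Qed.

Lemma rep_D0 x : rep x -> D0 x.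
Proof. by move=> /repellerP/(_ 0%N). Qed.

(** Extension by 0 off the branches gives the total measurable map that the ergodic argument needs;
    orbits in the repeller are unchanged. *)
Definition base_ext : measurableTypeR R -> measurableTypeR R := F0 \_ D0.
Definition obs (g : nat -> R) : measurableTypeR R -> R := (g \o idx) \_ D0.

Lemma base_ext_meas : measurable_fun setT base_ext.
Proof.
apply/(measurable_restrictT F0 (open_measurable D0_open)).
apply: open_continuous_measurable_fun; first exact: D0_open.
move=> x /set_mem[i Ii Jx]; apply: differentiable_continuous; apply/derivable1_diffP.
by have [] := branch_C2 bm Ii Jx.
Qed.

Lemma obs_meas g : measurable_fun setT (obs g).
Proof.
apply/(measurable_restrictT (g \o idx) (open_measurable D0_open)).
move=> _ A mA; have -> : D0 `&` (g \o idx) @^-1` A =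
    \bigcup_i (if `[< I i /\ A (g i) >] then J i else set0).
  apply/seteqP; split=> [x [Dx /= Ax]|x [i _]].
    by have [Ii Jx] := idxP Dx; exists (idx x) => //; rewrite asboolT.
  case: asboolP => // -[Ii Ai] Jx; split; first by exists i.
  by rewrite /= (idxE bm Ii Jx).
apply: countable_meas => i; case: asboolP => // -[Ii _].
by apply: open_measurable; exact: (branch_open bm Ii).
Qed.

Lemma base_ext_iter n x : rep x -> iter n base_ext x = iter n F0 x.
Proof.
move=> rx; elim: n => //= n ->; rewrite /base_ext patchE mem_set//.
by move/repellerP : rx; exact.
Qed.

Definition fsum (g : nat -> R) (w : seq nat) : R := \sum_(i <- w) g i.

Lemma fsum_cat g u v : fsum g (u ++ v) = fsum g u + fsum g v.
Proof. by rewrite /fsum big_cat. Qed.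

Lemma bsum_obs g n x : rep x -> bsum base_ext (obs g) n x = fsum g (itin n x).
Proof.
move=> rx; rewrite /bsum /fsum /itin /mkseq big_map.
have -> : iota 0 n = index_iota 0 n by rewrite /index_iota subn0.
rewrite big_mkord.
apply: eq_bigr => k _; rewrite base_ext_iter// /obs patchE mem_set//.
by move/repellerP : rx; exact.
Qed.

Lemma itin_take n k x : (k <= n)%N -> take k (itin n x) = itin k x.
Proof.
move=> kn; rewrite -(subnK kn) addnC itin_cat take_size_cat// /itin.
by rewrite size_mkseq.
Qed.

Context (mu : probability (measurableTypeR R) R).
Hypothesis mu_rep : mu rep = 1%E.
Hypothesis mu_inv : forall A : set R, measurable (A : set (measurableTypeR R)) ->
  mu (D0 `&` F0 @^-1` A) = mu A.

Definition m (A : set R) : R := fine (mu A).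

Lemma mE (A : set R) : measurable (A : set (measurableTypeR R)) -> mu A = (m A)%:E.
Proof. by move=> mA; rewrite fineK// fin_num_measure. Qed.

Lemma m_ge0 A : 0 <= m A. Proof. exact: fine_ge0. Qed.

Lemma m_le (A B : set R) : measurable (A : set (measurableTypeR R)) ->
  measurable (B : set (measurableTypeR R)) -> A `<=` B -> m A <= m B.
Proof.
by move=> mA mB AB; rewrite -lee_fin -!mE//; apply: le_measure; rewrite ?inE.
Qed.

Lemma m_cap (E : nat -> set R) c : (forall n, measurable (E n : set (measurableTypeR R))) ->
  (forall n, E n.+1 `<=` E n) -> (forall n, c <= m (E n)) -> c <= m (\bigcap_n E n).
Proof.
move=> mEn dec h; have mcap : measurable (\bigcap_n E n : set (measurableTypeR R)).
  exact: bigcap_measurable.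
have cv := @nonincreasing_cvg_mu _ _ _ mu E.
rewrite -lee_fin -mE// -(cvg_lim _ (cv _ _ _ _))//.
- apply: lime_ge; first by apply/cvg_ex; exists (mu (\bigcap_n E n)); apply: cv => //;
    [by rewrite ltey_eq fin_num_measure|by apply/nonincreasing_seqP => n; apply/subsetPset].
  by near=> n; rewrite /= mE// lee_fin.
- by rewrite ltey_eq fin_num_measure.
- by apply/nonincreasing_seqP => n; apply/subsetPset.
Unshelve. all: by end_near. Qed.

Lemma m_cup (E : nat -> set R) c : (forall n, measurable (E n : set (measurableTypeR R))) ->
  (forall n, E n `<=` E n.+1) -> (forall n, m (E n) <= c) -> m (\bigcup_n E n) <= c.
Proof.
move=> mEn inc h; have mcup : measurable (\bigcup_n E n : set (measurableTypeR R)).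
  exact: bigcup_measurable.
have cv := @nondecreasing_cvg_mu _ _ _ mu E.
rewrite -lee_fin -mE// -(cvg_lim _ (cv _ _ _))//.
- apply: lime_le; first by apply/cvg_ex; exists (mu (\bigcup_n E n)); apply: cv => //;
    by apply/nondecreasing_seqP => n; apply/subsetPset.
  by near=> n; rewrite /= mE// lee_fin.
- by apply/nondecreasing_seqP => n; apply/subsetPset.
Unshelve. all: by end_near. Qed.

Lemma mu_repC : mu (~` rep) = 0%E.
Proof. by rewrite probability_setC ?mu_rep ?subee//; exact: rep_meas. Qed.

Lemma mu_capr (A B : set R) : measurable (A : set (measurableTypeR R)) ->
  measurable (B : set (measurableTypeR R)) -> rep `<=` B -> mu (A `&` B) = mu A.
Proof.
move=> mA mB rB; have mI : measurable (A `&` B : set (measurableTypeR R)) by exact: measurableI.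
have mC : measurable (~` rep : set (measurableTypeR R)) by apply: measurableC; exact: rep_meas.
apply/eqP; rewrite eq_le; apply/andP; split; first by apply: le_measure; rewrite ?inE.
rewrite -[leRHS]adde0 -mu_repC; apply: le_trans (measureU2 _ mI mC).
apply: le_measure; rewrite ?inE//; first exact: measurableU.
move=> x Ax; have [/rB|] := pselect (rep x); [by left|by right].
Qed.

Lemma base_ext_inv A : measurable A -> mu (base_ext @^-1` A) = mu A.
Proof.
move=> mA; have mD : measurable (D0 : set (measurableTypeR R)).
  by apply: open_measurable; exact: D0_open.
have mP : measurable (base_ext @^-1` A) by rewrite -[X in measurable X]setTI; exact: base_ext_meas.
rewrite -(mu_capr mP mD rep_D0) -(mu_inv mA); congr (mu _).
apply/seteqP; split=> x [h1 h2]; split=> //; move: h1 h2.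
  by rewrite /= /base_ext patchE => h /mem_set Dx; move: h; rewrite Dx.
by move=> /mem_set Dx; rewrite /= /base_ext patchE Dx.
Qed.

Definition mc w : R := m (cyl w).

Lemma lev_cyl n w : words I n w -> m (lev n (fun u => u = w)) = mc w.
Proof.
move=> [sw hw]; congr fine; rewrite -(mu_capr (cyl_meas hw) rep_meas)//; congr (mu _).
apply/seteqP; split=> x; last by move=> [cx rx]; split=> //; rewrite -sw (itinE bm hw cx).
by move=> [rx e]; split=> //; rewrite -e; have [] := itinP bm n rx.
Qed.

Lemma integral_itin n (h : seq nat -> R) : (forall w, 0 <= h w) ->
  (\int[mu]_(x in rep) (h (itin n x))%:E = \esum_(w in words I n) (h w * mc w)%:E)%E.
Proof.
move=> h0; pose F k := lev n (fun w => pickle w = k).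
have mF k : measurable (F k : set (measurableTypeR R)) by exact: lev_meas.
have e : rep = \bigcup_k F k.
  apply/seteqP; split=> [x rx|x [k _ []]//].
  by exists (pickle (itin n x)).
have tF : trivIset [set: nat] F.
  by move=> i j _ _ [x [[_ <-] [_ <-]]].
have mf : measurable_fun (\bigcup_k F k : set (measurableTypeR R)) (fun x => (h (itin n x))%:E).
  rewrite -e; apply/measurable_EFinP; exact: (@itin_measfun _ _ n h).
rewrite {1}e (@ge0_integral_bigcup _ _ _ mu F)//; last by move=> x _; rewrite lee_fin.
have F0' k : (0 <= \int[mu]_(x in F k) (h (itin n x))%:E)%E.
  by apply: integral_ge0 => x _; rewrite lee_fin.
rewrite nneseries_esumT//.
have Fw w : words I n w -> (\int[mu]_(x in F (pickle w)) (h (itin n x))%:E = (h w * mc w)%:E)%E.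
  move=> hw; have Fe : F (pickle w) = lev n (fun u => u = w).
    apply/seteqP; split=> x [rx ex]; split=> //; last by rewrite ex.
    exact: (pcan_inj pickleK ex).
  rewrite Fe (eq_integral (cst (h w)%:E)); last by move=> x /set_mem[_ ->].
  rewrite integral_cst; last exact: lev_meas.
  by rewrite EFinM -(lev_cyl hw) -mE//; exact: lev_meas.
have inj : set_inj (words I n) (@pickle (seq nat)).
  by move=> u v _ _; exact: (pcan_inj pickleK).
rewrite -(eq_esum Fw) -(esum_image (words I n) _ (fun k => \int[mu]_(x in F k) (h (itin n x))%:E)%E inj).
rewrite [RHS]esum_mkcond; apply: eq_esum => k _; case: ifPn => // /negP hk.
have -> : F k = set0; last by rewrite integral_set0.
apply/seteqP; split=> // x [rx ek]; case: hk; apply/mem_set.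
by exists (itin n x) => //; have [] := itinP bm n rx.
Qed.

Lemma lev_esum n Q : mu (lev n Q) = \esum_(w in words I n `&` [set w | Q w]) (mc w)%:E.
Proof.
have e := @integral_itin n (fun w => if `[< Q w >] then 1 else 0).
rewrite esum_mkcondr; transitivity (\int[mu]_(x in rep) (if `[< Q (itin n x) >] then 1 else 0)%:E)%E.
  rewrite -[lev n Q]setIid -[X in _ `&` X](_ : rep `&` lev n Q = _).
    rewrite setICA setIid setIC -(integral_indic mu rep_meas (lev_meas n Q)).
    apply: eq_integral => x /set_mem rx; congr EFin; rewrite indicE.
    case: asboolP => h; first by rewrite mem_set.
    by rewrite memNset// => -[].
  by apply/seteqP; split=> x; [move=> []|move=> [rx hx]; split].
rewrite e => [|w]; last by case: ifP.
apply: eq_esum => w _; case: asboolP => h; first by rewrite mem_set// mul1r.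
by rewrite memNset// mul0r.
Qed.

Lemma lev_ge n Q L : uniq L -> {in L, forall w, words I n w /\ Q w} ->
  \sum_(w <- L) mc w <= m (lev n Q).
Proof.
move=> uL hL; rewrite -lee_fin -mE; last exact: lev_meas.
by rewrite lev_esum; apply: esum_list_le.
Qed.

Lemma lev_le n Q c : (forall L, uniq L -> {in L, forall w, words I n w /\ Q w} ->
  \sum_(w <- L) mc w <= c) -> m (lev n Q) <= c.
Proof.
move=> h; rewrite leNgt; apply/negP; rewrite -lte_fin -mE; last exact: lev_meas.
by rewrite lev_esum => /esum_list[L [uL hL]]; rewrite ltNge h.
Qed.

Context (kap : R).
Hypothesis kap_gt0 : 0 < kap.
Hypothesis mc_cat : forall u v, wordP I u -> wordP I v -> kap * (mc u * mc v) <= mc (u ++ v).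

(** The inequality for single words passes to arbitrary events on the first [n] and the next [k]
    letters, because the measures are suprema over finite lists of words. This one-sided mixing
    drives the zero-one law. *)
Lemma lev_prod n k (Q1 Q2 : seq nat -> Prop) :
  kap * (m (lev n Q1) * m (lev k Q2)) <= m (lev (n + k) (fun w => Q1 (take n w) /\ Q2 (drop n w))).
Proof.
set X := lev (n + k) _.
have X0 : 0 <= m X := m_ge0 X.
have key L L' : uniq L -> {in L, forall w, words I n w /\ Q1 w} ->
    uniq L' -> {in L', forall w, words I k w /\ Q2 w} ->
    kap * ((\sum_(w <- L) mc w) * (\sum_(w <- L') mc w)) <= m X.
  move=> uL hL uL' hL'.
  apply: (@le_trans _ _ (\sum_(w <- cat_list L L') mc w)).
    rewrite /cat_list big_allpairs_dep mulr_suml mulr_sumr [leLHS]big_seq [leRHS]big_seq.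
    apply: ler_sum => u /hL[[_ hu] _]; rewrite mulr_sumr mulr_sumr [leLHS]big_seq [leRHS]big_seq.
    by apply: ler_sum => v /hL'[[_ hv] _]; exact: mc_cat.
  have wL : word_list I n L by split=> // w /hL[].
  have wL' : word_list I k L' by split=> // w /hL'[].
  have [ucl hcl] := word_list_cat wL wL'.
  apply: lev_ge => // w hw; split; first exact: hcl.
  move: hw => /allpairsP[[u v] /= [uL0 vL0 ->]].
  have [[su _] q1] := hL _ uL0; have [_ q2] := hL' _ vL0.
  by rewrite take_size_cat ?drop_size_cat.
have [->|m2] := eqVneq (m (lev k Q2)) 0; first by rewrite !mulr0.
have m2' : 0 < m (lev k Q2) by rewrite lt_neqAle eq_sym m2 m_ge0.
rewrite mulrCA -ler_pdivlMr ?mulr_gt0//; apply: lev_le => L uL hL.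
have S0 : 0 <= \sum_(w <- L) mc w by apply: sumr_ge0 => w _; exact: m_ge0.
rewrite ler_pdivlMr ?mulr_gt0//.
have [->|s1] := eqVneq (\sum_(w <- L) mc w) 0; first by rewrite mul0r.
have s1' : 0 < \sum_(w <- L) mc w by rewrite lt_neqAle eq_sym s1.
rewrite mulrA mulrC -ler_pdivlMr ?mulr_gt0//; apply: lev_le => L' uL' hL'.
by rewrite ler_pdivlMr ?mulr_gt0// mulrC -mulrA mulrCA; exact: key.
Qed.

End GibbsMeasure.

(** * A zero-one law for sums bounded below *)

Section ZeroOne.
Context {R : realType} (I : set nat) (J : nat -> set R) (F0 : R -> R).
Notation D0 := (Delta0 I J).
Notation cyl := (cyl J F0).
Notation idx := (idx I J).
Notation itin := (itin I J F0).
Notation rep := (repeller F0 D0).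
Notation lev := (lev I J F0).
Notation T := (base_ext I J F0).
Notation obs := (obs I J).
Notation mset := (set (measurableTypeR R)).

Context (lam : R).
Hypothesis bm : base_map I J F0.
Hypothesis lam_gt1 : 1 < lam.
Hypothesis lamP : forall x, Delta0 I J x -> lam <= `|derive1 F0 x|.
Context (mu : probability (measurableTypeR R) R).
Hypothesis mu_rep : mu rep = 1%E.
Hypothesis mu_inv : forall A : set R, measurable (A : mset) ->
  mu (D0 `&` F0 @^-1` A) = mu A.
Notation m := (m mu).
Notation mc := (mc J F0 mu).
Context (kap : R).
Hypothesis kap_gt0 : 0 < kap.
Hypothesis mc_cat : forall u v, wordP I u -> wordP I v -> kap * (mc u * mc v) <= mc (u ++ v).

Let levM n Q : measurable (lev n Q : mset) := lev_meas bm lam_gt1 lamP n Q.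
Let repM : measurable (rep : mset) := rep_meas bm lam_gt1 lamP.

Implicit Types f : nat -> R.

Definition low f (C : nat) : set R :=
  [set x | rep x /\ forall n, - C%:R <= fsum f (itin n x)].
Definition bounded_below f : set R := \bigcup_C low f C.

Let lowE f C : low f C = \bigcap_N lev N (fun w => - C%:R <= fsum f w).
Proof.
apply/seteqP; split=> [x [rx hx] N _//|x hx].
by split=> [|n]; [have [] := hx 0%N Logic.I|have [] := hx n Logic.I].
Qed.

Lemma low_meas f C : measurable (low f C : mset).
Proof. by rewrite lowE; apply: bigcap_measurable => // N _; exact: levM. Qed.

Lemma bounded_below_meas f : measurable (bounded_below f : mset).
Proof. by apply: bigcup_measurable => C _; exact: low_meas. Qed.

Let m_rep : m rep = 1. Proof. by rewrite /m mu_rep. Qed.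

Let m_D (A B : set R) : measurable (A : mset) -> measurable (B : mset) -> B `<=` A ->
  m (A `\` B) = m A - m B.
Proof.
move=> mA mB BA; rewrite /m measureD//; last by rewrite ltey_eq fin_num_measure.
by rewrite setIidr// fineB// fin_num_measure.
Qed.

Let fsum_take f k w : - \sum_(i <- w) `|f i| <= fsum f (take k w).
Proof.
apply: (@le_trans _ _ (- \sum_(i <- take k w) `|f i|)).
  rewrite lerN2 -[in leRHS](cat_take_drop k w) big_cat /= lerDl.
  by apply: sumr_ge0.
rewrite /fsum lerNl -sumrN; apply: ler_sum => i _.
by have := ler_norm (- f i); rewrite normrN.
Qed.

Let itin_take' n k x : (k <= n)%N -> take k (itin n x) = itin k x := @itin_take _ I J F0 n k x.

Lemma bounded_below_shift f n x : rep x -> bounded_below f (iter n F0 x) -> bounded_below f x.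
Proof.
move=> rx [C _ [_ hC]]; pose B := \sum_(i <- itin n x) `|f i|.
have B0 : 0 <= B by apply: sumr_ge0.
have [k hk] : exists k : nat, B + C%:R <= k%:R.
  by exists (Num.truncn (B + C%:R)).+1; exact: (ltW (Num.Theory.truncnS_gt _)).
exists k => //; split=> // j; have [jn|nj] := leqP j n.
  have := fsum_take f j (itin n x); rewrite itin_take' // -/B => h.
  have : 0 <= C%:R :> R by [].
  lra.
rewrite -(subnKC (ltnW nj)) itin_cat fsum_cat.
have := fsum_take f n (itin n x); rewrite itin_take' // -/B; have := hC (j - n)%N; lra.
Qed.

(** The events that [Q] holds and that the sums over the next [N] letters stay above [-C] decrease
    in [N], so the product inequality passes to their intersection; the first [n] letters do not
    affect boundedness. *)
Let mix f n Q C : kap * (m (lev n Q) * m (low f C)) <= m (lev n Q `&` bounded_below f).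
Proof.
pose P N w := forall k, (k <= N)%N -> - C%:R <= fsum f (take k w).
pose X N := lev (n + N) (fun w => Q (take n w) /\ P N (drop n w)).
have XE N x : X N x <-> [/\ rep x, Q (itin n x) & P N (itin N (iter n F0 x))].
  rewrite /X /lev /=; rewrite itin_cat take_size_cat ?drop_size_cat ?size_mkseq//.
  by split=> [[? []]|[]].
apply: (@le_trans _ _ (m (\bigcap_N X N))).
  apply: m_cap => [N|N x|N]; first exact: levM.
    move/XE => [rx qx px]; apply/XE; split=> // k kN.
    by rewrite itin_take'//; have := px k (leqW kN); rewrite itin_take'// leqW.
  apply: le_trans (lev_prod bm lam_gt1 lamP mu_rep kap_gt0 mc_cat n N Q (P N)).
  rewrite ler_pM2l// ler_wpM2l ?m_ge0//; apply: m_le; [exact: low_meas|exact: levM|].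
  by move=> x [rx hx]; split=> // k kN; rewrite itin_take'.
apply: m_le.
- by apply: bigcap_measurable => // N _; exact: levM.
- by apply: measurableI; [exact: levM|exact: bounded_below_meas].
move=> x hx; have /XE[rx qx _] := hx 0%N Logic.I; split=> //.
apply: (bounded_below_shift (n := n)) => //; exists C => //; split; first exact: repeller_iter.
move=> N; have /XE[_ _ /(_ N (leqnn N))] := hx N Logic.I.
by rewrite itin_take'.
Qed.

(** Let [e > 0] be the measure of some [low f C']. A point outside [low f C] shows this on a finite
    initial word, so mixing gives [G] minus [low f C] at least [kap * e] times the measure of the
    complement of [low f C]. As [C] grows, the left side tends to 0 and that complement has measure
    tending to [1 - m G]. *)
Lemma zero_one f : m (bounded_below f) != 0 -> m (bounded_below f) = 1.
Proof.
move=> G0; set G := bounded_below f; have mG : measurable (G : mset) by exact: bounded_below_meas.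
have GR : G `<=` rep by move=> x [C _ []].
have lowG C : low f C `<=` G by move=> x hx; exists C.
have G1 : m G <= 1 by rewrite -m_rep; exact: m_le.
have low_inc C : low f C `<=` low f C.+1.
  move=> x [rx hx]; split=> // n; apply: le_trans (hx n).
  by rewrite lerN2 ler_nat.
have sup c : (forall C, m (low f C) <= c) -> m G <= c.
  by move=> h; apply: m_cup => // C; exact: low_meas.
have [C' e0] : exists C', 0 < m (low f C').
  apply: contrapT => h; move/negP: G0; apply; rewrite eq_le m_ge0 andbT.
  by apply: sup => C; rewrite leNgt; apply/negP => h'; apply: h; exists C.
set e := m (low f C') in e0.
have key C : kap * e * (1 - m (low f C)) <= m G - m (low f C).
  pose V N := lev N (fun w => exists2 k, (k <= N)%N & fsum f (take k w) < - C%:R).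
  rewrite -(m_D mG (low_meas f C) (lowG C)) -m_rep -(m_D repM (low_meas f C)); last by move=> x [].
  have -> : rep `\` low f C = \bigcup_N V N.
    apply/seteqP; split=> x.
      move=> [rx hx]; apply: contrapT => h; apply: hx; split=> // n; rewrite leNgt; apply/negP => hn.
      by apply: h; exists n => //; split=> //; exists n => //; rewrite itin_take'.
    move=> [N _ [rx [k kN]]]; rewrite itin_take'// => h; split=> // -[_ /(_ k)].
    by rewrite leNgt h.
  have ke : 0 < kap * e by rewrite mulr_gt0.
  rewrite mulrC -ler_pdivlMr//; apply: m_cup => [N|N x [rx [k kN hk]]|N]; first exact: levM.
    by split=> //; exists k; rewrite ?leqW//; move: hk; rewrite !itin_take'// leqW.
  rewrite ler_pdivlMr// mulrCA mulrA -mulrA; apply: (le_trans (mix f N _ C')).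
  apply: m_le.
  - by apply: measurableI => //; exact: levM.
  - by apply: measurableD => //; exact: low_meas.
  move=> x [[rx [k kN]]]; rewrite itin_take'// => h Gx; split=> // -[_ /(_ k)].
  by rewrite leNgt h.
apply/eqP; rewrite eq_le G1 /= leNgt; apply/negP => h1.
have : m G <= m G - kap * e * (1 - m G).
  apply: sup => C; have := key C; have hC : m (low f C) <= m G.
    by apply: m_le => //; exact: low_meas.
  have ke : 0 < kap * e by rewrite mulr_gt0.
  have : kap * e * (1 - m G) <= kap * e * (1 - m (low f C)) by rewrite ler_pM2l//; lra.
  lra.
have : 0 < kap * e * (1 - m G) by rewrite !mulr_gt0// subr_gt0.
lra.
Qed.

Lemma small_deviation f (dl : R) : m (bounded_below f) = 1 -> 0 < dl ->
  exists C : nat, forall n, m (lev n (fun w => fsum f w < - C%:R)) <= dl.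
Proof.
move=> G1 d0; have [C hC] : exists C, 1 - dl < m (low f C).
  apply: contrapT => h; have : m (bounded_below f) <= 1 - dl.
    apply: m_cup => [C|C x [rx hx]|C]; first exact: low_meas.
      by split=> // n; apply: le_trans (hx n); rewrite lerN2 ler_nat.
    by rewrite leNgt; apply/negP => h'; apply: h; exists C.
  rewrite G1; lra.
exists C => n; apply: (@le_trans _ _ (m (rep `\` low f C))).
  apply: m_le; [exact: levM|by apply: measurableD => //; exact: low_meas|].
  by move=> x [rx h]; split=> // -[_ /(_ n)]; rewrite leNgt h.
rewrite m_D ?m_rep//; [lra|exact: low_meas|by move=> x []].
Qed.

Lemma bounded_belowE f : bounded_orbit T (obs f) `&` rep = bounded_below f.
Proof.
apply/seteqP; split=> x.
  move=> [[C hC] rx]; exists C => //; split=> // n.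
  by have := hC n; rewrite bsum_obs.
move=> [C _ [rx hC]]; split=> //; exists C => n.
by rewrite bsum_obs.
Qed.

Section Integrable.
Variable f : nat -> R.
Hypothesis fi : mu.-integrable setT (EFin \o obs f).

Let mT : measurable_fun setT T := base_ext_meas bm.
Let invT : forall A, measurable A -> mu (T @^-1` A) = mu A :=
  base_ext_inv bm lam_gt1 lamP mu_rep mu_inv.

Let mu_bb : mu (bounded_orbit T (obs f)) = (m (bounded_below f))%:E.
Proof.
rewrite -bounded_belowE -mE; last first.
  by apply: measurableI => //; exact: (bounded_orbit_meas mT fi).
rewrite (mu_capr bm lam_gt1 lamP mu_rep)//; exact: (bounded_orbit_meas mT fi).
Qed.

Lemma bounded_below_ae : 0 < \int[mu]_x obs f x -> m (bounded_below f) = 1.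
Proof.
move=> /(bounded_orbit_pos mT invT fi); rewrite mu_bb => h; apply: zero_one.
by apply: contra h => /eqP ->.
Qed.

Let mu_iter n A : measurable A -> mu (iter n T @^-1` A) = mu A /\ measurable (iter n T @^-1` A).
Proof.
move=> mA; elim: n => [//|n [IH1 IH2]].
have -> : iter n.+1 T @^-1` A = T @^-1` (iter n T @^-1` A).
  by apply/seteqP; split=> x; rewrite /= -iterSr.
split; first by rewrite invT.
by rewrite -[X in measurable X]setTI; exact: mT.
Qed.

(** [B] consists of the points all of whose nonempty sums are at least 1. It is null: either sums
    are almost surely unbounded below, which excludes [B], or [positive_orbit_null] applies. If no
    iterate of [x] lies in [B], every time is followed by a later one with a sum no larger; starting
    from the empty sum, sums at most 0 recur forever. *)
Lemma drift_null (p : nat -> int) : (forall i, f i = (p i)%:~R) -> (forall i, I i -> -1 <= p i) ->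
  \int[mu]_x obs f x <= 0 ->
  exists N : mset, [/\ measurable N, mu N = 0%E &
    forall x, rep x -> (exists k, forall n, (k <= n)%N -> 1 <= psum p (itin n x)) -> N x].
Proof.
move=> fp p1 f0.
have fs w : fsum f w = (psum p w)%:~R.
  by rewrite /fsum /psum rmorph_sum; apply: eq_bigr => i _; exact: fp.
pose B : mset := \bigcap_n lev n.+1 (fun w => 1 <= psum p w).
have mB : measurable B by apply: bigcap_measurable => // n _; exact: levM.
have hB x : B x -> forall n, 1 <= bsum T (obs f) n.+1 x.
  move=> Bx n; have [rx hx] := Bx n Logic.I.
  by rewrite bsum_obs// fs -[1]/(1%:~R) ler_int.
have BG : B `<=` bounded_orbit T (obs f).
  move=> x /hB hx; exists 0%N => -[|n]; first by rewrite /bsum big_ord0 oppr0.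
  by apply: le_trans (hx n); rewrite oppr0.
have mG := bounded_orbit_meas mT fi.
have B0 : mu B = 0%E.
  have [g0|g0] := eqVneq (m (bounded_below f)) 0.
    apply/eqP; rewrite eq_le measure_ge0 andbT.
    have -> : 0%E = mu (bounded_orbit T (obs f)) by rewrite mu_bb g0.
    by apply: le_measure; rewrite ?inE.
  apply: (positive_orbit_null mT invT fi mB _ f0 _ hB).
    move=> x; rewrite /obs patchE; case: ifPn => [/set_mem Dx|_]; last exact: lerN10.
    by rewrite /= fp -[-1]/((-1)%:~R) ler_int; have [Ii _] := idxP Dx; exact: p1.
  by rewrite probability_setC// mu_bb zero_one// subee.
pose N : mset := \bigcup_n (iter n T @^-1` B).
have mN : measurable N by apply: bigcup_measurable => n _; exact: (mu_iter n mB).2.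
exists N; split=> //.
  apply/eqP; rewrite eq_le measure_ge0 andbT.
  have := measure_sigma_subadditive mu (fun n => (mu_iter n mB).2) mN (@subset_refl _ _).
  by move=> /le_trans; apply; rewrite eseries0// => n _ _; exact: (etrans (mu_iter n mB).1 B0).
move=> x rx [k hk]; apply: contrapT => hN.
have ret n : exists2 j, (0 < j)%N & psum p (itin (n + j) x) <= psum p (itin n x).
  apply: contrapT => hj; apply: hN; exists n => // j _.
  rewrite /= base_ext_iter//; split; first exact: repeller_iter.
  have : psum p (itin n x) < psum p (itin (n + j.+1) x).
    by rewrite ltNge; apply/negP => h; apply: hj; exists j.+1.
  by rewrite itin_cat psum_cat; move: (psum _ _) (psum _ _); clear; lia.
have low' j : exists2 n, (j <= n)%N & psum p (itin n x) <= 0.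
  elim: j => [|j [n jn hn]]; first by exists 0%N => //; rewrite /psum big_nil.
  have [i i0 hi] := ret n; exists (n + i)%N; last exact: le_trans hn.
  by rewrite -addn1 leq_add.
have [n kn hn] := low' k; have := le_trans (hk n kn) hn.
by [].
Qed.

End Integrable.
End ZeroOne.

(** * Openness and interpolation of partition functions *)

Section Interpolation.
Context {R : realType} (I : set nat) (l : seq nat -> R) (K th : R) (p : nat -> int).
Hypothesis l_gt0 : forall w, wordP I w -> 0 < l w.
Hypothesis K_ge1 : 1 <= K.
Hypothesis l_cat_le : forall u v, wordP I u -> wordP I v -> l (u ++ v) <= K * l u * l v.
Notation part := (part I l p).
Notation wterm := (wterm l p).
Notation psum := (psum p).

Let K0 : 0 < K. Proof. exact: lt_le_trans K_ge1. Qed.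

Lemma esum_le_list (T : choiceType) (S : set T) (f : T -> R) (c : R) :
  (forall L : seq T, uniq L -> {in L, forall i, S i} -> \sum_(i <- L) f i <= c) ->
  (\esum_(i in S) (f i)%:E <= c%:E)%E.
Proof.
move=> h; rewrite leNgt; apply/negP => /esum_list[L [uL hL]].
by rewrite ltNge h.
Qed.

Lemma wterm_expR s q w : wordP I w -> wterm s q w = expR (s * ln (l w) + q * (psum w)%:~R).
Proof.
by move=> hw; rewrite /wterm /powR ifF ?expRD//; apply/negbTE/lt0r_neq0/l_gt0.
Qed.

(** A finite list already has [psize] mass [r > 1] with all terms bounded away from 0, so a small
    increase of [s] is affordable. The increment [e] is such that at most a factor equal to the
    square root of [r] is lost. *)
Lemma part_open n s : ((K `^ s)%:E < part n s 0)%E ->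
  exists2 t, s < t & ((K `^ t)%:E < part n t 0)%E.
Proof.
move=> /esum_list[L [uL hL hs]].
have WE t w : w \in L -> wterm t 0 w = K `^ t * psize l K t w.
  move=> /hL[_ hw]; have := psize_wterm p l_gt0 K_ge1 t 0 hw.
  rewrite mul0r expR0 mulr1 => ->; rewrite mulrA divff ?mul1r//.
  by apply: lt0r_neq0; exact: powR_gt0.
have Kt t : 0 < K `^ t by exact: powR_gt0.
have r1 : 1 < \sum_(w <- L) psize l K s w.
  move: hs; rewrite big_seq (eq_bigr _ (WE s)) -big_seq -mulr_sumr.
  by rewrite -[X in X < _]mulr1 ltr_pM2l.
set r := \sum_(w <- L) _ in r1.
have [c c0 hc] : exists2 c, 0 < c & {in L, forall w, c <= l w / K}.
  by apply: list_min => w /hL[_ hw]; rewrite divr_gt0// l_gt0.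
pose b := Num.min c 2^-1.
have b0 : 0 < b by rewrite lt_min c0 /=; lra.
have lb : ln b < 0.
  by rewrite ln_lt0// b0 /= gt_min; apply/orP; right; lra.
have lr : 0 < ln r by rewrite ln_gt0.
pose e := ln r / (2 * - ln b).
have e0 : 0 < e by rewrite divr_gt0// mulr_gt0// oppr_gt0.
exists (s + e); first by rewrite ltrDl.
apply: (lt_le_trans _ (esum_list_le _ uL hL)); rewrite lte_fin.
rewrite big_seq (eq_bigr _ (WE _)) -big_seq -mulr_sumr -[X in X < _]mulr1 ltr_pM2l//.
have be : b `^ e = expR (- (ln r / 2)).
  rewrite /powR ifF; last exact/negbTE/lt0r_neq0.
  congr expR; rewrite /e; field.
  exact: ltr0_neq0.
apply: (@lt_le_trans _ _ (r * b `^ e)).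
  rewrite be -[X in X * _]lnK ?posrE; last exact: lt_trans r1.
  rewrite -expRD; have -> : ln r - ln r / 2 = ln r / 2 by field.
  by rewrite expR_gt1; lra.
rewrite /r mulr_suml [leLHS]big_seq [leRHS]big_seq; apply: ler_sum => w wL.
have [_ hw] := hL w wL; have h0 : 0 < l w / K by rewrite divr_gt0// l_gt0.
rewrite /psize powRD; last by rewrite (gt_eqF h0) implybT.
rewrite ler_wpM2l ?powR_ge0//; apply: ge0_ler_powR; rewrite ?nnegrE ?(ltW e0) ?(ltW b0) ?(ltW h0)//.
by apply: le_trans (hc w wL); rewrite ge_min lexx.
Qed.

Lemma expR_interp (t a b : R) : 0 <= t -> t <= 1 ->
  expR ((1 - t) * a + t * b) <= (1 - t) * expR a + t * expR b.
Proof.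
move=> t0 t1; set c := (1 - t) * a + t * b.
have tan x : expR c * (1 + (x - c)) <= expR x.
  have -> : expR x = expR c * expR (x - c) by rewrite -expRD; congr expR; ring.
  by rewrite ler_pM2l ?expR_gt0// expR_ge1Dx.
have h1 : (1 - t) * (expR c * (1 + (a - c))) <= (1 - t) * expR a by rewrite ler_wpM2l// subr_ge0.
have h2 : t * (expR c * (1 + (b - c))) <= t * expR b by rewrite ler_wpM2l.
apply: le_trans (lerD h1 h2); rewrite le_eqVlt; apply/orP; left; apply/eqP.
have {2}-> : c = (1 - t) * a + t * b by []; rewrite /c; ring.
Qed.

(** Convexity of the exponential bounds an interpolated term by the convex combination of the two
    terms. The length comes first, with strong decay at [(s2, q2)]; then [t] is so small that the
    merely finite value [B] at [(s1, q1)] adds at most 1/4 after multiplication by K^s2. *)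
Lemma contr_young s1 q1 s2 q2 : 0 <= s1 -> s1 < s2 -> I !=set0 -> contr I l K p s2 q2 ->
  (part 1 s1 q1 < +oo)%E ->
  exists t, [/\ 0 < t, t < 1 & contr I l K p ((1 - t) * s2 + t * s1) ((1 - t) * q2 + t * q1)].
Proof.
move=> s10 s12 I0 ct fin; have s20 : 0 <= s2 by lra.
have [N [r [N0 r0 r1 hr]]] := contr_step l_gt0 K_ge1 l_cat_le s20 I0 ct.
have Ks0 : 0 < K `^ s2 by exact: powR_gt0.
have [N' hN'] := @geometric_small R (K `^ s2 * 4) r 1 r0 r1 ltr01.
have hk := hN' N'.+1 (leqnSn N').
pose n := (N'.+1 * N)%N; have n0 : (0 < n)%N by rewrite muln_gt0.
have := part_fin l_gt0 K_ge1 l_cat_le s10 fin n0.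
have : (0 <= part n s1 q1)%E by exact: part_ge0.
case E1 : (part n s1 q1) => [B| |]// B0 _; rewrite lee_fin in B0.
pose t := (4 * (K `^ s2 * B + 1))^-1.
have den : 1 <= K `^ s2 * B + 1 by rewrite lerDr mulr_ge0// ltW.
have t0 : 0 < t by rewrite invr_gt0; lra.
have t1 : t < 1 by rewrite invf_lt1; lra.
have tB : t * (K `^ s2 * B) <= 4^-1.
  rewrite /t mulrC ler_pdivrMr; last by lra.
  lra.
exists t; split=> //; exists n => //.
have le1 : (part n ((1 - t) * s2 + t * s1) ((1 - t) * q2 + t * q1) <= (r ^+ N'.+1 + t * B)%:E)%E.
  apply: esum_le_list => L uL hL.
  apply: (@le_trans _ _ (\sum_(w <- L) ((1 - t) * wterm s2 q2 w + t * wterm s1 q1 w))).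
    rewrite [leLHS]big_seq [leRHS]big_seq; apply: ler_sum => w /hL[_ hw].
    rewrite !wterm_expR//; apply: le_trans (expR_interp _ _ (ltW t0) (ltW t1)).
    by rewrite ler_expR le_eqVlt; apply/orP; left; apply/eqP; ring.
  rewrite big_split /= -!mulr_sumr; apply: lerD.
    have h : \sum_(w <- L) wterm s2 q2 w <= r ^+ N'.+1.
      by rewrite -lee_fin; apply: le_trans (hr N'); apply: esum_list_le.
    have h0 : 0 <= \sum_(w <- L) wterm s2 q2 w.
      by rewrite big_seq; apply: sumr_ge0 => w /hL[_ hw]; exact: (ltW (wterm_gt0 p l_gt0 s2 q2 hw)).
    apply: le_trans h; rewrite -[leRHS]mul1r ler_wpM2r//; lra.
  rewrite ler_pM2l// -lee_fin -E1; exact: esum_list_le.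
apply: (@le_lt_trans _ _ ((K `^ s2)%:E * (r ^+ N'.+1 + t * B)%:E)%E).
  apply: lee_pmul => //; [by rewrite lee_fin powR_ge0|exact: part_ge0|].
  rewrite lee_fin ler_powR//; have : t * s1 <= t * s2 by rewrite ler_pM2l// ltW.
  lra.
rewrite -EFinM lte_fin mulrDr; move: tB; rewrite mulrCA => tB; move: hk; rewrite -mulrA [4 * _]mulrC mulrA => hk.
lra.
Qed.

End Interpolation.

Lemma bsum_int d (X : measurableType d) (R : realType) (P : probability X R) (T : X -> X) (f : X -> R) n :
  measurable_fun setT T -> (forall A, measurable A -> P (T @^-1` A) = P A) ->
  P.-integrable setT (EFin \o f) ->
  P.-integrable setT (EFin \o bsum T f n) /\ \int[P]_x bsum T f n x = n%:R * \int[P]_x f x.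
Proof.
move=> mT invT fi; elim: n => [|n [IH1 IH2]].
  have -> : bsum T f 0 = cst 0 by apply/funext => x; rewrite /bsum big_ord0.
  by split; [exact: integrable0|rewrite Rintegral_cst// !mul0r].
have [i1 e1] := integrable_inv mT invT IH1.
have -> : bsum T f n.+1 = fun x => f x + bsum T f n (T x) by apply/funext => x; rewrite bsum_recl.
split; first exact: (integrableD measurableT fi i1).
rewrite (RintegralD measurableT fi i1) e1 IH2 -addn1 natrD; ring.
Qed.

(** * Decay of partition functions from linear drift *)

Section Growth.
Context {R : realType} (I : set nat) (J : nat -> set R) (F0 : R -> R).
Notation D0 := (Delta0 I J).
Notation cyl := (cyl J F0).
Notation idx := (idx I J).
Notation itin := (itin I J F0).
Notation rep := (repeller F0 D0).
Notation lev := (lev I J F0).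
Notation T := (base_ext I J F0).
Notation obs := (obs I J).
Notation ell := (ell J F0).
Notation mset := (set (measurableTypeR R)).

Context (lam M : R).
Hypothesis bm : base_map I J F0.
Hypothesis lam_gt1 : 1 < lam.
Hypothesis lamP : forall x, Delta0 I J x -> lam <= `|derive1 F0 x|.
Hypothesis M_ge0 : 0 <= M.
Hypothesis MP : forall x, Delta0 I J x -> `|derive1n 2 F0 x| <= M * (derive1 F0 x) ^+ 2.
Notation K := (distortion lam M).
Context (mu : probability (measurableTypeR R) R).
Hypothesis mu_rep : mu rep = 1%E.
Hypothesis mu_inv : forall A : set R, measurable (A : mset) ->
  mu (D0 `&` F0 @^-1` A) = mu A.
Notation m := (m mu).
Notation mc := (mc J F0 mu).
Context (p : nat -> int).
Hypothesis p_ge : forall i, I i -> -1 <= p i.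
Hypothesis I0 : I !=set0.
Context (d0 C1 : R).
Hypothesis d0_ge0 : 0 <= d0.
Hypothesis C1_ge1 : 1 <= C1.
Hypothesis mc_le : forall w, wordP I w -> mc w <= C1 * ell w `^ d0.
Hypothesis mc_ge : forall w, wordP I w -> ell w `^ d0 <= C1 * mc w.
Notation psum := (psum p).
Notation part := (part I ell p).

Let K1 : 1 <= K := distortion_ge1 lam_gt1 M_ge0.
Let K0 : 0 < K. Proof. exact: lt_le_trans K1. Qed.
Let Kd : 0 < K `^ d0. Proof. exact: powR_gt0. Qed.
Let C0 : 0 < C1. Proof. exact: lt_le_trans C1_ge1. Qed.
Let lg := ell_gt0 bm lam_gt1 lamP.
Let lcat_le := ell_cat_le bm lam_gt1 lamP M_ge0 MP.
Let levM n Q : measurable (lev n Q : mset) := lev_meas bm lam_gt1 lamP n Q.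
Let repM : measurable (rep : mset) := rep_meas bm lam_gt1 lamP.
Let mc0 w : 0 <= mc w := m_ge0 mu (cyl w).

Let part_lt n q c : (forall L, uniq L -> {in L, forall w, words I n w} ->
   \sum_(w <- L) expR (q * (psum w)%:~R) * mc w <= c) -> (part n d0 q <= (C1 * c)%:E)%E.
Proof.
move=> h; apply: esum_le_list => L uL hL; apply: le_trans (ler_wpM2l (ltW C0) (h L uL hL)).
rewrite mulr_sumr [leLHS]big_seq [leRHS]big_seq; apply: ler_sum => w /hL[_ hw].
by rewrite /wterm mulrC mulrCA ler_pM2l ?expR_gt0// mc_ge.
Qed.

Let lev_sum n (Q : seq nat -> Prop) L : uniq L -> {in L, forall w, words I n w} ->
  \sum_(w <- L) (if `[< Q w >] then 1 else 0) * mc w <= m (lev n Q).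
Proof.
move=> uL hL; have := @lev_ge _ _ _ _ _ bm lam_gt1 lamP _ mu_rep n Q [seq w <- L | `[< Q w >]].
move=> /(_ (filter_uniq _ uL)); rewrite big_filter big_mkcond => h.
apply: le_trans (h _); last by move=> w; rewrite mem_filter => /andP[/asboolP ? /hL].
by apply: ler_sum => w _; case: ifP => _; rewrite ?mul1r ?mul0r.
Qed.

Let mc_sum n L : uniq L -> {in L, forall w, words I n w} -> \sum_(w <- L) mc w <= 1.
Proof.
move=> uL hL; have h := lev_sum (fun=> True) uL hL.
apply: (@le_trans _ _ (m (lev n (fun=> True)))).
  by apply: le_trans h; apply: ler_sum => w _; rewrite asboolT// mul1r.
have -> : 1 = m rep by rewrite /m mu_rep.
by apply: m_le; [exact: levM|exact: repM|move=> x []].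
Qed.

Let contr_of n q c : (0 < n)%N -> K `^ d0 * (C1 * c) < 1 ->
  (forall L, uniq L -> {in L, forall w, words I n w} ->
   \sum_(w <- L) expR (q * (psum w)%:~R) * mc w <= c) -> contr I ell K p d0 q.
Proof.
move=> n0 hc h; exists n => //; apply: (@le_lt_trans _ _ ((K `^ d0)%:E * (C1 * c)%:E)%E).
  by apply: lee_pmul => //; [rewrite lee_fin ltW|exact: part_ge0|exact: part_lt].
by rewrite -EFinM lte_fin.
Qed.

Let D := K `^ d0 * C1.
Let D0' : 0 < D. Proof. exact: mulr_gt0. Qed.

Let expRN_le (x : R) : 0 < x -> expR (- x) <= x^-1.
Proof.
move=> x0; rewrite expRN lef_pV2 ?posrE ?expR_gt0//.
by apply: le_trans (expR_ge1Dx x); lra.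
Qed.

Let big_nat (x y : R) : exists n : nat, [/\ (0 < n)%N, x <= n%:R & y <= n%:R].
Proof.
exists (Num.truncn (`|x| + `|y|)).+1; split=> //; apply: le_trans (ltW (Num.Theory.truncnS_gt _)).
  by apply: le_trans (ler_norm x) _; rewrite lerDl.
by apply: le_trans (ler_norm y) _; rewrite lerDr.
Qed.

Let fsumB g (e : R) w : fsum (fun i => g i - e) w = fsum g w - (size w)%:R * e.
Proof.
rewrite /fsum sumrB; congr (_ - _); rewrite big_const_seq count_predT iter_addr addr0.
by rewrite mulr_natl.
Qed.

Let psumR w : (psum w)%:~R = fsum (fun i => (p i)%:~R : R) w.
Proof. by rewrite /fsum /psum rmorph_sum. Qed.

(** For [q = - t / n], words with sum at least [n * e / 2] receive the factor exp(-4 D). The others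
    have measure at most [dl], uniformly in [n], and weight at most exp(t), because [psum] is at
    least [- n]. The constants [t] and [dl] make both contributions at most 1/(4 D). *)
Lemma contr_neg g e : (forall i, I i -> g i <= (p i)%:~R) -> 0 < e ->
  m (bounded_below I J F0 (fun i => g i - e)) = 1 -> exists2 q, q < 0 & contr I ell K p d0 q.
Proof.
move=> gp e0 G1; pose t := 8 * D / e.
have t0 : 0 < t by rewrite !mulr_gt0// invr_gt0.
have te : t * (e / 2) = 4 * D by rewrite /t; field; exact: lt0r_neq0.
pose dl := (4 * D * expR t)^-1.
have dl0 : 0 < dl by rewrite invr_gt0 !mulr_gt0// expR_gt0.
have [C hC] := small_deviation bm lam_gt1 lamP mu_rep G1 dl0.
have [n [n0 hn _]] := big_nat (2 * C%:R / e) 0.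
have nR : 0 < n%:R :> R by rewrite ltr0n.
have nC : C%:R <= n%:R * (e / 2).
  have : 2 * C%:R <= n%:R * e by rewrite -ler_pdivrMr.
  lra.
exists (- (t / n%:R)); first by rewrite oppr_lt0 divr_gt0.
apply: (@contr_of n _ (expR (- (4 * D)) + expR t * dl)) => //.
  have h1 := expRN_le (mulr_gt0 (ltr0n R 4) D0').
  have -> : expR t * dl = (4 * D)^-1.
    by rewrite /dl; field; rewrite !lt0r_neq0//; exact: expR_gt0.
  rewrite mulrA -/D; apply: (@le_lt_trans _ _ (D * ((4 * D)^-1 + (4 * D)^-1))).
    by rewrite ler_pM2l// lerD2r.
  have -> : D * ((4 * D)^-1 + (4 * D)^-1) = 2^-1 by field; exact: lt0r_neq0.
  lra.
move=> L uL hL.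
pose bad w := fsum (fun i => g i - e) w < - C%:R.
apply: (@le_trans _ _ (\sum_(w <- L) (expR (- (4 * D)) * mc w + expR t * ((if `[< bad w >] then 1 else 0) * mc w)))).
  rewrite [leLHS]big_seq [leRHS]big_seq; apply: ler_sum => w /hL[sw hw].
  rewrite mulrA -mulrDl ler_wpM2r//.
  have sg : fsum g w <= (psum w)%:~R.
    by rewrite psumR /fsum [leLHS]big_seq [leRHS]big_seq; apply: ler_sum => i /hw; exact: gp.
  have tn : 0 < t / n%:R by rewrite divr_gt0.
  case: asboolP => hb.
    rewrite mulr1; apply: (@le_trans _ _ (expR t)); last by rewrite lerDr expR_ge0.
    rewrite ler_expR; have := psum_ge p_ge hw; rewrite sw -(ler_int R) rmorphN /= => h.
    have : t / n%:R * (- n%:R) <= t / n%:R * (psum w)%:~R by rewrite ler_pM2l.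
    have -> : t / n%:R * (- n%:R) = - t by field; exact: lt0r_neq0.
    lra.
  rewrite mulr0 addr0 ler_expR -te; move/negP : hb; rewrite -leNgt fsumB sw => hb.
  have h : n%:R * (e / 2) <= (psum w)%:~R by lra.
  have : t / n%:R * (n%:R * (e / 2)) <= t / n%:R * (psum w)%:~R by rewrite ler_pM2l.
  have -> : t / n%:R * (n%:R * (e / 2)) = t * (e / 2) by field; exact: lt0r_neq0.
  lra.
rewrite big_split /= -!mulr_sumr; apply: lerD.
  by rewrite -[leRHS]mulr1 ler_pM2l ?expR_gt0//; exact: (mc_sum uL hL).
by rewrite ler_pM2l ?expR_gt0//; apply: le_trans (lev_sum _ uL hL) (hC n).
Qed.

Lemma part_exp_bound q : (part 1 d0 q < +oo)%E ->
  exists2 A : R, 1 <= A & forall n, (part n.+1 d0 q <= (A ^+ n.+1)%:E)%E.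
Proof.
move=> fin; have : (0 <= part 1 d0 q)%E by exact: part_ge0.
case E : (part 1 d0 q) fin => [x| |]// _; rewrite lee_fin => x0.
have Kx : 0 <= K `^ d0 * x by rewrite mulr_ge0// ltW.
have Kd1 : 1 <= K `^ d0 by rewrite -(powRr0 K) ler_powR.
exists (K `^ d0 * x + 1); first by rewrite lerDr.
elim=> [|n IH].
  rewrite E lee_fin expr1; have : x <= K `^ d0 * x by rewrite ler_peMl.
  lra.
rewrite -addn1; apply: le_trans (part_cat_le lg K1 lcat_le d0_ge0 IH E) _.
set A := K `^ d0 * x + 1; have A0 : 0 <= A by rewrite addr_ge0.
rewrite lee_fin addn1 [leRHS]exprSr mulrCA ler_wpM2l ?exprn_ge0//.
by rewrite lerDl.
Qed.

(** For [q > 0] exceptional words may have arbitrarily large sums, so small measure alone does not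
    control them. Their weight exp(y) is bounded by [Lm + expR (2 * y) / Lm]. The exponential moment
    at [q0] grows at most geometrically by [part_exp_bound]; since [2 * y] is only the fraction 2 t
    / (q0 n) of [q0 * psum w], this growth leaves a constant independent of [n]. *)
Lemma contr_pos e q0 : 0 < e -> 0 < q0 -> (part 1 d0 q0 < +oo)%E ->
  m (bounded_below I J F0 (fun i => - (p i)%:~R - e)) = 1 ->
  exists2 q, 0 < q & contr I ell K p d0 q.
Proof.
move=> e0 q00 fin G1; have [A A1 hA] := part_exp_bound fin.
pose B := C1 * A; have B1 : 1 <= B by rewrite -[1]mulr1 ler_pM.
have B0 : 0 < B by exact: lt_le_trans B1.
pose t := 16 * D / e.
have t0 : 0 < t by rewrite !mulr_gt0// invr_gt0.
have te : t * (e / 2) = 8 * D by rewrite /t; field; exact: lt0r_neq0.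
pose G := expR (2 * t / q0 * ln B).
have G0 : 0 < G by exact: expR_gt0.
pose Lm := 16 * D * G; have Lm0 : 0 < Lm by rewrite !mulr_gt0.
pose dl := (8 * D * Lm)^-1.
have dl0 : 0 < dl by rewrite invr_gt0 !mulr_gt0.
have [C hC] := small_deviation bm lam_gt1 lamP mu_rep G1 dl0.
have [n [n0 hn hn']] := big_nat (2 * C%:R / e) (2 * t / q0).
have nR : 0 < n%:R :> R by rewrite ltr0n.
have nC : C%:R <= n%:R * (e / 2).
  have : 2 * C%:R <= n%:R * e by rewrite -ler_pdivrMr.
  lra.
have tn : 0 < t / n%:R by rewrite divr_gt0.
exists (t / n%:R) => //.
(* Typical words, the measure of exceptional words, and the exponential moment contribute at most
   1/(8 D) each. *)
apply: (@contr_of n _ (expR (- (8 * D)) + Lm * dl + G / Lm * 2)) => //.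
  have h1 := expRN_le (mulr_gt0 (ltr0n R 8) D0').
  have -> : Lm * dl = (8 * D)^-1 by rewrite /dl; field; rewrite !lt0r_neq0.
  have -> : G / Lm * 2 = (8 * D)^-1 by rewrite /Lm; field; rewrite !lt0r_neq0.
  rewrite mulrA -/D; apply: (@le_lt_trans _ _ (D * ((8 * D)^-1 + (8 * D)^-1 + (8 * D)^-1))).
    by rewrite ler_pM2l// !lerD2r.
  have -> : D * ((8 * D)^-1 + (8 * D)^-1 + (8 * D)^-1) = 3 / 8 by field; exact: lt0r_neq0.
  lra.
move=> L uL hL.
pose bad w := fsum (fun i => - (p i)%:~R - e) w < - C%:R.
pose th := 2 * t / q0 / n%:R.
have th0 : 0 <= th by rewrite !mulr_ge0// ?invr_ge0 ltW.
have th1 : th <= 1 by rewrite ler_pdivrMr// mul1r.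
(* [z] normalises the exponential moment: the mean of exp(z) is at most 1 by the choice of [B]. As
   [0 <= th <= 1], exp(th z) is at most 1 + exp(z), and the constant left over is [G]. *)
pose z w := q0 * (psum w)%:~R - n%:R * ln B.
have ez w : expR (z w) = expR (q0 * (psum w)%:~R) / B ^+ n.
  by rewrite expRB expRM_natl lnK.
have pt w : words I n w -> expR (t / n%:R * (psum w)%:~R) <=
    expR (- (8 * D)) + Lm * (if `[< bad w >] then 1 else 0) + G / Lm * (1 + expR (z w)).
  move=> [sw hw]; set y := t / n%:R * (psum w)%:~R.
  case: asboolP => hb; last first.
    rewrite mulr0 addr0; apply: (@le_trans _ _ (expR (- (8 * D)))); last first.
      by rewrite lerDl mulr_ge0 ?divr_ge0 ?addr_ge0 ?expR_ge0// ltW.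
    rewrite ler_expR -te; move/negP : hb; rewrite -leNgt fsumB sw.
    rewrite /fsum sumrN -/(fsum _ _) -psumR => hb.
    have h : n%:R * (e / 2) <= - (psum w)%:~R by lra.
    have : t / n%:R * (n%:R * (e / 2)) <= t / n%:R * (- (psum w)%:~R) by rewrite ler_pM2l.
    have -> : t / n%:R * (n%:R * (e / 2)) = t * (e / 2) by field; exact: lt0r_neq0.
    rewrite /y; lra.
  rewrite mulr1.
  have e2 : expR (2 * y) <= G * (1 + expR (z w)).
    have -> : 2 * y = 2 * t / q0 * ln B + th * z w.
      by rewrite /y /th /z; field; rewrite !lt0r_neq0.
    rewrite expRD ler_pM2l//; have [z0|z0] := leP 0 (z w).
      apply: (@le_trans _ _ (expR (z w))); last by rewrite lerDr.
      by rewrite ler_expR ler_piMl.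
    apply: (@le_trans _ _ 1); last by rewrite lerDl expR_ge0.
    by rewrite -expR0 ler_expR mulr_ge0_le0// ltW.
  have : expR y <= Lm + expR (2 * y) / Lm.
    have sq : expR (2 * y) = expR y ^+ 2 by rewrite expr2 -expRD; congr expR; ring.
    rewrite -(ler_pM2l Lm0) sq.
    have -> : Lm * (Lm + expR y ^+ 2 / Lm) = Lm ^+ 2 + expR y ^+ 2 by field; exact: lt0r_neq0.
    have := expR_ge0 y; nra.
  have : expR (2 * y) / Lm <= G / Lm * (1 + expR (z w)).
    by rewrite mulrAC ler_pM2r ?invr_gt0.
  have := expR_ge0 (- (8 * D)); lra.
apply: (@le_trans _ _ (\sum_(w <- L) (expR (- (8 * D)) * mc w + Lm * ((if `[< bad w >] then 1 else 0) * mc w)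
    + G / Lm * (mc w + expR (z w) * mc w)))).
  rewrite [leLHS]big_seq [leRHS]big_seq; apply: ler_sum => w /hL hw.
  apply: le_trans (ler_wpM2r (mc0 w) (pt w hw)) _.
  by rewrite le_eqVlt; apply/orP; left; apply/eqP; ring.
have s1 := mc_sum uL hL.
rewrite !big_split /= -!mulr_sumr; apply: lerD; first apply: lerD.
- by rewrite -[leRHS]mulr1 ler_pM2l ?expR_gt0.
- by rewrite ler_pM2l//; apply: le_trans (lev_sum _ uL hL) (hC n).
rewrite ler_pM2l ?divr_gt0// big_split /=.
have Bn : 0 < B ^+ n by exact: exprn_gt0.
suff : \sum_(w <- L) expR (z w) * mc w <= 1 by move: s1; lra.
have h2 : \sum_(w <- L) C1 * wterm ell p d0 q0 w <= B ^+ n.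
  rewrite -mulr_sumr; apply: (@le_trans _ _ (C1 * A ^+ n)).
    rewrite ler_pM2l// -lee_fin -(prednK n0); apply: le_trans (hA _).
    by rewrite (prednK n0); exact: esum_list_le.
  by rewrite /B exprMn ler_wpM2r ?exprn_ge0 ?(le_trans ler01)// -[leLHS]expr1 ler_weXn2l.
rewrite -(ler_pM2l Bn) mulr1; apply: le_trans h2; rewrite mulr_sumr.
rewrite [leLHS]big_seq [leRHS]big_seq; apply: ler_sum => w /hL[_ hw].
rewrite ez /wterm; set E := expR _.
have -> : B ^+ n * (E / B ^+ n * mc w) = E * mc w by field; exact: lt0r_neq0.
rewrite [C1 * _]mulrA [leRHS]mulrC ler_pM2l ?expR_gt0//; exact: mc_le.
Qed.

End Growth.

(** * Mean drift and uniform lower bounds *)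

Section Mean.
Context {R : realType} (I : set nat) (J : nat -> set R) (F0 : R -> R).
Notation D0 := (Delta0 I J).
Notation cyl := (cyl J F0).
Notation idx := (idx I J).
Notation itin := (itin I J F0).
Notation rep := (repeller F0 D0).
Notation lev := (lev I J F0).
Notation T := (base_ext I J F0).
Notation obs := (obs I J).
Notation ell := (ell J F0).
Notation mset := (set (measurableTypeR R)).

Context (lam M : R).
Hypothesis bm : base_map I J F0.
Hypothesis lam_gt1 : 1 < lam.
Hypothesis lamP : forall x, Delta0 I J x -> lam <= `|derive1 F0 x|.
Hypothesis M_ge0 : 0 <= M.
Hypothesis MP : forall x, Delta0 I J x -> `|derive1n 2 F0 x| <= M * (derive1 F0 x) ^+ 2.
Notation K := (distortion lam M).
Context (mu : probability (measurableTypeR R) R).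
Hypothesis mu_rep : mu rep = 1%E.
Hypothesis mu_inv : forall A : set R, measurable (A : mset) ->
  mu (D0 `&` F0 @^-1` A) = mu A.
Notation m := (m mu).
Notation mc := (mc J F0 mu).
Context (p : nat -> int).
Hypothesis p_ge : forall i, I i -> -1 <= p i.
Hypothesis I0 : I !=set0.
Context (d0 C1 : R).
Hypothesis d0_ge0 : 0 <= d0.
Hypothesis C1_ge1 : 1 <= C1.
Hypothesis mc_le : forall w, wordP I w -> mc w <= C1 * ell w `^ d0.
Hypothesis mc_ge : forall w, wordP I w -> ell w `^ d0 <= C1 * mc w.
Notation psum := (psum p).
Notation part := (part I ell p).

Let K1 : 1 <= K := distortion_ge1 lam_gt1 M_ge0.
Let C0 : 0 < C1. Proof. exact: lt_le_trans C1_ge1. Qed.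
Let lg := ell_gt0 bm lam_gt1 lamP.
Let lcat_ge := ell_cat_ge bm lam_gt1 lamP M_ge0 MP.
Let lle := ell_le bm lam_gt1 lamP M_ge0.
Let th0 : 0 < lam^-1. Proof. by rewrite invr_gt0 (lam_gt0 lam_gt1). Qed.
Let th1 : lam^-1 < 1. Proof. by rewrite invf_lt1// (lam_gt0 lam_gt1). Qed.
Let repM : measurable (rep : mset) := rep_meas bm lam_gt1 lamP.
Let muT : fine (mu [set: measurableTypeR R]) = 1.
Proof. by rewrite (@probability_setT _ _ _ mu). Qed.
Let repCM : measurable (~` rep : mset) := measurableC repM.
Let mT : measurable_fun setT T := base_ext_meas bm.
Let invT : forall A, measurable A -> mu (T @^-1` A) = mu A :=
  base_ext_inv bm lam_gt1 lamP mu_rep mu_inv.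

(** The tangent inequality for the exponential is integrated, and a Birkhoff sum of length [n] has
    mean [n] times that of one step. The function [g] stands for [p] or a truncation of it, since
    [p] may have infinite mean. *)
Lemma part_mean_ge n g q : mu.-integrable setT (EFin \o obs g) -> 0 <= q * \int[mu]_x obs g x ->
  (forall i, I i -> q * g i <= q * (p i)%:~R) -> ((C1^-1)%:E <= part n d0 q)%E.
Proof.
move=> gi g0 gp; pose h w := expR (q * (psum w)%:~R).
have -> : (C1^-1)%:E = ((C1^-1)%:E * 1%:E)%E by rewrite mule1.
apply: (@le_trans _ _ ((C1^-1)%:E * \esum_(w in words I n) (h w * mc w)%:E)%E); last first.
  rewrite -esumZl ?invr_gt0//; last by move=> w _; rewrite lee_fin mulr_ge0 ?expR_ge0 ?m_ge0.
  apply: le_esum => w [_ hw]; rewrite -EFinM lee_fin /wterm mulrCA mulrC.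
  by rewrite ler_pM2r ?expR_gt0// ler_pdivrMl// mc_le.
apply: lee_pmul => //; first by rewrite lee_fin invr_ge0 ltW.
rewrite -(integral_itin bm lam_gt1 lamP mu_rep); last by move=> w; exact: expR_ge0.
have mh : measurable_fun (rep : mset) (fun x => (h (itin n x))%:E).
  by apply/measurable_EFinP; exact: (@itin_measfun _ _ _ _ _ bm lam_gt1 lamP _ _ n h).
have [->|fin] := eqVneq (\int[mu]_(x in rep) (h (itin n x))%:E)%E +oo%E; first exact: leey.
have hi : mu.-integrable (rep : mset) (fun x => (h (itin n x))%:E).
  apply/integrableP; split=> //.
  apply: (@le_lt_trans _ _ (\int[mu]_(x in rep) (h (itin n x))%:E)%E); last by rewrite ltey.
  rewrite le_eqVlt; apply/orP; left; apply/eqP; apply: eq_integral => x _.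
  by rewrite gee0_abs// lee_fin expR_ge0.
have [bi be] := bsum_int n mT invT gi.
pose k x := 1 + q * bsum T (obs g) n x.
have qi : mu.-integrable setT (EFin \o (fun x => q * bsum T (obs g) n x)).
  exact: (integrableZl measurableT q bi).
have c1 : mu.-integrable setT (EFin \o cst 1) by exact: finite_measure_integrable_cst.
have ki : mu.-integrable setT (EFin \o k) by exact: (integrableD measurableT c1 qi).
have kE : \int[mu]_x k x = 1 + q * (n%:R * \int[mu]_x obs g x).
  rewrite (RintegralD measurableT c1 qi) Rintegral_cst// (RintegralZl q measurableT bi) be.
  by rewrite muT mul1r.
apply: (@le_trans _ _ (\int[mu]_(x in rep) (k x)%:E)%E).
  have -> : (\int[mu]_(x in rep) (k x)%:E = \int[mu]_x (k x)%:E)%E.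
    rewrite (@negligible_integral _ _ _ mu setT (~` rep))//; last exact: (mu_repC bm lam_gt1 lamP mu_rep).
    by rewrite setTD setCK.
  have -> : (\int[mu]_x (k x)%:E = (\int[mu]_x k x)%R%:E)%E.
    by rewrite /Rintegral fineK//; exact: integrable_fin_num.
  by rewrite kE lee_fin lerDl mulrCA mulr_ge0.
apply: le_integral => //; first exact: (integrableS measurableT).
move=> x /set_mem rx; rewrite lee_fin /k (bsum_obs _ _ rx).
apply: le_trans (expR_ge1Dx _); rewrite lerD2l.
have [_ hw _] := itinP bm n rx.
rewrite /fsum /psum rmorph_sum !mulr_sumr [leLHS]big_seq [leRHS]big_seq.
by apply: ler_sum => i /hw; exact: gp.
Qed.

Let lowC : 0 < C1^-1. Proof. by rewrite invr_gt0. Qed.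

Lemma unif_minus_mean s : s < d0 -> mu.-integrable setT (EFin \o obs (fun i => (p i)%:~R)) ->
  \int[mu]_x obs (fun i => (p i)%:~R) x <= 0 -> unif_minus I ell p s.
Proof.
move=> sd pi p0; apply: (unif_of_lower lg K1 th0 th1 lle (Q := [set q | q <= 0]) sd lowC).
by move=> n q _ q0; apply: (part_mean_ge _ pi) => //; exact: mulr_le0.
Qed.

Lemma unif_plus_mean g s : s < d0 -> mu.-integrable setT (EFin \o obs g) ->
  0 <= \int[mu]_x obs g x -> (forall i, I i -> g i <= (p i)%:~R) -> unif_plus I ell p s.
Proof.
move=> sd gi g0 gp; apply: (unif_of_lower lg K1 th0 th1 lle (Q := [set q | 0 <= q]) sd lowC).
move=> n q _ q0; apply: (part_mean_ge _ gi) => //; first exact: mulr_ge0.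
by move=> i Ii; rewrite ler_wpM2l// gp.
Qed.

Lemma part0_ge n : ((C1^-1)%:E <= part n d0 0)%E.
Proof.
have e : obs (fun=> 0 : R) = cst 0.
  by apply/funext => x; rewrite /obs patchE; case: ifP.
apply: (@part_mean_ge n (fun=> 0)) => [||i _]; rewrite ?mul0r//.
by rewrite e; exact: integrable0.
Qed.

(** At [q = 0] the bound is [part0_ge]; for [q > 0] the sums are infinite at every positive length
    by [part1_fin]. Divergence thus has the same effect as a nonnegative drift. *)
Lemma unif_plus_infinite s : s < d0 -> (forall q, 0 < q -> part 1 d0 q = +oo%E) ->
  unif_plus I ell p s.
Proof.
move=> sd h; apply: (unif_of_lower lg K1 th0 th1 lle (Q := [set q | 0 <= q]) sd lowC).
move=> n q n0; rewrite /= le_eqVlt => /orP[/eqP <-|q0]; first exact: part0_ge.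
have -> : part n d0 q = +oo%E; last exact: leey.
apply/eqP; rewrite -leye_eq leNgt; apply/negP => hn.
by have := part1_fin lg K1 lcat_ge d0_ge0 I0 n0 hn; rewrite h.
Qed.

Let pr i : R := (p i)%:~R.
Let f := obs pr.
Let mf : measurable_fun setT f. Proof. exact: (obs_meas bm). Qed.
Let f1 x : 0 <= f x + 1.
Proof.
rewrite /f /obs patchE; case: ifPn => [/set_mem Dx|_]; last by rewrite add0r.
have [Ii _] := idxP Dx; have := p_ge Ii; rewrite -(ler_int R) /= /pr rmorphN1; lra.
Qed.

Definition mean : \bar R := (\int[mu]_(x in rep) (pr (idx x))%:E)%E.

Let meanE : mean = (\int[mu]_x (f x)%:E)%E.
Proof.
rewrite /mean (eq_integral (EFin \o f)); last first.
  by move=> x /set_mem rx; rewrite /= /f /obs patchE mem_set//; exact: (rep_D0 rx).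
rewrite integral_mkcond; apply: ae_eq_integral => //.
- apply/(measurable_restrictT _ repM); apply/measurable_EFinP.
  exact: measurable_funTS.
- by apply/measurable_EFinP.
exists (~` rep); split=> //; first exact: (mu_repC bm lam_gt1 lamP mu_rep).
by move=> x /= hx rx; apply: hx => _; rewrite patchE mem_set.
Qed.

Let mf1 : measurable_fun setT (fun x => (f x + 1)%:E).
Proof. by apply/measurable_EFinP; exact: measurable_funD. Qed.

Let c1 : mu.-integrable setT (EFin \o cst 1).
Proof. exact: finite_measure_integrable_cst. Qed.

Let fin_int : (\int[mu]_x (f x + 1)%:E < +oo)%E -> mu.-integrable setT (EFin \o f).
Proof.
move=> h; have : mu.-integrable setT (EFin \o (fun x => f x + 1)).
  apply/integrableP; split=> //; rewrite (eq_integral (fun x => (f x + 1)%:E))//.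
  by move=> x _; rewrite gee0_abs// lee_fin.
move=> /(fun h => integrableB measurableT h c1); apply: eq_integrable => // x _.
by rewrite /= -EFinB addrK.
Qed.

(** Steps are at least -1, so the negative part is integrable, and a nonpositive mean forces the
    positive part to be integrable too. *)
Lemma mean_le0 : (mean <= 0)%E -> mu.-integrable setT (EFin \o obs pr) /\
  mean = (\int[mu]_x obs pr x)%:E.
Proof.
rewrite meanE => h.
have hfin : mu.-integrable setT (EFin \o f); last first.
  by split=> //; rewrite /Rintegral fineK//; exact: integrable_fin_num.
apply/integrableP; split; first exact/measurable_EFinP.
have mp : measurable_fun setT (EFin \o f)^\+%E by apply: measurable_funepos; exact/measurable_EFinP.
have mn : measurable_fun setT (EFin \o f)^\-%E by apply: measurable_funeneg; exact/measurable_EFinP.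
have neg1 : (\int[mu]_x (EFin \o f)^\- x <= 1)%E.
  apply: (@le_trans _ _ (\int[mu]_x cst 1%E x)%E); last first.
    by rewrite integral_cst// mul1e; exact: probability_le1.
  apply: ge0_le_integral => // x _; rewrite funenegE /= ge_max !lee_fin ler01 andbT.
  have := f1 x; lra.
have negf : (\int[mu]_x (EFin \o f)^\- x)%E \is a fin_num.
  by rewrite ge0_fin_numE ?integral_ge0//; exact: le_lt_trans neg1 (ltry _).
have posf : (\int[mu]_x (EFin \o f)^\+ x < +oo)%E.
  move: h; rewrite integralE leeBlDr//.
  by rewrite add0e => /le_lt_trans; apply; apply: (le_lt_trans neg1); exact: ltry.
rewrite (eq_integral (fun x => (EFin \o f)^\+ x + (EFin \o f)^\- x)%E); last first.
  by move=> x _; exact: (congr1 (fun g => g x) (fune_abse (EFin \o f))).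
by rewrite ge0_integralD//; apply: lte_add_pinfty => //; rewrite -ge0_fin_numE ?integral_ge0.
Qed.

(** The truncations of [pr] at [k] are bounded. If none had positive integral, monotone convergence,
    after adding 1 to reach nonnegative functions, would make the mean nonpositive. This covers an
    infinite mean. *)
Lemma mean_gt0 : (0 < mean)%E -> exists g : nat -> R,
  [/\ forall i, I i -> g i <= (p i)%:~R, mu.-integrable setT (EFin \o obs g) &
      0 < \int[mu]_x obs g x].
Proof.
move=> h; pose g (k : nat) i := Num.min (pr i) k%:R.
have gE k x : obs (g k) x = Num.min (f x) k%:R.
  by rewrite /f /obs !patchE; case: ifP => // _; rewrite min_l.
have mg k : measurable_fun setT (obs (g k)) by exact: (obs_meas bm).
have gi k : mu.-integrable setT (EFin \o obs (g k)).
  have := @finite_measure_integrable_cst _ _ _ mu setT (k%:R + 1) measurableT.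
  apply: le_integrable => //; first exact/measurable_EFinP.
  move=> x _ /=; rewrite lee_fin gE [leRHS]ger0_norm ?addr_ge0// ler_norml; apply/andP; split.
    have := f1 x; have : 0 <= k%:R :> R by []; rewrite le_min => k0 h1; apply/andP; split; lra.
  by rewrite ge_min; apply/orP; right; rewrite lerDl.
have [k hk] : exists k, 0 < \int[mu]_x obs (g k) x; last first.
  by exists (g k); split=> // i _; rewrite /g ge_min lexx.
apply: contrapT => hn.
have le0 k : \int[mu]_x obs (g k) x <= 0 by rewrite leNgt; apply/negP => hk; apply: hn; exists k.
have mc1 : (\int[mu]_x (f x + 1)%:E <= 1)%E.
  have := @cvg_monotone_convergence _ _ _ mu setT measurableT (fun k x => (obs (g k) x + 1)%:E).
  have lim_f x : limn (fun k => (obs (g k) x + 1)%:E) = (f x + 1)%:E.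
    apply: cvg_lim => //; apply: cvg_near_cst.
    exists (Num.truncn `|f x|).+1 => // n /= hn'; rewrite gE min_l//.
    apply: le_trans (ler_norm _) _; apply: le_trans (ltW (Num.Theory.truncnS_gt _)) _.
    by rewrite ler_nat.
  move=> /(_ _ _ _) cv.
  have {}cv : (\int[mu]_x (obs (g k) x + 1)%:E)%E @[k --> \oo] --> (\int[mu]_x (f x + 1)%:E)%E.
    rewrite (eq_integral (fun x => limn (fun k => (obs (g k) x + 1)%:E))) => [|x _]; last by rewrite lim_f.
    apply: cv => //.
    - by move=> k; apply/measurable_EFinP; exact: measurable_funD.
    - move=> k x _; rewrite lee_fin gE -lerBlDr le_min sub0r; have h1 := f1 x.
      by apply/andP; split; [lra|apply: (@le_trans _ _ 0); rewrite ?oppr_le0].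
    - move=> x _; apply/nondecreasing_seqP => k; rewrite lee_fin lerD2r !gE.
      by rewrite le_min ge_min lexx /= ge_min orbC ler_nat leqnSn.
  rewrite -(cvg_lim _ cv)//; apply: lime_le; first by apply/cvg_ex; exists (\int[mu]_x (f x + 1)%:E)%E.
  near=> k; have -> : (\int[mu]_x (obs (g k) x + 1)%:E = (\int[mu]_x (obs (g k) x + cst 1 x))%R%:E)%E.
    rewrite /Rintegral fineK//; apply: integrable_fin_num => //.
    exact: (integrableD measurableT (gi k) c1).
  rewrite lee_fin (RintegralD measurableT (gi k) c1) Rintegral_cst// muT mulr1.
  by have := le0 k; lra.
have fi := fin_int (le_lt_trans mc1 (ltry _)).
move: h; rewrite meanE.
have -> : (\int[mu]_x (f x)%:E = (\int[mu]_x f x)%R%:E)%E.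
  by rewrite /Rintegral fineK//; exact: integrable_fin_num.
have : (\int[mu]_x (f x + cst 1 x) <= 1).
  rewrite -lee_fin /Rintegral fineK//; apply: integrable_fin_num => //.
  exact: (integrableD measurableT fi c1).
rewrite (RintegralD measurableT fi c1) Rintegral_cst// muT mulr1 lte_fin; lra.
Unshelve. all: by end_near. Qed.

End Mean.

(** * Pressure *)

Section LimSup.
Context {R : realType}.
Implicit Types u : nat -> \bar R.

Lemma limn_esup_inf_range u : limn_esup u = ereal_inf (range (esups u)).
Proof. by rewrite limn_esup_lim; apply/cvg_lim => //; exact: cvg_esups_inf. Qed.

Lemma limn_esup_le0 u :
  (forall e : R, 0 < e -> exists N, forall n, (N <= n)%N -> (u n <= e%:E)%E) -> (limn_esup u <= 0)%E.
Proof.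
move=> h; rewrite limn_esup_inf_range; apply/lee_addgt0Pr => e e0; rewrite add0e.
have [N hN] := h e e0; apply: (@le_trans _ _ (esups u N)).
  by apply: ereal_inf_lbound; exists N.
by apply: ge_ereal_sup => _ [n Nn <-]; exact: hN.
Qed.

Lemma limn_esup_lt u c : (limn_esup u < c)%E -> exists N, forall n, (N <= n)%N -> (u n < c)%E.
Proof.
rewrite limn_esup_inf_range => /ereal_inf_lt[_ [N _ <-] hN]; exists N => n Nn.
by apply: le_lt_trans hN; apply: ereal_sup_ubound; exists n.
Qed.

End LimSup.

Section Contraction.
Context {R : realType} (I : set nat) (l : seq nat -> R) (K th : R) (p : nat -> int).
Hypothesis l_gt0 : forall w, wordP I w -> 0 < l w.
Hypothesis K_ge1 : 1 <= K.
Hypothesis th_gt0 : 0 < th.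
Hypothesis th_lt1 : th < 1.
Hypothesis l_le : forall w, wordP I w -> l w <= K * th ^+ size w.
Hypothesis l_cat_le : forall u v, wordP I u -> wordP I v -> l (u ++ v) <= K * l u * l v.
Notation part := (part I l p).

Let K0 : 0 < K. Proof. exact: lt_le_trans K_ge1. Qed.

Lemma contr_above s0 s c q : s0 < s -> (forall n, (0 < n)%N -> (part n s0 q <= c%:E)%E) ->
  contr I l K p s q.
Proof.
move=> ss hc; have ss' : 0 < s - s0 by rewrite subr_gt0.
have [n n0 hn] := th_powR_small K_ge1 th_gt0 th_lt1 (2 * (K `^ s * (`|c| + 1))) ss'.
exists n => //.
set e := (K * th ^+ n) `^ (s - s0) in hn.
have e0 : 0 <= e by exact: powR_ge0.
have Ks : 0 < K `^ s by exact: powR_gt0.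
apply: (@le_lt_trans _ _ ((K `^ s)%:E * (e%:E * (`|c| + 1)%:E))%E).
  apply: lee_pmul => //; [by rewrite lee_fin ltW|exact: part_ge0|].
  apply: le_trans (part_s_le p l_gt0 K_ge1 th_gt0 l_le n q (ltW ss)) _.
  apply: lee_pmul; rewrite ?part_ge0//.
  apply: le_trans (hc n n0) _; rewrite lee_fin; have := ler_norm c; lra.
rewrite -!EFinM lte_fin; move: hn; rewrite -mulrA -mulrA [(_ + 1) * _]mulrC; lra.
Qed.

(** Each unit added to the exponent multiplies the quantity in [contr] by at most
    [K * (K * th ^ n)], which is at most 1/2 for the chosen [n]; enough units bring it below 1. *)
Lemma contr_exists s1 q : 0 <= s1 -> (part 1 s1 q < +oo)%E -> exists2 s, 0 <= s & contr I l K p s q.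
Proof.
move=> s10 fin; have [n n0 hn] := th_powR_small K_ge1 th_gt0 th_lt1 (2 * K) ltr01.
have := part_fin l_gt0 K_ge1 l_cat_le s10 fin n0.
have : (0 <= part n s1 q)%E by exact: part_ge0.
case E1 : (part n s1 q) => [B| |]// B0 _; rewrite lee_fin in B0.
have T0 : 0 < K * th ^+ n by rewrite mulr_gt0// exprn_gt0.
have h2 : K * (K * th ^+ n) <= 2^-1 by move: hn; rewrite powRr1 ?(ltW T0)//; lra.
have h0 : 0 <= K * (K * th ^+ n) by rewrite mulr_ge0 ?(ltW T0) ?(ltW K0).
have h1 : K * (K * th ^+ n) < 1 by lra.
have [N /(_ N (leqnn N)) hN] := @geometric_small R (K `^ s1 * B) (K * (K * th ^+ n)) 1 h0 h1 ltr01.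
exists (s1 + N%:R); first by rewrite addr_ge0.
exists n => //.
apply: (@le_lt_trans _ _ ((K `^ (s1 + N%:R))%:E * (((K * th ^+ n) `^ N%:R)%:E * B%:E))%E).
  apply: lee_pmul => //; [by rewrite lee_fin powR_ge0|exact: part_ge0|].
  rewrite -E1; have := part_s_le p l_gt0 K_ge1 th_gt0 l_le n q (s1 := s1) (s2 := s1 + N%:R).
  by rewrite addrAC subrr add0r; apply; rewrite lerDl.
rewrite -!EFinM lte_fin powRD; last by rewrite (gt_eqF K0) implybT.
rewrite !powR_mulrn ?(ltW K0) ?(ltW T0)//; move: hN; rewrite exprMn.
set a := K `^ s1; set b := K ^+ N; set c := _ ^+ N.
by have -> : a * b * (c * B) = a * B * (b * c) by ring.
Qed.

End Contraction.

Section Pressure.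
Context {R : realType} (I : set nat) (J : nat -> set R) (F0 : R -> R).
Notation D0 := (Delta0 I J).
Notation cyl := (cyl J F0).
Notation itin := (itin I J F0).
Notation rep := (repeller F0 D0).
Notation lev := (lev I J F0).
Notation ell := (ell J F0).
Notation dF := (dF F0).
Notation phi := (geom_pot F0).

Context (lam M : R).
Hypothesis bm : base_map I J F0.
Hypothesis lam_gt1 : 1 < lam.
Hypothesis lamP : forall x, Delta0 I J x -> lam <= `|derive1 F0 x|.
Hypothesis M_ge0 : 0 <= M.
Hypothesis MP : forall x, Delta0 I J x -> `|derive1n 2 F0 x| <= M * (derive1 F0 x) ^+ 2.
Notation K := (distortion lam M).
Context (p : nat -> int).
Notation part := (part I ell p).

Let K1 : 1 <= K := distortion_ge1 lam_gt1 M_ge0.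
Let K0 : 0 < K. Proof. exact: lt_le_trans K1. Qed.
Let lg := ell_gt0 bm lam_gt1 lamP.
Let lcat_ge := ell_cat_ge bm lam_gt1 lamP M_ge0 MP.

Lemma birkhoff_geom s w x : wordP I w -> cyl w x ->
  birkhoff F0 (fun y => s * phi y) (size w) x = - (s * ln (dF (size w) x)).
Proof.
elim: w x => [|i w IH] x hw cx; first by rewrite /birkhoff big_geq// ln1 mulr0 oppr0.
have [Ii hw'] := wordP_cons hw; case: cx => Jx cx'.
rewrite /birkhoff /= big_nat_recl//=.
rewrite (eq_bigr (fun k => s * phi (iter k F0 (F0 x)))); last by move=> k _; rewrite -iterSr.
rewrite -/(birkhoff F0 (fun y => s * phi y) (size w) (F0 x)) IH// /geom_pot.
rewrite lnM ?posrE; first by rewrite mulrDr opprD mulrN.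
- by rewrite normr_gt0; apply: (branch_der_neq0 lam_gt1 lamP Ii Jx).
- exact: (dF_gt0 lam_gt1 lamP hw' cx').
Qed.

Lemma birkhoff_bounds s w x : 0 <= s -> wordP I w -> cyl w x ->
  (ell w / K) `^ s <= expR (birkhoff F0 (fun y => s * phi y) (size w) x) <= (K * ell w) `^ s.
Proof.
move=> s0 hw cx; rewrite birkhoff_geom//.
have d0 := dF_gt0 lam_gt1 lamP hw cx.
have -> : expR (- (s * ln (dF (size w) x))) = (dF (size w) x)^-1 `^ s.
  rewrite /powR ifF; last by apply/negbTE; rewrite invr_neq0// lt0r_neq0.
  by rewrite lnV ?posrE// mulrN.
have di : 0 <= (dF (size w) x)^-1 by rewrite invr_ge0 ltW.
have l0 := lg hw.
apply/andP; split; apply: ge0_ler_powR; rewrite ?nnegrE//.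
- by rewrite divr_ge0 ?ltW.
- exact: (dF_ell_ge bm lam_gt1 lamP M_ge0 MP hw cx).
- by rewrite mulr_ge0 ?ltW.
- exact: (dF_ell_le bm lam_gt1 lamP M_ge0 MP hw cx).
Qed.

Definition per_sum B n s : \bar R :=
  \esum_(x in Per F0 D0 n `&` B) (expR (birkhoff F0 (fun y => s * phi y) n x))%:E.

Lemma per_sum_le B n s c : 0 <= s -> (0 < n)%N -> (part n s 0 <= c%:E)%E ->
  (per_sum B n s <= (K `^ s * c)%:E)%E.
Proof.
move=> s0 n0 hc; apply: esum_le_list => L uL hL.
have hit x : x \in L -> [/\ size (itin n x) = n, wordP I (itin n x) & cyl (itin n x) x].
  by move=> /hL[[rx _] _]; exact: itinP.
have uM : uniq [seq itin n x | x <- L].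
  rewrite map_inj_in_uniq// => x y xL yL e.
  have [sx wx cx] := hit x xL; have [_ _ cy] := hit y yL.
  have [[_ px] _] := hL x xL; have [[_ py] _] := hL y yL.
  apply: (periodic_uniq bm lam_gt1 lamP (w := itin n x)) => //; rewrite ?sx ?e//.
  by apply/eqP => e0; move: sx n0; rewrite e e0 => <-.
have : \sum_(w <- [seq itin n x | x <- L]) wterm ell p s 0 w <= c.
  rewrite -lee_fin; apply: le_trans hc; apply: esum_list_le => // w /mapP[x xL ->].
  by have [] := hit x xL.
rewrite big_map => h; apply: le_trans (ler_wpM2l (powR_ge0 K s) h).
rewrite mulr_sumr [leLHS]big_seq [leRHS]big_seq; apply: ler_sum => x xL.
have [sx wx cx] := hit x xL; have /andP[_] := birkhoff_bounds s0 wx cx.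
rewrite sx powRM ?(ltW K0) ?(ltW (lg wx))//.
by rewrite /wterm mul0r expR0 mulr1.
Qed.

(** If no partition function exceeded K^s, the periodic sums would be bounded by K^(2 s) at every
    length and the pressure would be at most 0. *)
Lemma pressure_gt0_part B s : 0 <= s -> (0 < pressure F0 D0 B (fun x => s * phi x)%R)%E ->
  exists2 n, (0 < n)%N & ((K `^ s)%:E < part n s 0)%E.
Proof.
move=> s0 h; apply: contrapT => hn.
suff : (pressure F0 D0 B (fun x => s * phi x)%R <= 0)%E by rewrite leNgt h.
pose c := K `^ s * K `^ s.
have Ks : 1 <= K `^ s by rewrite -(powRr0 K) ler_powR.
have c1 : 1 <= c by rewrite -[1]mulr1 ler_pM.
have c0 : 0 < c by exact: lt_le_trans c1.
apply: limn_esup_le0 => e e0.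
exists (Num.truncn (ln c / e)).+1 => n hn'.
have n0 : (0 < n)%N by exact: leq_ltn_trans hn'.
have nR : 0 < n%:R :> R by rewrite ltr0n.
have hE : (per_sum B n s <= c%:E)%E.
  apply: per_sum_le => //; rewrite leNgt; apply/negP => h'; apply: hn.
  by exists n.
have E0 : (0 <= per_sum B n s)%E by apply: esum_ge0 => x _; rewrite lee_fin expR_ge0.
apply: (@le_trans _ _ ((n%:R^-1)%:E * (ln c)%:E)%E).
  rewrite lee_wpmul2l ?lee_fin ?invr_ge0// -lne_EFin// lee_lne//.
    by rewrite in_itv/= E0 leey.
  by rewrite in_itv/= lee_fin ltW// leey.
rewrite -EFinM lee_fin mulrC ler_pdivrMr// mulrC -ler_pdivrMr//.
apply: le_trans (ltW (Num.Theory.truncnS_gt _)) _; by rewrite ler_nat.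
Qed.

(** Finite pressure gives one length with a finite periodic sum. Each letter is planted in a
    periodic word of that length, after [ip] and before a fixed word [v] ending in an inner block,
    which supplies a periodic point in the basic interval. *)
Lemma pressure_fin_part ip s : I ip -> 0 <= s ->
  (pressure F0 D0 (J ip) (fun x => s * phi x)%R < +oo)%E -> (part 1 s 0 < +oo)%E.
Proof.
move=> Iip s0 /limn_esup_lt[N hN].
have [b [b0 hb inb]] := inner_exists bm lam_gt1 lamP.
pose v := nseq N ip ++ b.
have hv : wordP I v by apply: wordP_cat => //; exact: wordP_nseq.
pose n := (2 + size v)%N.
have Nn : (N <= n)%N by rewrite /n /v size_cat size_nseq addnCA leq_addr.
have hE : (per_sum (J ip) n s < +oo)%E.
  have := hN n Nn; rewrite -/(per_sum (J ip) n s).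
  case: (per_sum _ _ _) => [r _|/=|_]; rewrite ?ltry ?ltNyr//.
  by rewrite gt0_muley ?ltxx// lte_fin invr_gt0 ltr0n.
have E0 : (0 <= per_sum (J ip) n s)%E by apply: esum_ge0 => x _; rewrite lee_fin expR_ge0.
case Ee : (per_sum (J ip) n s) hE E0 => [e| |]// _ _.
pose ext w := [:: ip] ++ w ++ v.
have hip : wordP I [:: ip] by move=> j; rewrite inE => /eqP ->.
have hext w : wordP I w -> wordP I (ext w) by move=> hw; do 2!apply: wordP_cat => //.
have /choice[X hX] : forall w, exists x, words I 1 w ->
    [/\ cyl (ext w) x, iter (size (ext w)) F0 x = x & rep x].
  move=> w; have [[sw hw]|nw] := pselect (words I 1 w); last by exists 0.
  have [|x hx] := @periodic_point _ _ _ _ _ bm lam_gt1 lamP (ext w) ([:: ip] ++ w ++ nseq N ip) b [::] _ (hext w hw) b0 inb.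
    by rewrite cats0 /ext /v -!catA.
  by exists x.
pose c := (ell [:: ip] * ell v / (K * K * K)) `^ s.
have K3 : 0 < K * K * K by apply: mulr_gt0 => //; exact: mulr_gt0.
have c0 : 0 < c.
  by apply: powR_gt0; apply: divr_gt0 => //; apply: mulr_gt0; exact: lg.
suff : (part 1 s 0 <= (c^-1 * e)%:E)%E by move=> /le_lt_trans; apply; exact: ltry.
apply: esum_le_list => L uL hL; rewrite ler_pdivlMl//.
have uM : uniq [seq X w | w <- L].
  rewrite map_inj_in_uniq// => w w' wL wL' ex.
  have [sw hw] := hL w wL; have [sw' hw'] := hL w' wL'.
  have [cx _ _] := hX w (hL w wL); have [cx' _ _] := hX w' (hL w' wL').
  have e1 := itinE bm (hext w hw) cx; have e2 := itinE bm (hext w' hw') cx'.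
  have : ext w = ext w'.
    by rewrite -e1 -e2 ex /ext [size _]size_cat [in RHS]size_cat !(size_cat _ v) sw sw'.
  rewrite /ext => -[] /eqP; rewrite eqseq_cat ?sw ?sw'//.
  by move=> /andP[/eqP].
have : \sum_(x <- [seq X w | w <- L]) expR (birkhoff F0 (fun y => s * phi y) n x) <= e.
  rewrite -lee_fin -Ee; apply: esum_list_le => // x /mapP[w wL ->].
  have [cx px rx] := hX w (hL w wL); have [sw hw] := hL w wL.
  have sn : size (ext w) = n by rewrite /ext size_cat size_cat sw.
  by split; [split=> //; rewrite -sn|case: cx].
rewrite big_map => h; apply: le_trans h; rewrite mulr_sumr.
rewrite [leLHS]big_seq [leRHS]big_seq; apply: ler_sum => w wL.
have [cx px rx] := hX w (hL w wL); have [sw hw] := hL w wL.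
have sn : size (ext w) = n by rewrite /ext size_cat size_cat sw.
have /andP[h1 _] := birkhoff_bounds s0 (hext w hw) cx; rewrite sn in h1.
apply: le_trans h1; rewrite /wterm mul0r expR0 mulr1 /c -powRM ?(ltW (lg hw))//; last first.
  by rewrite divr_ge0 ?mulr_ge0// ltW// lg.
have a0 : 0 < ell [:: ip] by exact: lg.
have b0' : 0 < ell v by exact: lg.
have w0 : 0 < ell w by exact: lg.
have x0 : 0 < ell (ext w) by exact/lg/hext.
apply: ge0_ler_powR; rewrite ?nnegrE//.
- by apply: ltW; rewrite mulr_gt0// divr_gt0// mulr_gt0.
- by apply: ltW; rewrite divr_gt0.
have hwv : wordP I (w ++ v) by exact: wordP_cat.
have h2 := lcat_ge hip hwv; have h3 := lcat_ge hw hv.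
rewrite ler_pdivlMr//.
have -> : ell [:: ip] * ell v / (K * K * K) * ell w * K = ell [:: ip] * (ell w * ell v) / (K * K).
  by field; rewrite lt0r_neq0.
have K2 : 0 < K * K by exact: mulr_gt0.
rewrite ler_pdivrMr//.
apply: (@le_trans _ _ (ell [:: ip] * (K * ell (w ++ v)))); first by rewrite ler_pM2l.
rewrite mulrCA [ell (ext w) * _]mulrC -[leRHS]mulrA ler_pM2l//; exact: h2.
Qed.

Context (mu : probability (measurableTypeR R) R).
Notation mc := (mc J F0 mu).

(** By bounded distortion the exponential of the supremum over a cylinder is comparable to the power
    [d0] of [ell w]; the supremum is finite because each cylinder contains a periodic point. The
    pressure [r] is finite too: [+oo] would annihilate all cylinders, [-oo] would give one of them
    infinite measure. *)
Lemma gibbs_word ip d0 : I ip -> 0 <= d0 -> is_gibbs I J F0 (J ip) (fun x => d0 * phi x) mu ->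
  exists (r C : R), 1 <= C /\ forall w, wordP I w -> w != [::] ->
    ell w `^ d0 * expR (- (size w)%:R * r) <= C * mc w /\
    mc w <= C * (ell w `^ d0 * expR (- (size w)%:R * r)).
Proof.
move=> Iip d00 [mrep minv [C C1 hC]].
have Cp : 0 < C by exact: lt_le_trans C1.
set Pr := pressure _ _ _ _ in hC.
have [b [b0 hb inb]] := inner_exists bm lam_gt1 lamP.
have hsup w : wordP I w -> w != [::] -> exists G : R, [/\ cyl_sup I J F0 (fun x => d0 * phi x) w = G%:E,
    (ell w / K) `^ d0 <= expR G & expR G <= (K * ell w) `^ d0].
  move=> hw w0; set S := cyl_sup _ _ _ _ _.
  have we : w ++ b = w ++ b ++ [::] by rewrite cats0.
  have [x [cx _ rx]] := periodic_point bm lam_gt1 lamP we (wordP_cat hw hb) b0 inb.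
  have cw : cyl w x by have [] := (cyl_cat bm x hw hb).1 cx.
  have [lo up] := andP (birkhoff_bounds d00 hw cw).
  have le1 : ((birkhoff F0 (fun x => d0 * phi x) (size w) x)%:E <= S)%E.
    by apply: ereal_sup_ubound; exists x => //; split=> //; exact/(cylinder_cyl bm).
  have KL : 0 < K * ell w by rewrite mulr_gt0// lg.
  have le2 : (S <= (ln ((K * ell w) `^ d0))%:E)%E.
    apply: ge_ereal_sup => _ [y [cy _] <-]; rewrite lee_fin.
    have cy' : cyl w y by exact/(cylinder_cyl bm).
    have /andP[_ h] := birkhoff_bounds d00 hw cy'.
    by rewrite -ler_expR lnK// posrE powR_gt0.
  case: S le1 le2 => [G| |]; rewrite ?leeNy_eq ?leye_eq//= !lee_fin => g1 g2.
  exists G; split=> //; first by apply: le_trans lo _; rewrite ler_expR.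
  by rewrite -[leRHS]lnK ?ler_expR// posrE powR_gt0.
have mcE w : wordP I w -> w != [::] -> mu (cylinder J F0 w) = (mc w)%:E.
  move=> hw w0; have -> : cylinder J F0 w = cyl w.
    by apply/seteqP; split=> x /(cylinder_cyl bm x hw w0).
  by rewrite mE//; exact: (cyl_meas bm lam_gt1 lamP).
have hw1 : wordP I [:: ip] by move=> j; rewrite inE => /eqP ->.
case EP : Pr hC => [r| |] hC.
- exists r, (C * K `^ d0); split.
    by rewrite -[1]mulr1 ler_pM// -(powRr0 K) ler_powR.
  move=> w hw w0; have [G [GE lo up]] := hsup w hw w0.
  have := hC w w0 hw; rewrite /= GE mcE// -EFinM -EFinB /= -!EFinM !lee_fin => -[h1 h2].
  have e1 : expR (G - (size w)%:R * r) = expR G * expR (- (size w)%:R * r).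
    by rewrite -expRD mulNr.
  rewrite e1 in h1 h2; set ee := expR (- (size w)%:R * r) in h1 h2 *.
  have ee0 : 0 < ee by exact: expR_gt0.
  have l0 := lg hw; have Kd : 0 < K `^ d0 by exact: powR_gt0.
  have lo' : ell w `^ d0 <= K `^ d0 * expR G.
    apply: le_trans (ler_wpM2l (ltW Kd) lo); rewrite -powRM ?(ltW K0) ?divr_ge0 ?(ltW l0) ?(ltW K0)//.
    by rewrite mulrCA divff ?mulr1// lt0r_neq0.
  rewrite powRM ?(ltW l0) ?(ltW K0)// in up.
  split.
    move: h1; rewrite -ler_pdivlMl ?invr_gt0// invrK => h1.
    apply: (@le_trans _ _ (K `^ d0 * (expR G * ee))); first by rewrite mulrA ler_pM2r.
    by rewrite [C * _]mulrC -mulrA ler_pM2l.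
  apply: le_trans h2 _; rewrite -mulrA ler_pM2l// mulrA ler_pM2r//.
- exfalso; have z w : wordP I w -> w != [::] -> mc w <= 0.
    move=> hw w0; have [G [GE _ _]] := hsup w hw w0.
    have [_] := hC w w0 hw; rewrite /= GE mcE//.
    rewrite gt0_muley; last by rewrite lte_fin ltr0n; case: (w) w0.
    by rewrite /= mule0 lee_fin.
  have : m mu (lev 1 (fun=> True)) <= 0.
    apply: (lev_le bm lam_gt1 lamP mrep) => L uL hL; rewrite big_seq; apply: sumr_le0 => w /hL[[sw hw] _].
    by apply: z => //; apply/eqP => e; move: sw; rewrite e.
  have -> : lev 1 (fun=> True) = rep by apply/seteqP; split=> x; [move=> []|].
  by rewrite /m mrep /= ler10.
- exfalso; have [G [GE _ _]] := hsup _ hw1 isT.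
  have [h _] := hC [:: ip] isT hw1; move: h; rewrite /= GE mcE//.
  by rewrite mul1e /= gt0_muley ?lte_fin ?invr_gt0.
Qed.

End Pressure.

Section ExtendedReals.
Context {R : realType}.
Implicit Types x y : \bar R.

Lemma lee_dense (d : R) x : 0 < d -> (forall s, 0 < s -> s < d -> (s%:E <= x)%E) -> (d%:E <= x)%E.
Proof.
move=> d0; case: x => [x| |] h; rewrite ?leey//.
  rewrite lee_fin leNgt; apply/negP => xd.
  have m0 : 0 < Num.max ((x + d) / 2) (d / 2) by rewrite lt_max; apply/orP; right; lra.
  have md : Num.max ((x + d) / 2) (d / 2) < d by rewrite gt_max; apply/andP; split; lra.
  have := h _ m0 md; rewrite lee_fin ge_max => /andP[]; lra.
have h0 : 0 < d / 2 by lra.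
have h1 : d / 2 < d by lra.
by have := h _ h0 h1; rewrite leeNy_eq.
Qed.

Lemma gee_dense (d : R) x : (forall s, d < s -> (x <= s%:E)%E) -> (x <= d%:E)%E.
Proof.
move=> h; apply/lee_addgt0Pr => e e0; rewrite -EFinD; apply: h; lra.
Qed.

Lemma lte_dense2 x y : (0 <= x)%E -> (x < y)%E ->
  exists s1 s2 : R, [/\ 0 <= s1, s1 < s2, (x < s1%:E)%E & (s2%:E < y)%E].
Proof.
case: x => [x| |]; [|by move=> _; rewrite ltNge leey|by rewrite leeNy_eq].
rewrite lee_fin => x0; case: y => [y| |]//.
  rewrite lte_fin => xy; exists ((x + x + y) / 3), ((x + y + y) / 3).
  by rewrite !lte_fin; split; lra.
by move=> _; exists (x + 1), (x + 2); rewrite lte_fin ltry; split=> //; lra.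
Qed.

End ExtendedReals.

(** * Conformality of the Gibbs measure *)

Section Conformal.
Context {R : realType} (I : set nat) (J : nat -> set R) (F0 : R -> R) (psi : R -> int).
Notation D0 := (Delta0 I J).
Notation cyl := (cyl J F0).
Notation itin := (itin I J F0).
Notation rep := (repeller F0 D0).
Notation lev := (lev I J F0).
Notation ell := (ell J F0).
Notation phi := (geom_pot F0).
Notation p := (pstep J F0 psi).
Notation mset := (set (measurableTypeR R)).

Context (lam M : R).
Hypothesis bm : base_map I J F0.
Hypothesis lam_gt1 : 1 < lam.
Hypothesis lamP : forall x, Delta0 I J x -> lam <= `|derive1 F0 x|.
Hypothesis M_ge0 : 0 <= M.
Hypothesis MP : forall x, Delta0 I J x -> `|derive1n 2 F0 x| <= M * (derive1 F0 x) ^+ 2.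
Notation K := (distortion lam M).
Hypothesis sf : step_function I J psi.
Notation part := (part I ell p).

Let K1 : 1 <= K := distortion_ge1 lam_gt1 M_ge0.
Let K0 : 0 < K. Proof. exact: lt_le_trans K1. Qed.
Let lg := ell_gt0 bm lam_gt1 lamP.
Let lcat_le := ell_cat_le bm lam_gt1 lamP M_ge0 MP.
Let lle := ell_le bm lam_gt1 lamP M_ge0.
Let th0 : 0 < lam^-1. Proof. by rewrite invr_gt0 (lam_gt0 lam_gt1). Qed.
Let th1 : lam^-1 < 1. Proof. by rewrite invf_lt1// (lam_gt0 lam_gt1). Qed.
Let I0 : I !=set0. Proof. by have [i Ii _] := pstep_minus bm sf; exists i. Qed.

Lemma delta_ge0 f D B : (0 <= @delta R f D B)%E.
Proof. by apply: le_ereal_inf_tmp => _ [s [s0 _] <-]; rewrite lee_fin. Qed.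

Let contr_nil w n : (0 < n)%N -> words I n w -> w != [::].
Proof. by move=> n0 [sw _]; apply/eqP => e; move: sw n0; rewrite e => <-. Qed.

(** Positive pressure at [s] puts the critical exponent strictly above [s], by [part_open]. The rate
    [r] then vanishes. If [r < 0], partition functions at [d0] decay, and interpolation with the
    finite one at [s] moves the decay to an exponent below [d0], against criticality. If [r > 0],
    they grow, and [part_open] gives growth at an exponent above [d0]. *)
Lemma conformal i0 ip (mu : probability (measurableTypeR R) R) :
  let d0 := fine (delta F0 D0 (J i0)) in I i0 -> I ip ->
  strongly_regular I J F0 (J ip) -> is_gibbs I J F0 (J ip) (fun x => d0 * phi x) mu ->
  delta F0 D0 (J i0) = d0%:E /\
  exists s1 C1, [/\ 0 <= s1, s1 < d0, (part 1 s1 0 < +oo)%E &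
    [/\ 1 <= C1, forall w, wordP I w -> mc J F0 mu w <= C1 * ell w `^ d0 &
     forall w, wordP I w -> ell w `^ d0 <= C1 * mc J F0 mu w]].
Proof.
move=> d0 Ii0 Iip [s s0' /andP[Pgt Plt]] gibbs; have s0 := ltW s0'.
have [mrep minv _] := gibbs.
have [n n0 /part_open hn] := pressure_gt0_part bm lam_gt1 lamP M_ge0 MP p s0 Pgt.
have [t st ht] := hn lg K1.
have t0 : 0 <= t by lra.
have dge : (t%:E <= delta F0 D0 (J i0))%E := delta0_ge bm lam_gt1 lamP M_ge0 MP Ii0 t0 n0 ht.
have fin1 : (part 1 s 0 < +oo)%E := pressure_fin_part bm lam_gt1 lamP M_ge0 MP p Iip s0 Plt.
have [s2 s20 cs2] := contr_exists lg K1 th0 th1 lle lcat_le s0 fin1.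
have dle : (delta F0 D0 (J i0) <= s2%:E)%E := delta0_le bm lam_gt1 lamP M_ge0 MP sf Ii0 s20 cs2.
have dE : delta F0 D0 (J i0) = d0%:E.
  by rewrite fineK// ge0_fin_numE ?delta_ge0//; exact: le_lt_trans dle (ltry _).
split=> //; rewrite dE lee_fin in dge; have sd : s < d0 by lra.
have d00 : 0 <= d0 by lra.
have [r [C [C1 hC]]] := gibbs_word bm lam_gt1 lamP M_ge0 MP Iip d00 gibbs.
have C0 : 0 < C by exact: lt_le_trans C1.
have Kd : 0 < K `^ d0 by exact: powR_gt0.
have levT k : m mu (lev k (fun=> True)) = 1.
  have -> : lev k (fun=> True) = rep by apply/seteqP; split=> x; [move=> []|].
  by rewrite /m mrep.
have WE w : wterm ell p d0 0 w = ell w `^ d0 by rewrite /wterm mul0r expR0 mulr1.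
have up k : (0 < k)%N -> (part k d0 0 <= (C * expR (k%:R * r))%:E)%E.
  move=> k0; apply: esum_le_list => L uL hL.
  have h : \sum_(w <- L) mc J F0 mu w <= 1.
    rewrite -(levT k); apply: (lev_ge bm lam_gt1 lamP mrep) => // w /hL //.
  apply: (@le_trans _ _ (C * expR (k%:R * r) * \sum_(w <- L) mc J F0 mu w)); last first.
    by rewrite -[leRHS]mulr1 ler_pM2l ?mulr_gt0 ?expR_gt0.
  rewrite mulr_sumr [leLHS]big_seq [leRHS]big_seq; apply: ler_sum => w /hL hw.
  have [h1 _] := hC w hw.2 (contr_nil k0 hw); rewrite WE mulrAC -ler_pdivrMr ?expR_gt0//.
  by rewrite -expRN -mulNr -hw.1.
have lo k c : (0 < k)%N -> (part k d0 0 <= c%:E)%E -> 1 <= C * expR (- k%:R * r) * c.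
  move=> k0 hc; rewrite -[leLHS](levT k); apply: (lev_le bm lam_gt1 lamP mrep) => L uL hL.
  have h : \sum_(w <- L) ell w `^ d0 <= c.
    rewrite -lee_fin; apply: le_trans hc; rewrite -(eq_bigr _ (fun w _ => WE w)).
    by apply: esum_list_le => // w /hL[].
  apply: (@le_trans _ _ (C * expR (- k%:R * r) * \sum_(w <- L) ell w `^ d0)); last first.
    by rewrite ler_pM2l ?mulr_gt0 ?expR_gt0.
  rewrite mulr_sumr [leLHS]big_seq [leRHS]big_seq; apply: ler_sum => w /hL[hw _].
  have [_ h2] := hC w hw.2 (contr_nil k0 hw).
  by rewrite -mulrA [expR _ * _]mulrC -hw.1.
have r0 : r = 0.
  have [rneg|rpos|//] := ltgtP r 0; exfalso.
    have [k [k0 hk]] : exists k, (0 < k)%N /\ K `^ d0 * C <= k%:R * - r.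
      exists (Num.truncn (`|K `^ d0 * C / - r|)).+1; split=> //.
      rewrite -ler_pdivrMr; last by rewrite oppr_gt0.
      by apply: le_trans (ler_norm _) (ltW (Num.Theory.truncnS_gt _)).
    have ct : contr I ell K p d0 0.
      exists k => //; apply: (@le_lt_trans _ _ ((K `^ d0)%:E * (C * expR (k%:R * r))%:E)%E).
        by apply: lee_pmul; rewrite ?part_ge0 ?lee_fin ?(ltW Kd)//; exact: up.
      rewrite -EFinM lte_fin mulrA -ltr_pdivlMr ?expR_gt0// mul1r -expRN -mulrN.
      by apply: lt_le_trans (expR_ge1Dx _); lra.
    have [t' [t'0 t'1 ct']] := contr_young lg K1 lcat_le s0 sd I0 ct fin1.
    rewrite !mulr0 addr0 in ct'; set s' := (1 - t') * d0 + t' * s in ct'.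
    have s'0 : 0 <= s' by rewrite addr_ge0 ?mulr_ge0//; lra.
    have := delta0_le bm lam_gt1 lamP M_ge0 MP sf Ii0 s'0 ct'; rewrite dE lee_fin /s'.
    have : t' * s < t' * d0 by rewrite ltr_pM2l.
    lra.
  have [k [k0 hk]] : exists k, (0 < k)%N /\ K `^ d0 * C <= k%:R * r.
    exists (Num.truncn (`|K `^ d0 * C / r|)).+1; split=> //.
    rewrite -ler_pdivrMr//.
    by apply: le_trans (ler_norm _) (ltW (Num.Theory.truncnS_gt _)).
  have big : ((K `^ d0)%:E < part k d0 0)%E.
    rewrite ltNge; apply/negP => /(lo k _ k0); rewrite mulNr expRN mulrAC.
    rewrite ler_pdivlMr ?expR_gt0// mul1r; have := expR_ge1Dx (k%:R * r); lra.
  have [t' dt' ht'] := part_open lg K1 big.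
  have t'0 : 0 <= t' by lra.
  have := delta0_ge bm lam_gt1 lamP M_ge0 MP Ii0 t'0 k0 ht'; rewrite dE lee_fin; lra.
exists s, C; split=> //; split=> //.
  move=> w hw; have [->|w0] := eqVneq w [::]; last first.
    by have [_] := hC w hw w0; rewrite r0 mulr0 expR0 mulr1.
  rewrite /ell /= invr1 powR1 mulr1; apply: le_trans C1.
  by rewrite /mc /m -lee_fin fineK ?fin_num_measure ?probability_le1//; exact: (cyl_meas bm lam_gt1 lamP).
move=> w hw; have [->|w0] := eqVneq w [::]; last first.
  by have [+ _] := hC w hw w0; rewrite r0 mulr0 expR0 mulr1.
rewrite /ell /= invr1 powR1; apply: (le_trans C1); rewrite -[leLHS]mulr1 ler_pM2l//.
have -> : 1 = m mu rep by rewrite /m mrep.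
apply: m_le; [exact: (rep_meas bm lam_gt1 lamP)|exact: (cyl_meas bm lam_gt1 lamP)|].
by move=> x /(repeller01 bm).
Qed.

End Conformal.

(** * Fixed points and letters *)

Section FixedPoints.
Context {R : realType} (I : set nat) (J : nat -> set R) (F0 : R -> R) (psi : R -> int).
Notation D0 := (Delta0 I J).
Notation cyl := (cyl J F0).
Notation ell := (ell J F0).
Notation phi := (geom_pot F0).
Notation p := (pstep J F0 psi).
Context (lam M : R).
Hypothesis bm : base_map I J F0.
Hypothesis lam_gt1 : 1 < lam.
Hypothesis lamP : forall x, Delta0 I J x -> lam <= `|derive1 F0 x|.
Hypothesis M_ge0 : 0 <= M.
Hypothesis MP : forall x, Delta0 I J x -> `|derive1n 2 F0 x| <= M * (derive1 F0 x) ^+ 2.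
Notation K := (distortion lam M).
Hypothesis sf : step_function I J psi.
Notation part := (part I ell p).

Let K1 : 1 <= K := distortion_ge1 lam_gt1 M_ge0.
Let K0 : 0 < K. Proof. exact: lt_le_trans K1. Qed.
Let lg := ell_gt0 bm lam_gt1 lamP.

Let cyl1 i x : I i -> J i x -> cyl [:: i] x.
Proof. by move=> Ii Jx; split=> //; exact: (branch_F01 bm Ii Jx). Qed.

Let word1 i : I i -> wordP I [:: i].
Proof. by move=> Ii j; rewrite inE => /eqP ->. Qed.

Let weight_bounds d q i x : 0 <= d -> I i -> J i x ->
  K `^ d * expR (d * phi x + q * (psi x)%:~R) >= wterm ell p d q [:: i] /\
  expR (d * phi x + q * (psi x)%:~R) <= K `^ d * wterm ell p d q [:: i].
Proof.
move=> d0 Ii Jx; have hw := word1 Ii; have cx := cyl1 Ii Jx.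
have /andP[lo up] := birkhoff_bounds bm lam_gt1 lamP M_ge0 MP d0 hw cx.
have e1 : birkhoff F0 (fun y => d * phi y) (size [:: i]) x = d * phi x.
  by rewrite /birkhoff big_nat1.
rewrite e1 in lo up.
have Dx : D0 x by exists i.
have px : (psi x)%:~R = (psum p [:: i])%:~R :> R.
  by rewrite /psum big_seq1 (psi_idx bm sf Dx) (idxE bm Ii Jx).
have l0 := lg hw; have Kd : 0 < K `^ d by exact: powR_gt0.
rewrite expRD px /wterm; set E := expR (q * _); have E0 : 0 < E by exact: expR_gt0.
split; rewrite mulrA ler_pM2r//.
  apply: le_trans (ler_wpM2l (ltW Kd) lo); rewrite -powRM ?(ltW K0) ?divr_ge0 ?(ltW l0) ?(ltW K0)//.
  by rewrite mulrCA divff ?mulr1// lt0r_neq0.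
by rewrite -powRM ?(ltW K0) ?(ltW l0).
Qed.

(** Distinct fixed points lie in distinct branches, so the series over fixed points is dominated by
    the one over letters. *)
Lemma fix_sum_infty d q : 0 <= d -> fix_sum I J F0 psi d q = +oo%E -> part 1 d q = +oo%E.
Proof.
move=> d0 hZ; apply/eqP; rewrite -leye_eq leNgt; apply/negP.
have : (0 <= part 1 d q)%E by exact: part_ge0.
case E1 : (part 1 d q) => [c| |]// _ _.
suff : (fix_sum I J F0 psi d q <= (K `^ d * c)%:E)%E by rewrite hZ leye_eq.
apply: esum_le_list => L uL hL.
have D0L x : x \in L -> D0 x by move=> /hL[/repellerP/(_ 0%N)].
have uM : uniq [seq [:: idx I J x] | x <- L].
  rewrite map_inj_in_uniq// => x y xL yL [e].
  have [Ix Jx] := idxP (D0L x xL); have [_ Jy] := idxP (D0L y yL).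
  have [_ px] := hL x xL; have [_ py] := hL y yL.
  apply: (periodic_uniq bm lam_gt1 lamP (w := [:: idx I J x])) => //; first exact: word1.
    exact: cyl1.
  by rewrite e; apply: cyl1 => //; rewrite -e.
have : \sum_(w <- [seq [:: idx I J x] | x <- L]) wterm ell p d q w <= c.
  rewrite -lee_fin -E1; apply: esum_list_le => // w /mapP[x xL ->].
  by have [Ix Jx] := idxP (D0L x xL); split=> //; exact: word1.
rewrite big_map => h; apply: le_trans (ler_wpM2l (powR_ge0 K d) h).
rewrite mulr_sumr [leLHS]big_seq [leRHS]big_seq; apply: ler_sum => x xL.
by have [Ix Jx] := idxP (D0L x xL); have [] := weight_bounds q d0 Ix Jx.
Qed.

(* A branch interval that stays away from 0 and 1 is mapped across itself and
   contains a fixed point; at most two branch intervals touch 0 or 1. *)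
Lemma outer_letters : exists i0 i1, forall i, I i -> ~ inner J F0 [:: i] -> i = i0 \/ i = i1.
Proof.
pose Z i := I i /\ exists b, J i = `]0, b[%classic /\ 0 < b.
pose O i := I i /\ exists a, J i = `]a, 1[%classic /\ a < 1.
have Zu i j : Z i -> Z j -> i = j.
  move=> [Ii [b [eb b0]]] [Ij [c [ec c0]]].
  have m0 : 0 < Num.min b c / 2 by rewrite divr_gt0// lt_min b0.
  have mb : Num.min b c <= b by rewrite ge_min lexx.
  have mc' : Num.min b c <= c by rewrite ge_min lexx orbT.
  apply: (branch_disj bm (x := Num.min b c / 2)) => //.
    by rewrite eb /= in_itv /= m0; lra.
  by rewrite ec /= in_itv /= m0; lra.
have Ou i j : O i -> O j -> i = j.
  move=> [Ii [b [eb b0]]] [Ij [c [ec c0]]].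
  have m0 : Num.max b c < 1 by rewrite gt_max b0.
  have mb : b <= Num.max b c by rewrite le_max lexx.
  have mc' : c <= Num.max b c by rewrite le_max lexx orbT.
  apply: (branch_disj bm (x := (Num.max b c + 1) / 2)) => //.
    by rewrite eb /= in_itv /=; lra.
  by rewrite ec /= in_itv /=; lra.
have [i0 hi0] : exists i0, forall i, Z i -> i = i0.
  have [[i Zi]|n] := pselect (exists i, Z i); first by exists i => j Zj; exact: Zu.
  by exists 0%N => i Zi; exfalso; apply: n; exists i.
have [i1 hi1] : exists i1, forall i, O i -> i = i1.
  have [[i Oi]|n] := pselect (exists i, O i); first by exists i => j Oj; exact: Ou.
  by exists 0%N => i Oi; exfalso; apply: n; exists i.
exists i0, i1 => i Ii; have [a [b [a0 ab b1 e]]] := branch_itv bm Ii.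
move: a0 b1; rewrite le_eqVlt => /orP[/eqP a0 _ _|a0].
  by left; apply: hi0; split=> //; exists b; rewrite e -a0; split=> //; rewrite a0.
rewrite le_eqVlt => /orP[/eqP b1 _|b1 []].
  by right; apply: hi1; split=> //; exists a; rewrite e b1; split=> //; rewrite -b1.
exists (Num.min a (1 - b)); first by rewrite lt_min a0/=; lra.
move=> x [Jx _]; move: Jx; rewrite e /= in_itv /= => /andP[ax xb].
have m1 : Num.min a (1 - b) <= a by rewrite ge_min lexx.
have m2 : Num.min a (1 - b) <= 1 - b by rewrite ge_min lexx orbT.
by apply/andP; split; lra.
Qed.

(** A letter with inner branch carries a fixed point of comparable weight. The remaining letters are
    at most two by [outer_letters] and add at most [B] each. *)
Lemma fix_sum_fin d q : 0 <= d -> (fix_sum I J F0 psi d q < +oo)%E -> (part 1 d q < +oo)%E.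
Proof.
move=> d0; have : (0 <= fix_sum I J F0 psi d q)%E by apply: esum_ge0 => x _; rewrite lee_fin expR_ge0.
case EZ : (fix_sum I J F0 psi d q) => [z| |]// _ _.
have [i0 [i1 hout]] := outer_letters.
have /choice[X hX] : forall i, exists x, I i -> inner J F0 [:: i] ->
    [/\ J i x, F0 x = x & repeller F0 D0 x].
  move=> i; have [[Ii ini]|h] := pselect (I i /\ inner J F0 [:: i]); last first.
    by exists 0 => Ii ini; exfalso; apply: h.
  have [x [cx px rx]] := periodic_point bm lam_gt1 lamP (erefl ([::] ++ [:: i] ++ [::])) (word1 Ii) isT ini.
  by exists x => _ _; case: cx.
pose in1 (w : seq nat) := `[< inner J F0 w >].
pose B := `|wterm ell p d q [:: i0]| + `|wterm ell p d q [:: i1]|.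
have B0 : 0 <= B by rewrite addr_ge0.
suff : (part 1 d q <= (K `^ d * z + B *+ 2)%:E)%E by move=> /le_lt_trans; apply; exact: ltry.
apply: esum_le_list => L uL hL.
rewrite (bigID in1) /=; apply: lerD.
  have hi w : w \in [seq v <- L | in1 v] -> [/\ exists i, w = [:: i], wordP I w & inner J F0 w].
    rewrite mem_filter => /andP[/asboolP iw /hL[sw hw]]; split=> //.
    by case: w sw {hw iw} => [|i [|]]// _; exists i.
  have hd w : w \in [seq v <- L | in1 v] -> let x := X (head 0%N w) in
      [/\ w = [:: head 0%N w], I (head 0%N w), J (head 0%N w) x, F0 x = x & repeller F0 D0 x].
    move=> /hi[[i ->] hw iw] /=; have Ii : I i by apply: hw; rewrite mem_head.
    by have [? ? ?] := hX i Ii iw.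
  have uM : uniq [seq X (head 0%N w) | w <- L & in1 w].
    rewrite map_inj_in_uniq ?filter_uniq// => w w' wL wL' e.
    have [ew Iw Jw _ _] := hd w wL; have [ew' Iw' Jw' _ _] := hd w' wL'.
    by rewrite ew ew'; congr [:: _]; apply: (branch_disj bm Iw Iw' Jw); rewrite e.
  have : \sum_(x <- [seq X (head 0%N w) | w <- L & in1 w]) expR (d * phi x + q * (psi x)%:~R) <= z.
    rewrite -lee_fin -EZ; apply: esum_list_le => // x /mapP[w wL ->].
    by have [_ _ _ fx rx] := hd w wL; split.
  rewrite big_map => h; apply: le_trans (ler_wpM2l (powR_ge0 K d) h).
  rewrite mulr_sumr -big_filter [leLHS]big_seq [leRHS]big_seq; apply: ler_sum => w wL.
  have [ew Iw Jw _ _] := hd w wL; rewrite {1}ew.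
  by have [] := weight_bounds q d0 Iw Jw.
rewrite -big_filter; set L' := [seq w <- L | ~~ in1 w].
have sL' : {subset L' <= [:: [:: i0]; [:: i1]]}.
  move=> w; rewrite mem_filter => /andP[/asboolP nw /hL[sw hw]].
  case: w sw hw nw => [|i [|]]// _ hw nw; rewrite !inE.
  have Ii : I i by apply: hw; rewrite mem_head.
  by have [->|->] := hout i Ii nw; rewrite eqxx ?orbT.
have szL : (size L' <= 2)%N by apply: (uniq_leq_size _ sL'); rewrite filter_uniq.
apply: (@le_trans _ _ (\sum_(w <- L') B)).
  rewrite [leLHS]big_seq [leRHS]big_seq; apply: ler_sum => w /sL'; rewrite !inE.
  by move=> /orP[/eqP ->|/eqP ->]; apply: (le_trans (ler_norm _)); rewrite /B ?lerDl ?lerDr.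
by rewrite big_const_seq count_predT iter_addr addr0 -!(mulr_natr B) ler_wpM2l// ler_nat.
Qed.

End FixedPoints.

(** * Typical orbits *)

Section Typical.
Context {R : realType} (I : set nat) (J : nat -> set R) (F0 : R -> R)
  (psi : R -> int) (psi1 : R -> nat).
Notation D0 := (Delta0 I J).
Notation itin := (itin I J F0).
Notation rep := (repeller F0 D0).
Notation lev := (lev I J F0).
Notation FN := (extN F0 psi psi1).
Notation DN := (domN I J).
Notation p := (pstep J F0 psi).
Notation stp := (stepN J F0 psi psi1).
Notation mset := (set (measurableTypeR R)).

Context (lam : R).
Hypothesis bm : base_map I J F0.
Hypothesis lam_gt1 : 1 < lam.
Hypothesis lamP : forall x, Delta0 I J x -> lam <= `|derive1 F0 x|.
Hypothesis sf : step_function I J psi.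
Hypothesis rr : reflexion_rule I J psi psi1.
Let SN : set int := [set k | 0 <= k].
Let stepS k i : SN k -> I i -> SN (stp k i) := @stepN_S _ _ _ _ _ _ bm sf k i.
Let domE := @domNE R I J.
Let FE x k := @FNE _ _ _ _ _ _ bm sf rr x k.

Let repM : measurable (rep : mset) := rep_meas bm lam_gt1 lamP.
Let levM n Q : measurable (lev n Q : mset) := lev_meas bm lam_gt1 lamP n Q.

Let shift_meas (A : mset) (k : int) : measurable A ->
  measurable ([set x + k%:~R | x in A] : mset).
Proof.
move=> mA; have -> : [set x + k%:~R | x in A] = setT `&` (fun y : measurableTypeR R => y - k%:~R) @^-1` A.
  apply/seteqP; split=> [_ [x Ax <-]|y [_ /= Ay]]; first by split=> //=; rewrite addrK.
  by exists (y - k%:~R) => //; rewrite subrK.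
by apply: (measurable_funB (@measurable_id _ _ _) (measurable_cst _)).
Qed.

Let level_meas (P : int -> set R) (S : set R) : (forall k, measurable (P k : mset)) ->
  (forall y, S y -> repeller FN DN y) ->
  (forall x k, rep x -> 0 <= k -> S (x + k%:~R) <-> P k x) -> (forall k x, P k x -> rep x) ->
  measurable (S : mset).
Proof.
move=> mP SR SP PR; have -> : S = \bigcup_(k : nat) [set x + (k%:Z)%:~R | x in P k%:Z].
  apply/seteqP; split=> [y Sy|_ [k _ [x Px <-]]]; last by apply/SP => //; exact: (PR k%:Z).
  have [x [k [rx k0 e]]] := skew_repellerE bm stepS domE FE (SR y Sy).
  exists `|k|%N => //; exists x; last by rewrite gez0_abs.
  by rewrite gez0_abs//; apply/SP => //; rewrite -e.
by apply: bigcup_measurable => k _; exact: shift_meas.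
Qed.

Let high k : set R := \bigcap_(B : nat) \bigcup_N \bigcap_n
  lev (N + n) (fun w => B%:Z <= height stp k w).

Let highP k x : rep x -> high k x <-> forall B : int, exists N, forall n, (N <= n)%N ->
  B <= height stp k (itin n x).
Proof.
move=> rx; split=> [h B|h B _].
  have [N _ hN] := h `|B|%N Logic.I; exists N => n Nn.
  have [_] := hN (n - N)%N Logic.I; rewrite subnKC//; move: (height _ _ _); clear; lia.
by have [N hN] := h B%:Z; exists N => // n _; split=> //; apply: hN; rewrite leq_addr.
Qed.

Let high_meas k : measurable (high k : mset).
Proof.
apply: bigcap_measurable => // B _; apply: bigcup_measurable => N _.
by apply: bigcap_measurable => // n _; exact: levM.
Qed.

Lemma Tplus_meas : measurable (Tplus FN DN : mset).
Proof.
apply: (@level_meas high) => //.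
- by move=> y [].
- by move=> x k rx k0; rewrite (TplusP bm sf rr rx k0) highP.
- by move=> k x /(_ 0%N Logic.I)[N _ /(_ 0%N Logic.I)[]].
Qed.

Let RsetNT x k : rep x -> 0 <= k -> Rset FN DN (x + k%:~R) <-> ~ Tplus FN DN (x + k%:~R).
Proof.
move=> rx k0; rewrite (RsetP bm sf rr rx k0) (TplusP bm sf rr rx k0).
split=> [[B hB] h|/existsNP[B /forallNP hB]].
  have [N hN] := h (B + 1); have [n /hN h1 h2] := hB N.
  by move: (le_trans h1 h2); clear; lia.
exists B => N; apply: contrapT => hn; apply: (hB N) => n Nn; rewrite leNgt; apply/negP => h.
by apply: hn; exists n => //; exact: ltW.
Qed.

Lemma Rset_notTplus y : Rset FN DN y -> ~ Tplus FN DN y.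
Proof.
move=> Ry; have [x [k [rx k0 e]]] := skew_repellerE bm stepS domE FE Ry.1.
by move: Ry; rewrite e => /(RsetNT rx k0).
Qed.

Lemma Rset_meas : measurable (Rset FN DN : mset).
Proof.
apply: (@level_meas (fun k => rep `\` high k)) => //.
- by move=> k; apply: measurableD.
- by move=> y [].
- move=> x k rx k0; rewrite RsetNT// (TplusP bm sf rr rx k0) -highP//.
  by split=> [h|[]].
- by move=> k x [].
Qed.

Context (mu : probability (measurableTypeR R) R).
Hypothesis mu_rep : mu rep = 1%E.
Hypothesis mu_inv : forall A : set R, measurable (A : mset) ->
  mu (D0 `&` F0 @^-1` A) = mu A.
Notation mc := (mc J F0 mu).
Context (kap : R).
Hypothesis kap_gt0 : 0 < kap.
Hypothesis mc_cat : forall u v, wordP I u -> wordP I v -> kap * (mc u * mc v) <= mc (u ++ v).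

Let mu_ge1 (A B : set R) : measurable (A : mset) -> measurable (B : mset) -> mu A = 1%E ->
  A `<=` B -> mu B = 1%E.
Proof.
move=> mA mB A1 AB; apply/eqP; rewrite eq_le probability_le1//= -A1.
by apply: le_measure; rewrite ?inE.
Qed.

Let Tplus0 x : rep x -> Tplus FN DN x <-> forall B : int, exists N, forall n, (N <= n)%N ->
  B <= height stp 0 (itin n x).
Proof. by move=> rx; have := TplusP bm sf rr rx (lexx 0); rewrite addr0. Qed.

(** If the sums of [g - e] are bounded below, those of [g], and with them the heights, grow at least
    like [n * e] up to a constant. *)
Lemma Tplus_typical g e : (forall i, I i -> g i <= (p i)%:~R) -> 0 < e ->
  m mu (bounded_below I J F0 (fun i => g i - e)) = 1 -> mu (Tplus FN DN) = 1%E.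
Proof.
move=> gp e0 G1.
have mG := bounded_below_meas bm lam_gt1 lamP (fun i => g i - e).
apply: (mu_ge1 mG Tplus_meas); first by rewrite mE// G1.
move=> x [C _ [rx hC]]; apply/(Tplus0 rx) => B.
pose N := (Num.truncn ((`|B%:~R : R| + C%:R) / e)).+1.
exists N => n Nn.
have [sz hw _] := itinP bm n rx.
have := heightN_ge bm sf rr (lexx 0) hw; rewrite add0r => /(le_trans _); apply.
rewrite -(ler_int R).
have h1 : fsum (fun i => g i - e) (itin n x) <= (psum p (itin n x))%:~R - n%:R * e.
  rewrite /fsum /psum rmorph_sum sumrB; apply: lerB.
    by rewrite [leLHS]big_seq [leRHS]big_seq; apply: ler_sum => i /hw; exact: gp.
  by rewrite big_const_seq count_predT iter_addr addr0 sz mulr_natl.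
have h2 : `|B%:~R : R| + C%:R <= n%:R * e.
  rewrite -ler_pdivrMr//; apply: le_trans (ltW (Num.Theory.truncnS_gt _)) _.
  by rewrite ler_nat.
have := hC n; have := ler_norm (B%:~R : R); lra.
Qed.

(** On an orbit tending to infinity the height is eventually positive, so heights and free sums
    differ by a constant from then on and the free sums are eventually at least 1. By [drift_null]
    this happens on a null set only. *)
Lemma Rset_typical : mu.-integrable setT (EFin \o obs I J (fun i => (p i)%:~R)) ->
  \int[mu]_x obs I J (fun i => (p i)%:~R) x <= 0 -> mu (Rset FN DN) = 1%E.
Proof.
move=> pi p0.
have [N [mN N0 hN]] := drift_null bm lam_gt1 lamP mu_rep mu_inv kap_gt0 mc_cat pi (fun=> erefl)
  (fun i Ii => pstep_ge bm sf Ii) p0.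
have mC : measurable (rep `\` N : mset) by exact: measurableD.
apply: (mu_ge1 mC Rset_meas).
  have n0 : mu (rep `&` N) = 0%E.
    apply/eqP; rewrite eq_le measure_ge0 andbT -N0.
    by apply: le_measure; rewrite ?inE//; exact: measurableI.
  rewrite measureD//; last by rewrite [X in (X < _)%E]mu_rep ltry.
  by rewrite [X in (X - _)%E]mu_rep [X in (_ - X)%E]n0 sube0.
move=> x [rx nx]; have := RsetNT rx (lexx 0); rewrite addr0 => ->.
move=> /(Tplus0 rx) hT; apply: nx; apply: hN => //.
have [n1 h1] := hT 1; have [_ hw1 _] := itinP bm n1 rx.
pose h := height stp 0 (itin n1 x).
have rn := repeller_iter n1 rx.
have [n2 h2] := hT (h + 1 - psum p (itin n1 x)).
exists (n1 + n2)%N => n Nn.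
have n1n : (n1 <= n)%N by apply: leq_trans Nn; rewrite leq_addr.
have pos j : 1 <= height stp h (itin j (iter n1 F0 x)).
  by have := h1 (n1 + j)%N (leq_addr _ _); rewrite itin_cat height_cat.
have := h2 n (leq_trans (leq_addl _ _) Nn).
rewrite -(subnKC n1n) itin_cat height_cat psum_cat -/h (heightN_pos rn pos).
by move: (psum _ _) (psum _ _); clear; lia.
Qed.

End Typical.

Section Observables.
Context {R : realType} (I : set nat) (J : nat -> set R) (F0 : R -> R).
Hypothesis bm : base_map I J F0.
Context (mu : probability (measurableTypeR R) R).
Notation obs := (obs I J).

Lemma obs_sub (g h : nat -> R) : obs (fun i => g i - h i) = fun x => obs g x - obs h x.
Proof. by apply/funext => x; rewrite /obs !patchE; case: ifP => //; rewrite subr0. Qed.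

Lemma obs_opp (g : nat -> R) : obs (fun i => - g i) = fun x => - obs g x.
Proof. by apply/funext => x; rewrite /obs !patchE; case: ifP => //; rewrite oppr0. Qed.

Lemma obs_opp_int g : mu.-integrable setT (EFin \o obs g) ->
  mu.-integrable setT (EFin \o obs (fun i => - g i)) /\
  \int[mu]_x obs (fun i => - g i) x = - \int[mu]_x obs g x.
Proof.
move=> gi; have e : (fun x => - obs g x) = fun x => -1 * obs g x.
  by apply/funext => x; rewrite mulN1r.
rewrite obs_opp e; split; last by rewrite (RintegralZl (-1) measurableT gi) mulN1r.
exact: (integrableZl measurableT (-1) gi).
Qed.

(** Only an inequality for the means: [obs] vanishes off the branches, where nothing is
    subtracted. *)
Lemma obs_shift_int g e : 0 <= e -> mu.-integrable setT (EFin \o obs g) ->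
  mu.-integrable setT (EFin \o obs (fun i => g i - e)) /\
  \int[mu]_x obs g x - e <= \int[mu]_x obs (fun i => g i - e) x.
Proof.
move=> e0 gi; pose c (_ : measurableTypeR R) := e.
have muT : fine (mu [set: measurableTypeR R]) = 1 by rewrite (@probability_setT _ _ _ mu).
have ci : mu.-integrable setT (EFin \o c) by exact: finite_measure_integrable_cst.
have bnd x : 0 <= obs (fun=> e) x <= e.
  by rewrite /obs patchE; case: ifP => _; rewrite /= ?e0 ?lexx.
have oi : mu.-integrable setT (EFin \o obs (fun=> e)).
  apply: le_integrable ci => //; first by apply/measurable_EFinP; exact: (obs_meas bm).
  move=> x _ /=; have /andP[h1 h2] := bnd x.
  by rewrite lee_fin ger0_norm// (le_trans h2)// ler_norm.
rewrite obs_sub; split; first exact: (integrableB measurableT gi oi).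
rewrite (RintegralB measurableT gi oi) lerD2l lerN2.
apply: (@le_trans _ _ (\int[mu]_x c x)).
  by apply: le_Rintegral => // x _; have /andP[] := bnd x.
by rewrite Rintegral_cst// muT mulr1.
Qed.

End Observables.

(** * Critical exponents and the trichotomy *)

Theorem theorem2p6 (R : realType) (I : set nat) (J : nat -> set R)
    (F0 : R -> R) (psi : R -> int) (psi1 : R -> nat)
    (* the basic intervals used for the critical exponents and the pressure *)
    (i0 ip iN iZ hN : nat) (hZ : int)
    (mu : probability (measurableTypeR R) R) :
  let D0 := Delta0 I J in
  let DZ := domZ I J in
  let DN := domN I J in
  let FZ := extZ F0 psi in
  let FN := extN F0 psi psi1 in
  let phi := geom_pot F0 in
  let delta_0 := delta F0 D0 (J i0) in
  let delta_N := delta FN DN (shiftJ J iN hN%:Z) in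
  let delta_Z := delta FZ DZ (shiftJ J iZ hZ) in
  let d0 := fine delta_0 in
  let alpha_max := (\int[mu]_(x in repeller F0 D0) ((psi x)%:~R : R)%:E)%E in
  let Z q := fix_sum I J F0 psi d0 q in
  let dimR := dimH (Rset FN DN) in
  let dimT := dimH (Tplus FN DN) in
  let gap := (dimR < dimH (repeller FN DN))%E in
  base_map I J F0 ->
  step_function I J psi ->
  reflexion_rule I J psi psi1 ->
  top_transitive FZ DZ ->
  top_transitive FN DN ->
  I i0 -> I ip -> I iN -> I iZ ->
  strongly_regular I J F0 (J ip) ->
  is_gibbs I J F0 (J ip) (fun x => d0 * phi x) mu ->
  (\int[mu]_(x in repeller F0 D0) (- phi x)%:E < +oo)%E ->
  [/\ (* critical exponent *)
      ((0 <= alpha_max)%E -> delta_N = delta_Z) /\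
      ((alpha_max < 0)%E -> delta_N = delta_0),
      (* lean case *)
      ((dimT < dimR)%E <->
         (alpha_max < 0)%E /\ exists2 q : R, 0 < q & (Z q < +oo)%E) /\
      ((dimT < dimR)%E -> mu (Rset FN DN) = 1%E),
      (* balanced case *)
      (dimR = dimT <->
         alpha_max = 0%E \/
         ((alpha_max < 0)%E /\ forall q : R, 0 < q -> Z q = +oo%E)) /\
      (dimR = dimT -> mu (Rset FN DN) = 1%E),
      (* black hole case *)
      [/\ (dimR < dimT)%E <-> gap,
          gap <-> (0 < alpha_max)%E
        & (0 < alpha_max)%E <-> mu (Tplus FN DN) = 1%E]
    & (* dimension gap *)
      (gap <-> (0 < alpha_max)%E) /\ (gap <-> mu (Tplus FN DN) = 1%E)].
Proof.
move=> D0 DZ DN FZ FN phi delta_0 delta_N delta_Z d0 alpha_max Z dimR dimT gap.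
move=> bm sf rr _ ttN Ii0 Iip IiN IiZ sreg gibbs _.
have [lam lam_gt1 lamP] := expansion bm; have [M M_ge0 MP] := adler bm.
have [mrep minv _] := gibbs.
have p_ge : forall i, I i -> -1 <= pstep J F0 psi i := fun i Ii => pstep_ge bm sf Ii.
have I0 : I !=set0 by exists i0.
set K := distortion lam M; have K1 : 1 <= K := distortion_ge1 lam_gt1 M_ge0.
have K0 : 0 < K by exact: lt_le_trans K1.
have lg := ell_gt0 bm lam_gt1 lamP.
have lcat_le := ell_cat_le bm lam_gt1 lamP M_ge0 MP.
have lle := ell_le bm lam_gt1 lamP M_ge0.
have th0 : 0 < lam^-1 by rewrite invr_gt0 (lam_gt0 lam_gt1).
have th1 : lam^-1 < 1 by rewrite invf_lt1// (lam_gt0 lam_gt1).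
have [dE [s1 [C1 [s10 s1d fin1 [C1_ge1 mc_le mc_ge]]]]] :=
  conformal bm lam_gt1 lamP M_ge0 MP sf Ii0 Iip sreg gibbs.
rewrite -/delta_0 -/d0 in dE s1d mc_le mc_ge.
have C0 : 0 < C1 by exact: lt_le_trans C1_ge1.
have d0_gt0 : 0 < d0 by exact: le_lt_trans s1d.
have d0_ge0 := ltW d0_gt0.
(* Two upper comparisons and one lower comparison of [mu] with [ell] give the three factors [C1];
   the distortion of a concatenation gives K^d0. *)
pose kap := (C1 * C1 * C1 * K `^ d0)^-1.
have Kd : 0 < K `^ d0 by exact: powR_gt0.
have kap_gt0 : 0 < kap by rewrite invr_gt0 !mulr_gt0.
have mc_cat u v : wordP I u -> wordP I v ->
    kap * (mc J F0 mu u * mc J F0 mu v) <= mc J F0 mu (u ++ v).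
  move=> hu hv; rewrite ler_pdivrMl ?mulr_gt0//.
  have lu := lg _ hu; have lv := lg _ hv; have luv := lg _ (wordP_cat hu hv).
  apply: (@le_trans _ _ (C1 * ell J F0 u `^ d0 * (C1 * ell J F0 v `^ d0))).
    by apply: ler_pM => //; [exact: m_ge0|exact: m_ge0|exact: mc_le|exact: mc_le].
  have h1 : ell J F0 u `^ d0 * ell J F0 v `^ d0 <= K `^ d0 * ell J F0 (u ++ v) `^ d0.
    rewrite -!powRM ?(ltW lu) ?(ltW lv) ?(ltW luv) ?(ltW K0)//.
    apply: ge0_ler_powR; rewrite ?nnegrE ?mulr_ge0 ?(ltW lu) ?(ltW lv) ?(ltW luv) ?(ltW K0)//.
    exact: (ell_cat_ge bm lam_gt1 lamP M_ge0 MP hu hv).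
  have h2 := mc_ge _ (wordP_cat hu hv).
  have h3 : K `^ d0 * ell J F0 (u ++ v) `^ d0 <= K `^ d0 * (C1 * mc J F0 mu (u ++ v)) by rewrite ler_pM2l.
  have -> : C1 * ell J F0 u `^ d0 * (C1 * ell J F0 v `^ d0) =
    C1 * C1 * (ell J F0 u `^ d0 * ell J F0 v `^ d0) by ring.
  have -> : C1 * C1 * C1 * K `^ d0 * mc J F0 mu (u ++ v) =
    C1 * C1 * (K `^ d0 * (C1 * mc J F0 mu (u ++ v))) by ring.
  by rewrite ler_pM2l ?mulr_gt0//; exact: le_trans h3.
have alphaE : alpha_max = mean I J F0 mu (pstep J F0 psi).
  rewrite /alpha_max /mean; apply: eq_integral => x /set_mem rx.
  by rewrite (psi_idx bm sf (rep_D0 rx)).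
have part_le n : (0 < n)%N -> (part I (ell J F0) (pstep J F0 psi) n d0 0 <= C1%:E)%E.
  move=> _; apply: esum_le_list => L uL hL.
  apply: (@le_trans _ _ (\sum_(w <- L) C1 * mc J F0 mu w)).
    rewrite [leLHS]big_seq [leRHS]big_seq; apply: ler_sum => w /hL[_ hw].
    by rewrite /wterm mul0r expR0 mulr1; exact: mc_ge.
  rewrite -mulr_sumr -[leRHS]mulr1 ler_pM2l//.
  have -> : 1 = m mu (lev I J F0 n (fun=> True)).
    have -> : lev I J F0 n (fun=> True) = repeller F0 D0 by apply/seteqP; split=> x; [move=> []|].
    by rewrite /m mrep.
  by apply: (lev_ge bm lam_gt1 lamP mrep) => // w /hL.
have contr_gt s : d0 < s -> contr I (ell J F0) K (pstep J F0 psi) s 0.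
  by move=> ds; exact: (contr_above lg K1 th0 th1 lle ds part_le).
have dimX : (dimH (repeller FN DN) <= d0%:E)%E.
  apply: gee_dense => s ds; have s0 : 0 <= s by lra.
  apply: dimH_le => //; apply: (null_repellerN bm lam_gt1 lamP M_ge0 MP sf rr s0).
  exact: contr_gt.
have dimRX : (dimR <= dimH (repeller FN DN))%E by apply: dimH_subset => y [].
have dimTX : (dimT <= dimH (repeller FN DN))%E by apply: dimH_subset => y [].
(* Contraction at [d0] moves to some [s' < d0] by interpolation with the point [(s1, 0)]. The tilt
   is multiplied by a positive number and keeps its sign, which decides whether it bounds [Rset] or
   [Tplus]. *)
have lower q : contr I (ell J F0) K (pstep J F0 psi) d0 q -> exists s' t',
    [/\ 0 <= s', s' < d0, 0 < t' & contr I (ell J F0) K (pstep J F0 psi) s' (t' * q)].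
  move=> ct; have [t [t0 t1 ct']] := contr_young lg K1 lcat_le s10 s1d I0 ct fin1.
  exists ((1 - t) * d0 + t * s1), (1 - t); rewrite mulr0 addr0 in ct'; split=> //.
  - by rewrite addr_ge0 ?mulr_ge0// ?(ltW t0)// subr_ge0 ltW.
  - have : t * s1 < t * d0 by rewrite ltr_pM2l.
    lra.
  - by rewrite subr_gt0.
have mean0 : (alpha_max <= 0)%E -> mu.-integrable setT (EFin \o obs I J (fun i => (pstep J F0 psi i)%:~R)) /\
    alpha_max = (\int[mu]_x obs I J (fun i => (pstep J F0 psi i)%:~R) x)%:E.
  by rewrite alphaE => /(mean_le0 bm lam_gt1 lamP mrep p_ge).
have R_full : (alpha_max <= 0)%E -> mu (Rset FN DN) = 1%E.
  move=> a0; have [pi pE] := mean0 a0.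
  apply: (Rset_typical bm lam_gt1 lamP sf rr mrep minv kap_gt0 mc_cat pi).
  by rewrite -lee_fin -pE.
have um : (alpha_max <= 0)%E -> forall s, s < d0 -> unif_minus I (ell J F0) (pstep J F0 psi) s.
  move=> a0 s sd; have [pi pE] := mean0 a0.
  apply: (unif_minus_mean bm lam_gt1 lamP M_ge0 mrep minv C1_ge1 mc_le sd pi).
  by rewrite -lee_fin -pE.
have up : (0 <= alpha_max)%E -> forall s, s < d0 -> unif_plus I (ell J F0) (pstep J F0 psi) s.
  rewrite le_eqVlt => /orP[/eqP a0|a0] s sd.
    have [|pi pE] := mean0; first by rewrite -a0.
    apply: (unif_plus_mean bm lam_gt1 lamP M_ge0 mrep minv C1_ge1 mc_le sd pi) => //.
    by rewrite -lee_fin -pE -a0.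
  rewrite alphaE in a0; have [g [gp gi g0]] := mean_gt0 bm lam_gt1 lamP mrep p_ge a0.
  exact: (unif_plus_mean bm lam_gt1 lamP M_ge0 mrep minv C1_ge1 mc_le sd gi (ltW g0) gp).
have dimR_full : (alpha_max <= 0)%E -> dimR = d0%:E.
  move=> a0; apply/eqP; rewrite eq_le (le_trans dimRX dimX) /=; apply: lee_dense => // s s0 sd.
  exact: (dimR_ge bm lam_gt1 lamP M_ge0 MP sf rr s0 (um a0 s sd)).
have dimT_full : (forall s, s < d0 -> unif_plus I (ell J F0) (pstep J F0 psi) s) -> dimT = d0%:E.
  move=> hu; apply/eqP; rewrite eq_le (le_trans dimTX dimX) /=; apply: lee_dense => // s s0 sd.
  exact: (dimT_ge bm lam_gt1 lamP M_ge0 MP sf rr s0 (hu s sd)).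
have drift g e : mu.-integrable setT (EFin \o obs I J g) -> 0 < e ->
    e < \int[mu]_x obs I J g x -> m mu (bounded_below I J F0 (fun i => g i - e)) = 1.
  move=> gi e0 ge; have [oi oE] := obs_shift_int bm (ltW e0) gi.
  apply: (bounded_below_ae bm lam_gt1 lamP mrep minv kap_gt0 mc_cat oi).
  by apply: lt_le_trans oE; rewrite subr_gt0.
(* A minorant [g] of positive mean, lowered by half its mean, still has positive mean, so its sums
   are almost surely bounded below. This gives both a contraction with negative tilt and the
   divergence of typical orbits. *)
have pos : (0 < alpha_max)%E -> (dimR < d0%:E)%E /\ mu (Tplus FN DN) = 1%E.
  rewrite alphaE => a0; have [g [gp gi g0]] := mean_gt0 bm lam_gt1 lamP mrep p_ge a0.
  set e := (\int[mu]_x obs I J g x) / 2.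
  have e0 : 0 < e by rewrite divr_gt0.
  have G1 : m mu (bounded_below I J F0 (fun i => g i - e)) = 1.
    by apply: drift => //; rewrite /e; lra.
  split; last exact: (Tplus_typical bm lam_gt1 lamP sf rr gp e0 G1).
  have [q q0 ct] := contr_neg bm lam_gt1 lamP M_ge0 mrep p_ge C1_ge1 mc_ge gp e0 G1.
  have [s' [t' [s'0 s'd t'0 ct']]] := lower q ct.
  apply: (@le_lt_trans _ _ s'%:E); last by rewrite lte_fin.
  apply: dimH_le => //; apply: (null_Rset bm lam_gt1 lamP M_ge0 MP sf rr s'0 _ ct').
  by rewrite mulr_ge0_le0// ltW.
(* The same scheme for [- psi], with the finite series at [q0] as the exponential moment required by
   [contr_pos]. *)
have neg q0 : (alpha_max < 0)%E -> 0 < q0 -> (Z q0 < +oo)%E -> (dimT < d0%:E)%E.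
  move=> a0 q00 /(fix_sum_fin bm lam_gt1 lamP M_ge0 MP sf d0_ge0) fin.
  have [pi pE] := mean0 (ltW a0).
  have im0 : \int[mu]_x obs I J (fun i => (pstep J F0 psi i)%:~R) x < 0 by rewrite -lte_fin -pE.
  have [oi oE] := obs_opp_int pi.
  set e := - (\int[mu]_x obs I J (fun i => (pstep J F0 psi i)%:~R) x) / 2.
  have e0 : 0 < e by rewrite divr_gt0// oppr_gt0.
  have G1 : m mu (bounded_below I J F0 (fun i => - (pstep J F0 psi i)%:~R - e)) = 1.
    by apply: drift => //; rewrite oE /e; lra.
  have [q qp ct] := contr_pos bm lam_gt1 lamP M_ge0 MP mrep d0_ge0 C1_ge1 mc_le mc_ge e0 q00 fin G1.
  have [s' [t' [s'0 s'd t'0 ct']]] := lower q ct.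
  apply: (@le_lt_trans _ _ s'%:E); last by rewrite lte_fin.
  apply: dimH_le => //; apply: (null_Tplus bm lam_gt1 lamP M_ge0 MP sf rr s'0 _ ct').
  by rewrite mulr_ge0// ltW.
have ninf : (forall q, 0 < q -> Z q = +oo%E) -> dimT = d0%:E.
  move=> Zinf; apply: dimT_full => s sd.
  apply: (unif_plus_infinite bm lam_gt1 lamP M_ge0 MP mrep minv I0 d0_ge0 C1_ge1 mc_le sd) => q q0.
  exact: (fix_sum_infty bm lam_gt1 lamP M_ge0 MP sf d0_ge0 (Zinf q q0)).
have dimT_pos : (0 <= alpha_max)%E -> dimT = d0%:E by move=> a0; exact: dimT_full (up a0).
have Zdich : (exists2 q, 0 < q & (Z q < +oo)%E) \/ (forall q, 0 < q -> Z q = +oo%E).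
  have [h|h] := pselect (exists2 q, 0 < q & (Z q < +oo)%E); [by left|right=> q q0].
  by apply/eqP; rewrite -leye_eq leNgt; apply/negP => hq; apply: h; exists q.
have disj : mu (Tplus FN DN) = 1%E -> mu (Rset FN DN) = 1%E -> False.
  move=> T1 R1.
  have mT := Tplus_meas bm lam_gt1 lamP sf rr; have mR := Rset_meas bm lam_gt1 lamP sf rr.
  have := @measureU _ _ _ mu _ _ mT mR.
  have -> : Tplus FN DN `&` Rset FN DN = set0.
    by apply/seteqP; split=> // y [Ty Ry]; exact: (Rset_notTplus bm sf rr Ry Ty).
  move=> /(_ erefl) e; have := probability_le1 mu (measurableU _ _ mT mR).
  by rewrite e [X in (X + _)%E]T1 [X in (_ + X)%E]R1 -EFinD lee_fin; lra.
have gapE : gap <-> (0 < alpha_max)%E.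
  rewrite /gap; split=> [h|a0].
    rewrite ltNge; apply/negP => a0; move: h; rewrite (dimR_full a0) => /lt_le_trans/(_ dimX).
    by rewrite ltxx.
  by apply: lt_le_trans dimTX; rewrite (dimT_pos (ltW a0)); have [] := pos a0.
have TE : (0 < alpha_max)%E <-> mu (Tplus FN DN) = 1%E.
  split=> [a0|T1]; first by have [] := pos a0.
  by rewrite ltNge; apply/negP => a0; exact: (disj T1 (R_full a0)).
have RTgap : (dimR < dimT)%E <-> gap.
  rewrite gapE; split=> [h|a0]; last by rewrite (dimT_pos (ltW a0)); have [] := pos a0.
  rewrite ltNge; apply/negP => a0; move: h; rewrite (dimR_full a0) => /lt_le_trans/(_ (le_trans dimTX dimX)).
  by rewrite ltxx.
have le0 : ~~ (dimR < dimT)%E -> (alpha_max <= 0)%E.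
  by move=> /negP h; rewrite leNgt; apply/negP => /gapE/RTgap.
have hN0 : 0 <= hN%:Z by [].
have dN_le t q : 0 <= t -> q <= 0 -> contr I (ell J F0) K (pstep J F0 psi) t q -> (delta_N <= t%:E)%E.
  exact: (deltaN_le bm lam_gt1 lamP M_ge0 MP sf rr IiN hN0).
have dN_ge t : 0 <= t -> unif_minus I (ell J F0) (pstep J F0 psi) t -> (t%:E <= delta_N)%E.
  exact: (deltaN_ge bm lam_gt1 lamP M_ge0 MP sf rr ttN IiN hN0).
have dZ_le t q : 0 <= t -> contr I (ell J F0) K (pstep J F0 psi) t q -> (delta_Z <= t%:E)%E.
  exact: (deltaZ_le bm lam_gt1 lamP M_ge0 MP sf hZ IiZ).
have dZ_ge t : 0 <= t -> unif_plus I (ell J F0) (pstep J F0 psi) t ->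
    unif_minus I (ell J F0) (pstep J F0 psi) t -> (t%:E <= delta_Z)%E.
  exact: (deltaZ_ge bm lam_gt1 lamP M_ge0 MP sf hZ IiZ).
have dN0 : (0 <= delta_N)%E := delta_ge0 _ _ _.
have dZ0 : (0 <= delta_Z)%E := delta_ge0 _ _ _.
clearbody delta_N delta_Z.
have deltaN_d0 : (delta_N <= d0%:E)%E.
  apply: gee_dense => s ds; have s0 : 0 <= s by exact: le_trans d0_ge0 (ltW ds).
  exact: (dN_le s 0 s0 (lexx 0) (contr_gt s ds)).
have dichotomy s t : 0 <= s -> s < t ->
    (exists2 q, q <= 0 & contr I (ell J F0) K (pstep J F0 psi) t q) \/ unif_minus I (ell J F0) (pstep J F0 psi) s.
  by move=> s0 st; exact: (contr_or_unif_minus (pstep J F0 psi) lg K1 th0 th1 lle s0 st).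
split.
(* If the two exponents differed, choose [s < t] strictly between them. Either [contr] holds at [t]
   with some [q <= 0] and bounds the larger exponent by [t], or descending families at [s] are large
   and bound the smaller one below by [s]. When [delta_Z] is the smaller, ascending families are
   needed as well; they exist for [s < d0], which follows from [delta_N <= d0]. *)
- split=> [a0|a0].
    apply/le_anti/andP; split; rewrite leNgt; apply/negP => h.
      have [s [t [s0 st hs ht]]] := lte_dense2 dZ0 h.
      have t0 : 0 <= t := le_trans s0 (ltW st).
      have [[q q0 ct]|hu] := dichotomy s t s0 st.
        by have := dN_le t q t0 q0 ct; rewrite leNgt ht.
      have sd : s < d0.
        by rewrite -lte_fin; apply: lt_le_trans deltaN_d0; apply: lt_trans ht; rewrite lte_fin.
      by have := dZ_ge s s0 (up a0 s sd) hu; rewrite leNgt hs.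
    have [s [t [s0 st hs ht]]] := lte_dense2 dN0 h.
    have t0 : 0 <= t := le_trans s0 (ltW st).
    have [[q q0 ct]|hu] := dichotomy s t s0 st.
      by have := dZ_le t q t0 ct; rewrite leNgt ht.
    by have := dN_ge s s0 hu; rewrite leNgt hs.
  rewrite dE; apply/le_anti/andP; split=> //; apply: lee_dense => // s s0 sd.
  exact: (dN_ge s (ltW s0) (um (ltW a0) s sd)).
- split; last by move=> h; apply/R_full/le0; rewrite -leNgt ltW.
  split=> [h|[a0 [q q0 hq]]]; last by rewrite (dimR_full (ltW a0)); exact: (neg q a0 q0 hq).
  have a0 : (alpha_max < 0)%E.
    rewrite ltNge; apply/negP => a0; move: h; rewrite (dimT_pos a0) => /lt_le_trans/(_ (le_trans dimRX dimX)).
    by rewrite ltxx.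
  split=> //; have [//|hZinf] := Zdich; move: h.
  by rewrite (ninf hZinf) (dimR_full (ltW a0)) ltxx.
- split; last by move=> h; apply/R_full/le0; rewrite h ltxx.
  split=> [h|[a0|[a0 hZinf]]].
  + have a0 : (alpha_max <= 0)%E by apply: le0; rewrite h ltxx.
    move: a0; rewrite le_eqVlt => /orP[/eqP ->|a0]; [by left|right; split=> //].
    have [[q q0 hq]|//] := Zdich; have := neg q a0 q0 hq.
    by rewrite -h (dimR_full (ltW a0)) ltxx.
  + by rewrite dimR_full ?dimT_pos// a0.
  + by rewrite (dimR_full (ltW a0)) (ninf hZinf).
- by split.
- by split=> //; rewrite gapE.
Qed.
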